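(* Let $n\ge 2$ be an integer, let $\lambda,\mu\in\mathbb{R}$ satisfy $\lambda+2\mu>0$ and $\mu>0$, let $N\in\{1,\dots,n\}$, and let $(f_0,f_1)\in\{H^1(\mathbb{R}^n)\cap L^1(\mathbb{R}^n)\}^n\times\{L^2(\mathbb{R}^n)\cap L^1(\mathbb{R}^n)\}^n$. Then the solution $u={}^T(u_1,\dots,u_n)$ of $$\partial_t^2u-\mu\Delta u-(\lambda+\mu)\nabla(\operatorname{div}u)=0\ (t>0,\ x\in\mathbb{R}^n),\qquad u(0,x)=f_0(x),\quad \partial_tu(0,x)=f_1(x)\ (x\in\mathbb{R}^n)$$ belongs to $C([0,\infty);\{H^1\}^n)\cap C^1([0,\infty);\{L^2\}^n)$. In particular, the $N$th component $u_N$ satisfies $$\|u_N(t)\|_{L^2}\le\begin{cases} C\big(\|f_0\|_2+\|f_1\|_1\sqrt{\log(t+2)}+\|f_1\|_2\big), & n=2,\\ C\big(\|f_0\|_2+\|f_1\|_1+\|f_1\|_2\big), & n\ge 3\end{cases}$$ for $t\ge 0$. In addition, suppose that $\lambda+\mu\ne 0$. If either $|M_0|\neq 0$ or $|M_1|\ne 0$, then $$\|u_N(t)\|_{L^2}\ge\begin{cases} C|M_0|+C|M_1|\sqrt{\log(t+2)}, & n=2,\\ C(|M_0|+|M_1|), & n\ge 3\end{cases}$$ for $t\gg 1$.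
   Context: All functions are real valued; $f_j={}^T(f_{j1},\dots,f_{jn})$ for $j=0,1$. For $p\in\{1,2\}$ and a vector function $f={}^T(f_1,\dots,f_n)$, $\|f\|_p:=\sum_{k=1}^n\|f_k\|_{L^p(\mathbb{R}^n)}$. Moments: $m_{jk}:=\int_{\mathbb{R}^n}f_{jk}(x)\,dx$, $M_j:={}^T(m_{j1},\dots,m_{jn})$, $|M_j|:=\sum_{k=1}^n|m_{jk}|$. $C$ denotes a generic positive constant, which may differ between occurrences, and ''$t\gg1$'' means for all sufficiently large $t$. The solution is the one given in Fourier space by $$\hat u(t,\xi)=\cos(t\alpha_1|\xi|)P\hat f_0+\frac{\sin(t\alpha_1|\xi|)}{\alpha_1|\xi|}P\hat f_1+\cos(t\alpha_2|\xi|)(I-P)\hat f_0+\frac{\sin(t\alpha_2|\xi|)}{\alpha_2|\xi|}(I-P)\hat f_1,$$ where $\alpha_1=\sqrt{\lambda+2\mu}$, $\alpha_2=\sqrt{\mu}$, $P=\frac{\xi}{|\xi|}\otimes\frac{\xi}{|\xi|}$, and $I$ is the $n\times n$ identity matrix. *)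

(* Defs.v *)
From HB Require Import structures.
From mathcomp Require Import all_boot all_order all_algebra.
From mathcomp Require Import all_classical all_reals all_analysis.
From mathcomp.real_closed Require Import complex.
Set Implicit Arguments.
Unset Strict Implicit.
Unset Printing Implicit Defensive.
Import Order.TTheory GRing.Theory Num.Theory.
Import numFieldNormedType.Exports.
Local Open Scope classical_set_scope.
Local Open Scope ring_scope.

(* R^n with its product (= Borel) sigma-algebra *)
Notation Rn R n := (n.-tuple (measurableTypeR R)).

Section lebesgue_Rn_step.
Context (R : realType) (n : nat)
  (m : {sigma_finite_measure set (Rn R n) -> \bar R}).

Definition consRn (x : measurableTypeR R * Rn R n) : Rn R n.+1 :=
  [tuple of x.1 :: x.2].

Lemma measurable_consRn : measurable_fun setT consRn.
Proof. by apply: measurable_cons; [exact: measurable_fst|exact: measurable_snd]. Qed.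

Definition unconsRn (x : Rn R n.+1) : measurableTypeR R * Rn R n :=
  (thead x, [tuple of behead x]).

Lemma measurable_unconsRn : measurable_fun setT unconsRn.
Proof.
apply/measurable_fun_pairP; split; last exact: measurable_behead.
exact: (@measurable_tnth _ _ _ ord0).
Qed.

Lemma consRnK : cancel consRn unconsRn.
Proof.
by move=> [a x]; rewrite /unconsRn theadE; congr pair; apply/val_inj.
Qed.

Lemma unconsRnK : cancel unconsRn consRn.
Proof. by move=> x; rewrite /consRn /= [RHS]tuple_eta. Qed.

Definition lebesgue_step (A : set (Rn R n.+1)) : \bar R :=
  (@lebesgue_measure R \x m)%E (consRn @^-1` A).

Let step_measure : {measure set (Rn R n.+1) -> \bar R} :=
  measure_function_pushforward__canonical__measure_function_Measure
    (@lebesgue_measure R \x m)%E measurable_consRn.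

HB.instance Definition _ := isMeasure.Build _ _ _ lebesgue_step
  (measure0 step_measure) (measure_ge0 step_measure)
  (@measure_semi_sigma_additive _ _ _ step_measure).

Lemma lebesgue_step_sigma_finite : sigma_finite setT lebesgue_step.
Proof.
have /sigma_finiteP[F [TF ndF Foo]] := sigma_finiteT (@lebesgue_measure R).
have /sigma_finiteP[G [TG ndG Goo]] := sigma_finiteT m.
exists (fun k => unconsRn @^-1` (F k `*` G k)).
  rewrite -preimage_bigcup (_ : \bigcup_i _ = setT) ?preimage_setT//.
  rewrite -setXTT TF TG predeqE => -[x y]; split.
    by move=> [k _ []/= ? ?]; split; exists k.
  move=> [/= [k _ Fkx] [l _ Gly]]; exists (maxn k l) => //; split.
  - by move: x Fkx; exact/subsetPset/ndF/leq_maxl.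
  - by move: y Gly; exact/subsetPset/ndG/leq_maxr.
move=> k; have [mF Fk] := Foo k; have [mG Gk] := Goo k; split.
  rewrite -[X in measurable X]setTI; apply: measurable_unconsRn => //.
  exact: measurableX.
rewrite /lebesgue_step -comp_preimage (_ : _ \o _ = id); last first.
  by apply/funext => x /=; rewrite consRnK.
by rewrite preimage_id product_measure1E// lte_mul_pinfty// ge0_fin_numE.
Qed.

HB.instance Definition _ :=
  Measure_isSigmaFinite.Build _ _ _ lebesgue_step lebesgue_step_sigma_finite.

End lebesgue_Rn_step.

Fixpoint lebesgue_Rn (R : realType) (n : nat) :
    {sigma_finite_measure set (Rn R n) -> \bar R} :=
  if n is n'.+1 then lebesgue_step (lebesgue_Rn R n')
  else \d_([tuple] : Rn R 0).

Lemma lebesgue_Rn_box (R : realType) n (A : 'I_n -> set (measurableTypeR R)) :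
  (forall i, measurable (A i)) ->
  lebesgue_Rn R n [set x : Rn R n | forall i, A i (tnth x i)] =
  (\prod_(i < n) lebesgue_measure (A i))%E.
Proof.
elim: n A => [|n IH] A mA /=.
  by rewrite big_ord0 diracE mem_set//= => -[].
rewrite big_ord_recl -(IH (fun i => A (lift ord0 i)))// /lebesgue_step.
rewrite -product_measure1E//; last first.
  rewrite (_ : [set _ | _] =
    \bigcap_(i in setT) ((fun x : Rn R n => tnth x i) @^-1` A (lift ord0 i))).
    apply: fin_bigcap_measurable => [|i _]; first exact: finite_finset.
    by rewrite -[X in measurable X]setTI; exact: measurable_tnth.
  by apply/seteqP; split => x /= H i; [move=> _|]; exact: H.
congr (_ _); apply/seteqP; split => -[a x] /=.
  move=> H; split; first by have := H ord0; rewrite tnth0.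
  by move=> i; have := H (lift ord0 i); rewrite tnthS.
move=> [Aa Ax] i; case: (unliftP ord0 i) => [j|] ->.
  by rewrite tnthS.
by rewrite tnth0.
Qed.

Section function_spaces.
Context (R : realType) (n : nat).
Local Notation E := (Rn R n).
Local Notation leb := (lebesgue_Rn R n).
Implicit Types (f g : E -> R) (phi : 'rV[R]_n -> R) (u v : R -> 'I_n -> E -> R).

(* 'rV[R]_n carries the normed structure, n.-tuple R the measurable one *)
Definition vec (x : E) : 'rV[R]_n := \row_i tnth x i.

Definition in_L1 f : Prop := f \in Lfun leb 1.
Definition in_L2 f : Prop := f \in Lfun leb 2%:E.
Definition L1norm f : \bar R := 'N[leb]_1[EFin \o f]%E.
Definition L2norm f : \bar R := 'N[leb]_2%:E[EFin \o f]%E.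

Definition partial (j : 'I_n) phi : 'rV[R]_n -> R :=
  fun x => 'D_(delta_mx 0 j) phi x.

(* C_c^oo(R^n): all iterated partial derivatives are differentiable *)
Definition test_function phi : Prop :=
  (forall (s : seq 'I_n) x, differentiable (foldr partial phi s) x) /\
  compact (closure [set x | phi x != 0]).

Definition weak_partial (j : 'I_n) f g : Prop :=
  forall phi, test_function phi ->
    \int[leb]_x (f x * partial j phi (vec x)) =
    - \int[leb]_x (g x * phi (vec x)).

Definition in_H1 f : Prop :=
  in_L2 f /\ forall j, exists2 g, in_L2 g & weak_partial j f g.

(* a representative of the weak derivative, unique up to null sets on H1 *)
Definition weakD (j : 'I_n) f : E -> R :=
  xget (fun=> 0) [set g | in_L2 g /\ weak_partial j f g].

Definition H1norm f : \bar R :=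
  ((L2norm f `^ 2 + \sum_(j < n) L2norm (weakD j f) `^ 2) `^ 2^-1)%E.

(* continuity on [0, +oo[, one-sided at 0 *)
Definition time_continuous (nrm : (E -> R) -> \bar R) u : Prop :=
  forall t0 : R, 0 <= t0 -> forall k,
    nrm (fun x => u t k x - u t0 k x)
      @[t --> within [set t | 0 <= t] (nbhs t0)] --> 0%E.

Definition in_C_H1 u : Prop :=
  (forall t : R, 0 <= t -> forall k, in_H1 (u t k)) /\ time_continuous H1norm u.

Definition in_C_L2 u : Prop :=
  (forall t : R, 0 <= t -> forall k, in_L2 (u t k)) /\ time_continuous L2norm u.

Definition L2_time_derivative u v : Prop :=
  forall t0 : R, 0 <= t0 -> forall k,
    L2norm (fun x => h^-1 * (u (t0 + h) k x - u t0 k x) - v t0 k x)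
      @[h --> within [set h | 0 <= t0 + h] (0 : R)^'] --> 0%E.

(* u belongs to C^1([0, +oo[; (L^2)^n), with time derivative v *)
Definition in_C1_L2 u v : Prop :=
  [/\ in_C_L2 u, in_C_L2 v & L2_time_derivative u v].

Definition vL1norm (f : 'I_n -> E -> R) : R := \sum_k fine (L1norm (f k)).
Definition vL2norm (f : 'I_n -> E -> R) : R := \sum_k fine (L2norm (f k)).

Definition moment f : R := \int[leb]_x f x.
Definition vmoment (f : 'I_n -> E -> R) : R := \sum_k `|moment (f k)|.

End function_spaces.

Section fourier.
Context (R : realType) (n : nat).
Local Notation E := (Rn R n).
Local Notation leb := (lebesgue_Rn R n).
Local Open Scope complex_scope.
Implicit Types (f : E -> R) (g : E -> R[i]) (x xi : E).

Definition dot x xi : R := \sum_(i < n) tnth x i * tnth xi i.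
Definition enorm xi : R := Num.sqrt (dot xi xi).

(* \int exp(- i x.xi) f(x) dx, split into real and imaginary parts since the
   library integrates real-valued functions *)
Definition fourier f xi : R[i] :=
  (\int[leb]_x (cos (dot x xi) * f x)) -i*
  (\int[leb]_x (sin (dot x xi) * f x)).

Definition L2C g : Prop :=
  in_L2 (fun xi => complex.Re (g xi)) /\ in_L2 (fun xi => complex.Im (g xi)).
Definition L2Cnorm g : \bar R := L2norm (fun xi => Normc.normc (g xi)).

(* g is the Fourier-Plancherel transform of f: an L^2 limit of transforms of
   functions of L^1 and L^2 tending to f *)
Definition fourier_L2 f g : Prop :=
  [/\ in_L2 f, L2C g & exists f_ : nat -> E -> R,
    [/\ forall m, in_L1 (f_ m) /\ in_L2 (f_ m),
        L2norm (fun x => f_ m x - f x) @[m --> \oo] --> 0%E &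
        L2Cnorm (fun xi => fourier (f_ m) xi - g xi) @[m --> \oo] --> 0%E]].

Definition fourier_col (f : 'I_n -> E -> R) xi : 'cV[R[i]]_n :=
  \col_k fourier (f k) xi.

(* (xi / |xi|) (x) (xi / |xi|); the value at xi = 0 is irrelevant *)
Definition xi_proj xi : 'M[R[i]]_n :=
  \matrix_(k, l) ((tnth xi k / enorm xi) * (tnth xi l / enorm xi))%:C.

End fourier.

Section navier.
Context (R : realType) (n : nat) (lam mu : R).
Local Notation E := (Rn R n).
Local Notation leb := (lebesgue_Rn R n).
Implicit Types (u v : R -> 'I_n -> E -> R).

Definition uhat (f0 f1 : 'I_n -> E -> R) (t : R) (xi : E) : 'cV[R[i]]_n :=
  let a1 := Num.sqrt (lam + 2 * mu) in
  let a2 := Num.sqrt mu in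
  let r := enorm xi in
  let P := xi_proj xi in
  (cos (t * a1 * r))%:C%C *: (P *m fourier_col f0 xi)
  + (sin (t * a1 * r) / (a1 * r))%:C%C *: (P *m fourier_col f1 xi)
  + (cos (t * a2 * r))%:C%C *: ((1%:M - P) *m fourier_col f0 xi)
  + (sin (t * a2 * r) / (a2 * r))%:C%C *: ((1%:M - P) *m fourier_col f1 xi).

Definition fourier_solution (f0 f1 : 'I_n -> E -> R) u : Prop :=
  forall t : R, 0 <= t -> forall k,
    fourier_L2 (u t k) (fun xi => uhat f0 f1 t xi k 0).

(* k-th component of mu Delta phi + (lam + mu) grad (div phi) *)
Definition navier_op (phi : 'I_n -> 'rV[R]_n -> R) (k : 'I_n)
    (x : 'rV[R]_n) : R :=
  mu * (\sum_j partial j (partial j (phi k)) x)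
  + (lam + mu) * partial k (fun y => \sum_j partial j (phi j) y) x.

(* v stands for the time derivative of u; the equation is taken in the sense
   of distributions in x for every t > 0, and the spatial operator, being
   formally symmetric, is moved unchanged onto the test function *)
Definition solves_cauchy (f0 f1 : 'I_n -> E -> R) u v : Prop :=
  [/\ forall k, {ae leb, forall x, u 0 k x = f0 k x},
      forall k, {ae leb, forall x, v 0 k x = f1 k x} &
      forall phi : 'I_n -> 'rV[R]_n -> R, (forall k, test_function (phi k)) ->
      forall t : R, 0 < t ->
        is_derive t (1 : R)
          (fun s => \sum_k \int[leb]_x (v s k x * phi k (vec x)))
          (\sum_k \int[leb]_x (u t k x * navier_op phi k (vec x)))].

End navier.

(* Main.v *)
(* The data are real, so the Fourier transform can be traded for the Hartley
   transform hart f xi = \int (cos + sin)(x.xi) f(x) dx, which is real valued.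
   It is sqrt((2 pi)^n) times an isometry of L^2: by polarization and density it
   suffices to check this on indicators of boxes, where it reduces to
   \int (1 - cos(u x)) / x^2 dx = pi |u|. Since uhat acts by real multipliers
   that are even in xi, u is the solution exactly when hart (u t) = HU t, the
   same multipliers applied to hart f0 and hart f1; the regularity of u then
   follows from elementary bounds on these multipliers.

   Upper bound: the only delicate term is sin(t a r) / (a r) hart f1 for
   r = |xi| small. There |hart f1| <= 2 |f1|_1 and the multiplier is at most
   min(t, 1 / (a r)); the shells r ~ 2^-k with 2^k <= t contribute O(1) each in
   dimension 2 and a convergent geometric series in dimension at least 3.

   Lower bound: on a small box away from the coordinate hyperplanes, HU t is
   close to a combination of cos and sin of t a1 r and t a2 r with constant
   amplitudes, which do not all vanish because hart f is close to the moment of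
   f near 0 and the direction of the box can be chosen not orthogonal to the
   moment vector. As a1 <> a2, integration by parts in the first coordinate
   shows that the cross terms are O(1/t), so the squared norm over the box stays
   above a multiple of the sum of the squared amplitudes. In dimension 2 the
   amplitudes of r HU t persist on the boxes 2^-k Q with 2^k << t, which
   contribute equally, whence the factor log t. *)
Require Import Defs.
From HB Require Import structures.
From mathcomp Require Import all_boot all_order all_algebra finmap.
From mathcomp Require Import all_classical all_reals all_analysis.
From mathcomp Require Import measurable_realfun ring lra.
From mathcomp.real_closed Require Import complex.
Set Implicit Arguments.
Unset Strict Implicit.
Unset Printing Implicit Defensive.
Import Order.TTheory GRing.Theory Num.Theory.
Import numFieldNormedType.Exports.
Local Open Scope classical_set_scope.
Local Open Scope ring_scope.

(** * Real-valued integrals and the space L^2 *)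

(** An L^2 transform is only a limit of transforms of nicer functions, so it is carried by a
    relation [hartL2], the closed graph of [hart] on functions that are both in L^1 and L^2.
    Solutions exist because this relation is surjective, which rests on the completeness of L^2 and
    on the transform being its own inverse up to the factor [cP]. The way back from Hartley to
    Fourier needs evenness: the real and imaginary parts of the Fourier transform are, up to sign,
    the even and odd parts of the Hartley transform, and even multipliers respect this splitting.
    The weak derivatives of f0 are known only through test functions; they reach the frequency side
    by difference quotients and Fatou's lemma, and those of u come back by duality. In the lower
    bound the weight xi_1/|xi|, the first partial derivative of |xi|, gives the oscillating
    integrals explicit primitives; it must stay positive, whence the boxes off the hyperplanes. The
    constant C precedes the data, while c may depend on them, so that a bare positive lower bound
    can be rescaled by the moments. *)

Section real_sequences.
Context (R : realType).
Implicit Types u v : nat -> R.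

Lemma seqP u (l : R) : u m @[m --> \oo] --> l <->
  forall e, 0 < e -> exists N, forall m, (N <= m)%N -> `|u m - l| <= e.
Proof.
split=> [/cvgrPdist_le H e e0|H].
  have [N _ HN] := H e e0; exists N => m Nm; rewrite distrC; exact: HN.
apply/cvgrPdist_le => e e0; have [N HN] := H e e0.
by exists N => // m Nm; rewrite distrC; exact: HN.
Qed.

Lemma squeeze0 u v (l K : R) : (forall m, `|u m - l| <= K * `|v m|) ->
  v m @[m --> \oo] --> 0 -> u m @[m --> \oo] --> l.
Proof.
move=> uv /seqP v0; apply/seqP => e e0.
have K1 : 0 < `|K| + 1 by rewrite ltr_pwDr.
have [N HN] := v0 (e / (`|K| + 1)) (divr_gt0 e0 K1).
exists N => m Nm; have := HN m Nm; rewrite subr0 ler_pdivlMr// => h.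
apply: le_trans (uv m) _; apply: le_trans h.
by rewrite mulrC ler_wpM2l// (le_trans (ler_norm _))// lerDl.
Qed.

End real_sequences.

Section real_integral.
Context d (T : measurableType d) (R : realType) (mu : {measure set T -> \bar R}).
Implicit Types (f g h : T -> R) (F : nat -> T -> R).

Definition itg f : Prop := mu.-integrable setT (EFin \o f).
Definition int f : R := \int[mu]_x f x.

Lemma itg_meas f : itg f -> measurable_fun setT f.
Proof. by move=> /measurable_int/measurable_EFinP. Qed.

Lemma int_ext f g : f =1 g -> int f = int g.
Proof. by move=> fg; congr int; apply/funext. Qed.

Lemma itg_ext f g : f =1 g -> itg f -> itg g.
Proof. by move=> /funext ->. Qed.

Lemma itgD f g : itg f -> itg g -> itg (fun x => f x + g x).
Proof. by move=> If Ig; exact: (integrableD measurableT If Ig). Qed.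

Lemma itgZ c f : itg f -> itg (fun x => c * f x).
Proof. by move=> If; exact: (integrableZl measurableT c If). Qed.

Lemma itgN f : itg f -> itg (fun x => - f x).
Proof. by move=> /(itgZ (-1)); apply: itg_ext => x; rewrite mulN1r. Qed.

Lemma itgB f g : itg f -> itg g -> itg (fun x => f x - g x).
Proof. by move=> If Ig; exact: itgD If (itgN Ig). Qed.

Lemma itg0 : itg (fun=> 0).
Proof. exact: integrable0. Qed.

Lemma itg_le f g : measurable_fun setT f -> (forall x, `|f x| <= g x) ->
  itg g -> itg f.
Proof.
move=> mf fg; apply: le_integrable => //; first exact/measurable_EFinP.
by move=> x _ /=; rewrite lee_fin (le_trans (fg x))// ler_norm.
Qed.

Lemma itg_abs f : itg f -> itg (fun x => `|f x|).
Proof. by move=> /integrable_norm; apply. Qed.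

Lemma itg_sum (I : Type) (s : seq I) (G : I -> T -> R) :
  (forall i, itg (G i)) -> itg (fun x => \sum_(i <- s) G i x).
Proof.
move=> IG; elim: s => [|i s IH].
  by apply: itg_ext itg0 => x; rewrite big_nil.
by apply: itg_ext (itgD (IG i) IH) => x; rewrite big_cons.
Qed.

Lemma intD f g : itg f -> itg g -> int (fun x => f x + g x) = int f + int g.
Proof. by move=> If Ig; exact: RintegralD. Qed.

Lemma intB f g : itg f -> itg g -> int (fun x => f x - g x) = int f - int g.
Proof. by move=> If Ig; exact: RintegralB. Qed.

Lemma intZ c f : itg f -> int (fun x => c * f x) = c * int f.
Proof. by move=> If; exact: RintegralZl. Qed.

Lemma intN f : itg f -> int (fun x => - f x) = - int f.
Proof.
move=> If; rewrite -mulN1r -intZ//; apply: int_ext => x; by rewrite mulN1r.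
Qed.

Lemma int0 : int (fun=> 0) = 0.
Proof. by rewrite /int /Rintegral integral0. Qed.

Lemma int_sum (I : Type) (s : seq I) (G : I -> T -> R) :
  (forall i, itg (G i)) ->
  int (fun x => \sum_(i <- s) G i x) = \sum_(i <- s) int (G i).
Proof.
move=> IG; elim: s => [|i s IH].
  by rewrite big_nil -[RHS]int0; apply: int_ext => x; rewrite big_nil.
rewrite big_cons -IH -intD//; last exact: itg_sum.
by apply: int_ext => x; rewrite big_cons.
Qed.

Lemma int_le f g : itg f -> itg g -> (forall x, f x <= g x) -> int f <= int g.
Proof. by move=> If Ig fg; apply: le_Rintegral => // x _; exact: fg. Qed.

Lemma int_ge0 f : (forall x, 0 <= f x) -> 0 <= int f.
Proof. by move=> f0; apply: Rintegral_ge0. Qed.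

Lemma int_abs f : itg f -> `|int f| <= int (fun x => `|f x|).
Proof. by move=> If; apply: le_normr_Rintegral. Qed.

Lemma int_EFin f : itg f -> (int f)%:E = (\int[mu]_x (f x)%:E)%E.
Proof. by move=> If; rewrite /int /Rintegral fineK//; exact: integrable_fin_num. Qed.

Lemma itg_ge0P f : measurable_fun setT f -> (forall x, 0 <= f x) ->
  itg f <-> (\int[mu]_x (f x)%:E < +oo)%E.
Proof.
move=> mf f0; split.
  move=> /integrableP[_]; apply: le_lt_trans.
  by apply: ge0_le_integral => //= [|||x _]; [by move=> x _; rewrite lee_fin|exact/measurable_EFinP|
    exact/measurable_EFinP/measurableT_comp|rewrite lee_fin ler_norm].
move=> foo; apply/integrableP; split; first exact/measurable_EFinP.
by under eq_integral => x _ do rewrite /= ger0_norm//.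
Qed.

Lemma int_dct F f g : (forall m, measurable_fun setT (F m)) ->
  (forall m x, `|F m x| <= g x) -> itg g ->
  (forall x, F m x @[m --> \oo] --> f x) ->
  [/\ itg f, int (F m) @[m --> \oo] --> int f &
     int (fun x => `|F m x - f x|) @[m --> \oo] --> 0].
Proof.
move=> mf fg Ig ff.
have mf' : measurable_fun setT f.
  apply/measurable_EFinP.
  apply: (emeasurable_fun_cvg (fun m => EFin \o F m)) => [m|x _].
    exact/measurable_EFinP.
  by apply: cvg_EFin; [exact/nearW|exact: ff].
have [|||||If h1 h2] := @dominated_convergence _ _ _ mu setT measurableT
  (fun m => EFin \o F m) (EFin \o f) (EFin \o g).
- by move=> m; exact/measurable_EFinP.
- exact/measurable_EFinP.
- by apply/aeW => x _; apply: cvg_EFin; [exact/nearW|exact: ff].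
- exact: Ig.
- by apply/aeW => x m _ /=; rewrite lee_fin.
have IF m : itg (F m) by exact: itg_le Ig.
split=> //.
  by apply/fine_cvg; move: h2; rewrite -int_EFin.
apply/fine_cvg; move: h1; rewrite /=.
exact.
Qed.

(** The form in which limits are shown integrable throughout: convergence everywhere replaces the
    lower limit, and the uniform bound passes to the limit. *)
Lemma int_fatou F f K : (forall m, itg (F m)) -> (forall m x, 0 <= F m x) ->
  (forall x, F m x @[m --> \oo] --> f x) -> (forall m, int (F m) <= K) ->
  itg f /\ int f <= K.
Proof.
move=> If f0 ff fK.
have mf : measurable_fun setT f.
  apply/measurable_EFinP.
  apply: (emeasurable_fun_cvg (fun m => EFin \o F m)) => [m|x _].
    exact/measurable_EFinP/itg_meas.
  by apply: cvg_EFin; [exact/nearW|exact: ff].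
have f0' x : 0 <= f x.
  have /cvg_lim <- // := ff x; apply: limr_ge; last exact: nearW.
  by apply/cvg_ex; exists (f x); exact: ff.
have h : (\int[mu]_x (f x)%:E <= K%:E)%E.
  have := @fatou _ _ _ mu setT measurableT (fun m => EFin \o F m).
  have E x : limn_einf (fun m => (EFin \o F m) x) = (f x)%:E.
    have [] := @cvg_limn_einf_sup _ (fun m => (EFin \o F m) x) (f x)%:E; last by [].
    by apply: cvg_EFin; [exact/nearW|exact: ff].
  under eq_integral => x _ do rewrite E.
  move=> H; apply: le_trans (H _ _) _ => [m|m x _|] /=.
  - exact/measurable_EFinP/itg_meas.
  - by rewrite lee_fin.
  - rewrite limn_einf_lim; apply: lime_le; first exact: is_cvg_einfs.
    apply: nearW => m; apply: le_trans (_ : _ <= (int (F m))%:E)%E _.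
      by apply: ereal_inf_lbound; exists m => //=; rewrite -int_EFin.
    by rewrite lee_fin.
have If' : itg f by apply/itg_ge0P => //; exact: le_lt_trans h (ltey _).
by split=> //; rewrite -lee_fin int_EFin.
Qed.

Lemma int_ae f g : measurable_fun setT f -> {ae mu, forall x, f x = g x} ->
  measurable_fun setT g -> itg f -> itg g /\ int f = int g.
Proof.
move=> mf fg mg If; split.
  apply/integrableP; split; first exact/measurable_EFinP.
  have /integrableP[_] := If; apply: le_lt_trans.
  rewrite le_eqVlt; apply/orP; left; apply/eqP/ae_eq_integral => //.
  - exact/measurableT_comp/measurable_EFinP.
  - exact/measurableT_comp/measurable_EFinP.
  - by apply: filterS fg => x /= -> _.
congr fine; apply: ae_eq_integral => //; try exact/measurable_EFinP.
by apply: filterS fg => x /= -> _.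
Qed.

Lemma int_eq0 f : itg f -> (forall x, 0 <= f x) -> int f = 0 ->
  {ae mu, forall x, f x = 0}.
Proof.
move=> If f0 i0.
have := @ae_eq_integral_abs _ _ _ mu setT measurableT (EFin \o f).
move=> /(_ (measurable_int _ If)) [+ _].
have -> : (\int[mu]_x `|(EFin \o f) x| = 0)%E.
  under eq_integral => x _ do rewrite gee0_abs ?lee_fin//.
  by rewrite -int_EFin// i0.
by move=> /(_ erefl); apply: filterS => x /= /(_ I) [].
Qed.

End real_integral.

Section L2_real.
Context d (T : measurableType d) (R : realType) (mu : {measure set T -> \bar R}).
Implicit Types (f g h : T -> R) (F : nat -> T -> R).
Local Notation itg := (itg mu).
Local Notation int := (int mu).

Definition L2 f : Prop := measurable_fun setT f /\ itg (fun x => f x ^+ 2).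
Definition ip f g : R := int (fun x => f x * g x).
Definition nm f : R := Num.sqrt (ip f f).

Lemma Lnorm2E f : 'N[mu]_2%:E[EFin \o f]%E =
  ((\int[mu]_x (f x ^+ 2)%:E) `^ 2^-1)%E.
Proof.
rewrite unlock; congr (_ `^ _)%E; apply: eq_integral => x _.
by rewrite /= powR_mulrn// -normrX ger0_norm// sqr_ge0.
Qed.

Lemma L2P f : f \in Lfun mu 2%:E <-> L2 f.
Proof.
split.
  move=> lf; split; last exact: Lfun2_integrable_sqr.
  by move: lf; rewrite inE => /andP[]; rewrite inE.
move=> [mf If]; rewrite inE; apply/andP; split; rewrite inE//=.
rewrite /finite_norm Lnorm2E poweR_lty//.
apply/itg_ge0P => //; first exact: measurable_funX.
by move=> x; exact: sqr_ge0.
Qed.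

Lemma L2_meas f : L2 f -> measurable_fun setT f. Proof. by case. Qed.
Lemma L2_itg f : L2 f -> itg (fun x => f x ^+ 2). Proof. by case. Qed.

Lemma L2_ext f g : f =1 g -> L2 f -> L2 g.
Proof. by move=> /funext ->. Qed.

Lemma nm_ext f g : f =1 g -> nm f = nm g.
Proof. by move=> /funext ->. Qed.

Lemma ipC f g : ip f g = ip g f.
Proof. by apply: int_ext => x; rewrite mulrC. Qed.

Lemma ip_ge0 f : 0 <= ip f f.
Proof. by apply: int_ge0 => x; rewrite -expr2 sqr_ge0. Qed.

Lemma nm_ge0 f : 0 <= nm f. Proof. exact: sqrtr_ge0. Qed.

Lemma nm_sq f : nm f ^+ 2 = ip f f.
Proof. by rewrite sqr_sqrtr// ip_ge0. Qed.

Lemma nm_sqE f : nm f ^+ 2 = int (fun x => f x ^+ 2).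
Proof. by rewrite nm_sq; apply: int_ext => x; rewrite expr2. Qed.

Lemma Lnorm2_nm f : L2 f -> 'N[mu]_2%:E[EFin \o f]%E = (nm f)%:E.
Proof.
move=> [mf If]; rewrite Lnorm2E -int_EFin// -nm_sqE poweR_EFin.
by rewrite powR12_sqrt ?sqr_ge0// sqrtr_sqr ger0_norm// nm_ge0.
Qed.

Lemma L2_mul f g : L2 f -> L2 g -> itg (fun x => f x * g x).
Proof.
move=> [mf If] [mg Ig]; apply: itg_le (itgD If Ig); first exact: measurable_funM.
move=> x; rewrite ler_norml; have := sqr_ge0 (f x - g x).
have := sqr_ge0 (f x + g x); have := sqr_ge0 (f x); have := sqr_ge0 (g x).
by move=> *; apply/andP; split; nra.
Qed.

Lemma L2D f g : L2 f -> L2 g -> L2 (fun x => f x + g x).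
Proof.
move=> Lf Lg; split; first exact: measurable_funD Lf.1 Lg.1.
apply: itg_ext (itgD (itgD (L2_itg Lf) (L2_itg Lg)) (itgZ 2 (L2_mul Lf Lg))).
by move=> x; ring.
Qed.

Lemma L2Z c f : L2 f -> L2 (fun x => c * f x).
Proof.
move=> Lf; split; first exact: measurable_funM (measurable_cst _) Lf.1.
by apply: itg_ext (itgZ (c ^+ 2) (L2_itg Lf)) => x; rewrite exprMn.
Qed.

Lemma L2N f : L2 f -> L2 (fun x => - f x).
Proof. by move=> /(L2Z (-1)); apply: L2_ext => x; rewrite mulN1r. Qed.

Lemma L2B f g : L2 f -> L2 g -> L2 (fun x => f x - g x).
Proof. by move=> Lf Lg; exact: L2D Lf (L2N Lg). Qed.

Lemma L2_0 : L2 (fun=> 0).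
Proof. by split=> //; apply: itg_ext (itg0 mu) => x; rewrite expr0n. Qed.

Lemma L2_sum (I : Type) (s : seq I) (G : I -> T -> R) :
  (forall i, L2 (G i)) -> L2 (fun x => \sum_(i <- s) G i x).
Proof.
move=> LG; elim: s => [|i s IH].
  by apply: L2_ext L2_0 => x; rewrite big_nil.
by apply: L2_ext (L2D (LG i) IH) => x; rewrite big_cons.
Qed.

Lemma L2_le f g : measurable_fun setT f -> (forall x, `|f x| <= `|g x|) ->
  L2 g -> L2 f.
Proof.
move=> mf fg Lg; split=> //; apply: itg_le (L2_itg Lg).
  exact: measurable_funX.
by move=> x; rewrite normrX -[leRHS]ger0_norm ?sqr_ge0// normrX lerXn2r// ?nnegrE.
Qed.

Lemma L2_abs f : L2 f -> L2 (fun x => `|f x|).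
Proof.
by move=> Lf; apply: L2_le (Lf) => [|x]; [apply: measurableT_comp => //; case: Lf|rewrite normr_id].
Qed.

Lemma ipDl f g h : L2 f -> L2 g -> L2 h ->
  ip (fun x => f x + g x) h = ip f h + ip g h.
Proof.
move=> Lf Lg Lh; rewrite /ip -intD//; try exact: L2_mul.
by apply: int_ext => x; rewrite mulrDl.
Qed.

Lemma ipZl c f h : L2 f -> L2 h -> ip (fun x => c * f x) h = c * ip f h.
Proof.
move=> Lf Lh; rewrite /ip -intZ//; try exact: L2_mul.
by apply: int_ext => x; rewrite mulrA.
Qed.

Lemma ipBl f g h : L2 f -> L2 g -> L2 h ->
  ip (fun x => f x - g x) h = ip f h - ip g h.
Proof.
move=> Lf Lg Lh; rewrite /ip -intB//; try exact: L2_mul.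
by apply: int_ext => x; rewrite mulrBl.
Qed.

Lemma ipDr f g h : L2 f -> L2 g -> L2 h ->
  ip h (fun x => f x + g x) = ip h f + ip h g.
Proof. by move=> *; rewrite ipC ipDl// ![ip h _]ipC. Qed.

Lemma ipBr f g h : L2 f -> L2 g -> L2 h ->
  ip h (fun x => f x - g x) = ip h f - ip h g.
Proof. by move=> *; rewrite ipC ipBl// ![ip h _]ipC. Qed.

Lemma ipZr c f h : L2 f -> L2 h -> ip h (fun x => c * f x) = c * ip h f.
Proof. by move=> *; rewrite ipC ipZl// ![ip h _]ipC. Qed.

Lemma cauchy_schwarz f g : L2 f -> L2 g -> `|ip f g| <= nm f * nm g.
Proof.
move=> Lf Lg.
have H (a : R) : 0 <= ip f f + 2 * a * ip f g + a ^+ 2 * ip g g.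
  have := ip_ge0 (fun x => f x + a * g x).
  have La := L2Z a Lg.
  rewrite ipDl// ?ipDr// ?ipZl ?ipZr//; last exact: L2D.
  by rewrite (ipC g f) => h; apply: le_trans h _; rewrite le_eqVlt; apply/orP; left;
     apply/eqP; ring.
rewrite -(@ler_pXn2r _ 2)// ?nnegrE ?mulr_ge0 ?nm_ge0//.
rewrite exprMn !nm_sq real_normK ?num_real//.
have [g0|g0] := eqVneq (ip g g) 0.
  rewrite g0 mulr0.
  have [->|fg0] := eqVneq (ip f g) 0; first by rewrite expr0n.
  (* With [ip g g = 0] the quadratic is affine in [a], and here it would take the value -1. *)
  have := H (- (ip f f + 1) / (2 * ip f g)).
  rewrite g0 mulr0 addr0 (_ : 2 * _ * _ = - (ip f f + 1)); last by field.
  by rewrite opprD addrA subrr add0r oppr_ge0 ler10.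
have gp : 0 < ip g g by rewrite lt_def g0 ip_ge0.
(* The minimiser of the quadratic. *)
have := H (- ip f g / ip g g).
rewrite (_ : _ + _ = (ip f f * ip g g - ip f g ^+ 2) / ip g g); last by field.
by rewrite pmulr_lge0 ?invr_gt0// subr_ge0.
Qed.

Lemma nmD f g : L2 f -> L2 g -> nm (fun x => f x + g x) <= nm f + nm g.
Proof.
move=> Lf Lg; rewrite -(@ler_pXn2r _ 2)// ?nnegrE ?addr_ge0 ?nm_ge0//.
have Lfg := L2D Lf Lg.
rewrite sqrrD !nm_sq ipDl// ?ipDr// (ipC g f).
have := cauchy_schwarz Lf Lg; have := ler_norm (ip f g).
rewrite -mulr_natr; nra.
Qed.

Lemma nmZ c f : L2 f -> nm (fun x => c * f x) = `|c| * nm f.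
Proof.
move=> Lf; have Lc := L2Z c Lf; rewrite /nm ipZl// ipZr// mulrA -expr2.
by rewrite sqrtrM ?sqr_ge0// sqrtr_sqr.
Qed.

Lemma nmN f : nm (fun x => - f x) = nm f.
Proof. by rewrite /nm /ip; congr Num.sqrt; apply: int_ext => x; rewrite mulrNN. Qed.

Lemma nm0 : nm (fun=> 0) = 0.
Proof. by apply/eqP; rewrite -sqrf_eq0 nm_sq /ip (int_ext _ (_ : _ =1 fun=> 0)) ?int0// => x; rewrite mul0r. Qed.

Lemma nm_subC f g : nm (fun x => f x - g x) = nm (fun x => g x - f x).
Proof. by rewrite -nmN; apply: nm_ext => x; rewrite opprB. Qed.

Lemma nm_triangle h f g : L2 f -> L2 g -> L2 h ->
  nm (fun x => f x - g x) <= nm (fun x => f x - h x) + nm (fun x => h x - g x).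
Proof.
move=> Lf Lg Lh; apply: le_trans (nmD (L2B Lf Lh) (L2B Lh Lg)).
by rewrite (nm_ext (_ : _ =1 fun x => f x - h x + (h x - g x))) => // x; ring.
Qed.

Lemma nm_dist f g : L2 f -> L2 g -> `|nm f - nm g| <= nm (fun x => f x - g x).
Proof.
move=> Lf Lg; rewrite ler_norml lerNl opprB !lerBlDr; apply/andP; split.
  rewrite nm_subC; apply: le_trans (nmD (L2B Lg Lf) Lf).
  by rewrite (nm_ext (_ : _ =1 fun x => g x - f x + f x)) => // x; ring.
apply: le_trans (nmD (L2B Lf Lg) Lg).
by rewrite (nm_ext (_ : _ =1 fun x => f x - g x + g x)) => // x; ring.
Qed.

Lemma nm_sum (I : Type) (s : seq I) (G : I -> T -> R) :
  (forall i, L2 (G i)) -> nm (fun x => \sum_(i <- s) G i x) <= \sum_(i <- s) nm (G i).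
Proof.
move=> LG; elim: s => [|i s IH].
  by rewrite big_nil (nm_ext (_ : _ =1 fun=> 0)) ?nm0// => x; rewrite big_nil.
rewrite big_cons; apply: le_trans (lerD (lexx _) IH).
apply: le_trans (nmD (LG i) (L2_sum s LG)).
by rewrite (nm_ext (_ : _ =1 fun x => G i x + \sum_(j <- s) G j x)) // => x; rewrite big_cons.
Qed.

Lemma nm_le f g : L2 f -> L2 g -> (forall x, `|f x| <= `|g x|) -> nm f <= nm g.
Proof.
move=> Lf Lg fg; rewrite -(@ler_pXn2r _ 2)// ?nnegrE ?nm_ge0// !nm_sqE.
apply: int_le; [exact: L2_itg|exact: L2_itg|move=> x].
by rewrite -[leLHS]ger0_norm ?sqr_ge0// -[leRHS]ger0_norm ?sqr_ge0// !normrX lerXn2r// ?nnegrE.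
Qed.

Lemma ip_ae0 f : L2 f -> ip f f = 0 -> {ae mu, forall x, f x = 0}.
Proof.
move=> Lf; rewrite -nm_sq nm_sqE => h.
have := int_eq0 (L2_itg Lf) (fun x => sqr_ge0 (f x)) h.
by apply: filterS => x /eqP; rewrite sqrf_eq0 => /eqP.
Qed.

Lemma nm_ae0 f : L2 f -> nm f = 0 -> {ae mu, forall x, f x = 0}.
Proof. by move=> Lf n0; apply: ip_ae0 => //; rewrite -nm_sq n0 expr0n. Qed.

Lemma L2_ae f g : {ae mu, forall x, f x = g x} -> measurable_fun setT g ->
  L2 f -> L2 g /\ nm f = nm g.
Proof.
move=> fg mg Lf.
have fg2 : {ae mu, forall x, f x ^+ 2 = g x ^+ 2} by apply: filterS fg => x ->.
have [Ig E] := int_ae (measurable_funX 2 Lf.1) fg2 (measurable_funX 2 mg) (L2_itg Lf).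
split=> //; apply/eqP; rewrite -(@eqrXn2 _ 2) ?nm_ge0//; apply/eqP.
by rewrite !nm_sqE.
Qed.

Lemma ip_cvg F f g : (forall m, L2 (F m)) -> L2 f -> L2 g ->
  nm (fun x => F m x - f x) @[m --> \oo] --> 0 -> ip (F m) g @[m --> \oo] --> ip f g.
Proof.
move=> LF Lf Lg h; apply: (squeeze0 (K := nm g)) h => m.
rewrite -ipBl//; apply: le_trans (cauchy_schwarz (L2B (LF m) Lf) Lg) _.
by rewrite mulrC ger0_norm// nm_ge0.
Qed.

Lemma nm_cvg F f : (forall m, L2 (F m)) -> L2 f ->
  nm (fun x => F m x - f x) @[m --> \oo] --> 0 -> nm (F m) @[m --> \oo] --> nm f.
Proof.
move=> LF Lf h; apply: (squeeze0 (K := 1)) h => m.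
by rewrite mul1r [leRHS]ger0_norm ?nm_ge0// nm_dist.
Qed.

Lemma L2_dct F f g : (forall m, measurable_fun setT (F m)) ->
  (forall m x, `|F m x| <= g x) -> L2 g ->
  (forall x, F m x @[m --> \oo] --> f x) ->
  L2 f /\ nm (fun x => F m x - f x) @[m --> \oo] --> 0.
Proof.
move=> mF Fg Lg Ff.
have mf : measurable_fun setT f.
  apply/measurable_EFinP.
  apply: (emeasurable_fun_cvg (fun m => EFin \o F m)) => [m|x _].
    exact/measurable_EFinP.
  by apply: cvg_EFin; [exact/nearW|exact: Ff].
have fg x : `|f x| <= g x.
  have /cvg_lim <- // : `|F m x| @[m --> \oo] --> `|f x| by apply: cvg_norm; exact: Ff.
  apply: limr_le; last exact: nearW.
  by apply/cvg_ex; exists `|f x|; apply: cvg_norm; exact: Ff.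
have Lf : L2 f by apply: L2_le Lg => // x; rewrite (le_trans (fg x))// ler_norm.
split=> //.
have [||||_ + _] := @int_dct _ _ _ mu (fun m x => (F m x - f x) ^+ 2) (fun=> 0)
  (fun x => 4 * g x ^+ 2).
- by move=> m; apply/measurable_funX/measurable_funB.
- move=> m x; rewrite ger0_norm ?sqr_ge0//.
  have := Fg m x; have := fg x; rewrite !ler_norml => /andP[? ?] /andP[? ?].
  nra.
- by apply: itgZ; exact: L2_itg.
- move=> x; have -> : 0 = (f x - f x) ^+ 2 :> R by rewrite subrr expr0n.
  under eq_fun do rewrite expr2; rewrite expr2.
  by apply: cvgM; apply: cvgB; (exact: Ff || exact: cvg_cst).
rewrite int0 => h.
have := cvg_comp _ _ h (@sqrt_continuous R 0); rewrite sqrtr0.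
by apply: cvg_trans; apply: near_eq_cvg; apply: nearW => m /=; rewrite /nm /ip;
  congr Num.sqrt; apply: int_ext => x; rewrite expr2.
Qed.

End L2_real.

(** * Completeness of L^2 *)

Section L2_completeness.
Context d (T : measurableType d) (R : realType) (mu : {measure set T -> \bar R}).
Implicit Types (f g h : T -> R) (F : nat -> T -> R).
Local Notation L2 := (L2 mu).
Local Notation nm := (nm mu).
Local Notation int := (int mu).
Local Notation itg := (itg mu).

(** By monotone convergence the extended-real limit has integral at most [K], so it is finite almost
    everywhere. *)
Lemma int_mct_ae F K : (forall m, itg (F m)) -> (forall m x, 0 <= F m x) ->
  (forall m x, F m x <= F m.+1 x) -> (forall m, int (F m) <= K) ->
  {ae mu, forall x, exists M, forall m, F m x <= M}.
Proof.
move=> IF F0 ndF FK.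
pose q x := limn (fun m => (F m x)%:E).
have ndE x : {homo (fun m => (F m x)%:E) : m n / (m <= n)%N >-> (m <= n)%E}.
  by move=> m n mn; rewrite lee_fin; elim: n mn => [|n IH];
    [rewrite leqn0 => /eqP ->|rewrite leq_eqVlt => /predU1P[->//|/IH h];
     exact: le_trans h (ndF _ _)].
have mq : measurable_fun setT q.
  apply: (emeasurable_fun_cvg (fun m => EFin \o F m)) => [m|x _].
    exact/measurable_EFinP/itg_meas.
  by apply: ereal_nondecreasing_is_cvgn; exact: ndE.
have Iq : mu.-integrable setT q.
  apply/integrableP; split=> //.
  apply: (@le_lt_trans _ _ K%:E); last exact: ltey.
  have q0 x : (0 <= q x)%E.
    by apply: lime_ge; [exact: ereal_nondecreasing_is_cvgn|apply: nearW => m; rewrite lee_fin].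
  under eq_integral => x _ do rewrite gee0_abs//.
  rewrite monotone_convergence//=.
  - apply: lime_le.
      apply: ereal_nondecreasing_is_cvgn => m n mn.
      apply: ge0_le_integral => //= [x _|||x _].
      + by rewrite lee_fin.
      + exact/measurable_EFinP/itg_meas.
      + exact/measurable_EFinP/itg_meas.
      + exact: ndE.
    by apply: nearW => m; rewrite -int_EFin// lee_fin.
  - by move=> m; exact/measurable_EFinP/itg_meas.
  - by move=> m x _; rewrite lee_fin.
have := integrable_ae measurableT Iq; apply: filterS => x /(_ I) qfin.
exists (fine (q x)) => m; rewrite -lee_fin fineK//.
by apply: lime_ge; [exact: ereal_nondecreasing_is_cvgn|exists m => // n /= mn; exact: ndE].
Qed.

(** Riesz-Fischer. Along a subsequence with increments of norm at most 2^-k, the sums of the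
    absolute increments have norm at most 2, hence are bounded almost everywhere; the telescoping
    series converges absolutely there, and Fatou's lemma bounds the distance of the whole sequence
    to the limit. *)
Lemma L2_complete F : (forall m, L2 (F m)) ->
  (forall e, 0 < e -> exists N, forall m n, (N <= m)%N -> (N <= n)%N ->
     nm (fun x => F m x - F n x) <= e) ->
  exists2 f, L2 f & nm (fun x => F m x - f x) @[m --> \oo] --> 0.
Proof.
move=> LF HC.
have /choice[N0 HN0] : forall k : nat, exists N, forall m n, (N <= m)%N -> (N <= n)%N ->
     nm (fun x => F m x - F n x) <= 2^-1 ^+ k.
  by move=> k; apply: HC; rewrite exprn_gt0.
pose N := fix N k := if k is k'.+1 then maxn (N k') (N0 k) else N0 0%N.
have ndN k : (N k <= N k.+1)%N by exact: leq_maxl.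
have NN0 k : (N0 k <= N k)%N by case: k => [|k] //=; exact: leq_maxr.
have ndN' k l : (k <= l)%N -> (N k <= N l)%N.
  by elim: l => [|l IH]; [rewrite leqn0 => /eqP ->|
    rewrite leq_eqVlt => /predU1P[->//|/IH h]; exact: leq_trans h (ndN _)].
pose G k := F (N k).
have LG k : L2 (G k) by exact: LF.
have HG k l m : (k <= l)%N -> (N k <= m)%N -> nm (fun x => G l x - F m x) <= 2^-1 ^+ k.
  move=> kl km; apply: HN0; first exact: leq_trans (NN0 k) (ndN' _ _ kl).
  exact: leq_trans (NN0 k) km.
pose D k x : R := `|G k.+1 x - G k x|.
have LD k : L2 (D k) by apply: L2_abs; exact: L2B.
have D0 k x : 0 <= D k x by exact: normr_ge0.
pose S k x : R := \sum_(i < k) D i x.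
have LS k : L2 (S k) by exact: L2_sum.
have S0 k x : 0 <= S k x by apply: sumr_ge0 => i _; exact: D0.
have nS k : nm (S k) <= 2.
  apply: le_trans (nm_sum _ _) _ => //.
  apply: (@le_trans _ _ (\sum_(i < k) 2^-1 ^+ i)).
    apply: ler_sum => i _; rewrite (_ : nm _ = nm (fun x => G i.+1 x - F (N i) x)).
      by apply: HG => //.
    by rewrite /nm /ip; congr Num.sqrt; apply: int_ext => x; rewrite /D -normrM -expr2
      ger0_norm ?sqr_ge0// expr2.
  suff -> : \sum_(i < k) 2^-1 ^+ i = 2 - 2 * 2^-1 ^+ k :> R.
    by rewrite gerBl mulr_ge0// exprn_ge0.
  elim: k => [|k IH]; first by rewrite big_ord0 expr0 mulr1 subrr.
  by rewrite big_ord_recr /= IH exprS; field.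
have [||||B [mB B0 HB]] := @int_mct_ae (fun k x => S k x ^+ 2) 4.
- by move=> k; exact: L2_itg.
- by move=> k x; exact: sqr_ge0.
- move=> k x; rewrite lerXn2r ?nnegrE ?S0//.
  by rewrite /S big_ord_recr /= lerDl.
- move=> k; rewrite -nm_sqE (_ : 4 = 2 ^+ 2); last by rewrite expr2 -natrM.
  by rewrite lerXn2r ?nnegrE// nm_ge0.
(* Setting the subsequence to 0 on the exceptional set makes it converge everywhere, as [int_fatou]
   requires. *)
pose G' k x := G k x * \1_(~` B) x.
have G'cvg x : cvgn (G' ^~ x).
  have [xB|xB] := pselect (B x).
    apply/cvg_ex; exists 0; apply: cvg_near_cst; apply: nearW => k.
    by rewrite /G' indicE memNset ?mulr0//; exact.
  have [M HM] : exists M, forall m, S m x ^+ 2 <= M.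
    by apply: contrapT => h; apply: xB; apply: HB.
  have cD : cvgn (series (fun k => `|G k.+1 x - G k x|)).
    apply: nondecreasing_is_cvgn.
      by apply: nondecreasing_series => k _ _; rewrite normr_ge0.
    (* From a bound on the square to one on [S k x]: 2 s <= s^2 + 1 and s >= 0. *)
    exists (M + 1) => _ [k _ <-].
    have := HM k; rewrite /series /= big_mkord -/(S k x) => h.
    have := sqr_ge0 (S k x - 1); rewrite sqrrB1 => h2.
    have := S0 k x; nra.
  have := normed_cvg cD => /cvg_ex[l Hl].
  apply/cvg_ex; exists (l + G 0%N x).
  have : (series (fun k => G k.+1 x - G k x) n + G 0%N x) @[n --> \oo] --> l + G 0%N x.
    by apply: cvgD => //; exact: cvg_cst.
  apply: cvg_trans; apply: near_eq_cvg; apply: nearW => k.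
  rewrite /G' indicE mem_set// mulr1 /series /= telescope_sumr// addrNK//.
pose f x := limn (G' ^~ x).
have mG' k : measurable_fun setT (G' k).
  by apply: measurable_funM; [exact: L2_meas|apply: measurable_indic; exact: measurableC].
have LG' k : L2 (G' k).
  apply: L2_le (LG k) => // x; rewrite /G' normrM ler_piMr// indicE.
  by case: (_ \in _); rewrite ?normr1 ?normr0.
have aeG k : {ae mu, forall x, G k x = G' k x}.
  exists B; split=> // x /= H; apply: contrapT => xB; apply: H.
  by rewrite /G' indicE mem_set// mulr1.
have fat k m : (N k <= m)%N ->
    L2 (fun x => F m x - f x) /\ nm (fun x => F m x - f x) <= 2^-1 ^+ k.
  move=> km.
  have nlm l : (k <= l)%N -> nm (fun x => F m x - G' l x) <= 2^-1 ^+ k.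
    move=> kl; apply: le_trans (HG k l m kl km); rewrite nm_subC le_eqVlt.
    apply/orP; left; apply/eqP/esym.
    apply: (L2_ae _ _ (L2B (LG l) (LF m))).2; last exact: measurable_funB (mG' l) (LF m).1.
    by apply: filterS (aeG l) => x ->.
  have [] := @int_fatou _ _ _ mu (fun l x => (F m x - G' (l + k)%N x) ^+ 2)
    (fun x => (F m x - f x) ^+ 2) ((2^-1 ^+ k) ^+ 2).
  - by move=> l; apply: L2_itg; exact: L2B.
  - by move=> l x; exact: sqr_ge0.
  - move=> x; rewrite expr2; under eq_fun do rewrite expr2.
    by apply: cvgM; (apply: cvgB; first exact: cvg_cst);
      have := G'cvg x; rewrite -(cvg_shiftn k).
  - move=> l; rewrite -nm_sqE lerXn2r ?nnegrE ?nm_ge0 ?exprn_ge0//.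
    by apply: nlm; exact: leq_addl.
  move=> I1 I2; split.
    split=> //; apply: measurable_funB; first exact: (LF m).1.
    apply/measurable_EFinP.
    apply: (emeasurable_fun_cvg (fun l => EFin \o G' l)) => [l|x _].
      exact/measurable_EFinP.
    by apply: cvg_EFin; [exact/nearW|exact: G'cvg].
  by rewrite -(@ler_pXn2r _ 2)// ?nnegrE ?nm_ge0 ?exprn_ge0// nm_sqE.
have Lf : L2 f.
  have [L0 _] := fat 0%N _ (leqnn _).
  apply: L2_ext (L2B (LF (N 0%N)) L0) => x; ring.
exists f => //; apply/seqP => e e0.
have [k ke] : exists k : nat, 2^-1 ^+ k <= e.
  have /cvgrPdist_lt /(_ e e0) [k _ /(_ k (leqnn _))] : 2^-1 ^+ k @[k --> \oo] --> (0:R).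
    by apply: cvg_expr; rewrite ger0_norm// invf_lt1// ltr1n.
  by rewrite sub0r normrN => /ltW h; exists k; apply: le_trans h; exact: ler_norm.
exists (N k) => m km; rewrite subr0 ger0_norm ?nm_ge0//.
exact: le_trans (fat k m km).2 ke.
Qed.

End L2_completeness.

(** * Integration over R^n *)

Section transfer.
Context d1 d2 (T1 : measurableType d1) (T2 : measurableType d2) (R : realType).
Variables (m1 : {measure set T1 -> \bar R}) (m2 : {measure set T2 -> \bar R}).
Variables (phi : T1 -> T2) (mphi : measurable_fun setT phi).
Hypothesis m2E : forall A, measurable A -> m2 A = m1 (phi @^-1` A).

Lemma ge0_integral_transfer (f : T2 -> \bar R) : measurable_fun setT f ->
  (forall y, 0 <= f y)%E -> (\int[m2]_y f y = \int[m1]_x f (phi x))%E.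
Proof.
move=> mf f0.
rewrite (eq_measure_integral (pushforward m1 phi)) //; last first.
  by move=> A mA _ /=; rewrite m2E.
by rewrite ge0_integral_pushforward// preimage_setT.
Qed.

Lemma itg_transfer (f : T2 -> R) : measurable_fun setT f ->
  itg m2 f <-> itg m1 (f \o phi).
Proof.
move=> mf.
have mfp : measurable_fun setT (f \o phi) by exact: measurableT_comp.
have E : (\int[m2]_y `|(f y)%:E| = \int[m1]_x `|(f (phi x))%:E|)%E.
  rewrite -(ge0_integral_transfer (f := fun y => `|(f y)%:E|%E))//.
  by apply: measurableT_comp => //; exact/measurable_EFinP.
split=> /integrableP[_ h]; apply/integrableP; split; try exact/measurable_EFinP.
  by move: h; rewrite /= E.
by rewrite /= E.
Qed.

Lemma int_transfer (f : T2 -> R) : measurable_fun setT f ->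
  int m2 f = int m1 (f \o phi).
Proof.
move=> mf; rewrite /int /Rintegral; congr fine.
rewrite integralE [RHS]integralE; congr (_ - _)%E.
  have := ge0_integral_transfer (f := (EFin \o f)^\+%E)
    (measurable_funepos ((measurable_EFinP _ _).2 mf)) (funepos_ge0 _).
  by move=> ->; apply: eq_integral => x _; rewrite !funeposE.
  have := ge0_integral_transfer (f := (EFin \o f)^\-%E)
    (measurable_funeneg ((measurable_EFinP _ _).2 mf)) (funeneg_ge0 _).
  by move=> ->; apply: eq_integral => x _; rewrite !funenegE.
Qed.
End transfer.

(** * Fubini's theorem for real-valued integrals *)

Section fubini_real.
Context d1 d2 (T1 : measurableType d1) (T2 : measurableType d2) (R : realType).
Variables (m1 : {sigma_finite_measure set T1 -> \bar R})
  (m2 : {sigma_finite_measure set T2 -> \bar R}).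
Local Notation m12 := (m1 \x m2)%E.
Implicit Types (k : T1 * T2 -> R).

Lemma measurable_section1 k x : measurable_fun setT k ->
  measurable_fun setT (fun y => k (x, y)).
Proof. by move=> mk; apply: (measurableT_comp mk); exact: measurable_pair1. Qed.

Lemma measurable_section2 k y : measurable_fun setT k ->
  measurable_fun setT (fun x => k (x, y)).
Proof. by move=> mk; apply: (measurableT_comp mk); exact: measurable_pair2. Qed.

Lemma measurable_int1 k : measurable_fun setT k ->
  measurable_fun setT (fun x => int m2 (fun y => k (x, y))).
Proof.
move=> mk; have mk' : measurable_fun setT (EFin \o k) by exact/measurable_EFinP.
apply: (measurableT_comp (f := fine)) => //.
under eq_fun do rewrite integralE.
apply: emeasurable_funB.
  have := measurable_fun_fubini_tonelli_F (m2 := m2) (EFin \o k)^\+%E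
    (measurable_funepos mk') (funepos_ge0 _).
  by congr (measurable_fun _ _); apply/funext => x; apply: eq_integral => y _; rewrite !funeposE.
have := measurable_fun_fubini_tonelli_F (m2 := m2) (EFin \o k)^\-%E
    (measurable_funeneg mk') (funeneg_ge0 _).
  by congr (measurable_fun _ _); apply/funext => x; apply: eq_integral => y _; rewrite !funenegE.
Qed.

Lemma measurable_int2 k : measurable_fun setT k ->
  measurable_fun setT (fun y => int m1 (fun x => k (x, y))).
Proof.
move=> mk; have mk' : measurable_fun setT (EFin \o k) by exact/measurable_EFinP.
apply: (measurableT_comp (f := fine)) => //.
under eq_fun do rewrite integralE.
apply: emeasurable_funB.
  have := measurable_fun_fubini_tonelli_G (m1 := m1) (EFin \o k)^\+%E
    (measurable_funepos mk') (funepos_ge0 _).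
  by congr (measurable_fun _ _); apply/funext => x; apply: eq_integral => y _; rewrite !funeposE.
have := measurable_fun_fubini_tonelli_G (m1 := m1) (EFin \o k)^\-%E
    (measurable_funeneg mk') (funeneg_ge0 _).
  by congr (measurable_fun _ _); apply/funext => x; apply: eq_integral => y _; rewrite !funenegE.
Qed.

(** Tonelli's theorem. All sections, not just almost all, are assumed integrable because [int] sends
    an infinite integral to 0; the right-hand side is then a genuine iterated integral. *)
Lemma itg_prodP k : measurable_fun setT k ->
  (forall x, itg m2 (fun y => k (x, y))) ->
  itg m12 k <-> itg m1 (fun x => int m2 (fun y => `|k (x, y)|)).
Proof.
move=> mk Ik.
have mk' : measurable_fun setT (EFin \o k) by exact/measurable_EFinP.
rewrite /itg (integrable12ltyP m1 m2 mk').
have E x : (\int[m2]_y `|(EFin \o k) (x, y)| = (int m2 (fun y => `|k (x, y)|))%:E)%E.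
  by rewrite int_EFin//; exact: itg_abs.
under eq_integral => x _ do rewrite E.
rewrite -itg_ge0P//; last by move=> x; exact: int_ge0.
by apply: (measurable_int1 (k := fun z => `|k z|)); exact: measurableT_comp.
Qed.

Lemma int_prod k : itg m12 k -> (forall x, itg m2 (fun y => k (x, y))) ->
  itg m1 (fun x => int m2 (fun y => k (x, y))) /\
  int m12 k = int m1 (fun x => int m2 (fun y => k (x, y))).
Proof.
move=> Ik Ix.
have E x : ((int m2 (fun y => k (x, y)))%:E = \int[m2]_y (k (x, y))%:E)%E.
  by rewrite int_EFin.
split.
  rewrite /itg (_ : EFin \o _ = fubini_F m2 (EFin \o k)); last first.
    by apply/funext => x /=; rewrite E.
  exact: integrable_fubini_F.
rewrite /int /Rintegral -(integral12_prod_meas1 Ik); congr fine.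
by apply: eq_integral => x _; rewrite E.
Qed.

Lemma int_prod_swap k : itg m12 k -> (forall x, itg m2 (fun y => k (x, y))) ->
  (forall y, itg m1 (fun x => k (x, y))) ->
  int m1 (fun x => int m2 (fun y => k (x, y))) =
  int m2 (fun y => int m1 (fun x => k (x, y))).
Proof.
move=> Ik Ix Iy; rewrite -(int_prod Ik Ix).2 /int /Rintegral.
rewrite -(integral21_prod_meas1 Ik); congr fine.
by apply: eq_integral => y _; rewrite int_EFin.
Qed.

Lemma itg_tensor (f : T1 -> R) (g : T2 -> R) : itg m1 f -> itg m2 g ->
  itg m12 (fun z => f z.1 * g z.2) /\
  int m12 (fun z => f z.1 * g z.2) = int m1 f * int m2 g.
Proof.
move=> If Ig.
have mk : measurable_fun setT (fun z : T1 * T2 => f z.1 * g z.2).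
  apply: measurable_funM.
    by apply: (measurableT_comp (itg_meas If)).
  by apply: (measurableT_comp (itg_meas Ig)).
have Ix x : itg m2 (fun y => f (x, y).1 * g (x, y).2) by exact: (itgZ (f x) Ig).
have Ik : itg m12 (fun z => f z.1 * g z.2).
  apply/itg_prodP => //.
  apply: itg_ext (itgZ (int m2 (fun y => `|g y|)) (itg_abs If)) => x /=.
  rewrite mulrC -intZ; last exact: itg_abs.
  by apply: int_ext => y; rewrite normrM.
split=> //; rewrite (int_prod Ik Ix).2 mulrC -intZ//; apply: int_ext => x /=.
by rewrite intZ// mulrC.
Qed.

End fubini_real.

Section Rn_fubini.
Context (R : realType) (n : nat).
Local Notation lam := (@lebesgue_measure R).
Local Notation leb := (lebesgue_Rn R).

Lemma itg_consRn (f : Rn R n.+1 -> R) : measurable_fun setT f ->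
  itg (leb n.+1) f <-> itg (lam \x leb n)%E (f \o @consRn R n).
Proof. by apply: itg_transfer => //; exact: measurable_consRn. Qed.

Lemma int_consRn (f : Rn R n.+1 -> R) : measurable_fun setT f ->
  int (leb n.+1) f = int (lam \x leb n)%E (f \o @consRn R n).
Proof. by apply: int_transfer => //; exact: measurable_consRn. Qed.

Lemma itg_Rn_tensor (f : R -> R) (g : Rn R n -> R) (h : Rn R n.+1 -> R) :
  (forall x y, h (consRn (x, y)) = f x * g y) ->
  itg lam f -> itg (leb n) g ->
  itg (leb n.+1) h /\ int (leb n.+1) h = int lam f * int (leb n) g.
Proof.
move=> hE If Ig; have [I1 I2] := itg_tensor If Ig.
have hE' : h = (fun z => f z.1 * g z.2) \o @unconsRn R n.
  apply/funext => z; rewrite -[in LHS](unconsRnK z) [RHS]/comp.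
  by case: (unconsRn z) => x y; exact: hE.
have mh : measurable_fun setT h.
  by rewrite hE'; apply: measurableT_comp; [exact: itg_meas I1|exact: measurable_unconsRn].
rewrite itg_consRn// int_consRn//.
rewrite (_ : h \o _ = fun z => f z.1 * g z.2)//.
by apply/funext => -[x y] /=; rewrite hE.
Qed.

End Rn_fubini.

(** * Boxes and the Borel sets of R^n *)

Section boxes.
Context (R : realType) (n : nat).
Local Notation E := (Rn R n).
Local Notation leb := (lebesgue_Rn R n).
Implicit Types (a b : 'I_n -> R).

(** Half-open like the intervals that generate the Borel sets of the line, so that the preimage of
    such an interval under a coordinate is a countable union of boxes. *)
Definition box a b : set E := [set x | forall i, a i < tnth x i <= b i].

Definition cube (k : nat) : set E := box (fun=> - k%:R) (fun=> k%:R).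

Lemma box_itv a b : box a b =
  [set x : E | forall i, `]a i, b i]%classic (tnth x i)].
Proof.
by apply/seteqP; split => x /= h i; have := h i; rewrite /= in_itv.
Qed.

Lemma measurable_box a b : measurable (box a b).
Proof.
rewrite box_itv (_ : [set _ | _] =
    \bigcap_(i in setT) ((fun x : E => tnth x i) @^-1` `]a i, b i]%classic)).
  apply: fin_bigcap_measurable => [|i _]; first exact: finite_finset.
  by rewrite -[X in measurable X]setTI; exact: measurable_tnth.
by apply/seteqP; split => x /= H i; [move=> _|]; exact: H.
Qed.

Lemma leb_box a b : (forall i, a i <= b i) ->
  leb (box a b) = (\prod_(i < n) (b i - a i))%:E.
Proof.
move=> ab; rewrite box_itv.
rewrite (lebesgue_Rn_box (A := fun i => `]a i, b i]%classic))//.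
rewrite (big_morph _ (@EFinM R) erefl).
apply: eq_bigr => i _; rewrite lebesgue_measure_itv /= lte_fin.
case: ltP => // ba; rewrite EFinB (_ : b i = a i) ?subee//.
by apply/eqP; rewrite eq_le ba ab.
Qed.

Lemma boxI a b a' b' : box a b `&` box a' b' =
  box (fun i => Num.max (a i) (a' i)) (fun i => Num.min (b i) (b' i)).
Proof.
apply/seteqP; split => x /=.
  by move=> [h h'] i; have := h i; have := h' i; rewrite gt_max le_min;
     move=> /andP[-> ->] /andP[-> ->].
by move=> h; split => i; have := h i; rewrite gt_max le_min;
  move=> /andP[/andP[? ?] /andP[? ?]]; apply/andP.
Qed.

Lemma cube_mono k l : (k <= l)%N -> cube k `<=` cube l.
Proof.
move=> kl x h i; have /andP[h1 h2] := h i; apply/andP; split.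
  by apply: le_lt_trans h1; rewrite lerN2 ler_nat.
by apply: le_trans h2 _; rewrite ler_nat.
Qed.

Lemma tuple_bound (x : E) : exists k : nat, forall i, `|tnth x i| < k%:R.
Proof.
have [K HK] : exists K : R, forall i, `|tnth x i| <= K.
  exists (\sum_i `|tnth x i|) => i; rewrite (bigD1 i)//= lerDl.
  exact: sumr_ge0.
exists (Num.truncn K).+1 => i; apply: le_lt_trans (HK i) _.
exact: truncnS_gt.
Qed.

Lemma cube_cover (x : E) : exists k, cube k x.
Proof.
have [k hk] := tuple_bound x; exists k => i; have := hk i.
by rewrite ltr_norml => /andP[-> /ltW ->].
Qed.

(** It is enough to reach the preimage of a half-open interval under one coordinate: it is the union
    over k of the boxes whose other sides are those of [cube k]. *)
Lemma boxes_generate (A : set E) : measurable A ->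
  <<s [set B | exists a b, B = box a b] >> A.
Proof.
set G := [set B | _].
have [G0 GC GU] := smallest_sigma_algebra setT G.
suff H (i : 'I_n) : preimage_set_system setT (fun x : E => tnth x i) measurable
    `<=` <<s G >>.
  apply: smallest_sub; first exact: smallest_sigma_algebra.
  by apply: (big_ind (fun S => S `<=` <<s G >>)) => // S1 S2 h1 h2 B [/h1|/h2].
move=> B [C mC <-]; rewrite setTI.
pose H := [set C : set (measurableTypeR R) | <<s G >> ((fun x : E => tnth x i) @^-1` C)].
suff : (measurable : set (set (measurableTypeR R))) `<=` H by move=> /(_ C mC).
apply: smallest_sub.
  split=> [|D HD|F HF] /=; rewrite /H /=.
  - by rewrite preimage_set0; exact: G0.
  - by rewrite setTD preimage_setC -setTD; exact: GC.
  - by rewrite preimage_bigcup; exact: GU.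
move=> _ [[u v] /= _ <-]; rewrite /H /=.
rewrite (_ : _ @^-1` _ = \bigcup_k box (fun j => if j == i then u else - k%:R)
   (fun j => if j == i then v else k%:R)).
  apply: GU => k.
  apply: sub_gen_smallest; by do 2 eexists.
apply/seteqP; split => x /=.
  rewrite in_itv /= => h; have [k hk] := cube_cover x; exists k => // j.
  by case: eqP => [->//|_]; exact: hk.
by move=> [k _ h]; have := h i; rewrite eqxx in_itv.
Qed.

End boxes.

(** * Reflections, translations and the invariance of Lebesgue measure *)

Section coordinatewise_maps.
Context (R : realType) (n : nat).
Local Notation E := (Rn R n).
Local Notation leb := (lebesgue_Rn R n).
Local Notation lam := (@lebesgue_measure R).

Lemma leb_box_fin (a b : 'I_n -> R) : (leb (box a b) < +oo)%E.
Proof.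
rewrite box_itv (lebesgue_Rn_box (A := fun i => `]a i, b i]%classic))//.
have : forall i, exists r, (lebesgue_measure `]a i, b i]%classic = r%:E)%E.
  move=> i; rewrite lebesgue_measure_itv /= lte_fin; case: ifP => _.
    by rewrite -EFinB; eexists.
  by exists 0.
move=> /choice[r Hr]; under eq_bigr do rewrite Hr.
by rewrite -(big_morph _ (@EFinM R) erefl) ltey.
Qed.

Definition coordmap (phi : 'I_n -> R -> R) (x : E) : E :=
  [tuple phi i (tnth x i) | i < n].

Lemma measurable_coordmap phi : (forall i, measurable_fun setT (phi i)) ->
  measurable_fun setT (coordmap phi).
Proof.
move=> mphi; apply/measurable_fun_tnthP => i.
rewrite (_ : _ \o _ = fun x : E => phi i (tnth x i)); last first.
  by apply/funext => x /=; rewrite tnth_mktuple.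
by apply: (measurableT_comp (mphi i)); exact: measurable_tnth.
Qed.

(** Uniqueness of measures: both sides agree on boxes, which generate, are stable under intersection
    and include an exhaustion by cubes of finite measure. *)
Lemma leb_coordmap phi : (forall i, measurable_fun setT (phi i)) ->
  (forall i (A : set (measurableTypeR R)), measurable A -> lam (phi i @^-1` A) = lam A) ->
  forall A, measurable A -> leb A = leb (coordmap phi @^-1` A).
Proof.
move=> mphi lphi A mA.
have mc := measurable_coordmap mphi.
apply: (g_sigma_algebra_measure_unique [set B | exists a b, B = box a b] _
  (@cube R n) _ _ leb
  (measure_function_pushforward__canonical__measure_function_Measure leb mc)).
- by move=> _ [a [b ->]]; exact: measurable_box.
- by move=> k; exists (fun=> - k%:R), (fun=> k%:R).
- by apply/seteqP; split => // x _; have [k hk] := cube_cover x; exists k.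
- move=> _ _ [a [b ->]] [a' [b' ->]]; rewrite boxI.
  by exists (fun i => Num.max (a i) (a' i)), (fun i => Num.min (b i) (b' i)).
- move=> _ [a [b ->]] /=; rewrite /pushforward.
  rewrite (_ : _ @^-1` _ = [set x : E | forall i, (phi i @^-1` `]a i, b i]%classic) (tnth x i)]).
    rewrite (lebesgue_Rn_box (A := fun i => phi i @^-1` `]a i, b i]%classic)); last first.
      by move=> i; rewrite -[X in measurable X]setTI; exact: mphi.
    rewrite box_itv (lebesgue_Rn_box (A := fun i => `]a i, b i]%classic))//.
    by apply: eq_bigr => i _; rewrite lphi.
  apply/seteqP; split => x /= h i; have := h i; rewrite /= ?in_itv /= tnth_mktuple //.
- by move=> k; exact: leb_box_fin.
- exact: boxes_generate.
Qed.

Definition negx (x : E) : E := coordmap (fun _ y => - y) x.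
Definition shiftx (h : 'I_n -> R) (x : E) : E := coordmap (fun i y => y + h i) x.

Lemma tnth_negx x i : tnth (negx x) i = - tnth x i.
Proof. by rewrite tnth_mktuple. Qed.

Lemma tnth_shiftx h x i : tnth (shiftx h x) i = tnth x i + h i.
Proof. by rewrite tnth_mktuple. Qed.

Lemma negxK : involutive negx.
Proof. by move=> x; apply: eq_from_tnth => i; rewrite !tnth_negx opprK. Qed.

Lemma measurable_negx : measurable_fun setT negx.
Proof. by apply: measurable_coordmap => i; exact: measurableT_comp. Qed.

Lemma measurable_shiftx h : measurable_fun setT (shiftx h).
Proof. by apply: measurable_coordmap => i; exact: measurable_funD. Qed.

Lemma lebesgue_translate (c : R) (A : set (measurableTypeR R)) : measurable A ->
  lam ((fun y => y + c) @^-1` A) = lam A.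
Proof.
move=> mA.
have mc : measurable_fun setT (fun y : measurableTypeR R => (y + c : measurableTypeR R)).
  by apply: measurable_funD => //; exact: measurable_id.
apply/esym.
apply: (lebesgue_measure_unique (mu :=
  measure_function_pushforward__canonical__measure_function_Measure lam mc)) => //.
move=> _ [[a b] /= _ <-]; rewrite /pushforward.
rewrite (_ : _ @^-1` _ = `]a - c, b - c]%classic); last first.
  by apply/seteqP; split => x /=; rewrite !in_itv /= ltrBlDr lerBrDr.
rewrite !lebesgue_measure_itv /= !lte_fin ltrD2r.
by case: ifP => // _; rewrite -!EFinB; congr EFin; ring.
Qed.

Lemma leb_negx A : measurable A -> leb A = leb (negx @^-1` A).
Proof.
apply: leb_coordmap => i; first exact: measurableT_comp.
by move=> B mB; exact: lebesgue_measureN.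
Qed.

Lemma leb_shiftx h A : measurable A -> leb A = leb (shiftx h @^-1` A).
Proof.
apply: leb_coordmap => i; first exact: measurable_funD.
exact: lebesgue_translate.
Qed.

Lemma itg_negx (f : E -> R) : itg leb f -> itg leb (f \o negx).
Proof.
move=> If; apply: (itg_transfer measurable_negx leb_negx (itg_meas If)).1 => //.
Qed.

Lemma int_negx (f : E -> R) : measurable_fun setT f -> int leb (f \o negx) = int leb f.
Proof. by move=> mf; rewrite -(int_transfer measurable_negx leb_negx mf). Qed.

Lemma itg_shiftx h (f : E -> R) : itg leb f -> itg leb (f \o shiftx h).
Proof.
by move=> If; apply: (itg_transfer (measurable_shiftx h) (@leb_shiftx h) (itg_meas If)).1.
Qed.

Lemma int_shiftx h (f : E -> R) : measurable_fun setT f ->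
  int leb (f \o shiftx h) = int leb f.
Proof.
by move=> mf; rewrite -(int_transfer (measurable_shiftx h) (@leb_shiftx h) mf).
Qed.

Lemma int_odd (f : E -> R) : itg leb f -> (forall x, f (negx x) = - f x) -> int leb f = 0.
Proof.
move=> If odd; have := int_negx (itg_meas If).
rewrite (int_ext leb (odd : f \o negx =1 fun x => - f x)) intN// => h.
by lra.
Qed.

Lemma L2_negx (f : E -> R) : L2 leb f -> L2 leb (f \o negx).
Proof.
move=> Lf; split; first exact: measurableT_comp Lf.1 measurable_negx.
exact: (itg_negx (L2_itg Lf)).
Qed.

Lemma nm_negx (f : E -> R) : measurable_fun setT f -> nm leb (f \o negx) = nm leb f.
Proof.
move=> mf; rewrite /nm /ip; congr Num.sqrt.
by rewrite -(int_negx (f := fun x => f x * f x))//; exact: measurable_funM.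
Qed.

Lemma ip_negx (f g : E -> R) : measurable_fun setT f -> measurable_fun setT g ->
  ip leb (f \o negx) (g \o negx) = ip leb f g.
Proof.
by move=> mf mg; rewrite /ip -(int_negx (f := fun x => f x * g x))//; exact: measurable_funM.
Qed.

End coordinatewise_maps.

(** * Functions in both L^1 and L^2, and induction over them *)

Section L12.
Import HBSimple HBNNSimple.
Context (R : realType) (n : nat).
Local Notation E := (Rn R n).
Local Notation leb := (lebesgue_Rn R n).
Implicit Types (f g : E -> R) (a b : 'I_n -> R).

(** The common domain of the integral transform and of the L^2 isometry. *)
Definition L12 f : Prop := itg leb f /\ L2 leb f.

Lemma L12D f g : L12 f -> L12 g -> L12 (fun x => f x + g x).
Proof. by move=> [? ?] [? ?]; split; [exact: itgD|exact: L2D]. Qed.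

Lemma L12Z c f : L12 f -> L12 (fun x => c * f x).
Proof. by move=> [? ?]; split; [exact: itgZ|exact: L2Z]. Qed.

Lemma L12B f g : L12 f -> L12 g -> L12 (fun x => f x - g x).
Proof. by move=> [? ?] [? ?]; split; [exact: itgB|exact: L2B]. Qed.

Lemma L12_le f g : measurable_fun setT f -> (forall x, `|f x| <= `|g x|) ->
  L12 g -> L12 f.
Proof.
move=> mf fg [? ?]; split; last exact: L2_le fg _.
by apply: (itg_le mf fg); exact: itg_abs.
Qed.

Lemma measurable_indicR (A : set E) : measurable A -> measurable_fun setT (\1_A : E -> R).
Proof. by move=> mA; exact: measurable_indic. Qed.

Lemma itg_indic (A : set E) : measurable A -> (leb A < +oo)%E -> itg leb \1_A.
Proof.
move=> mA Aoo; apply/itg_ge0P; first exact: measurable_indicR.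
  by move=> x; rewrite indicE.
by rewrite integral_indic// setIT.
Qed.

Lemma int_indic (A : set E) : measurable A -> int leb \1_A = fine (leb A).
Proof. by move=> mA; rewrite /int /Rintegral integral_indic// setIT. Qed.

Lemma indic_sq (A : set E) x : \1_A x ^+ 2 = \1_A x :> R.
Proof. by rewrite indicE; case: (_ \in _); rewrite ?expr1n ?expr0n. Qed.

Lemma L12_indic (A : set E) : measurable A -> (leb A < +oo)%E -> L12 \1_A.
Proof.
move=> mA Aoo; split; first exact: itg_indic.
split; first exact: measurable_indicR.
by apply: itg_ext (itg_indic mA Aoo) => x; rewrite indic_sq.
Qed.

Lemma L12_box a b : L12 \1_(box a b).
Proof. by apply: L12_indic; [exact: measurable_box|exact: leb_box_fin]. Qed.

Lemma indic_norm (A : set E) x : `|\1_A x| <= 1 :> R.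
Proof. by rewrite indicE; case: (_ \in _); rewrite ?normr1 ?normr0. Qed.

Lemma indic_cube_cvg (f : E -> R) (x : E) :
  f x * \1_(cube k : set E) x @[k --> \oo] --> f x.
Proof.
apply: cvg_near_cst; have [k hk] := cube_cover x; exists k => // l /= kl.
by rewrite indicE mem_set ?mulr1//; exact: cube_mono kl _ hk.
Qed.

(* Functional monotone class argument: the indicators of boxes are total for
   the combined L^1 and L^2 dominated convergence. *)
Lemma L12_ind (V : (E -> R) -> Prop) :
  (forall f g, V f -> V g -> V (fun x => f x + g x)) ->
  (forall c f, V f -> V (fun x => c * f x)) ->
  (forall (F : nat -> E -> R) f g, (forall m, V (F m)) -> (forall m, L12 (F m)) ->
     L12 g -> (forall m x, `|F m x| <= g x) ->
     (forall x, F m x @[m --> \oo] --> f x) -> V f) ->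
  (forall a b, (forall i, a i <= b i) -> V \1_(box a b)) ->
  forall f, L12 f -> V f.
Proof.
move=> VD VZ Vlim Vbox.
have Vext f g : f =1 g -> V f -> V g by move=> /funext ->.
have V0 : V (fun=> 0).
  by apply: Vext (VZ 0 _ (Vbox (fun=> 0) (fun=> 0) _)) => // x; rewrite mul0r.
have VB f g : V f -> V g -> V (fun x => f x - g x).
  move=> Vf Vg; apply: Vext (VD _ _ Vf (VZ (-1) _ Vg)) => x; by rewrite mulN1r.
have Vb a b : V \1_(box a b).
  have [/Vbox//|/existsNP[i /negP]] := pselect (forall i, a i <= b i).
  rewrite -ltNge => ba; apply: Vext V0 => x; rewrite indicE memNset// => /(_ i) /andP[h1 h2].
  by have := lt_le_trans h1 h2; rewrite ltNge (ltW ba).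
(* The sets with good trace on a fixed cube form a Dynkin system. Cutting by the cube keeps all
   indicators below one function of [L12], so [Vlim] handles increasing unions and [VB] proper
   differences. *)
have Vcube k A : measurable A -> V \1_(A `&` cube k).
  move=> mA; pose H := [set A : set E | measurable A /\ V \1_(A `&` cube k)].
  suff : <<s [set B : set E | exists a b, B = box a b] >> `<=` H.
    by move=> /(_ A (boxes_generate mA)) [].
  apply: lambda_system_subset => //.
  - move=> _ _ [a [b ->]] [a' [b' ->]]; rewrite boxI.
    by exists (fun i => Num.max (a i) (a' i)), (fun i => Num.min (b i) (b' i)).
  - split=> //.
    + by split=> //; rewrite setTI; exact: Vb.
    + move=> B C CB [mB VB'] [mC VC]; split; first exact: measurableD.
      apply: Vext (VB _ _ VB' VC) => x; rewrite !indicE.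
      rewrite [in RHS]in_setI [in RHS]in_setD !in_setI.
      have CB' : x \in C -> x \in B by move=> /set_mem xC; apply/mem_set; exact: CB.
      case: (boolP (x \in C)) => [xC|xC] /=; rewrite ?andbT ?andbF /= ?subr0//.
      by rewrite (CB' xC) subrr.
    + move=> F ndF HF; split.
        by apply: bigcup_measurable => m _; have [] := HF m.
      apply: (Vlim (fun m => \1_(F m `&` cube k)) _ \1_(cube k)).
      * by move=> m; have [] := HF m.
      * move=> m; apply: L12_le (L12_box (fun=> - k%:R) (fun=> k%:R)).
          apply: measurable_indicR; apply: measurableI; last exact: measurable_box.
          by have [] := HF m.
        move=> x; rewrite !indicE in_setI; case: (x \in F m) => /=; rewrite ?normr0//.
      * exact: L12_box.
      * move=> m x; rewrite !indicE in_setI; case: (x \in F m) => /=; rewrite ?normr0//.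
        by case: (_ \in _); rewrite ?normr1 ?normr0.
      * move=> x; have [[m _ Fx]|nF] := pselect ((\bigcup_m F m) x).
          apply: cvg_near_cst; exists m => // l /= ml; rewrite !indicE !in_setI.
          have -> : x \in F l by apply/mem_set; have /subsetPset := ndF _ _ ml; exact.
          by have -> : x \in \bigcup_i F i by apply/mem_set; exists m.
        apply: cvg_near_cst; exists 0%N => // l _; rewrite !indicE !in_setI.
        have -> : x \in \bigcup_i F i = false by apply: memNset.
        by have -> : x \in F l = false by apply: memNset => Fx; apply: nF; exists l.
  - by move=> _ [a [b ->]]; split; [exact: measurable_box|rewrite boxI; exact: Vb].
have Vset A : measurable A -> L12 \1_A -> V \1_A.
  move=> mA LA; apply: (Vlim (fun k => \1_(A `&` cube k)) _ \1_A) => //.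
  - by move=> k; exact: Vcube.
  - move=> k; apply: L12_le LA.
      by apply: measurable_indicR; apply: measurableI => //; exact: measurable_box.
    move=> x; rewrite !indicE in_setI; case: (x \in A) => //=.
    by case: (_ \in _); rewrite ?normr1 ?normr0.
  - move=> k x; rewrite !indicE in_setI; case: (x \in A) => /=; rewrite ?normr0//.
    by case: (_ \in _); rewrite ?normr1 ?normr0.
  - move=> x; have := @indic_cube_cvg (\1_A) x; apply: cvg_trans.
    by apply: near_eq_cvg; apply: nearW => k /=; rewrite !indicE in_setI -natrM mulnb.
have Vpos f : L12 f -> (forall x, 0 <= f x) -> V f.
  move=> Lf f0.
  have mf : measurable_fun setT (EFin \o f) by exact/measurable_EFinP/itg_meas/Lf.1.
  have [s [nds cvs]] := approximation measurableT mf (fun x _ => f0 x : (0 <= (f x)%:E)%E).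
  have cvs' x : s m x @[m --> \oo] --> f x by exact: (fine_cvg (cvs x I : _ --> (f x)%:E)).
  have s0 m x : 0 <= s m x by exact: fun_ge0.
  have sf m x : s m x <= f x.
    have /cvg_lim <- // := cvs' x; apply: limr_ge.
      by apply/cvg_ex; exists (f x); exact: cvs'.
    by exists m => // l /= ml; have /lefP := nds _ _ ml; exact.
  have Ls m : L12 (s m).
    apply: L12_le Lf; first exact: measurable_funP.
    by move=> x; rewrite !ger0_norm.
  apply: (Vlim (fun m => s m) f f) => //; last first.
    by move=> m x; rewrite ger0_norm.
  move=> m.
  apply: (Vext (fun x => \sum_(y <- fset_set (range (s m))) y * \1_(s m @^-1` [set y]) x)).
    by move=> x; rewrite [RHS]fimfunE fsbig_finite//=; exact: fimfunP.
  elim: (finmap.enum_fset _) => [|y r IH] /=.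
    by apply: Vext V0 => x; rewrite big_nil.
  apply: (Vext (fun x => y * \1_(s m @^-1` [set y]) x +
     \sum_(i <- r) i * \1_(s m @^-1` [set i]) x)) => [x|].
    by rewrite big_cons.
  apply: VD => //; have [->|y0] := eqVneq y 0.
    by apply: Vext V0 => x; rewrite mul0r.
  apply: VZ; apply: Vset; first exact: measurable_sfunP.
  (* A level set at a nonzero value y has finite measure, its indicator being at most |s / y|. *)
  apply: L12_le (L12Z y^-1 (Ls m)); first by apply: measurable_indicR; exact: measurable_sfunP.
  move=> x; rewrite indicE; have [xy|xy] := pselect (s m x = y).
    by rewrite mem_set// normr1 normrM xy -normrM mulVf// normr1.
  by rewrite memNset// normr0.
move=> f Lf.
have mf := itg_meas Lf.1.
apply: Vext (VB _ _ (Vpos (fun x => Num.max (f x) 0) _ _) (Vpos (fun x => Num.max (- f x) 0) _ _)).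
- move=> x; rewrite !maxEle oppr_le0.
  by case: (lerP (f x) 0) => h; case: (lerP 0 (f x)) => h'; lra.
- apply: L12_le Lf; first exact: measurable_maxr.
  by move=> x; case: (lerP (f x) 0) => h; rewrite ?normr0.
- by move=> x; rewrite le_max lexx orbT.
- apply: L12_le Lf; first by apply: measurable_maxr => //; exact: measurableT_comp.
  by move=> x; case: (lerP (- f x) 0) => h; rewrite ?normr0// normrN.
- by move=> x; rewrite le_max lexx orbT.
Qed.

End L12.

(** * Transforms of indicators of boxes *)

Section derivative_rules.
Context (R : realType).
Implicit Types (f g h : R -> R) (x c df dg dh d : R).

(* [is_derive] is a type class, which [apply] would try to resolve. *)
Definition der f x d : Prop := is_derive x (1 : R) f d.

Lemma der_cst c x : der (fun=> c) x 0.
Proof. exact: is_derive_cst. Qed.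

Lemma der_id x : der (fun y => y) x 1.
Proof. exact: is_derive_id. Qed.

Lemma derD f g x df dg : der f x df -> der g x dg ->
  der (fun y => f y + g y) x (df + dg).
Proof. by rewrite /der => *; exact: is_deriveD. Qed.

Lemma derN f x df : der f x df -> der (fun y => - f y) x (- df).
Proof. by rewrite /der => *; exact: is_deriveN. Qed.

Lemma derM f g x df dg : der f x df -> der g x dg ->
  der (fun y => f y * g y) x (f x * dg + g x * df).
Proof. by rewrite /der => *; exact: is_deriveM. Qed.

Lemma der_comp h f x df dh : der h (f x) dh -> der f x df ->
  der (fun y => h (f y)) x (dh * df).
Proof. by rewrite /der => *; exact: is_derive1_comp. Qed.

Lemma der_cos f x df : der f x df -> der (fun y => cos (f y)) x (- sin (f x) * df).
Proof. by apply: der_comp; exact: is_derive_cos. Qed.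

Lemma der_sin f x df : der f x df -> der (fun y => sin (f y)) x (cos (f x) * df).
Proof. by apply: der_comp; exact: is_derive_sin. Qed.

Lemma der_exp f x df : der f x df -> der (fun y => expR (f y)) x (expR (f x) * df).
Proof. by apply: der_comp; exact: is_derive_expR. Qed.

Lemma der_atan f x df : der f x df ->
  der (fun y => atan (f y)) x ((1 + f x ^+ 2)^-1 * df).
Proof. by apply: der_comp; exact: is_derive1_atan. Qed.

Lemma der_eq f x d d' : der f x d -> d = d' -> der f x d'.
Proof. by move=> + <-. Qed.

Lemma der_derivable f x d : der f x d -> derivable f x 1.
Proof. by case. Qed.

Lemma der_val f x d : der f x d -> derive1 f x = d.
Proof. by rewrite derive1E => -[]. Qed.

Lemma der_continuous f x d : der f x d -> {for x, continuous f}.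
Proof. by move=> /der_derivable/derivable1_diffP/differentiable_continuous. Qed.

Lemma der_mvt f (df : R -> R) x y : (forall z, der f z (df z)) ->
  exists2 c, Num.min x y <= c <= Num.max x y & f y - f x = df c * (y - x).
Proof.
move=> dF; have cf : continuous f by move=> z; exact: der_continuous (dF z).
have H a b : a <= b -> exists2 c, a <= c <= b & f b - f a = df c * (b - a).
  move=> ab; have [c cab E] := @MVT_segment _ f df a b ab
    (fun z _ => dF z) (continuous_subspaceT cf).
  by exists c => //; move: cab; rewrite in_itv.
case: (leP x y) => xy; first exact: H.
have [c cab E] := H y x (ltW xy); exists c => //.
by rewrite -opprB E -mulrN opprB.
Qed.

End derivative_rules.

Ltac derive := repeat first [exact: der_cst | exact: der_id | apply: derD | apply: derN
  | apply: derM | apply: der_cos | apply: der_sin | apply: der_exp | apply: der_atan].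

(** * Integrals on the line and transforms of intervals *)

Section one_dim_integrals.
Context (R : realType).
Local Notation lam := (@lebesgue_measure R).
Implicit Types (f g F : R -> R) (l : R).

Lemma measurable_cosR : measurable_fun setT (@cos R).
Proof. by apply: continuous_measurable_fun; exact: continuous_cos. Qed.

Lemma measurable_sinR : measurable_fun setT (@sin R).
Proof. by apply: continuous_measurable_fun; exact: continuous_sin. Qed.

Lemma ftc_halfline f F l : (forall x, 0 <= x -> 0 <= f x) -> continuous f ->
  (forall x, der F x (f x)) -> F x @[x --> +oo] --> l ->
  (\int[lam]_(x in `[0%R, +oo[) (f x)%:E = (l - F 0)%:E)%E.
Proof.
move=> f0 cf dF Fl; rewrite EFinB; apply: ge0_continuous_FTC2y => //.
- exact: continuous_subspaceT.
- by move=> x _; exact: der_derivable (dF x).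
- by apply: cvg_at_right_filter; apply: der_continuous (dF 0).
- by move=> x _; exact: der_val (dF x).
Qed.

Lemma cvgy_le F l K : (forall x, 0 < x -> `|F x - l| <= K / x) -> F x @[x --> +oo] --> l.
Proof.
move=> FK; apply/cvgrPdist_le => e e0.
exists (Num.max 1 (K / e)); split; first exact: num_real.
move=> x; rewrite gt_max => /andP[x1 xK].
have x0 : 0 < x by apply: lt_trans x1.
rewrite distrC; apply: le_trans (FK x x0) _.
rewrite ler_pdivrMr// -ler_pdivrMl// mulrC; exact: ltW.
Qed.

Lemma expN_le (x : R) : 0 < x -> expR (- x) <= x^-1.
Proof.
move=> x0; rewrite expRN lef_pV2 ?posrE ?expR_gt0//.
by apply: le_trans (expR_ge1Dx x); rewrite lerDr.
Qed.

Lemma expN_le2 (x : R) : 0 < x -> x * expR (- x) <= 2 / x.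
Proof.
move=> x0; have := expR_ge1Dxn 1 (ltW x0) => h.
have e0 := expR_gt0 x.
rewrite expRN ler_pdivrMr// mulrAC ler_pdivlMr//.
rewrite (_ : 2`! = 2)%N// in h; have : x ^+ 2 / 2 <= expR x by apply: le_trans h; rewrite lerDr.
rewrite ler_pdivrMr// => h2; rewrite -expr2 mulrC; lra.
Qed.

(** Writing x^-2 as a Laplace integral turns the integral of (1 - cos(u x)) / x^2 over the half-line
    into a double integral of a nonnegative function. *)
Lemma laplace_inv_sq (x : R) : 0 < x ->
  (\int[lam]_(s in `[0%R, +oo[) (s * expR (- (s * x)))%:E = (x ^-2)%:E)%E.
Proof.
move=> x0; have xn0 : x != 0 by rewrite gt_eqF.
pose F s : R := - ((s / x + x^-2) * expR (- (s * x))).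
have dF s : der F s (s * expR (- (s * x))).
  rewrite /F; apply: der_eq; first by derive.
  by rewrite /=; field.
have cf : continuous (fun s : R => s * expR (- (s * x))).
  move=> s; have [d Hd] : exists d : R, der (fun s => s * expR (- (s * x))) s d.
    by eexists; derive.
  exact: der_continuous Hd.
have Fl : F s @[s --> +oo] --> (0 : R).
  apply: (@cvgy_le _ _ (2 / x ^+ 3 + x^-3)) => s s0; rewrite subr0 normrN ger0_norm; last first.
    by rewrite mulr_ge0 ?expR_ge0// addr_ge0 ?divr_ge0 ?invr_ge0 ?exprn_ge0// ltW.
  have sx0 : 0 < s * x by exact: mulr_gt0.
  have h1 := expN_le sx0; have h2 := expN_le2 sx0.
  have sn0 : s != 0 by rewrite gt_eqF.
  rewrite (_ : (s / x + x^-2) * _ = x^-2 * (s * x * expR (- (s * x))) + x^-2 * expR (- (s * x))); last by field.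
  rewrite (_ : (_ + x^-3) / s = x^-2 * (2 / (s * x)) + x^-2 * (s * x)^-1); last first.
    by field; rewrite xn0.
  by apply: lerD; rewrite ler_pM2l// invr_gt0 exprn_gt0.
rewrite (ftc_halfline _ cf dF Fl); last by move=> s s0; rewrite mulr_ge0// expR_ge0.
by rewrite /F !mul0r oppr0 expR0; congr EFin; field.
Qed.

(** The inner integral of that double integral when x is integrated first; the Lorentzian of
    [int_lorentz] remains. *)
Lemma laplace_1mcos (u s : R) : 0 < s ->
  (\int[lam]_(x in `[0%R, +oo[) (s * (1 - cos (u * x)) * expR (- (s * x)))%:E =
   (u ^+ 2 / (s ^+ 2 + u ^+ 2))%:E)%E.
Proof.
move=> s0; have sn0 : s != 0 by rewrite gt_eqF.
have D0 : s ^+ 2 + u ^+ 2 != 0.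
  by rewrite gt_eqF// ltr_pwDl ?exprn_gt0 ?sqr_ge0.
pose F x : R := - expR (- (s * x)) +
   s / (s ^+ 2 + u ^+ 2) * (expR (- (s * x)) * (s * cos (u * x) - u * sin (u * x))).
have dF x : der F x (s * (1 - cos (u * x)) * expR (- (s * x))).
  rewrite /F; apply: der_eq; first by derive.
  by rewrite /=; field.
have cf : continuous (fun x : R => s * (1 - cos (u * x)) * expR (- (s * x))).
  move=> x; have [d Hd] : exists d : R, der
    (fun x => s * (1 - cos (u * x)) * expR (- (s * x))) x d by eexists; derive.
  exact: der_continuous Hd.
have Fl : F x @[x --> +oo] --> (0 : R).
  apply: (@cvgy_le _ _ (s^-1 * (1 + s / (s ^+ 2 + u ^+ 2) * (s + `|u|)))) => x x0; rewrite subr0.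
  have h1 := expN_le (mulr_gt0 s0 x0).
  have e0 := expR_ge0 (- (s * x)).
  have c0 : 0 <= s / (s ^+ 2 + u ^+ 2) by rewrite divr_ge0 ?addr_ge0 ?sqr_ge0// ltW.
  apply: (@le_trans _ _ (expR (- (s * x)) * (1 + s / (s ^+ 2 + u ^+ 2) * (s + `|u|)))).
    rewrite mulrDr mulr1; apply: le_trans (ler_normD _ _) _.
    rewrite normrN ger0_norm// lerD2l normrM ger0_norm// mulrCA ler_wpM2l//.
    rewrite normrM ger0_norm// ler_wpM2l//.
    apply: le_trans (ler_normB _ _) _; rewrite !normrM (ger0_norm (ltW s0)).
    by apply: lerD; rewrite ler_piMr ?cos_max ?sin_max// ltW.
  rewrite [leRHS]mulrAC (_ : s^-1 / x = (s * x)^-1); last by rewrite invfM.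
  rewrite ler_wpM2r// addr_ge0// mulr_ge0// addr_ge0// ltW//.
rewrite (ftc_halfline _ cf dF Fl); last first.
  by move=> x x0; rewrite !mulr_ge0 ?expR_ge0 ?subr_ge0 ?cos_le1// ltW.
by rewrite /F !mulr0 oppr0 expR0 cos0 sin0; congr EFin; field.
Qed.

Lemma int_lorentz (u : R) :
  (\int[lam]_(s in `[0%R, +oo[) (u ^+ 2 / (s ^+ 2 + u ^+ 2))%:E = (`|u| * (pi / 2))%:E)%E.
Proof.
have [->|u0] := eqVneq u 0.
  rewrite normr0 mul0r; apply: integral0_eq => s _; by rewrite expr0n mul0r.
have au : 0 < `|u| by rewrite normr_gt0.
have D0 s : s ^+ 2 + u ^+ 2 != 0.
  by rewrite gt_eqF// ltr_pwDr ?sqr_ge0// lt_def sqrf_eq0 u0 sqr_ge0.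
have auE : `|u| ^+ 2 = u ^+ 2 by rewrite real_normK// num_real.
pose F s : R := `|u| * atan (s / `|u|).
have dF s : der F s (u ^+ 2 / (s ^+ 2 + u ^+ 2)).
  rewrite /F; apply: der_eq; first by derive.
  rewrite expr_div_n -auE; field.
  by rewrite auE D0 gt_eqF.
have cf : continuous (fun s : R => u ^+ 2 / (s ^+ 2 + u ^+ 2)).
  move=> s; apply: cvgM; first exact: cvg_cst.
  apply: cvgV => //; apply: cvgD; last exact: cvg_cst.
  exact: exprn_continuous.
have Fl : F s @[s --> +oo] --> `|u| * (pi / 2).
  apply: cvgM; first exact: cvg_cst.
  apply: (cvg_comp _ _ _ (@cvgy_atan R)).
  apply/cvgryPge => A; exists (A * `|u|); split; first exact: num_real.
  by move=> s /ltW; rewrite ler_pdivlMr.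
rewrite (ftc_halfline _ cf dF Fl); last by move=> s s0; rewrite divr_ge0 ?addr_ge0 ?sqr_ge0.
by rewrite /F mul0r atan0 mulr0 subr0.
Qed.


Lemma itg_lamN (f : R -> R) : measurable_fun setT f ->
  itg lam f -> itg lam (fun x => f (- x)).
Proof.
move=> mf If; have mN : measurable_fun setT (-%R : R -> R) by exact: oppr_measurable.
apply: (itg_transfer (T1 := measurableTypeR R) (T2 := measurableTypeR R)
  (m1 := lam) (m2 := lam) mN _ mf).1 If => A mA.
exact/esym/(lebesgue_measureN mA).
Qed.

Lemma int_lamN (f : R -> R) : measurable_fun setT f ->
  int lam (fun x => f (- x)) = int lam f.
Proof.
move=> mf; have mN : measurable_fun setT (-%R : R -> R) by exact: oppr_measurable.
rewrite -(int_transfer (T1 := measurableTypeR R) (T2 := measurableTypeR R)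
  (m1 := lam) (m2 := lam) mN _ mf)// => A mA.
exact/esym/(lebesgue_measureN mA).
Qed.

(** The continuous functions x / (x^2 + 1/(m+1)) converge to the inverse at every point, including
    0, where the inverse is 0 by convention. *)
Lemma measurable_invR : measurable_fun setT (fun x : R => x^-1).
Proof.
apply/measurable_EFinP.
apply: (emeasurable_fun_cvg (fun (m : nat) (x : R) => (x / (x ^+ 2 + m.+1%:R^-1))%:E)).
  move=> m; apply/measurable_EFinP; apply: continuous_measurable_fun => x.
  apply: cvgM; first exact: cvg_id.
  apply: cvgV; first by rewrite gt_eqF// ltr_wpDl ?sqr_ge0// invr_gt0.
  by apply: cvgD; [exact: exprn_continuous|exact: cvg_cst].
move=> x _; apply: cvg_EFin; first exact: nearW.
have [->|x0] := eqVneq x 0.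
  by rewrite invr0 /=; under eq_fun do rewrite mul0r; exact: cvg_cst.
have -> : x^-1 = x / (x ^+ 2 + 0) by rewrite addr0; field.
apply: cvgM; first exact: cvg_cst.
apply: cvgV; first by rewrite addr0 sqrf_eq0.
by apply: cvgD; [exact: cvg_cst|exact: cvg_harmonic].
Qed.

Lemma measurable_1mcos_sq (u : R) :
  measurable_fun setT (fun x : R => (1 - cos (u * x)) / x ^+ 2).
Proof.
apply: measurable_funM.
  apply: measurable_funB => //; apply: measurableT_comp; first exact: measurable_cosR.
  by apply: measurable_funM.
apply: (measurableT_comp measurable_invR); exact: exprn_measurable.
Qed.

(** Tonelli's theorem for [k]: integrating in x first yields the Lorentzian, integrating in s first
    gives [f] back. At x = 0 both sides vanish. *)
Lemma int_1mcos_half (u : R) :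
  let f x := if 0 <= x then (1 - cos (u * x)) / x ^+ 2 else 0 in
  itg lam f /\ int lam f = `|u| * (pi / 2).
Proof.
move=> f.
pose k (z : R * R) : R := (\1_(`]0%R, +oo[%classic) z.1) * (\1_(`[0%R, +oo[%classic) z.2) *
   (z.1 * (1 - cos (u * z.2)) * expR (- (z.1 * z.2))).
have m1 : measurable_fun setT (fst : R * R -> R) by exact: measurable_fst.
have m2 : measurable_fun setT (snd : R * R -> R) by exact: measurable_snd.
have mk : measurable_fun setT (EFin \o k).
  apply/measurable_EFinP; apply: measurable_funM.
    by apply: measurable_funM; apply: measurableT_comp.
  apply: measurable_funM.
    apply: measurable_funM => //; apply: measurable_funB => //.
    apply: measurableT_comp; first exact: measurable_cosR.
    by apply: measurable_funM.
  apply: measurableT_comp => //; apply: measurableT_comp => //.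
  by apply: measurable_funM.
have k0 z : (0 <= (EFin \o k) z)%E.
  rewrite lee_fin /k (indicE _ _ z.1).
  case: (boolP (z.1 \in _)) => [/set_mem|_]; last by rewrite !mul0r.
  rewrite /= in_itv /= andbT => z0.
  by rewrite !mulr_ge0 ?expR_ge0 ?subr_ge0 ?cos_le1 ?indicE// ltW.
have := fubini_tonelli (m1 := lam) (m2 := lam) (EFin \o k) mk k0.
rewrite (_ : (\int[lam]_x _)%E = (`|u| * (pi / 2))%:E); last first.
  rewrite -int_lorentz -integral_itv_obnd_cbnd; last first.
    apply/measurable_EFinP/measurable_funTS/measurable_funM => //.
    apply: (measurableT_comp measurable_invR).
    by apply: measurable_funD => //; exact: exprn_measurable.
  rewrite [RHS]integral_mkcond; apply: eq_integral => s _; rewrite patchE.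
  have -> : (s \in `]0%R, +oo[%classic) = (0 < s).
    by apply/idP/idP => [/set_mem|h]; [|apply/mem_set]; rewrite /= in_itv /= andbT.
  case: ltP => s0.
    rewrite -laplace_1mcos// [RHS]integral_mkcond; apply: eq_integral => x _.
    rewrite patchE /= /k /= !indicE mem_set ?mul1r; last by rewrite /= in_itv /= s0.
    by case: ifP => _; rewrite ?mul1r ?mul0r.
  apply: integral0_eq => x _; rewrite /= /k /= indicE memNset ?mul0r//.
  by rewrite /= in_itv /= andbT ltNge s0.
move=> E.
have If : (\int[lam]_x (f x)%:E = (`|u| * (pi / 2))%:E)%E.
  rewrite E; apply: eq_integral => x _; rewrite /f.
  case: leP => x0; last first.
    apply/esym/integral0_eq => s _; rewrite /= /k /= (indicE _ _ x) memNset ?mulr0 ?mul0r//.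
    by rewrite /= in_itv /= andbT leNgt x0.
  move: x0; rewrite le_eqVlt => /predU1P[<-|x0].
    rewrite mulr0 cos0 subrr mul0r; apply/esym/integral0_eq => s _.
    by rewrite /k /= mulr0 cos0 subrr mulr0 mul0r mulr0.
  transitivity ((1 - cos (u * x))%:E * (x ^-2)%:E)%E; first by rewrite -EFinM.
  rewrite -laplace_inv_sq// -ge0_integralZl_EFin//.
  - rewrite -integral_itv_obnd_cbnd; last first.
      apply/measurable_funTS; apply: emeasurable_funM => //; apply/measurable_EFinP.
      apply: measurable_funM => //; apply: measurableT_comp => //.
      by apply: measurableT_comp => //; exact: measurable_funM.
    rewrite [LHS]integral_mkcond; apply: eq_integral => s _.
    rewrite patchE /= /k /= !indicE [x \in _]mem_set ?mulr1; last by rewrite /= in_itv /= ltW.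
    case: ifP => _; rewrite ?mul1r ?mul0r// -EFinM; congr EFin; ring.
  - by move=> s; rewrite /= in_itv /= andbT => s0; rewrite lee_fin mulr_ge0// expR_ge0.
  - apply/measurable_funTS/measurable_EFinP.
    apply: measurable_funM => //; apply: measurableT_comp => //.
    by apply: measurableT_comp => //; exact: measurable_funM.
have f0 x : 0 <= f x.
  by rewrite /f; case: ifP => // _; rewrite divr_ge0 ?sqr_ge0// subr_ge0 cos_le1.
have mf : measurable_fun setT f.
  by apply: measurable_fun_ifT => //; [exact: measurable_fun_ler|exact: measurable_1mcos_sq].
split; first by apply/itg_ge0P => //; rewrite If ltey.
by rewrite /int /Rintegral If.
Qed.

Lemma int_1mcos (u : R) : itg lam (fun x => (1 - cos (u * x)) / x ^+ 2) /\
  int lam (fun x => (1 - cos (u * x)) / x ^+ 2) = pi * `|u|.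
Proof.
have [If Ef] := int_1mcos_half u.
set f := (fun x => if 0 <= x then _ else _) in If Ef.
have E : (fun x => f x + f (- x)) =1 (fun x => (1 - cos (u * x)) / x ^+ 2).
  move=> x; rewrite /f oppr_ge0; case: (ltgtP x 0) => x0.
  - by rewrite add0r mulrN cosN sqrrN.
  - by rewrite addr0.
  - by rewrite x0 oppr0 mulr0 cos0 subrr !mul0r addr0.
have IN := itg_lamN (itg_meas If) If.
rewrite -(funext E); split; first exact: itgD If IN.
by rewrite intD// int_lamN ?Ef; [field|exact: itg_meas If].
Qed.

Lemma itg_lam_itv (g : R -> R) a b : measurable_fun setT g -> (forall x, `|g x| <= 1) ->
  itg lam (fun y => \1_(`]a, b]%classic) y * g y).
Proof.
move=> mg g1; pose A : set (measurableTypeR R) := `]a, b]%classic.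
have mA : measurable A by exact: measurable_itv.
have A0 x : 0 <= \1_A x :> R by rewrite indicE.
have mi : measurable_fun setT (\1_A : measurableTypeR R -> R) by exact: measurable_indic.
have IA : itg lam (\1_A : measurableTypeR R -> R).
  apply/itg_ge0P => //.
  rewrite integral_indic// setIT.
  have := lebesgue_measure_itv `]a, b]; rewrite /=; case: ifP => _ lE.
    by rewrite (lE : lam A = _) -EFinB ltey.
  by rewrite (lE : lam A = _) ltey.
apply: itg_le IA; first exact: measurable_funM.
by move=> x; rewrite normrM (ger0_norm (A0 x)) ler_piMr.
Qed.

Lemma int_itv_ftc (g G : R -> R) a b : a <= b -> continuous g ->
  (forall x, der G x (g x)) ->
  int lam (fun y => \1_(`]a, b]%classic) y * g y) = G b - G a.
Proof.
move=> ab cg dG.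
transitivity (\int[lam]_(y in `]a, b]) g y).
  rewrite Rintegral_mkcond; apply: int_ext => y; rewrite patchE indicE.
  by case: (_ \in _); rewrite ?mul1r ?mul0r.
have mg : measurable_fun setT g by exact: continuous_measurable_fun.
rewrite /Rintegral integral_itv_obnd_cbnd; last exact/measurable_funTS/measurable_EFinP.
move: ab; rewrite le_eqVlt => /predU1P[<-|ab].
  by rewrite set_itv1 integral_set1 subrr.
rewrite (@continuous_FTC2 _ g G a b)//.
- exact: continuous_subspaceT.
- split=> [x _| |]; first exact: der_derivable (dG x).
  + by apply: cvg_at_right_filter; exact: der_continuous (dG a).
  + by apply: cvg_at_left_filter; exact: der_continuous (dG b).
- by move=> x _; exact: der_val (dG x).
Qed.

Definition C1 a b (xi : R) : R := int lam (fun y => \1_(`]a, b]%classic) y * cos (y * xi)).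
Definition S1 a b (xi : R) : R := int lam (fun y => \1_(`]a, b]%classic) y * sin (y * xi)).

Lemma measurable_C1 a b : measurable_fun setT (C1 a b).
Proof.
apply: (@measurable_int1 _ _ (measurableTypeR R) (measurableTypeR R) R lam
  (fun z => \1_(`]a, b]%classic) z.2 * cos (z.2 * z.1))).
have m1 : measurable_fun setT (fst : measurableTypeR R * measurableTypeR R -> R)
  by exact: measurable_fst.
have m2 : measurable_fun setT (snd : measurableTypeR R * measurableTypeR R -> R)
  by exact: measurable_snd.
apply: measurable_funM; first exact: measurableT_comp.
by apply: (measurableT_comp measurable_cosR); exact: measurable_funM.
Qed.

Lemma measurable_S1 a b : measurable_fun setT (S1 a b).
Proof.
apply: (@measurable_int1 _ _ (measurableTypeR R) (measurableTypeR R) R lam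
  (fun z => \1_(`]a, b]%classic) z.2 * sin (z.2 * z.1))).
have m1 : measurable_fun setT (fst : measurableTypeR R * measurableTypeR R -> R)
  by exact: measurable_fst.
have m2 : measurable_fun setT (snd : measurableTypeR R * measurableTypeR R -> R)
  by exact: measurable_snd.
apply: measurable_funM; first exact: measurableT_comp.
by apply: (measurableT_comp measurable_sinR); exact: measurable_funM.
Qed.

Lemma C1E a b xi : a <= b -> xi != 0 -> C1 a b xi = (sin (b * xi) - sin (a * xi)) / xi.
Proof.
move=> ab x0; rewrite /C1 (@int_itv_ftc _ (fun y => sin (y * xi) / xi))//.
- by rewrite mulrBl.
- move=> y; have [d Hd] : exists d : R, der (fun y => cos (y * xi)) y d by eexists; derive.
  exact: der_continuous Hd.
- by move=> y; apply: der_eq; first derive; rewrite /=; field.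
Qed.

Lemma S1E a b xi : a <= b -> xi != 0 -> S1 a b xi = (cos (a * xi) - cos (b * xi)) / xi.
Proof.
move=> ab x0; rewrite /S1 (@int_itv_ftc _ (fun y => - cos (y * xi) / xi))//.
- by field.
- move=> y; have [d Hd] : exists d : R, der (fun y => sin (y * xi)) y d by eexists; derive.
  exact: der_continuous Hd.
- by move=> y; apply: der_eq; first derive; rewrite /=; field.
Qed.

Lemma C1N a b xi : C1 a b (- xi) = C1 a b xi.
Proof. by apply: int_ext => y; rewrite mulrN cosN. Qed.

Lemma S1N a b xi : S1 a b (- xi) = - S1 a b xi.
Proof.
rewrite /S1 -intN; first by apply: int_ext => y; rewrite mulrN sinN mulrN.
apply: itg_lam_itv => [|x]; last exact: sin_max.
by apply: (measurableT_comp measurable_sinR); exact: measurable_funM.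
Qed.

(** The four absolute values are those that [int_1mcos] produces in [int_CS1]; here they are
    recognised as the overlap of the two intervals. *)
Lemma int_itv_overlap a b c d : a <= b -> c <= d ->
  int lam (fun y => \1_(`]a, b]%classic) y * \1_(`]c, d]%classic) y) =
  (`|b - c| + `|d - a| - `|b - d| - `|a - c|) / 2.
Proof.
move=> ab cd.
have len u v : int lam (fun y => \1_(`]u, v]%classic) y * 1) = Num.max 0 (v - u).
  case: (leP u v) => uv.
    rewrite (@int_itv_ftc (fun=> 1) id u v uv); first by rewrite max_r// subr_ge0.
    - by move=> x; exact: cvg_cst.
    - by move=> x; exact: der_id.
  rewrite max_l; last by rewrite subr_le0 ltW.
  rewrite -[RHS](int0 lam); apply: int_ext => y; rewrite indicE memNset ?mul0r//.
  by rewrite /= in_itv /= => /andP[h1 h2]; have := lt_le_trans h1 h2; rewrite ltNge (ltW uv).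
transitivity (int lam (fun y => \1_(`]Num.max a c, Num.min b d]%classic) y * 1)).
  apply: int_ext => y; rewrite mulr1 !indicE -natrM mulnb; congr (nat_of_bool _)%:R.
  apply/idP/idP => [/andP[/set_mem + /set_mem]|/set_mem] /=; rewrite !in_itv /=.
    move=> /andP[? ?] /andP[? ?]; apply/mem_set.
    by rewrite /= in_itv /= gt_max le_min; apply/andP; split; apply/andP.
  rewrite gt_max le_min => /andP[/andP[? ?] /andP[? ?]].
  by apply/andP; split; apply/mem_set; rewrite /= in_itv /=; apply/andP.
rewrite len.
case: (leP a c) => h5; case: (leP b d) => h6.
- rewrite (@ler0_norm _ (b - d)) 1?(@ler0_norm _ (a - c)) 1?(@ger0_norm _ (d - a)); try lra.
  by case: (leP 0 (b - c)) => h; [rewrite ger0_norm|rewrite ltr0_norm]; lra.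
- rewrite max_r; last by lra.
  rewrite (@ger0_norm _ (b - d)) 1?(@ler0_norm _ (a - c)) 1?(@ger0_norm _ (d - a));
    rewrite 1?(@ger0_norm _ (b - c)); lra.
- rewrite max_r; last by lra.
  rewrite (@ler0_norm _ (b - d)) 1?(@ger0_norm _ (a - c)) 1?(@ger0_norm _ (d - a));
    rewrite 1?(@ger0_norm _ (b - c)); lra.
- rewrite (@ger0_norm _ (b - d)) 1?(@ger0_norm _ (a - c)) 1?(@ger0_norm _ (b - c)); try lra.
  by case: (leP 0 (d - a)) => h; [rewrite ger0_norm|rewrite ltr0_norm]; lra.
Qed.

(** The real part of Parseval's identity for two intervals. Off the origin the addition formulas
    turn [F] into a signed sum of four functions (1 - cos(u x)) / x^2, in which the constants 1
    cancel. *)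
Lemma int_CS1 a b c d : a <= b -> c <= d ->
  let F xi := C1 a b xi * C1 c d xi + S1 a b xi * S1 c d xi in
  itg lam F /\ int lam F =
    2 * pi * int lam (fun y => \1_(`]a, b]%classic) y * \1_(`]c, d]%classic) y).
Proof.
move=> ab cd F; pose J u (x : R) : R := (1 - cos (u * x)) / x ^+ 2.
pose H x := J (b - c) x + J (a - d) x - J (b - d) x - J (a - c) x.
have IJ u := (int_1mcos u).1; have EJ u := (int_1mcos u).2.
have IH : itg lam H by exact: itgB (itgB (itgD (IJ _) (IJ _)) (IJ _)) (IJ _).
have EH : int lam H = pi * (`|b - c| + `|a - d| - `|b - d| - `|a - c|).
  have I2 := itgD (IJ (b - c)) (IJ (a - d)).
  rewrite /H (intB (itgB I2 (IJ (b - d))) (IJ (a - c))) (intB I2 (IJ (b - d))).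
  by rewrite (intD (IJ (b - c)) (IJ (a - d))) !EJ; ring.
have mF : measurable_fun setT F.
  exact: measurable_funD (measurable_funM (measurable_C1 _ _) (measurable_C1 _ _))
    (measurable_funM (measurable_S1 _ _) (measurable_S1 _ _)).
have FH : {ae lam, forall x, H x = F x}.
  exists [set 0]; split=> //; first exact: lebesgue_measure_set1.
  move=> x /= h; apply: contrapT => /eqP x0; apply: h.
  rewrite /H /J /F !C1E// !S1E// !mulrBl !cosB; field.
  exact: x0.
have [If Ef] := int_ae (itg_meas IH) FH mF IH.
split=> //; rewrite -Ef EH int_itv_overlap// (distrC a d).
by field.
Qed.

(** The imaginary part of Parseval's identity: an odd function, dominated by the sums of squares
    that [int_CS1] integrates for equal intervals. *)
Lemma int_SC1 a b c d : a <= b -> c <= d ->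
  let G xi := S1 a b xi * C1 c d xi - C1 a b xi * S1 c d xi in
  itg lam G /\ int lam G = 0.
Proof.
move=> ab cd G.
have mG : measurable_fun setT G.
  exact: measurable_funB (measurable_funM (measurable_S1 _ _) (measurable_C1 _ _))
    (measurable_funM (measurable_C1 _ _) (measurable_S1 _ _)).
have IG : itg lam G.
  apply: itg_le (itgD (int_CS1 ab ab).1 (int_CS1 cd cd).1) => // x.
  rewrite /G ler_norml.
  have := sqr_ge0 (S1 a b x - C1 c d x); have := sqr_ge0 (S1 a b x + C1 c d x).
  have := sqr_ge0 (C1 a b x - S1 c d x); have := sqr_ge0 (C1 a b x + S1 c d x).
  have := sqr_ge0 (C1 a b x); have := sqr_ge0 (S1 a b x).
  have := sqr_ge0 (C1 c d x); have := sqr_ge0 (S1 c d x).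
  by move=> *; apply/andP; split; nra.
split=> //; have := int_lamN mG.
have -> : int lam (fun x => G (- x)) = - int lam G.
  by rewrite -intN//; apply: int_ext => x; rewrite /G !C1N !S1N; ring.
by move=> h; lra.
Qed.

End one_dim_integrals.

(** * Parseval's identity for boxes *)

Section box_transforms.
Context (R : realType).
Local Notation lam := (@lebesgue_measure R).
Local Notation leb := (lebesgue_Rn R).

Definition CB n (a b : 'I_n -> R) (xi : Rn R n) : R :=
  int (leb n) (fun x => \1_(box a b) x * cos (dot x xi)).
Definition SB n (a b : 'I_n -> R) (xi : Rn R n) : R :=
  int (leb n) (fun x => \1_(box a b) x * sin (dot x xi)).

Lemma measurable_dot n : measurable_fun setT (fun z : Rn R n * Rn R n => dot z.1 z.2).
Proof.
apply: measurable_sum => i; apply: measurable_funM.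
  by apply: (measurableT_comp (measurable_tnth i)); exact: measurable_fst.
by apply: (measurableT_comp (measurable_tnth i)); exact: measurable_snd.
Qed.

Lemma measurable_dotl n (xi : Rn R n) : measurable_fun setT (fun x => dot x xi).
Proof.
by apply: measurable_sum => i; apply: measurable_funM => //; exact: measurable_tnth.
Qed.

Lemma dot_cons n x (y : Rn R n) u (v : Rn R n) :
  dot (consRn (x, y)) (consRn (u, v)) = x * u + dot y v.
Proof.
rewrite /dot big_ord_recl !tnth0; congr (_ + _).
by apply: eq_bigr => i _; rewrite !tnthS.
Qed.

Lemma box_cons n (a b : 'I_n.+1 -> R) x (y : Rn R n) :
  \1_(box a b) (consRn (x, y)) = \1_(`]a ord0, b ord0]%classic) x *
    \1_(box (fun i => a (lift ord0 i)) (fun i => b (lift ord0 i))) y :> R.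
Proof.
rewrite !indicE -natrM mulnb; congr (nat_of_bool _)%:R.
apply/idP/idP => [/set_mem h|/andP[/set_mem + /set_mem h]].
  apply/andP; split; apply/mem_set => /=.
    by rewrite in_itv /=; have := h ord0; rewrite tnth0.
  by move=> i; have := h (lift ord0 i); rewrite tnthS.
rewrite /= in_itv /= => hx; apply/mem_set => i.
by case: (unliftP ord0 i) => [j|] ->; rewrite ?tnth0 ?tnthS//; exact: h.
Qed.

Lemma itg_bounded_box n (a b : 'I_n -> R) (g : Rn R n -> R) (K : R) :
  measurable_fun setT g -> (forall x, `|g x| <= K) ->
  itg (leb n) (fun x => \1_(box a b) x * g x).
Proof.
move=> mg gK; have [Ib _] := L12_box a b.
apply: itg_le (itgZ K Ib); first exact: measurable_funM (itg_meas Ib) mg.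
by move=> x; rewrite normrM [leRHS]mulrC ger0_norm ?indicE// ler_wpM2l.
Qed.

Lemma itg_CB n (a b : 'I_n -> R) xi :
  itg (leb n) (fun x => \1_(box a b) x * cos (dot x xi)).
Proof.
apply: (@itg_bounded_box _ _ _ _ 1) => [|x]; last exact: cos_max.
by apply: (measurableT_comp (@measurable_cosR R)); exact: measurable_dotl.
Qed.

Lemma itg_SB n (a b : 'I_n -> R) xi :
  itg (leb n) (fun x => \1_(box a b) x * sin (dot x xi)).
Proof.
apply: (@itg_bounded_box _ _ _ _ 1) => [|x]; last exact: sin_max.
by apply: (measurableT_comp (@measurable_sinR R)); exact: measurable_dotl.
Qed.

Lemma int_Rn_tensor n (f : R -> R) (g : Rn R n -> R) : itg lam f -> itg (leb n) g ->
  let h z := f (unconsRn z).1 * g (unconsRn z).2 in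
  itg (leb n.+1) h /\ int (leb n.+1) h = int lam f * int (leb n) g.
Proof. by move=> If Ig h; apply: itg_Rn_tensor => // x y; rewrite /h consRnK. Qed.

(** Product of the complex numbers [C1 + i S1] and [CB + i SB], in real terms. *)
Lemma CB_cons n (a b : 'I_n.+1 -> R) u (v : Rn R n) :
  let a' i := a (lift ord0 i) in let b' i := b (lift ord0 i) in
  CB a b (consRn (u, v)) =
    C1 (a ord0) (b ord0) u * CB a' b' v - S1 (a ord0) (b ord0) u * SB a' b' v /\
  SB a b (consRn (u, v)) =
    S1 (a ord0) (b ord0) u * CB a' b' v + C1 (a ord0) (b ord0) u * SB a' b' v.
Proof.
move=> a' b'.
have mc : measurable_fun setT (fun y : R => cos (y * u)).
  by apply: (measurableT_comp (@measurable_cosR R)); exact: measurable_funM.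
have ms : measurable_fun setT (fun y : R => sin (y * u)).
  by apply: (measurableT_comp (@measurable_sinR R)); exact: measurable_funM.
have Ic := itg_lam_itv (a ord0) (b ord0) mc (fun y => cos_max (y * u)).
have Is := itg_lam_itv (a ord0) (b ord0) ms (fun y => sin_max (y * u)).
have [I1 E1] := int_Rn_tensor Ic (itg_CB a' b' v).
have [I2 E2] := int_Rn_tensor Is (itg_SB a' b' v).
have [I3 E3] := int_Rn_tensor Is (itg_CB a' b' v).
have [I4 E4] := int_Rn_tensor Ic (itg_SB a' b' v).
rewrite /CB /SB /C1 /S1; split.
  rewrite -E1 -E2 -intB//; apply: int_ext => z.
  rewrite -[in LHS](unconsRnK z); case: (unconsRn z) => x y /=.
  by rewrite box_cons dot_cons cosD; ring.
rewrite -E3 -E4 -intD//; apply: int_ext => z.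
rewrite -[in LHS](unconsRnK z); case: (unconsRn z) => x y /=.
by rewrite box_cons dot_cons sinD; ring.
Qed.

Lemma itg_Rn0 (f : Rn R 0 -> R) : itg (leb 0) f /\ int (leb 0) f = f [tuple].
Proof.
have E x : x = [tuple] :> Rn R 0 by exact: tuple0.
have -> : f = cst (f [tuple]) by apply/funext => x; rewrite (E x).
split; last by rewrite /int /Rintegral /= integral_dirac// diracT mul1e.
apply: itg_ext (itgZ (f [tuple]) (itg_indic measurableT _)) => [x|].
  by rewrite indicT mulr1.
by rewrite /= diracT ltey.
Qed.

(** Real and imaginary parts are proved together: one more coordinate multiplies two complex
    numbers, so each part of the step uses both parts of the induction hypothesis. The induction
    starts in dimension 0, where the measure is a point mass. *)
Lemma box_isometry n (a b c d : 'I_n -> R) :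
  (forall i, a i <= b i) -> (forall i, c i <= d i) ->
  [/\ itg (leb n) (fun xi => CB a b xi * CB c d xi + SB a b xi * SB c d xi),
     int (leb n) (fun xi => CB a b xi * CB c d xi + SB a b xi * SB c d xi) =
       (2 * pi) ^+ n * int (leb n) (fun x => \1_(box a b) x * \1_(box c d) x),
     itg (leb n) (fun xi => SB a b xi * CB c d xi - CB a b xi * SB c d xi) &
     int (leb n) (fun xi => SB a b xi * CB c d xi - CB a b xi * SB c d xi) = 0].
Proof.
elim: n a b c d => [|n IH] a b c d ab cd.
  have bT (u v : 'I_0 -> R) x : \1_(box u v) x = 1 :> R.
    by rewrite indicE mem_set// => -[].
  have E1 (u v : 'I_0 -> R) xi : CB u v xi = 1.
    by rewrite /CB (itg_Rn0 _).2 bT /dot big_ord0 cos0 mulr1.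
  have E2 (u v : 'I_0 -> R) xi : SB u v xi = 0.
    by rewrite /SB (itg_Rn0 _).2 bT /dot big_ord0 sin0 mulr0.
  have X1 : (fun xi => CB a b xi * CB c d xi + SB a b xi * SB c d xi) = fun=> 1.
    by apply/funext => xi; rewrite !E1 !E2; ring.
  have X2 : (fun xi => SB a b xi * CB c d xi - CB a b xi * SB c d xi) = fun=> 0.
    by apply/funext => xi; rewrite !E1 !E2; ring.
  have X3 : (fun x => \1_(box a b) x * \1_(box c d) x) = fun=> 1 :> R.
    by apply/funext => x; rewrite !bT mulr1.
  by rewrite X1 X2 X3; split; rewrite ?(itg_Rn0 _).2 ?expr0 ?mul1r//; exact: (itg_Rn0 _).1.
set a' := fun i => a (lift ord0 i); set b' := fun i => b (lift ord0 i).
set c' := fun i => c (lift ord0 i); set d' := fun i => d (lift ord0 i).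
have [IK EK IL EL] := IH a' b' c' d' (fun i => ab _) (fun i => cd _).
have [IF EF] := int_CS1 (ab ord0) (cd ord0).
have [IG EG] := int_SC1 (ab ord0) (cd ord0).
have [I1 E1] := int_Rn_tensor IF IK; have [I2 E2] := int_Rn_tensor IG IL.
have [I3 E3] := int_Rn_tensor IF IL; have [I4 E4] := int_Rn_tensor IG IK.
have X1 : (fun xi : Rn R n.+1 => CB a b xi * CB c d xi + SB a b xi * SB c d xi) =1
   (fun z => (C1 (a ord0) (b ord0) (unconsRn z).1 * C1 (c ord0) (d ord0) (unconsRn z).1 +
    S1 (a ord0) (b ord0) (unconsRn z).1 * S1 (c ord0) (d ord0) (unconsRn z).1) *
   (CB a' b' (unconsRn z).2 * CB c' d' (unconsRn z).2 + SB a' b' (unconsRn z).2 * SB c' d' (unconsRn z).2) -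
   (S1 (a ord0) (b ord0) (unconsRn z).1 * C1 (c ord0) (d ord0) (unconsRn z).1 -
    C1 (a ord0) (b ord0) (unconsRn z).1 * S1 (c ord0) (d ord0) (unconsRn z).1) *
   (SB a' b' (unconsRn z).2 * CB c' d' (unconsRn z).2 - CB a' b' (unconsRn z).2 * SB c' d' (unconsRn z).2)).
  move=> z; rewrite -[in LHS](unconsRnK z); case: (unconsRn z) => u v /=.
  rewrite (CB_cons a b u v).1 (CB_cons a b u v).2 (CB_cons c d u v).1 (CB_cons c d u v).2; ring.
have X2 : (fun xi : Rn R n.+1 => SB a b xi * CB c d xi - CB a b xi * SB c d xi) =1
   (fun z => (C1 (a ord0) (b ord0) (unconsRn z).1 * C1 (c ord0) (d ord0) (unconsRn z).1 +
    S1 (a ord0) (b ord0) (unconsRn z).1 * S1 (c ord0) (d ord0) (unconsRn z).1) *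
   (SB a' b' (unconsRn z).2 * CB c' d' (unconsRn z).2 - CB a' b' (unconsRn z).2 * SB c' d' (unconsRn z).2) +
   (S1 (a ord0) (b ord0) (unconsRn z).1 * C1 (c ord0) (d ord0) (unconsRn z).1 -
    C1 (a ord0) (b ord0) (unconsRn z).1 * S1 (c ord0) (d ord0) (unconsRn z).1) *
   (CB a' b' (unconsRn z).2 * CB c' d' (unconsRn z).2 + SB a' b' (unconsRn z).2 * SB c' d' (unconsRn z).2)).
  move=> z; rewrite -[in LHS](unconsRnK z); case: (unconsRn z) => u v /=.
  rewrite (CB_cons a b u v).1 (CB_cons a b u v).2 (CB_cons c d u v).1 (CB_cons c d u v).2; ring.
have I00 : itg lam (fun y => \1_(`]a ord0, b ord0]%classic) y * \1_(`]c ord0, d ord0]%classic) y).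
  by apply: itg_lam_itv => // x; rewrite indicE; case: (_ \in _); rewrite ?normr1 ?normr0.
have I01 : itg (leb n) (fun x => \1_(box a' b') x * \1_(box c' d') x).
  apply: (@itg_bounded_box _ _ _ _ 1); first exact: itg_meas (L12_box c' d').1.
  exact: indic_norm.
have [_ E5] := int_Rn_tensor I00 I01.
have X5 : (fun x : Rn R n.+1 => \1_(box a b) x * \1_(box c d) x) =1 (fun z =>
   (\1_(`]a ord0, b ord0]%classic) (unconsRn z).1 * \1_(`]c ord0, d ord0]%classic) (unconsRn z).1) *
   (\1_(box a' b') (unconsRn z).2 * \1_(box c' d') (unconsRn z).2) : R).
  move=> z; rewrite -[in LHS](unconsRnK z); case: (unconsRn z) => u v.
  by rewrite !box_cons /=; ring.
rewrite (funext X1) (funext X2) (funext X5) E5.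
split; [exact: itgB| |exact: itgD|].
  by rewrite intB// E1 E2 EF EK EG EL exprS; ring.
by rewrite intD// E3 E4 EF EK EG EL; ring.
Qed.

End box_transforms.

(** * The Hartley transform *)

Section hartley.
Context (R : realType) (n : nat).
Local Notation E := (Rn R n).
Local Notation leb := (lebesgue_Rn R n).
Local Notation itg_of := itg.
Local Notation itg := (itg leb).
Local Notation int := (int leb).
Local Notation L2 := (L2 leb).
Local Notation ip := (ip leb).
Local Notation nm := (nm leb).
Implicit Types (f g s : E -> R) (x xi : E) (F : nat -> E -> R) (a b : 'I_n -> R).

Definition cas (t : R) : R := cos t + sin t.

Definition CT f xi : R := int (fun x => cos (dot x xi) * f x).
Definition ST f xi : R := int (fun x => sin (dot x xi) * f x).

(* The Hartley transform: real valued, with a symmetric kernel; the Fourier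
   transform of [f] is [CT f - i ST f], its even part minus i times its odd part. *)
Definition hart f xi : R := int (fun x => cas (dot x xi) * f x).

Lemma measurable_cos_dot xi : measurable_fun setT (fun x => cos (dot x xi)).
Proof. by apply: (measurableT_comp (@measurable_cosR R)); exact: measurable_dotl. Qed.

Lemma measurable_sin_dot xi : measurable_fun setT (fun x => sin (dot x xi)).
Proof. by apply: (measurableT_comp (@measurable_sinR R)); exact: measurable_dotl. Qed.

Lemma measurable_cas_dot xi : measurable_fun setT (fun x => cas (dot x xi)).
Proof. exact: measurable_funD (measurable_cos_dot xi) (measurable_sin_dot xi). Qed.

Lemma cas_max t : `|cas t| <= 2.
Proof. by rewrite (le_trans (ler_normD _ _))// lerD ?cos_max ?sin_max. Qed.

Lemma itg_bounded g f (K : R) : measurable_fun setT g -> (forall x, `|g x| <= K) ->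
  itg f -> itg (fun x => g x * f x).
Proof.
move=> mg gK If; apply: itg_le (itgZ K (itg_abs If)).
  exact: measurable_funM mg (itg_meas If).
by move=> x; rewrite normrM ler_wpM2r.
Qed.

Lemma itg_cos f xi : itg f -> itg (fun x => cos (dot x xi) * f x).
Proof.
by apply: (@itg_bounded _ _ 1); [exact: measurable_cos_dot|move=> x; exact: cos_max].
Qed.

Lemma itg_sin f xi : itg f -> itg (fun x => sin (dot x xi) * f x).
Proof.
by apply: (@itg_bounded _ _ 1); [exact: measurable_sin_dot|move=> x; exact: sin_max].
Qed.

Lemma itg_cas f xi : itg f -> itg (fun x => cas (dot x xi) * f x).
Proof.
by apply: (@itg_bounded _ _ 2); [exact: measurable_cas_dot|move=> x; exact: cas_max].
Qed.

Lemma dotC x xi : dot x xi = dot xi x.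
Proof. by apply: eq_bigr => i _; rewrite mulrC. Qed.

Lemma dotNr x xi : dot x (negx xi) = - dot x xi.
Proof. by rewrite /dot -sumrN; apply: eq_bigr => i _; rewrite tnth_negx mulrN. Qed.

Lemma hartE f xi : itg f -> hart f xi = CT f xi + ST f xi.
Proof.
move=> If; rewrite /hart /CT /ST -intD; [|exact: itg_cos|exact: itg_sin].
by apply: int_ext => x; rewrite mulrDl.
Qed.

Lemma CTN f xi : CT f (negx xi) = CT f xi.
Proof. by apply: int_ext => x; rewrite dotNr cosN. Qed.

Lemma STN f xi : itg f -> ST f (negx xi) = - ST f xi.
Proof.
move=> If; rewrite /ST -intN; last exact: itg_sin.
by apply: int_ext => x; rewrite dotNr sinN mulNr.
Qed.

Lemma hart_ext f g : f =1 g -> hart f =1 hart g.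
Proof. by move=> /funext ->. Qed.

Lemma hartD f g xi : itg f -> itg g -> hart (fun x => f x + g x) xi = hart f xi + hart g xi.
Proof.
move=> If Ig; rewrite /hart -intD; [|exact: itg_cas|exact: itg_cas].
by apply: int_ext => x; rewrite mulrDr.
Qed.

Lemma hartZ c f xi : itg f -> hart (fun x => c * f x) xi = c * hart f xi.
Proof.
move=> If; rewrite /hart -intZ; last exact: itg_cas.
by apply: int_ext => x; rewrite mulrCA.
Qed.

Lemma hartB f g xi : itg f -> itg g -> hart (fun x => f x - g x) xi = hart f xi - hart g xi.
Proof.
move=> If Ig; rewrite -mulN1r -hartZ// -hartD//; last exact: itgZ.
by apply: hart_ext => x; rewrite mulN1r.
Qed.

Lemma hart0 xi : hart (fun=> 0) xi = 0.
Proof. by rewrite /hart -[RHS](int0 leb); apply: int_ext => x; rewrite mulr0. Qed.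

Lemma hart_bound f xi : itg f -> `|hart f xi| <= 2 * int (fun x => `|f x|).
Proof.
move=> If; apply: le_trans (int_abs (itg_cas xi If)) _.
rewrite -intZ; last exact: itg_abs.
apply: int_le; [exact/itg_abs/itg_cas|exact/itgZ/itg_abs|move=> x].
by rewrite normrM ler_wpM2r// cas_max.
Qed.

Lemma measurable_hart f : measurable_fun setT f -> measurable_fun setT (hart f).
Proof.
move=> mf; apply: (@measurable_int1 _ _ E E R leb (fun z => cas (dot z.2 z.1) * f z.2)).
apply: measurable_funM; last by apply: (measurableT_comp mf); exact: measurable_snd.
have md : measurable_fun setT (fun z : E * E => dot z.2 z.1).
  by under eq_fun do rewrite dotC; exact: measurable_dot.
apply: measurable_funD.
  exact: (measurableT_comp (@measurable_cosR R)).
exact: (measurableT_comp (@measurable_sinR R)).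
Qed.

Definition cP : R := (2 * pi) ^+ n.

Lemma cP_gt0 : 0 < cP.
Proof. by rewrite exprn_gt0// mulr_gt0// pi_gt0. Qed.

Lemma CB_neg a b xi : CB a b (negx xi) = CB a b xi.
Proof. by apply: int_ext => x; rewrite dotNr cosN. Qed.

Lemma SB_neg a b xi : SB a b (negx xi) = - SB a b xi.
Proof.
rewrite /SB -intN; last exact: itg_SB.
by apply: int_ext => x; rewrite dotNr sinN mulrN.
Qed.

Lemma hart_box a b xi : hart \1_(box a b) xi = CB a b xi + SB a b xi.
Proof.
rewrite hartE; last exact: (L12_box a b).1.
by congr (_ + _); apply: int_ext => x; rewrite mulrC.
Qed.

Lemma measurable_CB a b : measurable_fun setT (CB a b).
Proof.
have := measurable_hart (itg_meas (L12_box a b).1) => m1.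
have m2 := measurableT_comp m1 (@measurable_negx R n).
have -> : CB a b = (fun xi => 2^-1 * (hart \1_(box a b) xi + hart \1_(box a b) (negx xi))).
  by apply/funext => xi; rewrite !hart_box CB_neg SB_neg; field.
by apply: measurable_funM => //; exact: measurable_funD.
Qed.

Lemma measurable_SB a b : measurable_fun setT (SB a b).
Proof.
have -> : SB a b = (fun xi => hart \1_(box a b) xi - CB a b xi).
  by apply/funext => xi; rewrite hart_box; ring.
apply: measurable_funB; last exact: measurable_CB.
exact: measurable_hart (itg_meas (L12_box a b).1).
Qed.

(** The product of two Hartley transforms is the integrand of [box_isometry] plus [O], which mixes
    cosine with sine transforms, is odd, and so integrates to 0. *)
Lemma hart_box_isometry a b c d : (forall i, a i <= b i) -> (forall i, c i <= d i) ->
  [/\ L2 (hart \1_(box a b)), L2 (hart \1_(box c d)) &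
  ip (hart \1_(box a b)) (hart \1_(box c d)) = cP * ip \1_(box a b) \1_(box c d)].
Proof.
move=> ab cd.
have key a' b' c' d' : (forall i, a' i <= b' i) -> (forall i, c' i <= d' i) ->
    itg (fun xi => hart \1_(box a' b') xi * hart \1_(box c' d') xi) /\
    ip (hart \1_(box a' b')) (hart \1_(box c' d')) = cP * ip \1_(box a' b') \1_(box c' d').
  move=> ab' cd'; have [IK EK _ _] := box_isometry ab' cd'.
  have [I1 _ _ _] := box_isometry ab' ab'; have [I2 _ _ _] := box_isometry cd' cd'.
  pose O xi := CB a' b' xi * SB c' d' xi + SB a' b' xi * CB c' d' xi.
  have IO : itg O.
    apply: itg_le (itgD I1 I2).
      exact: measurable_funD (measurable_funM (measurable_CB _ _) (measurable_SB _ _))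
        (measurable_funM (measurable_SB _ _) (measurable_CB _ _)).
    move=> xi; rewrite /O ler_norml.
    have := sqr_ge0 (CB a' b' xi + SB c' d' xi); have := sqr_ge0 (CB a' b' xi - SB c' d' xi).
    have := sqr_ge0 (SB a' b' xi + CB c' d' xi); have := sqr_ge0 (SB a' b' xi - CB c' d' xi).
    have := sqr_ge0 (CB a' b' xi); have := sqr_ge0 (SB a' b' xi).
    have := sqr_ge0 (CB c' d' xi); have := sqr_ge0 (SB c' d' xi).
    by move=> *; apply/andP; split; nra.
  have EO : int O = 0.
    by apply: int_odd => // xi; rewrite /O !CB_neg !SB_neg; ring.
  have X : (fun xi => hart \1_(box a' b') xi * hart \1_(box c' d') xi) =
      (fun xi => (CB a' b' xi * CB c' d' xi + SB a' b' xi * SB c' d' xi) + O xi).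
    by apply/funext => xi; rewrite !hart_box /O; ring.
  by rewrite /ip X; split; [exact: itgD|rewrite intD// EO addr0 EK].
have L a' b' : (forall i, a' i <= b' i) -> L2 (hart \1_(box a' b')).
  move=> ab'; split; first exact: measurable_hart (itg_meas (L12_box a' b').1).
  by apply: itg_ext (key _ _ _ _ ab' ab').1 => x; rewrite expr2.
by split; [exact: L|exact: L|exact: (key _ _ _ _ ab cd).2].
Qed.

(** Inductive, so that bilinearity extends the isometry one box at a time in each argument. *)
Inductive boxstep : (E -> R) -> Prop :=
| boxstep0 : boxstep (fun=> 0)
| boxstepS c a b s : (forall i, a i <= b i) -> boxstep s ->
    boxstep (fun x => c * \1_(box a b) x + s x).

Lemma boxstep_L12 s : boxstep s -> L12 s.
Proof.
elim=> [|c a b {}s ab _ Ls]; first by split; [exact: itg0|exact: L2_0].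
by apply: L12D => //; apply: L12Z; exact: L12_box.
Qed.

Lemma boxstepD s s' : boxstep s -> boxstep s' -> boxstep (fun x => s x + s' x).
Proof.
move=> + Bs'; elim=> [|c a b {}s ab _ IH].
  by rewrite (_ : (fun x => _) = s')//; apply/funext => x; rewrite add0r.
rewrite (_ : (fun x => _) = (fun x => c * \1_(box a b) x + (s x + s' x))).
  exact: boxstepS.
by apply/funext => x; rewrite addrA.
Qed.

Lemma boxstepZ k s : boxstep s -> boxstep (fun x => k * s x).
Proof.
elim=> [|c a b {}s ab _ IH].
  by rewrite (_ : (fun x => _) = fun=> 0); [exact: boxstep0|apply/funext => x; rewrite mulr0].
rewrite (_ : (fun x => _) = (fun x => (k * c) * \1_(box a b) x + k * s x)).
  exact: boxstepS.
by apply/funext => x; rewrite mulrDr mulrA.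
Qed.

Lemma boxstepB s s' : boxstep s -> boxstep s' -> boxstep (fun x => s x - s' x).
Proof.
move=> Bs /(boxstepZ (-1)) Bs'; have := boxstepD Bs Bs'.
by rewrite (_ : (fun x => s x + _) = (fun x => s x - s' x))//; apply/funext => x; rewrite mulN1r.
Qed.

Lemma boxstep_isometry s s' : boxstep s -> boxstep s' ->
  [/\ L2 (hart s), L2 (hart s') & ip (hart s) (hart s') = cP * ip s s'].
Proof.
have H1 c d t : (forall i, c i <= d i) -> boxstep t ->
    L2 (hart t) /\ ip (hart t) (hart \1_(box c d)) = cP * ip t \1_(box c d).
  move=> cd; elim=> [|k a b {}t ab Bt [Lt Et]].
    have h0 : hart (fun=> 0) = fun=> 0 by apply/funext => x; rewrite hart0.
    rewrite h0; split; first exact: L2_0.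
    rewrite /ip (int_ext _ (_ : _ =1 fun=> 0)) ?(int_ext _ (_ : _ =1 fun=> 0)) ?int0 ?mulr0//.
    - by move=> x; rewrite mul0r.
    - by move=> x; rewrite mul0r.
  have Lt12 := boxstep_L12 Bt; have Lb := L12_box a b.
  have E1 : hart (fun x => k * \1_(box a b) x + t x) =
      (fun xi => k * hart \1_(box a b) xi + hart t xi).
    apply/funext => xi; rewrite hartD ?hartZ//; [exact: Lb.1|exact: itgZ Lb.1|exact: Lt12.1].
  have [L1 L3 E2] := hart_box_isometry ab cd.
  rewrite E1; split; first by apply: L2D => //; exact: L2Z.
  rewrite ipDl//; last exact: L2Z.
  rewrite ipZl// Et E2 ipDl//; [|exact: L2Z Lb.2|exact: Lt12.2|exact: (L12_box c d).2].
  by rewrite ipZl ?mulrDr; [ring|exact: Lb.2|exact: (L12_box c d).2].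
move=> Bs; have Ls12 := boxstep_L12 Bs; elim=> [|k a b {}s' ab Bs' [Ls Ls' Es']].
  have h0 : hart (fun=> 0) = fun=> 0 by apply/funext => x; rewrite hart0.
  have [Ls _] := H1 (fun=> 0) (fun=> 0) _ (fun _ => lexx _) Bs.
  rewrite h0; split=> //; first exact: L2_0.
  rewrite /ip (int_ext _ (_ : _ =1 fun=> 0)) ?(int_ext _ (_ : _ =1 fun=> 0)) ?int0 ?mulr0//.
  - by move=> x; rewrite mulr0.
  - by move=> x; rewrite mulr0.
have Lt12 := boxstep_L12 Bs'; have Lb := L12_box a b.
have E1 : hart (fun x => k * \1_(box a b) x + s' x) =
    (fun xi => k * hart \1_(box a b) xi + hart s' xi).
  apply/funext => xi; rewrite hartD ?hartZ//; [exact: Lb.1|exact: itgZ Lb.1|exact: Lt12.1].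
have [L1 _ _] := hart_box_isometry ab ab; have [_ E2] := H1 _ _ _ ab Bs.
rewrite E1; split=> //; first by apply: L2D => //; exact: L2Z.
rewrite ipDr//; last exact: L2Z.
rewrite ipZr// Es' E2 ipDr//; [|exact: L2Z Lb.2|exact: Lt12.2|exact: Ls12.2].
by rewrite ipZr ?mulrDr; [ring|exact: Lb.2|exact: Ls12.2].
Qed.

(** One step function serves both norms: L^1 closeness gives pointwise convergence of the
    transforms, L^2 closeness controls their norms. *)
Lemma boxstep_dense f : L12 f -> forall e, 0 < e -> exists2 s, boxstep s &
  int (fun x => `|f x - s x|) <= e /\ nm (fun x => f x - s x) <= e.
Proof.
move=> Lf; pose V f := L12 f /\ forall e : R, 0 < e -> exists2 s, boxstep s &
  int (fun x => `|f x - s x|) <= e /\ nm (fun x => f x - s x) <= e.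
suff : V f by case.
move: f Lf; apply: L12_ind.
- move=> f g [Lf Hf] [Lg Hg]; split=> [|e e0]; first exact: L12D.
  have e2 : 0 < e / 2 by rewrite divr_gt0.
  have [s Bs [s1 s2]] := Hf _ e2; have [t Bt [t1 t2]] := Hg _ e2.
  have Ls := boxstep_L12 Bs; have Lt := boxstep_L12 Bt.
  have [I1 I2] := L12B Lf Ls; have [J1 J2] := L12B Lg Lt.
  exists (fun x => s x + t x); first exact: boxstepD.
  have X : (fun x => f x + g x - (s x + t x)) = (fun x => (f x - s x) + (g x - t x)).
    by apply/funext => x; ring.
  rewrite [e](splitr e); split.
    apply: le_trans (lerD s1 t1); rewrite -intD; [|exact: itg_abs|exact: itg_abs].
    apply: int_le.
    + by apply: itg_abs; rewrite X; exact: itgD.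
    + by apply: itgD; exact: itg_abs.
    + by move=> x; rewrite opprD addrACA; exact: ler_normD.
  by rewrite X; apply: le_trans (lerD s2 t2); exact: nmD.
- move=> c f [Lf Hf]; split=> [|e e0]; first exact: L12Z.
  have c1 : 0 < `|c| + 1 by rewrite ltr_wpDl.
  have [s Bs [s1 s2]] := Hf _ (divr_gt0 e0 c1).
  have [I1 I2] := L12B Lf (boxstep_L12 Bs).
  have ce : `|c| * (e / (`|c| + 1)) <= e.
    by rewrite mulrCA ler_piMr ?(ltW e0)// ler_pdivrMr// mul1r lerDl.
  exists (fun x => c * s x); first exact: boxstepZ.
  have X : (fun x => c * f x - c * s x) = (fun x => c * (f x - s x)).
    by apply/funext => x; ring.
  split.
    under [X in _ X <= _]eq_fun do rewrite -mulrBr normrM.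
    by rewrite intZ; [apply: le_trans ce; rewrite ler_wpM2l|exact: itg_abs].
  by rewrite X nmZ//; apply: le_trans ce; rewrite ler_wpM2l.
- move=> F f g VF LF Lg Fg Ff.
  have [||||If _ h1] := @int_dct _ _ _ leb F f g => //.
  - by move=> m; exact: itg_meas (LF m).1.
  - exact: Lg.1.
  have [Lf h2] := L2_dct (fun m => itg_meas (LF m).1) Fg Lg.2 Ff.
  split=> // e e0; have e2 : 0 < e / 2 by rewrite divr_gt0.
  have [N1 HN1] := (seqP _ _).1 h1 _ e2; have [N2 HN2] := (seqP _ _).1 h2 _ e2.
  pose N := maxn N1 N2.
  have [s Bs [s1 s2]] := (VF N).2 _ e2; exists s => //.
  have := HN1 N (leq_maxl _ _); have := HN2 N (leq_maxr _ _); rewrite !subr0.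
  rewrite ger0_norm ?nm_ge0// ger0_norm; last by apply: int_ge0.
  have Ls := boxstep_L12 Bs.
  move=> k2 k1; rewrite [e](splitr e); split.
    apply: le_trans (lerD k1 s1).
    have [I1 I2] := L12B (LF N) (conj If Lf); have [J1 J2] := L12B (LF N) Ls.
    rewrite -intD; [|exact: itg_abs|exact: itg_abs]; apply: int_le.
    + by apply: itg_abs; exact: itgB If Ls.1.
    + by apply: itgD; exact: itg_abs.
    + by move=> x; rewrite (distrC (F N x)); exact: ler_distD.
  apply: le_trans (lerD k2 s2); rewrite (nm_subC _ (F N)).
  exact: nm_triangle Lf Ls.2 (LF N).2.
- move=> a b ab; split=> [|e e0]; first exact: L12_box.
  exists (fun x => 1 * \1_(box a b) x + 0); first by apply: boxstepS => //; exact: boxstep0.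
  split; last first.
    rewrite (nm_ext _ (_ : _ =1 fun=> 0)) ?nm0 ?ltW// => x; ring.
  rewrite (int_ext _ (_ : _ =1 fun=> 0)) ?int0 ?ltW// => x.
  by rewrite mul1r addr0 subrr normr0.
Qed.

Lemma nm_hart_boxstep s : boxstep s -> nm (hart s) = Num.sqrt cP * nm s.
Proof.
move=> Bs; have [_ _ E] := boxstep_isometry Bs Bs.
by rewrite /nm E sqrtrM// ltW// cP_gt0.
Qed.

(** The transforms of the approximating step functions converge pointwise, by L^1 closeness. Fatou's
    lemma applied to [hart (s m) - hart (s (l + m))] upgrades this to L^2 convergence, and the
    identity for step functions passes to the limit. *)
Lemma hart_isometry f : L12 f -> L2 (hart f) /\ nm (hart f) = Num.sqrt cP * nm f.
Proof.
move=> Lf; have cP0 := cP_gt0.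
have /choice[s Hs] : forall m : nat, exists s, [/\ boxstep s,
   int (fun x => `|f x - s x|) <= m.+1%:R^-1 & nm (fun x => f x - s x) <= m.+1%:R^-1].
  move=> m; have [|s Bs [s1 s2]] := boxstep_dense Lf (e := m.+1%:R^-1).
    by rewrite invr_gt0.
  by exists s.
have Bs m : boxstep (s m) by have [] := Hs m.
have Ls m := boxstep_L12 (Bs m).
have Lhs m : L2 (hart (s m)) by have [] := boxstep_isometry (Bs m) (Bs m).
have mhf : measurable_fun setT (hart f) by exact: measurable_hart (itg_meas Lf.1).
have pw xi : hart (s l) xi @[l --> \oo] --> hart f xi.
  apply: (squeeze0 (K := 2)) (@cvg_harmonic R) => l.
  rewrite distrC -hartB//; [|exact: Lf.1|exact: (Ls l).1].
  apply: le_trans (hart_bound _ (itgB Lf.1 (Ls l).1)) _.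
  rewrite ler_wpM2l// ger0_norm ?invr_ge0//=; by have [] := Hs l.
(* By the triangle inequality through [f], two approximants of index at least m are within
   2/(m+1). *)
have fat m : L2 (fun xi => hart (s m) xi - hart f xi) /\
    nm (fun xi => hart (s m) xi - hart f xi) <= Num.sqrt cP * (2 / m.+1%:R).
  have nml l : nm (fun xi => hart (s m) xi - hart (s (l + m)%N) xi) <= Num.sqrt cP * (2 / m.+1%:R).
    rewrite (nm_ext _ (_ : _ =1 hart (fun x => s m x - s (l + m)%N x))); last first.
      by move=> xi; rewrite hartB//; [exact: (Ls _).1|exact: (Ls _).1].
    rewrite nm_hart_boxstep; last exact: boxstepB.
    rewrite ler_wpM2l ?sqrtr_ge0//.
    apply: le_trans (nm_triangle (Ls m).2 (Ls (l + m)%N).2 Lf.2) _.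
    have [_ _ h1] := Hs m; have [_ _ h2] := Hs (l + m)%N.
    rewrite mulr_natl mulr2n nm_subC; apply: lerD => //; apply: le_trans h2 _.
    by rewrite lef_pV2 ?posrE// ler_nat ltnS leq_addl.
  have [] := @int_fatou _ _ _ leb (fun l xi => (hart (s m) xi - hart (s (l + m)%N) xi) ^+ 2)
    (fun xi => (hart (s m) xi - hart f xi) ^+ 2) ((Num.sqrt cP * (2 / m.+1%:R)) ^+ 2).
  - by move=> l; apply: L2_itg; exact: L2B.
  - by move=> l xi; exact: sqr_ge0.
  - move=> xi; rewrite expr2; under eq_fun do rewrite expr2.
    by apply: cvgM; (apply: cvgB; first exact: cvg_cst);
      have := pw xi; rewrite -(cvg_shiftn m).
  - by move=> l; rewrite -nm_sqE lerXn2r ?nnegrE ?nm_ge0 ?mulr_ge0 ?sqrtr_ge0.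
  move=> I1 I2; split; first by split=> //; exact: measurable_funB (Lhs m).1 mhf.
  by rewrite -(@ler_pXn2r _ 2)// ?nnegrE ?nm_ge0 ?mulr_ge0 ?sqrtr_ge0// nm_sqE.
have Lhf : L2 (hart f).
  by apply: L2_ext (L2B (Lhs 0%N) (fat 0%N).1) => xi; ring.
split=> //.
have c1 : nm (hart (s m)) @[m --> \oo] --> nm (hart f).
  apply: nm_cvg => //; apply: (squeeze0 (K := Num.sqrt cP * 2)) (@cvg_harmonic R) => m.
  rewrite subr0 ger0_norm ?nm_ge0// ger0_norm ?invr_ge0//= -mulrA; exact: (fat m).2.
have c2 : nm (s m) @[m --> \oo] --> nm f.
  apply: nm_cvg => [m||]; [exact: (Ls m).2|exact: Lf.2|].
  apply: (squeeze0 (K := 1)) (@cvg_harmonic R) => m.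
  rewrite subr0 ger0_norm ?nm_ge0// ger0_norm ?invr_ge0//= mul1r nm_subC.
  by have [] := Hs m.
have c3 : nm (hart (s m)) @[m --> \oo] --> Num.sqrt cP * nm f.
  under eq_fun do rewrite nm_hart_boxstep//.
  by apply: cvgM => //; exact: cvg_cst.
by rewrite -(cvg_lim _ c1)// -(cvg_lim _ c3).
Qed.

(** Fubini's theorem, the kernel cas(x.xi) being bounded and symmetric. *)
Lemma hart_sym f g : itg f -> itg g ->
  int (fun xi => hart f xi * g xi) = int (fun x => f x * hart g x).
Proof.
move=> If Ig.
pose k (z : E * E) := cas (dot z.1 z.2) * (f z.1 * g z.2).
have [IT _] := itg_tensor If Ig.
have mc : measurable_fun setT (fun z : E * E => cas (dot z.1 z.2)).
  apply: measurable_funD.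
    by apply: (measurableT_comp (@measurable_cosR R)); exact: measurable_dot.
  by apply: (measurableT_comp (@measurable_sinR R)); exact: measurable_dot.
have Ik : itg_of (leb \x leb)%E k.
  apply: itg_le (itgZ 2 (itg_abs IT)).
    by apply: measurable_funM => //; exact: itg_meas IT.
  by move=> z; rewrite /k normrM ler_wpM2r// cas_max.
have Ix x : itg (fun xi => k (x, xi)).
  apply: itg_ext (itgZ (f x) (itg_cas x Ig)) => xi /=.
  by rewrite /k /= dotC; ring.
have Iy xi : itg (fun x => k (x, xi)).
  apply: itg_ext (itgZ (g xi) (itg_cas xi If)) => x /=.
  by rewrite /k /=; ring.
transitivity (int (fun xi => int (fun x => k (x, xi)))).
  apply: int_ext => xi; rewrite mulrC -intZ; last exact: itg_cas.
  by apply: int_ext => x; rewrite /k /=; ring.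
rewrite -(int_prod_swap Ik Ix Iy); apply: int_ext => x.
rewrite -intZ; last exact: itg_cas.
by apply: int_ext => xi; rewrite /k /= dotC; ring.
Qed.

Lemma L2_cut f : L2 f -> (forall m, L12 (fun x => f x * \1_(cube m : set E) x)) /\
  nm (fun x => f x * \1_(cube m : set E) x - f x) @[m --> \oo] --> 0.
Proof.
move=> Lf.
have mi m := itg_meas (L12_box (fun=> - m%:R) (fun=> m%:R : R) : L12 (\1_(cube m : set E) : E -> R)).1.
have mm m : measurable_fun setT (fun x => f x * \1_(cube m : set E) x).
  exact: measurable_funM Lf.1 (mi m).
have le m x : `|f x * \1_(cube m : set E) x| <= `|f x|.
  by rewrite normrM ler_piMr// indic_norm.
split.
  move=> m; split; last exact: L2_le (le m) Lf.
  have [I1 _] := L12_box (fun _ : 'I_n => - m%:R) (fun=> m%:R : R).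
  apply: (itg_le _ _ (itgD (L2_itg Lf) I1)) => // x.
  rewrite normrM indicE; case: (_ \in _); rewrite ?normr1 ?normr0 ?mulr1 ?mulr0 ?addr0 ?sqr_ge0//.
  rewrite -(real_normK (num_real (f x))); have := sqr_ge0 (`|f x| - 1); rewrite sqrrB1.
  have -> : (nat_of_bool true)%:R = 1 :> R by [].
  by have := normr_ge0 (f x); rewrite mulr2n; nra.
exact: (L2_dct mm le (L2_abs Lf) (fun x => @indic_cube_cvg R n f x)).2.
Qed.

(** Tested against its own truncation to a cube, [w] returns the squared norm of that truncation. *)
Lemma L12_orth w : L2 w -> (forall h, L12 h -> ip w h = 0) -> nm w = 0.
Proof.
move=> Lw Hw; have [Lc cc] := L2_cut Lw.
have c1 := nm_cvg (fun m => (Lc m).2) Lw cc.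
have z m : nm (fun x => w x * \1_(cube m : set E) x) = 0.
  apply/eqP; rewrite -sqrf_eq0 nm_sq -(Hw _ (Lc m)); apply/eqP/int_ext => x.
  by rewrite mulrAC -!mulrA -expr2 indic_sq mulrA.
by rewrite -(cvg_lim _ c1)//; under eq_fun do rewrite z; rewrite lim_cst.
Qed.

(** The closure of the graph of [hart], parallel to [fourier_L2]. It is a relation because functions
    equal almost everywhere are not identified. *)
Definition hartL2 f g : Prop := [/\ L2 f, L2 g & exists F, [/\ forall m, L12 (F m),
  nm (fun x => F m x - f x) @[m --> \oo] --> 0 &
  nm (fun x => hart (F m) x - g x) @[m --> \oo] --> 0]].

Lemma hartL2_L12 f : L12 f -> hartL2 f (hart f).
Proof.
move=> Lf; have [Lh _] := hart_isometry Lf; split=> //; first exact: Lf.2.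
have z (u : E -> R) : nm (fun x => u x - u x) = 0.
  by rewrite (nm_ext _ (_ : _ =1 fun=> 0)) ?nm0// => x; rewrite subrr.
exists (fun=> f); split=> //; rewrite z; exact: cvg_cst.
Qed.

Lemma nm_cvgD F F' f f' : (forall m, L2 (F m)) -> (forall m, L2 (F' m)) ->
  L2 f -> L2 f' -> nm (fun x => F m x - f x) @[m --> \oo] --> 0 ->
  nm (fun x => F' m x - f' x) @[m --> \oo] --> 0 ->
  nm (fun x => F m x + F' m x - (f x + f' x)) @[m --> \oo] --> 0.
Proof.
move=> LF LF' Lf Lf' h h'; have h2 : nm (fun x => F m x - f x) + nm (fun x => F' m x - f' x) @[m --> \oo] --> (0 : R).
  by rewrite -[X in _ --> X](addr0 0); exact: cvgD.
apply: (squeeze0 (K := 1)) h2 => m; rewrite subr0 ger0_norm ?nm_ge0// mul1r.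
rewrite ger0_norm ?addr_ge0 ?nm_ge0//.
apply: le_trans (nmD (L2B (LF m) Lf) (L2B (LF' m) Lf')).
by rewrite (nm_ext _ (_ : _ =1 fun x => F m x - f x + (F' m x - f' x))) // => x; ring.
Qed.

Lemma nm_cvgZ c F f : (forall m, L2 (F m)) -> L2 f ->
  nm (fun x => F m x - f x) @[m --> \oo] --> 0 ->
  nm (fun x => c * F m x - c * f x) @[m --> \oo] --> 0.
Proof.
move=> LF Lf h; apply: (squeeze0 (K := `|c|)) h => m.
rewrite subr0 (nm_ext _ (_ : _ =1 fun x => c * (F m x - f x))); last by move=> x; ring.
rewrite nmZ; last exact: L2B (LF m) Lf.
by rewrite normrM normr_id.
Qed.

Lemma hartL2D f g f' g' : hartL2 f g -> hartL2 f' g' ->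
  hartL2 (fun x => f x + f' x) (fun x => g x + g' x).
Proof.
move=> [Lf Lg [F [LF h1 h2]]] [Lf' Lg' [F' [LF' h1' h2']]].
split; [exact: L2D|exact: L2D|exists (fun m x => F m x + F' m x)]; split.
- by move=> m; exact: L12D.
- by apply: nm_cvgD => // m; [exact: (LF m).2|exact: (LF' m).2].
- have := nm_cvgD (fun m => (hart_isometry (LF m)).1) (fun m => (hart_isometry (LF' m)).1)
    Lg Lg' h2 h2'.
  apply: cvg_trans; apply: near_eq_cvg; apply: nearW => m; apply: nm_ext => x.
  by rewrite hartD//; [exact: (LF m).1|exact: (LF' m).1].
Qed.

Lemma hartL2Z c f g : hartL2 f g -> hartL2 (fun x => c * f x) (fun x => c * g x).
Proof.
move=> [Lf Lg [F [LF h1 h2]]].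
split; [exact: L2Z|exact: L2Z|exists (fun m x => c * F m x)]; split.
- by move=> m; exact: L12Z.
- by apply: nm_cvgZ => // m; exact: (LF m).2.
- have := nm_cvgZ c (fun m => (hart_isometry (LF m)).1) Lg h2.
  apply: cvg_trans; apply: near_eq_cvg; apply: nearW => m; apply: nm_ext => x.
  by rewrite hartZ//; exact: (LF m).1.
Qed.

Lemma hartL2_ext f g f' g' : f =1 f' -> g =1 g' -> hartL2 f g -> hartL2 f' g'.
Proof. by move=> /funext -> /funext ->. Qed.

Lemma hartL2B f g f' g' : hartL2 f g -> hartL2 f' g' ->
  hartL2 (fun x => f x - f' x) (fun x => g x - g' x).
Proof.
move=> h h'; apply: hartL2_ext (hartL2D h (hartL2Z (-1) h')) => x; by rewrite mulN1r.
Qed.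

Lemma hartL2_nm f g : hartL2 f g -> nm g = Num.sqrt cP * nm f.
Proof.
move=> [Lf Lg [F [LF h1 h2]]].
have c1 := nm_cvg (fun m => (LF m).2) Lf h1.
have c2 := nm_cvg (fun m => (hart_isometry (LF m)).1) Lg h2.
have c3 : nm (hart (F m)) @[m --> \oo] --> Num.sqrt cP * nm f.
  under eq_fun do rewrite (hart_isometry (LF _)).2.
  by apply: cvgM => //; exact: cvg_cst.
by rewrite -(cvg_lim _ c2)// -(cvg_lim _ c3).
Qed.

(** Polarization of [hartL2_nm]. *)
Lemma hartL2_ip f g f' g' : hartL2 f g -> hartL2 f' g' -> ip g g' = cP * ip f f'.
Proof.
move=> h h'; have [Lf Lg _] := h; have [Lf' Lg' _] := h'.
have sq (u v : E -> R) : hartL2 u v -> ip v v = cP * ip u u.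
  by move=> /hartL2_nm e; rewrite -!nm_sq e exprMn sqr_sqrtr// ltW// cP_gt0.
have := sq _ _ (hartL2D h h'); have := sq _ _ h; have := sq _ _ h'.
have pol (u v : E -> R) : L2 u -> L2 v ->
    ip (fun x => u x + v x) (fun x => u x + v x) = ip u u + 2 * ip u v + ip v v.
  move=> Lu Lv; have Luv := L2D Lu Lv.
  by rewrite ipDl// !ipDr// (ipC _ v u); ring.
by rewrite !pol// => e1 e2 e3; lra.
Qed.

Lemma hartL2_inj f f' g : hartL2 f g -> hartL2 f' g -> nm (fun x => f x - f' x) = 0.
Proof.
move=> h h'; have := hartL2_nm (hartL2B h h').
rewrite (nm_ext _ (_ : _ =1 fun=> 0)) ?nm0//; last by move=> x; rewrite subrr.
move/esym/eqP; rewrite mulf_eq0 sqrtr_eq0 leNgt cP_gt0 /= => /eqP //.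
Qed.

Lemma nm_sub0_cvg F g g' : (forall m, L2 (F m)) -> L2 g -> L2 g' ->
  nm (fun x => g x - g' x) = 0 ->
  nm (fun x => F m x - g x) @[m --> \oo] --> 0 ->
  nm (fun x => F m x - g' x) @[m --> \oo] --> 0.
Proof.
move=> LF Lg Lg' e h; apply: (squeeze0 (K := 1)) h => m.
rewrite subr0 !ger0_norm ?nm_ge0// mul1r.
by apply: le_trans (nm_triangle (LF m) Lg' Lg) _; rewrite e addr0.
Qed.

Lemma hartL2_congr f g g' : hartL2 f g -> L2 g' -> nm (fun x => g x - g' x) = 0 ->
  hartL2 f g'.
Proof.
move=> [Lf Lg [F [LF h1 h2]]] Lg' e; split=> //; exists F; split=> //.
by apply: nm_sub0_cvg h2 => // m; exact: (hart_isometry (LF m)).1.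
Qed.

(** The transforms of the truncations of [f] to cubes form a Cauchy sequence, by isometry. *)
Lemma hartL2_total f : L2 f -> exists g, hartL2 f g.
Proof.
move=> Lf; have [Lc cc] := L2_cut Lf.
have [||g Lg hg] := @L2_complete _ _ _ leb (fun m => hart (fun x => f x * \1_(cube m : set E) x)).
- by move=> m; exact: (hart_isometry (Lc m)).1.
- move=> e e0; have c0 : 0 < 2 * Num.sqrt cP by rewrite mulr_gt0// sqrtr_gt0 cP_gt0.
  have [N HN] := (seqP _ _).1 cc _ (divr_gt0 e0 c0); exists N => k l kN lN.
  have := HN k kN; have := HN l lN; rewrite !subr0 !ger0_norm ?nm_ge0// => hl hk.
  have [Ik Lk] := Lc k; have [Il Ll] := Lc l.
  rewrite (nm_ext _ (_ : _ =1 hart (fun x => f x * \1_(cube k : set E) x -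
     f x * \1_(cube l : set E) x))); last by move=> x; rewrite hartB.
  rewrite (hart_isometry (L12B (Lc k) (Lc l))).2.
  have := nm_triangle Lk Ll Lf; rewrite (nm_subC _ f) => h.
  have : Num.sqrt cP * (e / (2 * Num.sqrt cP) + e / (2 * Num.sqrt cP)) = e.
    by field; rewrite gt_eqF// sqrtr_gt0 cP_gt0.
  move=> eE; apply: (@le_trans _ _ (Num.sqrt cP * (e / (2 * Num.sqrt cP) + e / (2 * Num.sqrt cP)))).
    by rewrite ler_wpM2l ?sqrtr_ge0//; exact: le_trans h (lerD hk hl).
  by rewrite eE.
by exists g; split=> //; exists (fun m x => f x * \1_(cube m : set E) x); split.
Qed.

(** The transform squares to [cP]: if g' is a transform of g and u is in [L12], then <g', u> = <g,
    hart u> = cP <f, u>, by symmetry of the kernel and then by isometry. Surjectivity, hence the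
    existence of solutions, comes from here. *)
Lemma hartL2_sym f g : hartL2 f g -> hartL2 g (fun x => cP * f x).
Proof.
move=> h; have [Lf Lg [F [LF h1 h2]]] := h.
have [g' hg'] := hartL2_total Lg; have [_ Lg' [G [LG k1 k2]]] := hg'.
have Lcf := L2Z cP Lf; apply: (hartL2_congr hg') => //.
apply: L12_orth => [|u Lu]; first exact: L2B.
have [Lhu _] := hart_isometry Lu.
have LhG m := (hart_isometry (LG m)).1; have LhF m := (hart_isometry (LF m)).1.
have e1 : ip g' u = ip g (hart u).
  have c1 := ip_cvg LhG Lg' Lu.2 k2.
  have c2 := ip_cvg (fun m => (LG m).2) Lg Lhu k1.
  have c3 : ip (hart (G m)) u @[m --> \oo] --> ip g (hart u).
    apply: cvg_trans c2; apply: near_eq_cvg; apply: nearW => m.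
    exact/esym/(hart_sym (LG m).1 Lu.1).
  by rewrite -(cvg_lim _ c1)// -(cvg_lim _ c3).
have e2 : ip g (hart u) = cP * ip f u by exact: hartL2_ip h (hartL2_L12 Lu).
by rewrite ipBl ?ipZl//; [rewrite e1 e2 subrr|exact: Lu.2|exact: Lu.2].
Qed.

End hartley.

(** * The solution formula in terms of the Hartley transform *)

Section complex_parts.
Context (R : realType).
Implicit Types (z w : R[i]) (c : R).

Lemma ReD z w : complex.Re (z + w) = complex.Re z + complex.Re w.
Proof. by case: z; case: w. Qed.

Lemma ImD z w : complex.Im (z + w) = complex.Im z + complex.Im w.
Proof. by case: z; case: w. Qed.

Lemma ReB z w : complex.Re (z - w) = complex.Re z - complex.Re w.
Proof. by case: z; case: w. Qed.

Lemma ImB z w : complex.Im (z - w) = complex.Im z - complex.Im w.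
Proof. by case: z; case: w. Qed.

Lemma ReZ c z : complex.Re (c%:C%C * z) = c * complex.Re z.
Proof. by case: z => a b /=; rewrite mul0r subr0. Qed.

Lemma ImZ c z : complex.Im (c%:C%C * z) = c * complex.Im z.
Proof. by case: z => a b /=; rewrite mul0r addr0. Qed.

Lemma Re_sum (I : Type) (s : seq I) (F : I -> R[i]) :
  complex.Re (\sum_(i <- s) F i) = \sum_(i <- s) complex.Re (F i).
Proof. by apply: big_morph => [z w|]; first exact: ReD. Qed.

Lemma Im_sum (I : Type) (s : seq I) (F : I -> R[i]) :
  complex.Im (\sum_(i <- s) F i) = \sum_(i <- s) complex.Im (F i).
Proof. by apply: big_morph => [z w|]; first exact: ImD. Qed.

Lemma normc_sq z : Normc.normc z ^+ 2 = complex.Re z ^+ 2 + complex.Im z ^+ 2.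
Proof. by case: z => a b /=; rewrite sqr_sqrtr// addr_ge0 ?sqr_ge0. Qed.

Lemma normc_ge0 z : 0 <= Normc.normc z.
Proof. by case: z => a b /=; exact: sqrtr_ge0. Qed.

Lemma normc_le z : Normc.normc z <= `|complex.Re z| + `|complex.Im z|.
Proof.
rewrite -(@ler_pXn2r _ 2)// ?nnegrE ?addr_ge0 ?normc_ge0// normc_sq sqrrD.
rewrite !real_normK ?num_real//.
by have := mulr_ge0 (normr_ge0 (complex.Re z)) (normr_ge0 (complex.Im z)); rewrite mulr2n; lra.
Qed.

Lemma normc_ge z : `|complex.Re z - complex.Im z| <= 2 * Normc.normc z.
Proof.
rewrite -(@ler_pXn2r _ 2)// ?nnegrE ?mulr_ge0 ?normc_ge0// exprMn normc_sq.
rewrite real_normK ?num_real//.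
have := sqr_ge0 (complex.Re z + complex.Im z).
have := sqr_ge0 (complex.Re z); have := sqr_ge0 (complex.Im z); nra.
Qed.

End complex_parts.

(** * Passage between the Fourier and the Hartley transform *)

Section fourier_hartley.
Context (R : realType) (n : nat).
Local Notation E := (Rn R n).
Local Notation leb := (lebesgue_Rn R n).
Local Notation itg := (itg leb).
Local Notation int := (int leb).
Local Notation L2 := (L2 leb).
Local Notation nm := (nm leb).
Implicit Types (f : E -> R) (xi : E).

Lemma in_L2P f : in_L2 f <-> L2 f. Proof. exact: L2P. Qed.

Lemma in_L12P f : in_L1 f /\ in_L2 f <-> L12 f.
Proof.
by split=> -[h1 h2]; split; [exact/Lfun1_integrable|exact/L2P|exact/Lfun1_integrable|exact/L2P].
Qed.

Lemma L2norm_nm f : L2 f -> L2norm f = (nm f)%:E.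
Proof. exact: Lnorm2_nm. Qed.

Lemma L1norm_int f : itg f -> L1norm f = (int (fun x => `|f x|))%:E.
Proof. by move=> If; rewrite /L1norm Lnorm1 int_EFin//; exact: itg_abs. Qed.

Lemma L2norm_cvg0 (F : nat -> E -> R) : (forall m, L2 (F m)) ->
  L2norm (F m) @[m --> \oo] --> 0%E <-> nm (F m) @[m --> \oo] --> (0 : R).
Proof.
move=> LF; under eq_cvg do rewrite L2norm_nm//.
split=> [h|h]; first exact: (fine_cvg h).
by apply: cvg_EFin => //; exact: nearW.
Qed.

Lemma Re_fourier f xi : complex.Re (fourier f xi) = CT f xi. Proof. by []. Qed.
Lemma Im_fourier f xi : complex.Im (fourier f xi) = - ST f xi. Proof. by []. Qed.

Lemma measurable_evenpart f : L2 f -> L2 (fun xi => 2^-1 * (f xi + f (negx xi))) /\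
  L2 (fun xi => 2^-1 * (f xi - f (negx xi))).
Proof.
by move=> Lf; have Lf' := L2_negx Lf; split; apply: L2Z; [exact: L2D Lf Lf'|exact: L2B Lf Lf'].
Qed.

Lemma L2_CST f : L12 f -> L2 (CT f) /\ L2 (ST f).
Proof.
move=> Lf; have [Lh _] := hart_isometry Lf; have [h1 h2] := measurable_evenpart Lh.
split; [apply: L2_ext h1|apply: L2_ext h2] => xi; rewrite !hartE ?CTN ?STN; try exact: Lf.1;
  by field.
Qed.

Lemma L2_normc (g : E -> R[i]) : L2 (fun xi => complex.Re (g xi)) ->
  L2 (fun xi => complex.Im (g xi)) -> L2 (fun xi => Normc.normc (g xi)).
Proof.
move=> [m1 i1] [m2 i2]; split; last first.
  by apply: itg_ext (itgD i1 i2) => xi; rewrite normc_sq.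
rewrite (_ : (fun xi => _) = fun xi => Num.sqrt (complex.Re (g xi) ^+ 2 + complex.Im (g xi) ^+ 2)).
  apply: (measurableT_comp (f := @Num.sqrt R)).
    by apply: continuous_measurable_fun; exact: sqrt_continuous.
  by apply: measurable_funD; exact: measurable_funX.
by apply/funext => xi; case: (g xi).
Qed.

Lemma fourier_L2_hartL2 f (g : E -> R[i]) : fourier_L2 f g ->
  hartL2 f (fun xi => complex.Re (g xi) - complex.Im (g xi)).
Proof.
move=> [/in_L2P Lf [/in_L2P Lr /in_L2P Li] [F [LF h1 h2]]].
have LF12 m : L12 (F m) by apply/in_L12P.
split=> //; first exact: L2B; exists F; split=> //.
  by move/L2norm_cvg0 : h1; apply => m; exact: L2B (LF12 m).2 Lf.
have LD m : L2 (fun xi => Normc.normc (fourier (F m) xi - g xi)).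
  have [L1 L2'] := L2_CST (LF12 m).
  apply: L2_normc.
    by apply: L2_ext (L2B L1 Lr) => xi; rewrite ReB.
  by apply: L2_ext (L2B (L2N L2') Li) => xi; rewrite ImB.
move/(L2norm_cvg0 LD) : h2; apply: (squeeze0 (K := 2)) => m.
rewrite subr0 !ger0_norm ?nm_ge0// -[2]ger0_norm// -nmZ//.
apply: nm_le.
- by apply: L2B; [exact: (hart_isometry (LF12 m)).1|exact: L2B].
- exact: L2Z.
- move=> xi; rewrite [leRHS]ger0_norm ?mulr_ge0 ?normc_ge0//.
  apply: le_trans (normc_ge _); rewrite ReB ImB Re_fourier Im_fourier hartE; last exact: (LF12 m).1.
  by rewrite (_ : _ - _ - _ = CT (F m) xi + ST (F m) xi - (complex.Re (g xi) - complex.Im (g xi)))//; ring.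
Qed.

(** The two symmetries of [g], those of the transform of a real function, make its real part the
    even part of the Hartley side and its imaginary part minus the odd part. This is what allows Re
    and Im to be separated again. *)
Lemma hartL2_fourier_L2 f (g : E -> R[i]) :
  (forall xi, complex.Re (g (negx xi)) = complex.Re (g xi)) ->
  (forall xi, complex.Im (g (negx xi)) = - complex.Im (g xi)) ->
  hartL2 f (fun xi => complex.Re (g xi) - complex.Im (g xi)) -> fourier_L2 f g.
Proof.
move=> ge go [Lf Lh [F [LF h1 h2]]].
have [Lr Li] := measurable_evenpart Lh.
have Lr' : L2 (fun xi => complex.Re (g xi)).
  by apply: L2_ext Lr => xi; rewrite ge go; field.
have Li' : L2 (fun xi => complex.Im (g xi)).
  by apply: L2_ext (L2N Li) => xi; rewrite ge go; field.
split; [exact/in_L2P|split; exact/in_L2P|exists F; split].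
- by move=> m; apply/in_L12P.
- by apply/L2norm_cvg0 => // m; exact: L2B (LF m).2 Lf.
have LD m : L2 (fun xi => Normc.normc (fourier (F m) xi - g xi)).
  have [L1 L2'] := L2_CST (LF m).
  apply: L2_normc.
    by apply: L2_ext (L2B L1 Lr') => xi; rewrite ReB.
  by apply: L2_ext (L2B (L2N L2') Li') => xi; rewrite ImB.
apply/(L2norm_cvg0 LD); apply: (squeeze0 (K := 2)) h2 => m.
pose D xi := hart (F m) xi - (complex.Re (g xi) - complex.Im (g xi)).
have LDm : L2 D by exact: L2B (hart_isometry (LF m)).1 Lh.
rewrite subr0 !ger0_norm ?nm_ge0//.
have LDa := L2_abs LDm; have LDn := L2_negx LDa.
apply: (@le_trans _ _ (nm (fun xi => `|D xi| + `|D (negx xi)|))).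
  apply: nm_le => //; first exact: L2D LDa LDn.
  move=> xi; rewrite ger0_norm ?normc_ge0// ger0_norm ?addr_ge0//.
  apply: le_trans (normc_le _) _; rewrite ReB ImB Re_fourier Im_fourier.
  have -> : CT (F m) xi - complex.Re (g xi) = 2^-1 * (D xi + D (negx xi)).
    by rewrite /D !hartE ?CTN ?STN ?ge ?go; try exact: (LF m).1; field.
  have -> : - ST (F m) xi - complex.Im (g xi) = 2^-1 * (D (negx xi) - D xi).
    by rewrite /D !hartE ?CTN ?STN ?ge ?go; try exact: (LF m).1; field.
  rewrite !normrM ger0_norm//; have := ler_normD (D xi) (D (negx xi)).
  have := ler_normB (D (negx xi)) (D xi); lra.
apply: le_trans (nmD LDa LDn) _.
rewrite (nm_negx (f := fun xi => `|D xi|)) ?LDa.1//; last exact: LDa.1.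
rewrite mulr_natl mulr2n; have -> : nm (fun xi => `|D xi|) = nm D.
  by rewrite /nm /ip; congr Num.sqrt; apply: int_ext => x; rewrite -normrM -expr2
    ger0_norm ?sqr_ge0// expr2.
exact: lexx.
Qed.

End fourier_hartley.

(** * Matrix-valued Fourier multipliers *)

Section multipliers.
Context (R : realType) (n : nat).
Local Notation E := (Rn R n).
Local Notation leb := (lebesgue_Rn R n).
Local Notation L2 := (L2 leb).
Local Notation nm := (nm leb).
Implicit Types (f : E -> R) (xi : E) (phi psi : R -> R) (h : 'I_n -> E -> R).

Lemma enorm_ge0 xi : 0 <= enorm xi. Proof. exact: sqrtr_ge0. Qed.

Lemma enorm_sq xi : enorm xi ^+ 2 = \sum_i tnth xi i ^+ 2.
Proof.
rewrite sqr_sqrtr /dot; first by apply: eq_bigr => i _; rewrite expr2.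
by apply: sumr_ge0 => i _; rewrite -expr2 sqr_ge0.
Qed.

Lemma coord_enorm xi i : `|tnth xi i| <= enorm xi.
Proof.
rewrite -(@ler_pXn2r _ 2)// ?nnegrE ?enorm_ge0// enorm_sq real_normK ?num_real//.
by rewrite (bigD1 i)//= lerDl sumr_ge0// => j _; exact: sqr_ge0.
Qed.

Lemma enorm_negx xi : enorm (negx xi) = enorm xi.
Proof.
congr Num.sqrt; apply: eq_bigr => i _; by rewrite tnth_negx mulrNN.
Qed.

Lemma measurable_tnthR i : measurable_fun setT (fun xi : E => tnth xi i : R).
Proof. exact: measurable_tnth. Qed.

Lemma measurable_enorm : measurable_fun setT (@enorm R n).
Proof.
apply: (measurableT_comp (f := @Num.sqrt R)).
  by apply: continuous_measurable_fun; exact: sqrt_continuous.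
by apply: measurable_sum => i; apply: measurable_funM; exact: measurable_tnthR.
Qed.

Definition Pr xi (k l : 'I_n) : R := tnth xi k / enorm xi * (tnth xi l / enorm xi).

Lemma Pr_bound xi k l : `|Pr xi k l| <= 1.
Proof.
have H i : `|tnth xi i / enorm xi| <= 1.
  have [->|r0] := eqVneq (enorm xi) 0; first by rewrite invr0 mulr0 normr0.
  rewrite normrM normfV (ger0_norm (enorm_ge0 xi)) ler_pdivrMr ?mul1r ?coord_enorm//.
  by rewrite lt_def r0 enorm_ge0.
by rewrite /Pr normrM mulr_ile1.
Qed.

Lemma Pr_negx xi k l : Pr (negx xi) k l = Pr xi k l.
Proof. by rewrite /Pr enorm_negx !tnth_negx; ring. Qed.

Lemma measurable_Pr k l : measurable_fun setT (fun xi => Pr xi k l).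
Proof.
have mi : measurable_fun setT (fun xi : E => (enorm xi)^-1).
  by apply: (measurableT_comp (@measurable_invR R)); exact: measurable_enorm.
by apply: measurable_funM; apply: measurable_funM => //; exact: measurable_tnthR.
Qed.

(* [phi1 (|xi|) P + phi2 (|xi|) (I - P)] *)
Definition mult phi1 phi2 xi (k l : 'I_n) : R :=
  phi1 (enorm xi) * Pr xi k l + phi2 (enorm xi) * ((k == l)%:R - Pr xi k l).

Definition MA phi1 phi2 h (k : 'I_n) xi : R := \sum_l mult phi1 phi2 xi k l * h l xi.

Lemma measurable_mult phi1 phi2 k l : measurable_fun setT phi1 -> measurable_fun setT phi2 ->
  measurable_fun setT (fun xi => mult phi1 phi2 xi k l).
Proof.
move=> m1 m2; have mP := measurable_Pr k l.
apply: measurable_funD; apply: measurable_funM => //.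
- exact: (measurableT_comp m1 measurable_enorm).
- exact: (measurableT_comp m2 measurable_enorm).
- exact: measurable_funB.
Qed.

Lemma MA_negx phi1 phi2 h k xi : MA phi1 phi2 h k (negx xi) =
  MA phi1 phi2 (fun l xi => h l (negx xi)) k xi.
Proof. by apply: eq_bigr => l _; rewrite /mult enorm_negx Pr_negx. Qed.

Lemma MA_lin (c1 c2 : R) phi1 phi2 psi1 psi2 h k xi :
  c1 * MA phi1 phi2 h k xi + c2 * MA psi1 psi2 h k xi =
  MA (fun r => c1 * phi1 r + c2 * psi1 r) (fun r => c1 * phi2 r + c2 * psi2 r) h k xi.
Proof.
rewrite /MA !mulr_sumr -big_split; apply: eq_bigr => l _.
by rewrite /mult /=; ring.
Qed.

Lemma MA_ext phi1 phi2 psi1 psi2 h h' k xi : phi1 (enorm xi) = psi1 (enorm xi) ->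
  phi2 (enorm xi) = psi2 (enorm xi) -> (forall l, h l xi = h' l xi) ->
  MA phi1 phi2 h k xi = MA psi1 psi2 h' k xi.
Proof. by move=> e1 e2 e3; apply: eq_bigr => l _; rewrite /mult e1 e2 e3. Qed.

End multipliers.

Section uhat_hartley.
Context (R : realType) (n : nat) (lam mu : R).
Local Notation E := (Rn R n).
Local Notation leb := (lebesgue_Rn R n).
Implicit Types (f : 'I_n -> E -> R) (xi : E) (t : R).

Local Notation a1 := (Num.sqrt (lam + 2 * mu)).
Local Notation a2 := (Num.sqrt mu).

Definition cosr (a t r : R) : R := cos (t * a * r).
Definition sinr (a t r : R) : R := sin (t * a * r) / (a * r).

Definition HU f0 f1 t (k : 'I_n) xi : R :=
  MA (cosr a1 t) (cosr a2 t) (fun l => hart (f0 l)) k xi +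
  MA (sinr a1 t) (sinr a2 t) (fun l => hart (f1 l)) k xi.

Local Open Scope complex_scope.

Lemma uhatE f0 f1 t xi k : uhat lam mu f0 f1 t xi k 0 =
  \sum_l (mult (cosr a1 t) (cosr a2 t) xi k l)%:C * fourier (f0 l) xi +
  \sum_l (mult (sinr a1 t) (sinr a2 t) xi k l)%:C * fourier (f1 l) xi.
Proof.
rewrite /uhat; set M0 := fourier_col f0 xi; set M1 := fourier_col f1 xi.
set P := xi_proj xi.
have E1 (c : R) (M : 'cV[R[i]]_n) : (c%:C *: (P *m M)) k 0 =
    \sum_l (c * Pr xi k l)%:C * M l 0.
  rewrite !mxE mulr_sumr; apply: eq_bigr => l _.
  by rewrite /P mxE mulrA -rmorphM.
have E2 (c : R) (M : 'cV[R[i]]_n) : (c%:C *: ((1%:M - P) *m M)) k 0 =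
    \sum_l (c * ((k == l)%:R - Pr xi k l))%:C * M l 0.
  rewrite !mxE mulr_sumr; apply: eq_bigr => l _.
  have -> : (1%:M - P) k l = ((k == l)%:R - Pr xi k l)%:C.
    apply/eqP; rewrite !mxE eq_complex ReB ImB /=.
    by case: (k == l) => /=; rewrite subr0 !eqxx.
  by rewrite mulrA -rmorphM.
have -> : forall A B C D : 'cV[R[i]]_n, (A + B + C + D) k 0 = (A k 0 + C k 0) + (B k 0 + D k 0).
  by move=> A B C D; rewrite !mxE; ring.
congr (_ + _); rewrite E1 E2 -big_split /=; apply: eq_bigr => l _;
  by rewrite mxE -mulrDl -rmorphD.
Qed.

Lemma Re_uhat f0 f1 t xi k : complex.Re (uhat lam mu f0 f1 t xi k 0) =
  MA (cosr a1 t) (cosr a2 t) (fun l => CT (f0 l)) k xi +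
  MA (sinr a1 t) (sinr a2 t) (fun l => CT (f1 l)) k xi.
Proof.
by rewrite uhatE ReD !Re_sum; congr (_ + _); apply: eq_bigr => l _; rewrite ReZ.
Qed.

Lemma Im_uhat f0 f1 t xi k : complex.Im (uhat lam mu f0 f1 t xi k 0) =
  MA (cosr a1 t) (cosr a2 t) (fun l xi => - ST (f0 l) xi) k xi +
  MA (sinr a1 t) (sinr a2 t) (fun l xi => - ST (f1 l) xi) k xi.
Proof.
by rewrite uhatE ImD !Im_sum; congr (_ + _); apply: eq_bigr => l _; rewrite ImZ.
Qed.

(** Real multipliers commute with taking the real part minus the imaginary part. For the converse
    they are also even in xi, so [uhat] has the symmetry that [hartL2_fourier_L2] asks for. *)
Lemma fourier_solution_hart f0 f1 u : (forall k, itg leb (f0 k)) -> (forall k, itg leb (f1 k)) ->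
  fourier_solution lam mu f0 f1 u <->
  forall t, 0 <= t -> forall k, hartL2 (u t k) (HU f0 f1 t k).
Proof.
move=> I0 I1.
have E t k xi : complex.Re (uhat lam mu f0 f1 t xi k 0) -
    complex.Im (uhat lam mu f0 f1 t xi k 0) = HU f0 f1 t k xi.
  rewrite Re_uhat Im_uhat /HU /MA opprD addrACA -!sumrB.
  congr (_ + _); apply: eq_bigr => l _; (rewrite hartE; last by []);
    by rewrite -mulrBr opprK.
split=> H t t0 k.
  apply: hartL2_ext (fourier_L2_hartL2 (H t t0 k)) => [x|xi]; first by [].
  exact: E.
apply: hartL2_fourier_L2.
- move=> xi; apply: (eq_trans (Re_uhat _ _ _ _ _)); apply: (eq_trans _ (esym (Re_uhat _ _ _ _ _))).
  congr (_ + _).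
    rewrite (MA_negx _ _ _ k xi).
    by apply: eq_bigr => l _; congr (_ * _); exact: CTN.
  rewrite (MA_negx _ _ _ k xi).
  by apply: eq_bigr => l _; congr (_ * _); exact: CTN.
- move=> xi; apply: (eq_trans (Im_uhat _ _ _ _ _)).
  apply: (eq_trans _ (congr1 -%R (esym (Im_uhat _ _ _ _ _)))); rewrite opprD; congr (_ + _); rewrite (MA_negx _ _ _ k xi) /MA -sumrN;
    apply: eq_bigr => l _; (rewrite STN; last by []); by rewrite mulrN.
- by apply: hartL2_ext (H t t0 k) => [x|xi]; [|rewrite E].
Qed.

End uhat_hartley.

(** * Test functions *)

Section smooth1.
Context (R : realType).
Implicit Types (f g : R -> R).

Fixpoint smooth1 (k : nat) (g : R -> R) : Prop :=
  if k is k'.+1 then exists2 g' : R -> R, (forall x, der g x (g' x)) & smooth1 k' g'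
  else True.

Lemma smooth1_ext k f g : f =1 g -> smooth1 k f -> smooth1 k g.
Proof. by move=> /funext ->. Qed.

Lemma smooth1W k f : smooth1 k.+1 f -> smooth1 k f.
Proof. by elim: k f => [//|k IH] f [f' df /IH sf']; exists f'. Qed.

Lemma smooth1_cst k c : smooth1 k (fun=> c).
Proof.
elim: k c => [//|k IH] c; exists (fun=> 0) => // x; exact: der_cst.
Qed.

Lemma smooth1D k f g : smooth1 k f -> smooth1 k g -> smooth1 k (fun x => f x + g x).
Proof.
elim: k f g => [//|k IH] f g [f' df sf] [g' dg sg].
exists (fun x => f' x + g' x); last exact: IH.
by move=> x; exact: derD.
Qed.

Lemma smooth1M k f g : smooth1 k f -> smooth1 k g -> smooth1 k (fun x => f x * g x).
Proof.
elim: k f g => [//|k IH] f g sf sg.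
have sf0 := smooth1W sf; have sg0 := smooth1W sg.
case: sf => f' df sf; case: sg => g' dg sg.
exists (fun x => f x * g' x + g x * f' x); first by move=> x; exact: derM.
by apply: smooth1D; exact: IH.
Qed.

Lemma smooth1_affine k f c d : smooth1 k f -> smooth1 k (fun x => f (c * x + d)).
Proof.
elim: k f => [//|k IH] f [f' df sf].
exists (fun x => c * f' (c * x + d)).
  move=> x; apply: der_eq; first by apply: der_comp (df _) _; derive.
  by rewrite /=; ring.
by apply: smooth1M; [exact: smooth1_cst|exact: IH].
Qed.

(* [x^-i exp(- 1/x)] for [x > 0] and [0] elsewhere *)
Definition flat (i : nat) (x : R) : R := if 0 < x then x ^- i * expR (- x^-1) else 0.

Lemma expR_fact_ge (i : nat) (y : R) : 0 <= y -> y ^+ i / i`!%:R <= expR y.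
Proof.
move=> y0; case: i => [|i].
  rewrite expr0 fact0 divr1; apply: le_trans (expR_ge1Dx y); by rewrite lerDl.
by apply: le_trans (expR_ge1Dxn i y0); rewrite lerDr.
Qed.

(** exp(y) >= y^(i+2) / (i+2)! at y = 1/x. The two spare powers make every [flat i] vanish to second
    order at 0, as [der_quad] needs there. *)
Lemma flat_le (i : nat) (x : R) : `|flat i x| <= i.+2`!%:R * x ^+ 2.
Proof.
rewrite /flat; case: ifPn => x0; last by rewrite normr0 mulr_ge0// sqr_ge0.
rewrite ger0_norm; last by rewrite mulr_ge0 ?expR_ge0// invr_ge0 exprn_ge0// ltW.
have y0 : 0 < x^-1 by rewrite invr_gt0.
have := expR_fact_ge i.+2 (ltW y0) => h.
have f0 : 0 < i.+2`!%:R :> R by rewrite ltr0n fact_gt0.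
rewrite expRN ler_pdivrMr ?expR_gt0//.
rewrite -exprVn; apply: (@le_trans _ _ (i.+2`!%:R * x ^+ 2 * (x^-1 ^+ i.+2 / i.+2`!%:R))).
  rewrite le_eqVlt; apply/orP; left; apply/eqP.
  rewrite -addn2 exprD !exprVn; field.
  by rewrite expf_neq0 ?gt_eqF.
by rewrite ler_wpM2l// mulr_ge0// sqr_ge0.
Qed.

(** A quadratic remainder is how derivatives are obtained both at 0 for [flat] and under integral
    signs, where a pointwise remainder with integrable majorant can simply be integrated. *)
Lemma der_quad f x d C : (forall s : R, `|s| <= 1 -> `|f (x + s) - f x - s * d| <= C * s ^+ 2) ->
  der f x d.
Proof.
move=> H; apply/is_derive1_caratheodory.
exists (fun z => if z == x then d else (f z - f x) / (z - x)); split.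
- move=> z; case: eqP => [->|/eqP zx]; first by rewrite !subrr mulr0.
  by rewrite divfK// subr_eq0.
- apply/cvgrPdist_le => e e0; rewrite eqxx.
  have C1 : 0 < `|C| + 1 by rewrite ltr_wpDl.
  near=> z; case: eqP => [_|/eqP zx]; first by rewrite subrr normr0 ltW.
  have zx0 : z - x != 0 by rewrite subr_eq0.
  have z1 : `|z - x| <= 1 by near: z; under eq_near do rewrite distrC; apply/nbhs_ballP;
    by exists 1 => //= y; rewrite /ball /= => /ltW.
  have z2 : `|z - x| * (`|C| + 1) <= e.
    rewrite -ler_pdivlMr//; near: z; under eq_near do rewrite distrC; apply/nbhs_ballP.
    by exists (e / (`|C| + 1)); [exact: divr_gt0|move=> y; rewrite /ball /= => /ltW].
  have := H (z - x) z1; rewrite [x + _]addrC subrK => h.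
  rewrite distrC (_ : (f z - f x) / (z - x) - d = (f z - f x - (z - x) * d) / (z - x)); last by field.
  rewrite normrM normfV ler_pdivrMr ?normr_gt0//; apply: le_trans h _.
  rewrite -(real_normK (num_real (z - x))) expr2 mulrA ler_wpM2r//.
  apply: le_trans z2; rewrite mulrC ler_wpM2l// (le_trans (ler_norm C))// lerDl//.
- by rewrite eqxx.
Unshelve. all: by end_near. Qed.

Lemma der_inv (x : R) : x != 0 -> der (fun y => y^-1) x (- x ^- 2).
Proof.
move=> x0; rewrite /der; apply: is_derive_eq; first exact: is_deriveV.
by rewrite /GRing.scale /=; ring.
Qed.

(** The exponent [i] is there to make the family closed under differentiation up to linear
    combinations, so that smoothness of every order is an induction. *)
Lemma der_flat i x : der (flat i) x (flat i.+2 x - i%:R * flat i.+1 x).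
Proof.
case: (ltgtP x 0) => x0.
- have -> : flat i.+2 x - i%:R * flat i.+1 x = 0.
    by rewrite /flat ltNge (ltW x0) mulr0 subrr.
  apply: (near_eq_is_derive _ (der_cst 0 x)).
  near=> y; rewrite /flat ltNge (_ : y <= 0)//; near: y.
  by apply: filterS (lt_nbhsl x0) => y /ltW.
- have xn0 : x != 0 by rewrite gt_eqF.
  have dX k : der (fun y => (y^-1) ^+ k) x (- k%:R * x^-1 ^+ k.+1).
    elim: k => [|k IH].
      apply: der_eq; first exact: (der_cst 1 x).
      by rewrite oppr0 mul0r.
    apply: der_eq.
      under eq_fun do rewrite exprS.
      exact: derM (der_inv xn0) IH.
    by rewrite -exprVn !exprS -natr1; ring.
  have dE := derM (dX i) (der_exp (derN (der_inv xn0))).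
  apply: der_eq; first apply: (near_eq_is_derive _ dE).
    near=> y; rewrite /flat (_ : 0 < y) ?exprVn//; near: y; exact: lt_nbhsr.
  by rewrite /flat x0 -!exprVn !exprS /=; ring.
- rewrite x0; have z k : flat k 0 = 0 by rewrite /flat ltxx.
  rewrite !z mulr0 subrr; apply: (@der_quad _ _ _ i.+2`!%:R) => s _.
  by rewrite add0r z !subr0 mulr0 subr0; exact: flat_le.
Unshelve. all: by end_near. Qed.

Lemma smooth1_flat k i : smooth1 k (flat i).
Proof.
elim: k i => [//|k IH] i.
exists (fun x => flat i.+2 x - i%:R * flat i.+1 x); first exact: der_flat.
apply: (@smooth1_ext _ (fun x => flat i.+2 x + - i%:R * flat i.+1 x)).
  by move=> x; rewrite mulNr.
by apply: smooth1D => //; apply: smooth1M => //; exact: smooth1_cst.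
Qed.

Lemma flat0_itv x : 0 <= flat 0 x <= 1.
Proof.
rewrite /flat; case: ifPn => x0; last by rewrite lexx ler01.
rewrite expr0 invr1 mul1r expR_ge0 /= -[leRHS](@expR0 R) ler_expR oppr_le0 invr_ge0 ltW//.
Qed.

Lemma flat0_ge x : 0 < x -> 1 - x^-1 <= flat 0 x.
Proof.
by move=> x0; rewrite /flat x0 expr0 invr1 mul1r; exact: expR_ge1Dx.
Qed.

End smooth1.

Section multivariate_smoothness.
Context (R : realType) (n : nat).
Local Notation E := (Rn R n).
Local Notation leb := (lebesgue_Rn R n).
Implicit Types (phi psi : 'rV[R]_n -> R) (j : 'I_n).

Lemma partialE j phi x : differentiable phi x -> partial j phi x = 'd phi x (delta_mx 0 j).
Proof. by move=> d; rewrite /partial deriveE. Qed.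

(** Smoothness of finite order by recursion, so that stability under products, shifts and
    composition with coordinates is an induction on the order. *)
Fixpoint smooth (k : nat) phi : Prop :=
  if k is k'.+1 then (forall x, differentiable phi x) /\ forall j, smooth k' (partial j phi)
  else True.

Lemma smoothP phi :
  (forall (s : seq 'I_n) x, differentiable (foldr (@partial R n) phi s) x) <->
  forall k, smooth k phi.
Proof.
split.
  move=> H k; elim: k phi H => [//|k IH] phi H; split; first exact: (H [::]).
  by move=> j; apply: IH => s; rewrite -foldr_rcons.
move=> H s; elim/last_ind: s phi H => [|s j IH] phi H x.
  exact: (H 1%N).1.
by rewrite foldr_rcons; apply: IH => k; apply: (H k.+1).2.
Qed.

Lemma smoothW k phi : smooth k.+1 phi -> smooth k phi.
Proof.
by elim: k phi => [//|k IH] phi [d H]; split => // j; exact: IH.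
Qed.

Lemma smooth_cst k (c : R) : smooth k (fun=> c).
Proof.
elim: k c => [//|k IH] c; split; first by move=> x; exact: differentiable_cst.
move=> j; rewrite (_ : partial j _ = fun=> 0)//.
by apply/funext => x; rewrite /partial derive_cst.
Qed.

Lemma smoothD k phi psi : smooth k phi -> smooth k psi ->
  smooth k (fun x => phi x + psi x).
Proof.
elim: k phi psi => [//|k IH] phi psi [dp sp] [dq sq]; split.
  by move=> x; exact: differentiableD.
move=> j; rewrite (_ : partial j _ = fun x => partial j phi x + partial j psi x).
  by apply: IH; [exact: sp|exact: sq].
by apply/funext => x; rewrite /partial -deriveD//; exact: diff_derivable.
Qed.

Lemma smoothM k phi psi : smooth k phi -> smooth k psi ->
  smooth k (fun x => phi x * psi x).
Proof.
elim: k phi psi => [//|k IH] phi psi sP sQ.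
have sP' := smoothW sP; have sQ' := smoothW sQ.
case: sP => dp sp; case: sQ => dq sq; split.
  by move=> x; exact: differentiableM.
move=> j; rewrite (_ : partial j _ =
  fun x => phi x * partial j psi x + psi x * partial j phi x).
  by apply: smoothD; apply: IH => //; [exact: sq|exact: sp].
apply/funext => x; rewrite /partial.
by apply: (@deriveM _ _ phi psi); exact: diff_derivable.
Qed.

Lemma derive_coord (x v : 'rV[R]_n) i : 'D_v (fun y : 'rV[R]_n => y 0 i) x = v 0 i.
Proof.
apply: cvg_lim => //.
apply: cvg_near_cst; rewrite /=; near=> h.
rewrite !mxE addrK /GRing.scale /= mulrA mulVf ?mul1r//; near: h.
exact: nbhs_dnbhs_neq.
Unshelve. all: by end_near. Qed.

Lemma smooth_coord k (g : R -> R) i : smooth1 k g -> smooth k (fun x : 'rV[R]_n => g (x 0 i)).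
Proof.
elim: k g => [//|k IH] g [g' dg sg].
have dc x : differentiable (fun y : 'rV[R]_n => y 0 i) x by exact: differentiable_coord.
have dgx (y : R) : differentiable g y by apply/derivable1_diffP; exact: der_derivable (dg y).
split.
  by move=> x; apply: (differentiable_comp (dc x) (dgx _)).
move=> j; rewrite (_ : partial j _ = fun x => (i == j)%:R * g' (x 0 i)).
  by apply: smoothM; [exact: smooth_cst|exact: IH].
apply/funext => x; rewrite partialE; last exact: (differentiable_comp (dc x) (dgx _)).
rewrite (diff_comp (dc x) (dgx _)) /= diff1E// -(deriveE _ (dc x)) derive_coord mxE eqxx /=.
by rewrite (der_val (dg _)).
Qed.

Lemma smooth_prod k (g : 'I_n -> R -> R) : (forall i, smooth1 k (g i)) ->
  smooth k (fun x : 'rV[R]_n => \prod_i g i (x 0 i)).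
Proof.
move=> sg; elim: (index_enum _) => [|i s IH].
  by under eq_fun do rewrite big_nil; exact: smooth_cst.
under eq_fun do rewrite big_cons; apply: smoothM => //; exact: smooth_coord.
Qed.

Lemma derive_shift (v b x : 'rV[R]_n) phi :
  'D_v (fun y => phi (y + b)) x = 'D_v phi (x + b).
Proof.
rewrite /derive; set F1 := fun h => _; set F2 := fun h => _.
suff -> : F1 = F2 by [].
by apply/funext => h; rewrite /F1 /F2 /= addrA.
Qed.

Lemma smooth_shift k b phi : smooth k phi -> smooth k (fun y => phi (y + b)).
Proof.
elim: k phi => [//|k IH] phi [dp sp]; split.
  move=> x; apply: (@differentiable_comp _ _ _ _ (fun y => y + b) phi) => //.
move=> j; rewrite (_ : partial j _ = fun y => partial j phi (y + b)).
  by apply: IH; exact: sp.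
by apply/funext => x; rewrite /partial derive_shift.
Qed.

Lemma der_line phi (x v : 'rV[R]_n) (t : R) : differentiable phi (x + t *: v) ->
  der (fun s => phi (x + s *: v)) t ('D_v phi (x + t *: v)).
Proof.
move=> dp.
have dl : is_diff t (fun s : R => x + s *: v) (0 + ( *:%R ^~ v)).
  exact: is_diffD.
have dl' : differentiable (fun s : R => x + s *: v) t by case: dl.
have d := differentiable_comp dl' dp.
apply: DeriveDef; first exact/derivable1_diffP.
rewrite -derive1E derive1E'// deriveE// (diff_comp dl' dp) /=.
by rewrite (diff_val (is_diff_def := dl)) /= add0r scale1r.
Qed.

Definition tsupp phi : Prop := exists K : nat, forall x, phi x != 0 -> forall i, `|x 0 i| <= K%:R.

Lemma coord_le_norm (x : 'rV[R]_n) i : `|x 0 i| <= `|x|.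
Proof.
have /mapP[j Hj ->] : `|x ord0 i| \in [seq `|x y.1 y.2| | y : 'I_1 * 'I_n].
  by apply/mapP; exists (ord0, i) => //=; rewrite mem_enum.
by rewrite [leRHS]/Num.norm /= mx_normrE; apply/bigmax_geP; right => /=; exists j.
Qed.

Lemma norm_le_coord (x : 'rV[R]_n) (K : R) : 0 <= K -> (forall i, `|x 0 i| <= K) -> `|x| <= K.
Proof.
move=> K0 H; rewrite [leLHS]/Num.norm /= mx_normrE; apply: bigmax_le => // -[a b] _ /=.
by rewrite (ord1 a).
Qed.

Lemma tsuppP phi : compact (closure [set x | phi x != 0]) <-> tsupp phi.
Proof.
split.
  move=> /compact_bounded[M [_ HM]].
  exists (Num.truncn `|M|).+1.+1 => x px i; apply: le_trans (coord_le_norm x i) _.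
  apply: HM; last exact: subset_closure.
  apply: le_lt_trans (ler_norm M) _; apply: lt_trans (truncnS_gt _) _.
  by rewrite ltr_nat.
move=> [K HK]; apply: bounded_closed_compact; last exact: closed_closure.
exists K%:R; split; first exact: num_real.
move=> M KM x; rewrite /= => cx.
have cl : closed [set y : 'rV[R]_n | `|y| <= M].
  apply: (@closed_comp _ _ (fun y : 'rV[R]_n => `|y|) [set r : R | r <= M]); last exact: closed_le.
  by move=> y _; exact: norm_continuous.
have sub : [set x | phi x != 0] `<=` [set y : 'rV[R]_n | `|y| <= M].
  move=> y py /=; apply: norm_le_coord; first by rewrite (le_trans _ (ltW KM)).
  by move=> i; apply: le_trans (HK _ py i) (ltW KM).
by have := closure_subset sub; move/closure_id: cl => <-; apply.
Qed.

Lemma test_functionP phi : test_function phi <-> (forall k, smooth k phi) /\ tsupp phi.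
Proof.
by split => -[/smoothP h /tsuppP s].
Qed.

(** A coordinate exceeding [K] in modulus still does so nearby, so [phi] is locally 0 there. *)
Lemma tsupp_partial j phi : tsupp phi -> tsupp (partial j phi).
Proof.
move=> [K HK]; exists K => x; apply: contra_neqP => /existsNP[i /negP]; rewrite -ltNge => xi.
rewrite /partial (@near_eq_derive _ _ _ phi (cst 0)) ?derive_cst//.
have c : (fun M : 'rV[R]_n => M 0 i) @ x --> x 0 i by exact: coord_continuous.
have : \forall y \near x, K%:R < `|(y : 'rV[R]_n) 0 i|.
  exact: cvgr_norm_gt c _ xi.
apply: filterS => y yi; apply/eqP; apply: contraTT yi => /(HK _)/(_ i).
by rewrite -leNgt.
Qed.

Lemma test_partial j phi : test_function phi -> test_function (partial j phi).
Proof.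
move=> /test_functionP[s t]; apply/test_functionP; split; last exact: tsupp_partial.
by move=> k; apply: (s k.+1).2.
Qed.

Lemma test_shift b phi : test_function phi -> test_function (fun y => phi (y + b)).
Proof.
move=> /test_functionP[s [K HK]]; apply/test_functionP; split.
  by move=> k; exact: smooth_shift.
exists (K + (Num.truncn `|b|).+1)%N => x /HK h i.
have -> : x 0 i = (x + b) 0 i - b 0 i by rewrite mxE addrK.
apply: le_trans (ler_normB _ _) _; rewrite natrD lerD//.
by apply: le_trans (coord_le_norm _ _) _; apply: ltW; exact: truncnS_gt.
Qed.

Lemma testD phi psi : test_function phi -> test_function psi ->
  test_function (fun x => phi x + psi x).
Proof.
move=> /test_functionP[s [K HK]] /test_functionP[s' [K' HK']].
apply/test_functionP; split; first by move=> k; exact: smoothD.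
exists (K + K')%N => x h i.
have [z|/HK/(_ i)h2] := eqVneq (phi x) 0.
  move: h; rewrite z add0r => /HK'/(_ i) h2; apply: le_trans h2 _.
  by rewrite ler_nat leq_addl.
by apply: le_trans h2 _; rewrite ler_nat leq_addr.
Qed.

Lemma testZ c phi : test_function phi -> test_function (fun x => c * phi x).
Proof.
move=> /test_functionP[s [K HK]]; apply/test_functionP; split.
  by move=> k; apply: smoothM => //; exact: smooth_cst.
by exists K => x h; apply: HK; apply: contraNneq h => ->; rewrite mulr0.
Qed.

Lemma test_differentiable phi x : test_function phi -> differentiable phi x.
Proof. by move=> [/(_ [::])]. Qed.

Lemma test_continuous phi : test_function phi -> continuous phi.
Proof. by move=> h x; apply: differentiable_continuous; exact: test_differentiable. Qed.

Lemma test_bounded phi : test_function phi -> exists2 M, 0 <= M & forall x, `|phi x| <= M.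
Proof.
move=> h; have cp := test_continuous h; case: h => _ cs.
have := continuous_compact (continuous_subspaceT cp) cs.
move=> /compact_bounded[M [_ HM]]; exists (`|M| + 1); first by rewrite addr_ge0.
move=> x; have [->|px] := eqVneq (phi x) 0; first by rewrite normr0 addr_ge0.
apply: HM; first by rewrite (le_lt_trans (ler_norm M))// ltrDl.
by exists x => //; exact: subset_closure.
Qed.

Lemma vec_shiftx (h : 'I_n -> R) (x : E) : vec (shiftx h x) = vec x + \row_i h i.
Proof. by apply/rowP => i; rewrite !mxE tnth_shiftx. Qed.

(* [phi] is approximated by functions of the cell of side [1 / (k + 1)]
   containing the point, of which there are countably many. *)
Lemma measurable_vec phi : continuous phi -> measurable_fun setT (fun x : E => phi (vec x)).
Proof.
move=> cp.
pose fl (k : nat) (x : E) : {ffun 'I_n -> ssrint.int} := [ffun i => Num.floor (k.+1%:R * tnth x i)].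
pose pt (k : nat) (v : {ffun 'I_n -> ssrint.int}) : 'rV[R]_n := \row_i ((v i)%:~R / k.+1%:R).
apply: (@measurable_fun_cvg _ _ _ _ (fun k x => phi (pt k (fl k x)))).
  move=> k _ B mB; rewrite setTI.
  rewrite (_ : _ @^-1` _ = \bigcup_(v : {v : {ffun 'I_n -> ssrint.int} | `[< B (phi (pt k v)) >]})
      [set x | fl k x = val v]); last first.
    apply/seteqP; split => x /=.
      by move=> Bx; exists (exist _ (fl k x) (asboolT Bx)).
    by move=> [[v Bv] _ /= ->]; exact/asboolP.
  apply: countable_bigcupT_measurable; first exact: countableP.
  move=> [v _] /=.
  rewrite (_ : [set x | _] = \bigcap_(i in setT) ((fun x : E => tnth x i) @^-1`
      [set y : measurableTypeR R | (v i)%:~R <= k.+1%:R * y < (v i + 1)%:~R])).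
    apply: fin_bigcap_measurable => [|i _]; first exact: finite_finset.
    rewrite -[X in measurable X]setTI; apply: measurable_tnth => //.
    rewrite (_ : [set y | _] = `[(v i)%:~R / k.+1%:R, (v i + 1)%:~R / k.+1%:R[%classic).
      exact: measurable_itv.
    apply/seteqP; split => y /=; rewrite in_itv /= ler_pdivrMr// ltr_pdivlMr// ![_ * y]mulrC//.
  apply/seteqP; split => x /=.
    move=> <- i _ /=; rewrite ffunE.
    by rewrite floor_le_tmp floorD1_gt.
  move=> H; apply/ffunP => i; rewrite ffunE; apply/floor_def; exact: H.
move=> x _; apply: continuous_cvg; first exact: cp.
apply/cvgrPdist_le => e e0; near=> k.
apply: norm_le_coord => [|i]; first exact: ltW.
rewrite !mxE ffunE.
have k0 : 0 < k.+1%:R :> R by [].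
rewrite -(ler_pM2r k0) -[X in _ * X <= _](ger0_norm (ltW k0)) -normrM mulrBl divfK ?gt_eqF//.
rewrite [tnth x i * _]mulrC ger0_norm; last by rewrite subr_ge0 floor_le_tmp.
apply: (@le_trans _ _ 1).
  by rewrite lerBlDl ltW// -[X in _ + X]/(1%:~R) -intrD floorD1_gt.
rewrite mulrC -ler_pdivrMr// div1r; near: k.
have := @near_infty_natSinv_lt R (PosNum e0); apply: filterS => k /=.
by rewrite -ltf_pV2 ?posrE ?invr_gt0// invrK => /ltW.
Unshelve. all: by end_near. Qed.

End multivariate_smoothness.

(** * Test functions: Taylor bounds, transforms of derivatives, density *)

Section test_functions.
Context (R : realType) (n : nat).
Local Notation E := (Rn R n).
Local Notation leb := (lebesgue_Rn R n).
Local Notation L2 := (L2 leb).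
Local Notation nm := (nm leb).
Local Notation ip := (ip leb).
Local Notation itg := (itg leb).
Local Notation int := (int leb).
Local Notation e_ j := (delta_mx 0 j : 'rV[R]_n).
Implicit Types (phi psi : 'rV[R]_n -> R) (j : 'I_n) (f g : E -> R).

Lemma vec_notin_cube k (x : E) : ~ cube k x -> exists i, k%:R <= `|vec x 0 i|.
Proof.
move=> /existsNP[i /negP xi]; exists i; rewrite mxE.
move: xi; rewrite negb_and -leNgt -ltNge ler_normr => /orP[h|/ltW ->//].
by rewrite lerNr h orbT.
Qed.

Lemma tsupp_cube phi (K k : nat) : (forall x, phi x != 0 -> forall i, `|x 0 i| <= K%:R) ->
  (K < k)%N -> forall x : E, ~ cube k x -> phi (vec x) = 0.
Proof.
move=> H Kk x /vec_notin_cube[i xi]; apply/eqP; apply: contraTT xi => /H /(_ i) h.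
by rewrite -ltNge (le_lt_trans h)// ltr_nat.
Qed.

Lemma test_L12 phi : test_function phi -> L12 (fun x : E => phi (vec x)).
Proof.
move=> tp; have [M M0 HM] := test_bounded tp.
have [_ [K HK]] := (test_functionP phi).1 tp.
apply: (@L12_le _ _ _ (fun x => M * \1_(cube K.+1 : set E) x)).
- by apply: measurable_vec; exact: test_continuous.
- move=> x; rewrite normrM (ger0_norm M0) indicE.
  have [xk|xk] := pselect (cube K.+1 x).
    by rewrite mem_set// normr1 mulr1.
  by rewrite (tsupp_cube HK _ xk)// normr0 mulr_ge0.
- by apply: L12Z; exact: L12_box.
Qed.

Lemma partial_shift phi j (b x : 'rV[R]_n) :
  partial j (fun y => phi (y + b)) x = partial j phi (x + b).
Proof. exact: derive_shift. Qed.

(** The mean value theorem is used twice, the second partial derivative being bounded. Because the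
    remainder lives in a fixed cube, it can be integrated against any locally integrable
    function. *)
Lemma test_taylor phi j : test_function phi ->
  exists C, exists k : nat, forall (s : R) (x : E), `|s| <= 1 ->
  `|phi (vec x + s *: e_ j) - phi (vec x) - s * partial j phi (vec x)| <=
    C * s ^+ 2 * \1_(cube k : set E) x.
Proof.
move=> tp; have tp1 := test_partial j tp; have tp2 := test_partial j tp1.
have [M M0 HM] := test_bounded tp2.
have [_ [K HK]] := (test_functionP phi).1 tp.
have [_ [K1 HK1]] := (test_functionP _).1 tp1.
(* The cube contains both supports; one extra unit absorbs a shift of length at most 1, the other
   makes the inequality strict. *)
exists M, (K + K1).+2 => s x s1.
have [xk|xk] := pselect (cube (K + K1).+2 x).
  rewrite indicE mem_set// mulr1.
  have d0 (t : R) := der_line (@test_differentiable _ _ phi (vec x + t *: e_ j) tp).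
  have d1 (t : R) := der_line (@test_differentiable _ _ _ (vec x + t *: e_ j) tp1).
  have [c hc] := der_mvt 0 s d0; rewrite scale0r addr0 subr0 => ->.
  have [c' hc'] := der_mvt 0 c d1; rewrite scale0r addr0 subr0 => E1.
  rewrite mulrC -mulrBr normrM -/(partial j phi _) E1 normrM mulrC.
  have cs : `|c| <= `|s|.
    move: hc; rewrite /Num.min /Num.max; case: ifP => s0 /andP[h1 h2].
      by rewrite !ger0_norm// ltW.
    have s0' : s <= 0 by rewrite leNgt s0.
    by rewrite !ler0_norm ?lerN2.
  rewrite -(real_normK (num_real s)) expr2 mulrA ler_wpM2r//.
  by rewrite ler_pM// HM.
have [i xi] := vec_notin_cube xk.
have z (y : 'rV[R]_n) : y = vec x \/ y = vec x + s *: e_ j -> phi y = 0.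
  move=> hy; apply/eqP; have : (K.+1)%:R <= `|y 0 i|.
    case: hy => ->; first by apply: le_trans xi; rewrite ler_nat ltnS ltnW// ltnS leq_addr.
    have := ler_normB (vec x 0 i + s * (i == j)%:R) (s * (i == j)%:R).
    rewrite addrK => h; rewrite -(lerD2r 1); apply: (@le_trans _ _ (`|vec x 0 i|)).
      by apply: le_trans xi; rewrite natr1 ler_nat !ltnS leq_addr.
    apply: le_trans h _; rewrite !mxE eqxx /= lerD2l normrM.
    by case: eqP; rewrite ?normr1 ?mulr1// normr0 mulr0.
  by apply: contraTT => /HK /(_ i) h; rewrite -ltNge (le_lt_trans h)// ltr_nat.
have z1 : partial j phi (vec x) = 0.
  apply/eqP; apply: contraTT xi => /HK1 /(_ i) h.
  by rewrite -ltNge (le_lt_trans h)// ltr_nat ltnS ltnW// ltnS leq_addl.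
by rewrite z1 !z; [|left|right]; rewrite // mulr0 !subrr normr0 indicE memNset// mulr0.
Qed.

(** Weak enough to cover L^2 functions and also the bounded kernels cas(x.xi), which need not be in
    L^2. *)
Definition loc_itg f := forall k, itg (fun x => f x * \1_(cube k : set E) x).

Lemma L2_loc_itg f : L2 f -> loc_itg f.
Proof. by move=> Lf k; apply: L2_mul => //; exact: (L12_box _ _).2. Qed.

Lemma itg_test_mul f phi : measurable_fun setT f -> loc_itg f -> test_function phi ->
  itg (fun x => f x * phi (vec x)).
Proof.
move=> mf If tp; have [M M0 HM] := test_bounded tp.
have [_ [K HK]] := (test_functionP phi).1 tp.
apply: (itg_le _ _ (itgZ M (itg_abs (If K.+1)))).
  by apply: measurable_funM => //; exact: itg_meas (test_L12 tp).1.
move=> x; rewrite !normrM indicE.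
have [xk|xk] := pselect (cube K.+1 x).
  by rewrite mem_set// normr1 mulr1 mulrC ler_wpM2r.
by rewrite (tsupp_cube HK _ xk)// normr0 mulr0 mulr_ge0// mulr_ge0.
Qed.

(** [der_quad] reduces this to integrating the uniform Taylor bound against |f| on a cube. *)
Lemma der_int_shift f phi j h : measurable_fun setT f -> loc_itg f -> test_function phi ->
  der (fun h => int (fun x => f x * phi (vec x + h *: e_ j))) h
      (int (fun x => f x * partial j phi (vec x + h *: e_ j))).
Proof.
move=> mf If tp; pose psi y := phi (y + h *: e_ j).
have ts : test_function psi by exact: test_shift.
have [C [k HC]] := test_taylor j ts.
pose K := int (fun x => C * `|f x * \1_(cube k : set E) x|).
apply: (@der_quad _ _ _ _ K) => s s1.
have E1 : (fun x : E => f x * phi (vec x + (h + s) *: e_ j)) =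
          (fun x => f x * psi (vec x + s *: e_ j)).
  by apply/funext => x; rewrite /psi scalerDl -addrA [_ *: _ + _ *: _]addrC.
have E2 : (fun x : E => f x * partial j phi (vec x + h *: e_ j)) =
          (fun x => f x * partial j psi (vec x)).
  by apply/funext => x; rewrite partial_shift.
have I0 := itg_test_mul mf If ts.
have I1 := itg_test_mul mf If (test_partial j ts).
have I2 := itg_test_mul mf If (test_shift (s *: e_ j) ts).
rewrite E1 E2 -(intB I2 I0) -(intZ s I1) -(intB (itgB I2 I0) (itgZ s I1)).
apply: le_trans (int_abs (itgB (itgB I2 I0) (itgZ s I1))) _.
have I3 := itgZ C (itg_abs (If k)).
rewrite /K mulrC -(intZ (s ^+ 2) I3).
apply: int_le; [apply: itg_abs; exact: (itgB (itgB I2 I0) (itgZ s I1))|exact: itgZ|move=> x /=].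
have -> : f x * psi (vec x + s *: e_ j) - f x * psi (vec x) - s * (f x * partial j psi (vec x))
  = f x * (psi (vec x + s *: e_ j) - psi (vec x) - s * partial j psi (vec x)) by ring.
rewrite normrM; apply: le_trans (ler_wpM2l (normr_ge0 _) (HC s x s1)) _.
rewrite normrM (ger0_norm (_ : 0 <= \1_(cube k) x)) ?indicE//.
by rewrite le_eqVlt; apply/orP; left; apply/eqP; ring.
Qed.

Lemma vec_shift_dir j (h : R) (x : E) :
  vec (shiftx (fun i => h * (i == j)%:R) x) = vec x + h *: e_ j.
Proof. by rewrite vec_shiftx; congr (_ + _); apply/rowP => i; rewrite !mxE eqxx. Qed.

Lemma casD (a b : R) : cas (a + b) = cos b * cas a + sin b * cas (- a).
Proof. by rewrite /cas cosD sinD cosN sinN; ring. Qed.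

Lemma dot_shift j (h : R) (x xi : E) :
  dot (shiftx (fun i => h * (i == j)%:R) x) xi = dot x xi + h * tnth xi j.
Proof.
rewrite /dot (eq_bigr (fun i => tnth x i * tnth xi i + h * ((i == j)%:R * tnth xi i))).
  rewrite big_split /= -mulr_sumr; congr (_ + _ * _).
  rewrite (bigD1 j)//= eqxx mul1r big1 ?addr0// => i /negbTE ->; exact: mul0r.
by move=> i _; rewrite tnth_shiftx; ring.
Qed.

Lemma shiftx_opp j (h : R) (x : E) : shiftx (fun i => - h * (i == j)%:R)
  (shiftx (fun i => h * (i == j)%:R) x) = x.
Proof. by apply: eq_from_tnth => i; rewrite !tnth_shiftx; ring. Qed.

Lemma hart_shift f j (h : R) (xi : E) : itg f ->
  hart (f \o shiftx (fun i => - h * (i == j)%:R)) xi =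
  cos (h * tnth xi j) * hart f xi + sin (h * tnth xi j) * hart f (negx xi).
Proof.
move=> If; rewrite /hart.
have m1 : measurable_fun setT (fun x => cas (dot x xi) *
    (f \o shiftx (fun i => - h * (i == j)%:R)) x).
  by apply: itg_meas; apply: itg_cas; exact: itg_shiftx.
rewrite -(int_shiftx (fun i => h * (i == j)%:R) m1).
rewrite -(intZ (cos _) (itg_cas xi If)) -(intZ (sin _) (itg_cas (negx xi) If)).
rewrite -intD; [|apply: itgZ; exact: itg_cas|apply: itgZ; exact: itg_cas].
apply: int_ext => x /=; rewrite shiftx_opp dot_shift casD dotNr; ring.
Qed.

(** The integral of cas(x.xi) phi(x + h e_j) is differentiated at h = 0 in two ways: under the
    integral sign, and through the translation formula [hart_shift]. The reflection appears because
    the derivative of cas(t) is cas(-t). *)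
Lemma hart_partial phi j (xi : E) : test_function phi ->
  hart (fun x : E => partial j phi (vec x)) xi =
  - tnth xi j * hart (fun x : E => phi (vec x)) (negx xi).
Proof.
move=> tp; have [I0 _] := test_L12 tp.
pose c (x : E) := cas (dot x xi).
have mc : measurable_fun setT c by exact: measurable_cas_dot.
have lc : loc_itg c.
  by move=> k; apply: itg_cas; exact: (L12_box _ _).1.
have d1 := der_int_shift j 0 mc lc tp.
have E1 (h : R) : int (fun x => c x * phi (vec x + h *: e_ j)) =
    cos (- h * tnth xi j) * hart (fun x : E => phi (vec x)) xi +
    sin (- h * tnth xi j) * hart (fun x : E => phi (vec x)) (negx xi).
  rewrite -hart_shift//; apply: int_ext => x /=; congr (_ * phi _).
  by rewrite -vec_shift_dir opprK.
have d2 : der (fun h => int (fun x => c x * phi (vec x + h *: e_ j))) 0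
    (- tnth xi j * hart (fun x : E => phi (vec x)) (negx xi)).
  rewrite (funext E1); apply: der_eq; first by derive.
  by rewrite /= !(oppr0, mul0r) sin0 cos0; ring.
have := der_val d1; rewrite (der_val d2) => ->.
by apply: int_ext => x; rewrite scale0r addr0.
Qed.

Section bumps.
Variables (a b : 'I_n -> R).

(** The first factor rises steeply just after [a i]. The second has the larger slope (m+1)^2 and is
    shifted so that its argument is still m+1 at [b i] but vanishes 1/(m+1) further; hence the limit
    is the indicator of the half-open interval. *)
Definition bump1 (m : nat) i (y : R) : R :=
  flat 0 (m.+1%:R * y + (- (m.+1%:R * a i))) *
  flat 0 (- (m.+1%:R ^+ 2) * y + (m.+1%:R ^+ 2 * b i + m.+1%:R)).

Definition bump (m : nat) (x : 'rV[R]_n) : R := \prod_i bump1 m i (x 0 i).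

Lemma bump1_itv m i y : 0 <= bump1 m i y <= 1.
Proof.
rewrite /bump1; set u := flat _ _; set v := flat _ _.
have /andP[u0 u1] : 0 <= u <= 1 by exact: flat0_itv.
have /andP[v0 v1] : 0 <= v <= 1 by exact: flat0_itv.
by rewrite mulr_ge0//= mulr_ile1.
Qed.

Lemma bump1_out m i y : bump1 m i y != 0 -> a i < y < b i + m.+1%:R^-1.
Proof.
have m0 : 0 < m.+1%:R :> R by [].
rewrite /bump1 mulf_eq0 negb_or /flat; case: ifP; last by rewrite eqxx.
move=> h1; case: ifP; last by rewrite eqxx andbF.
move=> h2 _; apply/andP; split.
  by move: h1; rewrite -mulrBr pmulr_rgt0// subr_gt0.
rewrite -(ltr_pM2l (exprn_gt0 2 m0)) mulrDr expr2 -[_ * _ * _^-1]mulrA mulfV ?gt_eqF// mulr1.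
by move: h2; rewrite expr2; lra.
Qed.

Lemma bump_test m : test_function (bump m).
Proof.
have aux (y d A B u v a' b' : R) : a' < y -> y < b' + d -> d <= 1 -> - a' <= u -> b' <= v ->
    0 <= A -> 0 <= B -> u < A + 1 -> v < B + 1 -> `|y| <= A + B + 1 + 1 + 1.
  by move=> *; rewrite ler_norml; apply/andP; split; lra.
apply/test_functionP; split.
  move=> k; apply: smooth_prod => i; apply: smooth1M; apply: smooth1_affine; exact: smooth1_flat.
exists (\sum_i (Num.truncn `|a i| + Num.truncn `|b i|).+3)%N => x bx i.
have /bump1_out/andP[h1 h2] : bump1 m i (x 0 i) != 0.
  by apply: contraNneq bx => z; rewrite /bump (bigD1 i)//= z mul0r.
have hs : ((Num.truncn `|a i| + Num.truncn `|b i|).+3 <=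
   \sum_i (Num.truncn `|a i| + Num.truncn `|b i|).+3)%N by rewrite (bigD1 i)//= leq_addr.
apply: (@le_trans _ _ (Num.truncn `|a i| + Num.truncn `|b i|).+3%:R); last by rewrite ler_nat.
have ha : `|a i| < (Num.truncn `|a i|).+1%:R by exact: truncnS_gt.
have hb : `|b i| < (Num.truncn `|b i|).+1%:R by exact: truncnS_gt.
have m1 : m.+1%:R^-1 <= 1 :> R by rewrite invf_le1// ler1n.
have h3 := ler_norm (- a i); rewrite normrN in h3; have h4 := ler_norm (b i).
have p1 : 0 <= (Num.truncn `|a i|)%:R :> R by [].
have p2 : 0 <= (Num.truncn `|b i|)%:R :> R by [].
rewrite -!natr1 natrD; rewrite -natr1 in ha; rewrite -natr1 in hb.
exact: aux h1 h2 m1 h3 h4 p1 p2 ha hb.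
Qed.

Lemma bump1_cvg_in i y : a i < y <= b i -> bump1 m i y @[m --> \oo] --> (1 : R).
Proof.
move=> /andP[h1 h2]; pose d := Num.min (y - a i) 1.
have d0 : 0 < d by rewrite lt_min subr_gt0 h1 ltr01.
have h : m.+1%:R^-1 @[m --> \oo] --> (0 : R) by exact: cvg_harmonic.
apply: (squeeze0 (K := 2 / d)) h => m.
have m0 : 0 < m.+1%:R :> R by [].
have /andP[_ le1] := bump1_itv m i y.
rewrite -normrN opprB ger0_norm ?subr_ge0// ger0_norm ?invr_ge0//.
rewrite /bump1; set u := flat _ _; set v := flat _ _.
have /andP[u0 u1] : 0 <= u <= 1 by exact: flat0_itv.
have /andP[v0 v1] : 0 <= v <= 1 by exact: flat0_itv.
have key z : d * m.+1%:R <= z -> 1 - flat 0 z <= d^-1 / m.+1%:R.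
  move=> hz; have z0 : 0 < z by apply: lt_le_trans hz; exact: mulr_gt0.
  have := flat0_ge z0; rewrite -invfM => h'.
  have : z^-1 <= (d * m.+1%:R)^-1 by rewrite lef_pV2// posrE// mulr_gt0.
  by move=> hh; rewrite lerBlDr -lerBlDl (le_trans _ h')// lerD2l lerN2.
have k1 : 1 - u <= d^-1 / m.+1%:R.
  apply: key; rewrite -mulrBr [leRHS]mulrC ler_pM2r// ge_min lexx//.
have k2 : 1 - v <= d^-1 / m.+1%:R.
  apply: key; apply: (@le_trans _ _ m.+1%:R).
    by rewrite ger_pMl// ge_min lexx orbT.
  rewrite addrA lerDr mulNr addrC -mulrBr mulr_ge0 ?exprn_ge0//; lra.
rewrite -[2 / d * _]mulrA; move: (d^-1 / _) k1 k2 => w k1 k2; nra.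
Qed.

Lemma bump_cvg (x : E) : bump m (vec x) @[m --> \oo] --> (\1_(box a b) x : R).
Proof.
have [xb|xb] := pselect (box a b x).
  rewrite indicE mem_set//= /bump.
  have : forall s : seq 'I_n, \prod_(i <- s) bump1 m i (vec x 0 i) @[m --> \oo] --> (1 : R).
    elim=> [|i s IH]; first by under eq_fun do rewrite big_nil; exact: cvg_cst.
    have -> : (fun m => \prod_(k <- i :: s) bump1 m k (vec x 0 k)) =
        (fun m => bump1 m i (vec x 0 i) * \prod_(k <- s) bump1 m k (vec x 0 k)).
      by apply/funext => m; rewrite big_cons.
    have c1 : bump1 m i (vec x 0 i) @[m --> \oo] --> (1 : R).
      by apply: bump1_cvg_in; rewrite mxE.
    by rewrite -[X in _ --> X](mulr1 (1 : R)); exact: cvgM.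
  exact.
rewrite indicE memNset//=; apply: cvg_near_cst.
move/existsNP: xb => [i /negP]; rewrite negb_and -leNgt -ltNge => hi.
have z m : bump1 m i (vec x 0 i) = 0 -> bump m (vec x) = 0.
  by move=> e; rewrite /bump (bigD1 i)//= e mul0r.
case/orP: hi => hi.
  near=> m; apply: z; apply/eqP; apply: contraTT hi => /bump1_out/andP[].
  by rewrite mxE -ltNge.
near=> m; apply: z; apply/eqP.
have : m.+1%:R^-1 < tnth x i - b i.
  near: m; have d0 : 0 < tnth x i - b i by rewrite subr_gt0.
  exact: (near_infty_natSinv_lt (PosNum d0)).
apply: contraTT => /bump1_out/andP[_]; by rewrite mxE -leNgt lerBlDl => /ltW.
Unshelve. all: by end_near. Qed.

Lemma bump_le m (x : E) : `|bump m (vec x)| <= \1_(box a (fun i => b i + 1)) x.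
Proof.
have b01 : 0 <= bump m (vec x) <= 1.
  rewrite /bump; elim/big_ind: _ => [|u v /andP[u0 u1] /andP[v0 v1]|i _].
  - by rewrite ler01 lexx.
  - by rewrite mulr_ge0//= mulr_ile1.
  - exact: bump1_itv.
case/andP: b01 => h0 h1; rewrite ger0_norm// indicE.
have [xb|/existsNP[i /negP hi]] := pselect (box a (fun i => b i + 1) x).
  by rewrite mem_set.
suff -> : bump m (vec x) = 0 by [].
suff e : bump1 m i (vec x 0 i) = 0 by rewrite /bump (bigD1 i)//= e mul0r.
apply/eqP; apply: contraNT hi => /bump1_out; rewrite mxE => /andP[-> h] /=.
apply: ltW; apply: lt_le_trans h _; by rewrite lerD2l invf_le1 ?ler1n// ltr0Sn.
Qed.

End bumps.

(** The L^2 functions approximable by test functions are stable under L^2 limits and contain the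
    indicators of boxes, through the bumps; [L12_ind] and truncation to cubes give the rest. *)
Lemma test_dense f : L2 f -> forall e : R, 0 < e ->
  exists2 phi, test_function phi & nm (fun x => f x - phi (vec x)) <= e.
Proof.
have t0 : test_function (fun _ : 'rV[R]_n => 0).
  apply/test_functionP; split; first by move=> k; exact: smooth_cst.
  by exists 0%N => x; rewrite eqxx.
pose V f := L2 f /\ forall e : R, 0 < e ->
  exists2 phi, test_function phi & nm (fun x => f x - phi (vec x)) <= e.
have lim (F : nat -> E -> R) g : (forall m, V (F m)) -> L2 g ->
    nm (fun x => F m x - g x) @[m --> \oo] --> 0 -> V g.
  move=> VF Lg /seqP c; split=> // e e0.
  have e2 : 0 < e / 2 by rewrite divr_gt0.
  have [N HN] := c _ e2; have := HN N (leqnn N); rewrite subr0 ger0_norm ?nm_ge0// => h.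
  have [LF /(_ _ e2)[phi tp hp]] := VF N; exists phi => //.
  apply: le_trans (nm_triangle Lg (test_L12 tp).2 LF) _.
  by rewrite nm_subC [leRHS]splitr lerD.
have V12 g : L12 g -> V g.
  apply: L12_ind => {g}.
  - move=> g g' [Lg Hg] [Lg' Hg']; split; first exact: L2D.
    move=> e e0; have e2 : 0 < e / 2 by rewrite divr_gt0.
    have [phi tp h] := Hg _ e2; have [phi' tp' h'] := Hg' _ e2.
    exists (fun x => phi x + phi' x); first exact: testD.
    rewrite (nm_ext _ (_ : _ =1 fun x => g x - phi (vec x) + (g' x - phi' (vec x)))); last first.
      by move=> x; ring.
    apply: le_trans (nmD (L2B Lg (test_L12 tp).2) (L2B Lg' (test_L12 tp').2)) _.
    by rewrite [leRHS]splitr lerD.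
  - move=> c g [Lg Hg]; split; first exact: L2Z.
    move=> e e0; have c1 : 0 < `|c| + 1 by rewrite ltr_wpDl.
    have [phi tp h] := Hg _ (divr_gt0 e0 c1).
    exists (fun x => c * phi x); first exact: testZ.
    rewrite (nm_ext _ (_ : _ =1 fun x => c * (g x - phi (vec x)))); last by move=> x; ring.
    rewrite nmZ; last exact: L2B Lg (test_L12 tp).2.
    move: h; rewrite ler_pdivlMr// => h; apply: le_trans h; rewrite mulrC ler_wpM2l ?nm_ge0//.
    by rewrite lerDl.
  - move=> F g d VF LF Ld Fd Fg.
    have [Lg c] := L2_dct (fun m => (LF m).2.1) Fd Ld.2 Fg.
    exact: lim VF Lg c.
  - move=> a b ab.
    have mb m : measurable_fun setT (fun x : E => bump a b m (vec x)).
      exact: (test_L12 (bump_test a b m)).2.1.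
    have [Lg c] := L2_dct mb (@bump_le a b) (L12_box a (fun i => b i + 1)).2 (@bump_cvg a b).
    apply: lim _ Lg c => m; split; first exact: (test_L12 (bump_test a b m)).2.
    move=> e e0; exists (bump a b m); first exact: bump_test.
    by rewrite (nm_ext _ (_ : _ =1 fun=> 0)) ?nm0 ?ltW// => x; rewrite subrr.
move=> Lf; have [Lc c] := L2_cut Lf.
by case: (lim _ _ (fun m => V12 _ (Lc m)) Lf c).
Qed.

(** One factor of the squared norm of [f] is replaced by a nearby test function, which gives |f|^2
    <= K |f| up to an arbitrary error. *)
Lemma test_dual_bound f (K : R) : 0 <= K -> L2 f ->
  (forall phi, test_function phi -> `|ip f (fun x => phi (vec x))| <= K * nm (fun x => phi (vec x))) ->
  nm f <= K.
Proof.
move=> K0 Lf H.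
have H2 : nm f ^+ 2 <= K * nm f.
  apply/ler_addgt0Pr => e e0.
  (* The errors d |f| and K d together stay below e. *)
  pose d := e / (nm f + K + 1).
  have s0 : 0 < nm f + K + 1 by rewrite ltr_pwDr// addr_ge0// nm_ge0.
  have [phi tp h] := test_dense Lf (divr_gt0 e0 s0 : 0 < d).
  have Lp := (test_L12 tp).2.
  have E1 : nm f ^+ 2 = ip f (fun x => f x - phi (vec x)) + ip f (fun x => phi (vec x)).
    by rewrite ipBr// subrK nm_sq.
  have h1 := cauchy_schwarz Lf (L2B Lf Lp).
  have h2 := H _ tp.
  have h3 : nm (fun x => phi (vec x)) <= nm f + d.
    have := nm_dist Lp Lf; rewrite nm_subC => h3.
    have := le_trans (ler_norm _) h3; lra.
  have d0 : 0 < d by exact: divr_gt0.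
  have de : d * (nm f + K + 1) = e by rewrite divfK// gt_eqF.
  have := ler_norm (ip f (fun x => f x - phi (vec x))).
  have := ler_norm (ip f (fun x => phi (vec x))).
  have := nm_ge0 leb f.
  rewrite E1; nra.
have [->//|f0] := eqVneq (nm f) 0.
have fp : 0 < nm f by rewrite lt_def f0 nm_ge0.
by rewrite -(ler_pM2r fp) -expr2.
Qed.

End test_functions.

(** * Weak derivatives in frequency space *)

Lemma der_seq (R : realType) (f : R -> R) (x d : R) : der f x d ->
  m.+1%:R * (f (x + m.+1%:R^-1) - f x) @[m --> \oo] --> d.
Proof.
move=> [df dE]; have : h^-1 *: ((f \o shift x) (h *: 1) - f x) @[h --> 0^'] --> d.
  by rewrite -dE; exact: df.
move=> /cvgr_dnbhsP /(_ (fun m => m.+1%:R^-1)) H.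
rewrite (_ : (fun m : nat => m.+1%:R * (f (x + m.+1%:R^-1) - f x)) =
  (fun m : nat => (m.+1%:R^-1)^-1 *: ((f \o shift x) (m.+1%:R^-1 *: 1) - f x))).
  apply: H; split; first by move=> m; rewrite invr_eq0 pnatr_eq0.
  exact: cvg_harmonic.
by apply/funext => m /=; rewrite invrK /GRing.scale /= mulr1 [x + _]addrC.
Qed.

Section sobolev.
Context (R : realType) (n : nat).
Local Notation E := (Rn R n).
Local Notation leb := (lebesgue_Rn R n).
Local Notation L2 := (L2 leb).
Local Notation nm := (nm leb).
Local Notation ip := (ip leb).
Local Notation itg := (itg leb).
Local Notation int := (int leb).
Local Notation cP := (@cP R n).
Implicit Types (phi psi : 'rV[R]_n -> R) (j : 'I_n) (f g w : E -> R).

Local Notation tau j h f := (f \o shiftx (fun i => h * (i == j)%:R)).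

Lemma L2_shiftx (h : 'I_n -> R) f : L2 f -> L2 (f \o shiftx h).
Proof.
move=> [mf If]; split; first exact: measurableT_comp mf (measurable_shiftx h).
exact: itg_shiftx If.
Qed.

Lemma nm_shiftx (h : 'I_n -> R) f : measurable_fun setT f -> nm (f \o shiftx h) = nm f.
Proof.
move=> mf; rewrite /nm /ip; congr Num.sqrt.
exact: (int_shiftx h (measurable_funM mf mf)).
Qed.

Lemma ip_tau f phi j (h : R) : L2 f -> test_function phi ->
  ip (tau j (- h) f) (fun x => phi (vec x)) =
  int (fun x => f x * phi (vec x + h *: delta_mx 0 j)).
Proof.
move=> Lf tp; have Lp := (test_L12 tp).2.
have m1 : measurable_fun setT (fun x => tau j (- h) f x * phi (vec x)).
  by apply: measurable_funM; [exact: (L2_shiftx _ Lf).1|exact: Lp.1].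
rewrite /ip -(int_shiftx (fun i => h * (i == j)%:R) m1).
by apply: int_ext => x /=; rewrite shiftx_opp vec_shift_dir.
Qed.

(** By duality the translation falls on the test function, where the mean value theorem and the weak
    derivative apply; the translates of the test function all have the same norm. *)
Lemma nm_tau_weak f g j (h : R) : L2 f -> L2 g -> weak_partial j f g ->
  nm (fun x => tau j (- h) f x - f x) <= `|h| * nm g.
Proof.
move=> Lf Lg wfg; apply: test_dual_bound.
- by rewrite mulr_ge0 ?nm_ge0.
- by apply: L2B => //; exact: L2_shiftx.
move=> phi tp; have Lp := (test_L12 tp).2.
rewrite ipBl//; last exact: L2_shiftx.
rewrite ip_tau//.
have d s := der_int_shift j s Lf.1 (L2_loc_itg Lf) tp.
have [c _] := der_mvt 0 h d.
rewrite scale0r; under [X in _ - X = _]int_ext do rewrite addr0.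
rewrite subr0 => ->; rewrite normrM mulrC -mulrA ler_wpM2l//.
pose psi y := phi (y + c *: delta_mx 0 j).
have tpsi : test_function psi by exact: test_shift.
have -> : int (fun x => f x * partial j phi (vec x + c *: delta_mx 0 j)) =
    - ip g (fun x => psi (vec x)).
  rewrite -(wfg psi tpsi); apply: int_ext => x; by rewrite -partial_shift.
rewrite normrN; apply: le_trans (cauchy_schwarz Lg (test_L12 tpsi).2) _.
rewrite (_ : (fun x => psi (vec x)) = tau j c (fun x => phi (vec x))) ?nm_shiftx//.
  exact: Lp.1.
by apply/funext => x /=; rewrite vec_shift_dir.
Qed.

(* Fatou's lemma applied to the transforms of the difference quotients of [f]. *)
Lemma weak_freq f g j : L12 f -> L2 g -> weak_partial j f g ->
  L2 (fun xi => tnth xi j * hart f xi).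
Proof.
move=> Lf Lg wfg.
have mt := measurable_tnthR j : measurable_fun setT (fun xi : E => tnth xi j : R).
have [Lh _] := hart_isometry Lf.
pose q (m : nat) x := m.+1%:R * (tau j (- m.+1%:R^-1) f x - f x).
have Lq m : L12 (q m).
  apply: L12Z; apply: L12B => //.
  by split; [exact: itg_shiftx Lf.1|exact: L2_shiftx Lf.2].
have nq m : nm (q m) <= nm g.
  rewrite nmZ; last by apply: L2B; [exact: L2_shiftx Lf.2|exact: Lf.2].
  have m0 : 0 < m.+1%:R :> R by [].
  apply: le_trans (ler_wpM2l (normr_ge0 _) (nm_tau_weak m.+1%:R^-1 Lf.2 Lg wfg)) _.
  by rewrite mulrA -normrM mulfV ?gt_eqF// normr1 mul1r.
have c xi : hart (q m) xi @[m --> \oo] --> tnth xi j * hart f (negx xi).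
  pose F (h : R) : R := cos (h * tnth xi j) * hart f xi + sin (h * tnth xi j) * hart f (negx xi).
  have dF : der F 0 (tnth xi j * hart f (negx xi)).
    rewrite /F; apply: der_eq; first by derive.
    by rewrite /= !mul0r sin0 cos0; ring.
  have -> : (fun m => hart (q m) xi) = fun m => m.+1%:R * (F (0 + m.+1%:R^-1) - F 0).
    apply/funext => m; rewrite /F hartZ.
      rewrite hartB ?hart_shift//; [|exact: Lf.1|exact: itg_shiftx Lf.1|exact: Lf.1].
      by rewrite add0r mul0r cos0 sin0 mul0r mul1r addr0.
    by apply: itgB; [exact: itg_shiftx Lf.1|exact: Lf.1].
  exact: der_seq.
have Lneg : L2 (fun xi => tnth xi j * hart f (negx xi)).
  have mm : measurable_fun setT (fun xi : E => (tnth xi j : R) * hart f (negx xi)).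
    by apply: measurable_funM => //; exact: (L2_negx Lh).1.
  split=> //.
  apply: (int_fatou (F := fun m xi => hart (q m) xi ^+ 2) (K := cP * nm g ^+ 2) _ _ _ _).1.
  - by move=> m; apply: L2_itg; exact: (hart_isometry (Lq m)).1.
  - by move=> m xi; exact: sqr_ge0.
  - by move=> xi; under eq_cvg do rewrite expr2; rewrite expr2; exact: cvgM.
  - move=> m; have [Lhq e] := hart_isometry (Lq m).
    rewrite -nm_sqE e exprMn sqr_sqrtr ?ler_wpM2l//; try exact: ltW (cP_gt0 _ _).
    by rewrite lerXn2r// nnegrE nm_ge0.
have := L2N (L2_negx Lneg); apply: L2_ext => xi /=.
by rewrite tnth_negx negxK mulNr opprK.
Qed.

Lemma hartL2_surj w : L2 w -> exists f, hartL2 f w.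
Proof.
move=> Lw; have [g /hartL2_sym hg] := hartL2_total Lw.
exists (fun x => cP^-1 * g x); apply: hartL2_ext (hartL2Z cP^-1 hg) => x //.
by rewrite mulKf// gt_eqF// cP_gt0.
Qed.

(** The derivative is the preimage of the reflection of xi_j w, the reflection being the one in
    [hart_partial]. Parseval's identity then verifies it against test functions. *)
Lemma weak_of_hart f w j : hartL2 f w -> L2 (fun xi => tnth xi j * w xi) ->
  exists g, [/\ L2 g, weak_partial j f g &
    nm g = (Num.sqrt cP)^-1 * nm (fun xi => tnth xi j * w xi)].
Proof.
move=> h Lw; have Lw' := L2_negx Lw.
have s0 : 0 < Num.sqrt cP by rewrite sqrtr_gt0 cP_gt0.
have [Lf Lww _] := h.
have [g hg] := hartL2_surj Lw'; have [Lg _ _] := hg; exists g; split=> //.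
  move=> phi tp; have tp' := test_partial j tp.
  have c0 : cP != 0 by rewrite gt_eqF// cP_gt0.
  apply: (mulfI c0); rewrite mulrN.
  rewrite -(hartL2_ip h (hartL2_L12 (test_L12 tp'))) -(hartL2_ip hg (hartL2_L12 (test_L12 tp))).
  have m2 : measurable_fun setT (hart (fun x : E => phi (vec x)) \o @negx R n).
    by apply: (L2_negx _).1; exact: (hart_isometry (test_L12 tp)).1.
  have := ip_negx Lw.1 m2; rewrite (_ : (_ \o @negx R n) \o @negx R n = hart (fun x : E => phi (vec x))); last first.
    by apply/funext => x /=; rewrite negxK.
  move=> ->; rewrite -intN; last first.
    by apply: L2_mul => //; apply: L2_negx; exact: (hart_isometry (test_L12 tp)).1.
  by apply: int_ext => x /=; rewrite hart_partial//; ring.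
have := hartL2_nm hg; rewrite nm_negx; last exact: Lw.1.
by move=> ->; rewrite mulKf// gt_eqF.
Qed.

Lemma weak_unique f g g' j : L2 g -> L2 g' -> weak_partial j f g -> weak_partial j f g' ->
  nm (fun x => g x - g' x) = 0.
Proof.
move=> Lg Lg' w w'; apply/eqP; rewrite eq_le nm_ge0 andbT.
apply: test_dual_bound => //; first exact: L2B.
move=> phi tp; have Lp := (test_L12 tp).2.
rewrite ipBl// mul0r; have := w _ tp; rewrite w'// => /oppr_inj e.
have -> : ip g (fun x => phi (vec x)) = ip g' (fun x => phi (vec x)) by exact: esym e.
by rewrite subrr normr0.
Qed.

(** [weakD] is an arbitrary choice of weak derivative; any two differ by a function of norm 0. *)
Lemma weakDP f g j : L2 g -> weak_partial j f g ->
  L2 (weakD j f) /\ nm (weakD j f) = nm g.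
Proof.
move=> Lg wg.
have /(xgetPex (fun=> 0)) [/in_L2P LD wD] :
    exists g, [set g | in_L2 g /\ weak_partial j f g] g.
  by exists g; split => //; exact/in_L2P.
split=> //; have := nm_dist LD Lg; rewrite (weak_unique LD Lg wD wg).
by rewrite normr_le0 subr_eq0 => /eqP.
Qed.

(** The square root of a sum of squares is bounded by the sum of the norms, which is all that
    convergence to 0 in H^1 needs. *)
Lemma H1_hart f w : hartL2 f w -> (forall j, L2 (fun xi => tnth xi j * w xi)) ->
  in_H1 f /\ exists r, [/\ H1norm f = r%:E, 0 <= r &
    r <= (Num.sqrt cP)^-1 * (nm w + \sum_j nm (fun xi => tnth xi j * w xi))].
Proof.
move=> h Lw; have [Lf Lww _] := h.
have s0 : 0 < Num.sqrt cP by rewrite sqrtr_gt0 cP_gt0.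
split.
  split; first exact/in_L2P.
  by move=> j; have [g [Lg wg _]] := weak_of_hart h (Lw j); exists g => //; exact/in_L2P.
have HD j : L2 (weakD j f) /\
    nm (weakD j f) = (Num.sqrt cP)^-1 * nm (fun xi => tnth xi j * w xi).
  by have [g [Lg wg <-]] := weak_of_hart h (Lw j); exact: weakDP.
have nf : nm f = (Num.sqrt cP)^-1 * nm w by rewrite (hartL2_nm h) mulKf// gt_eqF.
pose S := nm f ^+ 2 + \sum_(j < n) nm (weakD j f) ^+ 2.
have S0 : 0 <= S by rewrite addr_ge0 ?sqr_ge0// sumr_ge0// => j _; exact: sqr_ge0.
have pw2 (a : R) : 0 <= a -> (a%:E `^ 2)%E = (a ^+ 2)%:E.
  by move=> a0; rewrite poweR_EFin powR_mulrn.
exists (Num.sqrt S); split.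
- rewrite /H1norm L2norm_nm// pw2 ?nm_ge0//.
  rewrite (eq_bigr (fun j => (nm (weakD j f) ^+ 2)%:E)); last first.
    by move=> j _; rewrite L2norm_nm ?pw2 ?nm_ge0//; exact: (HD j).1.
  by rewrite sumEFin -EFinD poweR_EFin powR12_sqrt.
- exact: sqrtr_ge0.
- rewrite mulrDr -nf mulr_sumr.
  under eq_bigr do rewrite -(HD _).2.
  have T0 : 0 <= \sum_(j < n) nm (weakD j f) by apply: sumr_ge0 => j _; exact: nm_ge0.
  rewrite -[leRHS]ger0_norm ?addr_ge0 ?nm_ge0// -sqrtr_sqr ler_wsqrtr//.
  rewrite sqrrD -addrA lerD2l.
  have : \sum_(j < n) nm (weakD j f) ^+ 2 <= (\sum_(j < n) nm (weakD j f)) ^+ 2.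
    elim: (index_enum _) => [|i s IH]; first by rewrite !big_nil expr0n.
    rewrite !big_cons sqrrD -addrA lerD2l; apply: le_trans IH _; rewrite lerDr mulrn_wge0//.
    by rewrite mulr_ge0 ?nm_ge0// sumr_ge0// => j _; exact: nm_ge0.
  move=> h1; apply: le_trans h1 _; rewrite lerDr mulrn_wge0// mulr_ge0 ?nm_ge0//.
Qed.

End sobolev.

(** * Time regularity of the solution *)

Section trigonometric_estimates.
Context (R : realType).
Implicit Types (x y a t s r K : R).

Lemma sin_lip x y : `|sin y - sin x| <= `|y - x|.
Proof.
have [c _ ->] := @der_mvt R sin cos x y (fun z => is_derive_sin z).
by rewrite normrM ler_piMl// cos_max.
Qed.

Lemma cos_lip x y : `|cos y - cos x| <= `|y - x|.
Proof.
have [c _ ->] := @der_mvt R cos (fun z => - sin z) x y (fun z => is_derive_cos z).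
by rewrite normrM normrN ler_piMl// sin_max.
Qed.

Lemma between_dist x y c : Num.min x y <= c <= Num.max x y -> `|c - x| <= `|y - x|.
Proof.
rewrite /Num.min /Num.max; case: ifP => xy /andP[h1 h2].
  by rewrite !ger0_norm ?subr_ge0// ?lerD2r// ltW.
have yx : y <= x by rewrite leNgt xy.
by rewrite !ler0_norm ?subr_le0// lerN2 lerD2r.
Qed.

Lemma sin_quad x y : `|sin (x + y) - sin x - y * cos x| <= y ^+ 2.
Proof.
have [c hc] := @der_mvt R sin cos x (x + y) (fun z => is_derive_sin z).
rewrite addrAC subrr add0r => ->; rewrite mulrC -mulrBr normrM.
have := between_dist hc; rewrite addrAC subrr add0r => cx.
rewrite -(real_normK (num_real y)) expr2 ler_wpM2l//; exact: le_trans (cos_lip x c) cx.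
Qed.

Lemma cos_quad x y : `|cos (x + y) - cos x + y * sin x| <= y ^+ 2.
Proof.
have [c hc] := @der_mvt R cos (fun z => - sin z) x (x + y) (fun z => is_derive_cos z).
rewrite addrAC subrr add0r => ->; rewrite mulrC -mulrDr normrM [- _ + _]addrC -opprB normrN.
have := between_dist hc; rewrite addrAC subrr add0r => cx.
rewrite -(real_normK (num_real y)) expr2 ler_wpM2l//; exact: le_trans (sin_lip x c) cx.
Qed.

Lemma sin_md x y K : `|y| <= K -> `|sin (x + y) - sin x| <= Num.min 2 K.
Proof.
move=> yK; rewrite le_min; apply/andP; split.
  by rewrite (le_trans (ler_normB _ _))// lerD ?sin_max.
by apply: le_trans yK; apply: le_trans (sin_lip _ _) _; rewrite addrAC subrr add0r.
Qed.

Lemma cos_md x y K : `|y| <= K -> `|cos (x + y) - cos x| <= Num.min 2 K.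
Proof.
move=> yK; rewrite le_min; apply/andP; split.
  by rewrite (le_trans (ler_normB _ _))// lerD ?cos_max.
by apply: le_trans yK; apply: le_trans (cos_lip _ _) _; rewrite addrAC subrr add0r.
Qed.

Definition dcosr a t r : R := - (a * r) * sin (t * a * r).

(* The time derivative of [sinr]: the last factor is [1], except at [r = 0]
   where [sinr] vanishes identically. *)
Definition dsinr a t r : R := cos (t * a * r) * ((a * r) / (a * r)).

Section fixed_speed.
Variables (a A : R).
Hypotheses (a0 : 0 < a) (aA : a <= A).

Let y_le r s : 0 <= r -> `|s * a * r| <= A * `|s| * r.
Proof.
move=> r0; rewrite !normrM (gtr0_norm a0) (ger0_norm r0) ler_wpM2r// [leRHS]mulrC.
by rewrite ler_wpM2l.
Qed.

Let ar_eq r : 0 <= r -> r = 0 \/ 0 < a * r.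
Proof.
rewrite le_eqVlt => /orP[/eqP <-|r0]; [by left|right; exact: mulr_gt0].
Qed.

Lemma cosr_diff t s r : 0 <= r ->
  `|cosr a (t + s) r - cosr a t r| <= Num.min 2 (A * `|s| * r).
Proof. by move=> r0; rewrite /cosr 2!mulrDl; apply: cos_md; exact: y_le. Qed.

Lemma sinr_diff t s r : 0 <= r -> `|sinr a (t + s) r - sinr a t r| <= `|s|.
Proof.
move=> r0; rewrite /sinr -mulrBl normrM normfV.
have [->|ar] := ar_eq r0; first by rewrite !mulr0 normr0 invr0 mulr0.
rewrite (gtr0_norm ar) ler_pdivrMr//; apply: le_trans (sin_lip _ _) _.
rewrite 2!mulrDl addrAC subrr add0r -mulrA normrM (gtr0_norm ar)//.
Qed.

(** The factor r cancels the 1/(a r) in [sinr]: the solution gains one derivative over f1, which is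
    only in L^2. *)
Lemma sinr_diff_r t s r : 0 <= r ->
  r * `|sinr a (t + s) r - sinr a t r| <= a^-1 * Num.min 2 (A * `|s| * r).
Proof.
move=> r0; rewrite /sinr -mulrBl normrM normfV.
have md0 : 0 <= Num.min 2 (A * `|s| * r).
  by rewrite le_min ler0n /= !mulr_ge0// (le_trans (ltW a0)).
have [->|ar] := ar_eq r0.
  by rewrite mul0r mulr_ge0 ?invr_ge0 ?(ltW a0)// le_min ler0n /= mulr0.
have r0' : 0 < r by move: ar; rewrite pmulr_rgt0.
rewrite (gtr0_norm ar) invfM mulrCA; apply: (@le_trans _ _
   (`|sin ((t + s) * a * r) - sin (t * a * r)| * a^-1)).
  by rewrite ler_wpM2l// mulrCA mulfV ?mulr1// gt_eqF.
rewrite mulrC ler_wpM2l ?invr_ge0 ?(ltW a0)// 2!mulrDl; apply: sin_md; exact: y_le.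
Qed.

Lemma dcosr_diff t s r : 0 <= r ->
  `|dcosr a (t + s) r - dcosr a t r| <= A * r * Num.min 2 (A * `|s| * r).
Proof.
move=> r0; rewrite /dcosr -mulrBr normrM normrN normrM (gtr0_norm a0) (ger0_norm r0).
apply: ler_pM => //; [by rewrite mulr_ge0// ltW|exact: ler_wpM2r|].
by rewrite 2!mulrDl; apply: sin_md; exact: y_le.
Qed.

Lemma dsinr_diff t s r : 0 <= r ->
  `|dsinr a (t + s) r - dsinr a t r| <= Num.min 2 (A * `|s| * r).
Proof.
move=> r0; rewrite /dsinr -mulrBl.
have [->|ar] := ar_eq r0; first by rewrite !mulr0 invr0 !mulr0 normr0 le_min lexx ler0n.
rewrite mulfV ?gt_eqF// mulr1 2!mulrDl; apply: cos_md; exact: y_le.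
Qed.

Lemma cosr_quot t s r : s != 0 -> 0 <= r ->
  `|s^-1 * (cosr a (t + s) r - cosr a t r) - dcosr a t r| <= A * r * Num.min 2 (A * `|s| * r).
Proof.
move=> s0 r0; rewrite /cosr /dcosr 2!mulrDl.
set x := t * a * r; set y := s * a * r.
have [c hc ->] := @der_mvt R cos (fun z => - sin z) x (x + y) (fun z => is_derive_cos z).
have := between_dist hc; rewrite addrAC subrr add0r => cx.
have -> : s^-1 * (- sin c * y) - - (a * r) * sin x = - (a * r) * (sin (x + (c - x)) - sin x).
  by rewrite [x + _]addrC subrK /y; field.
rewrite normrM normrN normrM (gtr0_norm a0) (ger0_norm r0).
apply: ler_pM => //; [by rewrite mulr_ge0// ltW|exact: ler_wpM2r|].
by apply: sin_md; apply: le_trans cx _; exact: y_le.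
Qed.

Lemma sinr_quot t s r : s != 0 -> 0 <= r ->
  `|s^-1 * (sinr a (t + s) r - sinr a t r) - dsinr a t r| <= Num.min 2 (A * `|s| * r).
Proof.
move=> s0 r0; rewrite /sinr /dsinr 2!mulrDl.
have [->|ar] := ar_eq r0.
  by rewrite !(mulr0, invr0) subrr mulr0 subr0 normr0 le_min lexx ler0n.
set x := t * a * r; set y := s * a * r.
have [c hc] := @der_mvt R sin cos x (x + y) (fun z => is_derive_sin z).
have := between_dist hc; rewrite addrAC subrr add0r => cx E1.
rewrite -mulrBl E1 mulfV ?gt_eqF// mulr1.
have -> : s^-1 * (cos c * y / (a * r)) - cos x = cos (x + (c - x)) - cos x.
  rewrite [x + _]addrC subrK /y; congr (_ - _).
  have rn : r != 0 by apply: contraTneq ar => ->; rewrite mulr0 ltxx.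
  by field; rewrite s0 rn gt_eqF.
by apply: cos_md; apply: le_trans cx _; exact: y_le.
Qed.

(** Taylor expansion in time, -a^2 r^2 [cosr] being the time derivative of [dcosr]. In
    [solution_equation] one power of the r^3 is paid for by the H^1 datum f0, the other two by the
    test function. *)
Lemma dcosr_quad t s r : 0 <= r ->
  `|dcosr a (t + s) r - dcosr a t r + s * (a ^+ 2 * r ^+ 2) * cosr a t r| <=
  A ^+ 3 * r ^+ 3 * s ^+ 2.
Proof.
move=> r0; rewrite /dcosr /cosr 2!mulrDl.
set x := t * a * r; set y := s * a * r.
have -> : - (a * r) * sin (x + y) - - (a * r) * sin x + s * (a ^+ 2 * r ^+ 2) * cos x =
  - (a * r) * (sin (x + y) - sin x - y * cos x) by rewrite /y; ring.
rewrite normrM normrN normrM (gtr0_norm a0) (ger0_norm r0).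
apply: le_trans (ler_wpM2l _ (sin_quad x y)) _; first by rewrite mulr_ge0// ltW.
have -> : a * r * y ^+ 2 = a ^+ 3 * (r ^+ 3 * s ^+ 2) by rewrite /y; ring.
rewrite -[leRHS]mulrA ler_wpM2r//; first by rewrite mulr_ge0 ?sqr_ge0// exprn_ge0.
by rewrite lerXn2r// nnegrE; [exact: ltW|exact: le_trans (ltW a0) aA].
Qed.

Lemma dsinr_quad t s r : 0 <= r ->
  `|dsinr a (t + s) r - dsinr a t r + s * (a ^+ 2 * r ^+ 2) * sinr a t r| <=
  A ^+ 2 * r ^+ 2 * s ^+ 2.
Proof.
move=> r0; rewrite /dsinr /sinr 2!mulrDl.
have [->|ar] := ar_eq r0.
  by rewrite !(mulr0, invr0, expr0n, mul0r) /= subrr ?(mulr0, mul0r, addr0) normr0.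
set x := t * a * r; set y := s * a * r.
have -> : cos (x + y) * (a * r / (a * r)) - cos x * (a * r / (a * r)) +
   s * (a ^+ 2 * r ^+ 2) * (sin x / (a * r)) = cos (x + y) - cos x + y * sin x.
  rewrite mulfV ?gt_eqF// !mulr1 /y; congr (_ + _).
  have -> : s * (a ^+ 2 * r ^+ 2) * (sin x / (a * r)) = s * sin x * (a * r) * ((a * r) / (a * r)).
    by ring.
  by rewrite mulfV ?gt_eqF//; ring.
apply: le_trans (cos_quad x y) _.
have -> : y ^+ 2 = a ^+ 2 * (r ^+ 2 * s ^+ 2) by rewrite /y; ring.
rewrite -[leRHS]mulrA ler_wpM2r//; first by rewrite mulr_ge0 ?sqr_ge0.
by rewrite lerXn2r// nnegrE; [exact: ltW|exact: le_trans (ltW a0) aA].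
Qed.

Lemma cosr_le t r : `|cosr a t r| <= 1. Proof. exact: cos_max. Qed.

Lemma sinr_le t r : 0 <= r -> `|sinr a t r| <= `|t|.
Proof.
move=> r0; have := sinr_diff 0 t r0.
by rewrite add0r {2}/sinr !mul0r sin0 mul0r subr0.
Qed.

Lemma sinr_le_r t r : 0 <= r -> r * `|sinr a t r| <= a^-1.
Proof.
move=> r0; rewrite /sinr normrM normfV.
have [->|ar] := ar_eq r0; first by rewrite mul0r invr_ge0 ltW.
have r0' : 0 < r by move: ar; rewrite pmulr_rgt0.
rewrite (gtr0_norm ar) invfM mulrCA [r * _]mulrCA mulfV ?mulr1 ?gt_eqF//.
by rewrite ler_piMl ?sin_max// invr_ge0 ltW.
Qed.

Lemma dcosr_le t r : 0 <= r -> `|dcosr a t r| <= A * r.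
Proof.
move=> r0; rewrite /dcosr normrM normrN normrM (gtr0_norm a0) (ger0_norm r0).
apply: le_trans (ler_wpM2r r0 aA); rewrite ler_piMr ?sin_max// mulr_ge0// ltW//.
Qed.

Lemma dsinr_le t r : `|dsinr a t r| <= 1.
Proof.
rewrite /dsinr normrM; have [->|ar] := eqVneq (a * r) 0.
  by rewrite mul0r normr0 mulr0.
by rewrite mulfV// normr1 mulr1 cos_max.
Qed.

End fixed_speed.

Lemma measurable_cosr a t : measurable_fun setT (cosr a t).
Proof.
apply: (measurableT_comp (@measurable_cosR R)).
by apply: measurable_funM => //; exact: measurable_cst.
Qed.

Lemma measurable_sin_lin a t : measurable_fun setT (fun r => sin (t * a * r)).
Proof.
apply: (measurableT_comp (@measurable_sinR R)).
by apply: measurable_funM => //; exact: measurable_cst.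
Qed.

Lemma measurable_inv_lin a : measurable_fun setT (fun r => (a * r)^-1).
Proof.
apply: (measurableT_comp (@measurable_invR R)).
by apply: measurable_funM => //; exact: measurable_cst.
Qed.

Lemma measurable_sinr a t : measurable_fun setT (sinr a t).
Proof. by apply: measurable_funM; [exact: measurable_sin_lin|exact: measurable_inv_lin]. Qed.

Lemma measurable_dcosr a t : measurable_fun setT (dcosr a t).
Proof.
apply: measurable_funM; last exact: measurable_sin_lin.
by apply: measurable_funN; apply: measurable_funM => //; exact: measurable_cst.
Qed.

Lemma measurable_dsinr a t : measurable_fun setT (dsinr a t).
Proof.
apply: measurable_funM; first exact: measurable_cosr.
by apply: measurable_funM; [apply: measurable_funM => //|exact: measurable_inv_lin].
Qed.

End trigonometric_estimates.

(** * Algebra and norm estimates of the matrix multipliers *)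

Section matrix_multipliers.
Context (R : realType) (n : nat).
Local Notation E := (Rn R n).
Local Notation leb := (lebesgue_Rn R n).
Local Notation L2 := (L2 leb).
Local Notation nm := (nm leb).
Local Notation ip := (ip leb).
Local Notation itg := (itg leb).
Local Notation int := (int leb).
Implicit Types (phi psi : R -> R) (h g : 'I_n -> E -> R) (xi : E) (k l : 'I_n).

(** Entries of P are at most 1 and those of I - P at most 2, whence the 3. *)
Lemma mult_le phi1 phi2 xi k l (y b : R) : `|phi1 (enorm xi) * y| <= b ->
  `|phi2 (enorm xi) * y| <= b -> `|mult phi1 phi2 xi k l * y| <= 3 * b.
Proof.
move=> h1 h2; have P1 := Pr_bound xi k l; have b0 : 0 <= b by apply: le_trans h1.
rewrite /mult mulrDl; apply: le_trans (ler_normD _ _) _.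
rewrite mulrAC [phi2 _ * _ * _]mulrAC !(normrM (_ * y)).
have h3 : `|phi1 (enorm xi) * y| * `|Pr xi k l| <= b * 1 by apply: ler_pM.
have h4 : `|(k == l)%:R - Pr xi k l| <= 2.
  apply: le_trans (ler_normB _ _) _; rewrite (_ : 2 = 1 + 1)//; apply: lerD => //.
  by case: (k == l); rewrite ?normr1 ?normr0.
have h5 : `|phi2 (enorm xi) * y| * `|(k == l)%:R - Pr xi k l| <= b * 2 by apply: ler_pM.
by apply: le_trans (lerD h3 h5) _; rewrite -mulrDr mulrC.
Qed.

Lemma MA_est phi1 phi2 h g k : measurable_fun setT phi1 -> measurable_fun setT phi2 ->
  (forall l, measurable_fun setT (h l)) ->
  (forall l xi, `|phi1 (enorm xi) * h l xi| <= `|g l xi|) ->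
  (forall l xi, `|phi2 (enorm xi) * h l xi| <= `|g l xi|) ->
  (forall l, L2 (g l)) ->
  L2 (MA phi1 phi2 h k) /\ nm (MA phi1 phi2 h k) <= 3 * \sum_l nm (g l).
Proof.
move=> m1 m2 mh h1 h2 Lg.
have le l xi : `|mult phi1 phi2 xi k l * h l xi| <= `|3 * g l xi|.
  by rewrite [leRHS]normrM normr_nat; exact: mult_le.
have Lm l : L2 (fun xi => mult phi1 phi2 xi k l * h l xi).
  apply: L2_le (le l) (L2Z 3 (Lg l)).
  by apply: measurable_funM => //; exact: measurable_mult.
split; first exact: L2_sum.
apply: le_trans (nm_sum _ _) _ => //.
rewrite mulr_sumr; apply: ler_sum => l _.
by rewrite -[3]ger0_norm// -nmZ//; apply: nm_le => //; exact: L2Z.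
Qed.

Lemma MA_scale (q : E -> R) phi1 phi2 h k xi :
  q xi * MA phi1 phi2 h k xi = MA phi1 phi2 (fun l xi => q xi * h l xi) k xi.
Proof. by rewrite /MA mulr_sumr; apply: eq_bigr => l _; rewrite mulrCA. Qed.

Lemma Pr_sym xi k l : Pr xi k l = Pr xi l k.
Proof. by rewrite /Pr mulrC. Qed.

(** P is a projection; at xi = 0 it is the zero matrix, since the inverse of 0 is 0, so the identity
    holds without exception. *)
Lemma Pr_idem xi k l : \sum_m Pr xi k m * Pr xi m l = Pr xi k l.
Proof.
have [r0|r0] := eqVneq (enorm xi) 0.
  by rewrite big1 => [|m _]; rewrite /Pr r0 invr0 !mulr0 ?mul0r.
rewrite (eq_bigr (fun m => Pr xi k l * (enorm xi ^- 2 * tnth xi m ^+ 2))); last first.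
  by move=> m _; rewrite /Pr -exprVn; ring.
by rewrite -!mulr_sumr -enorm_sq mulVf ?mulr1// expf_neq0.
Qed.

Lemma sum_delta k (F : 'I_n -> R) : \sum_l (k == l)%:R * F l = F k.
Proof.
rewrite (bigD1 k)//= eqxx mul1r big1 ?addr0// => l; rewrite eq_sym => /negbTE ->; exact: mul0r.
Qed.

Lemma mult_comp phi1 phi2 psi1 psi2 xi k l :
  \sum_m mult phi1 phi2 xi k m * mult psi1 psi2 xi m l =
  mult (fun r => phi1 r * psi1 r) (fun r => phi2 r * psi2 r) xi k l.
Proof.
set r := enorm xi.
rewrite (eq_bigr (fun m => (phi1 r * psi1 r + phi2 r * psi2 r - phi1 r * psi2 r - phi2 r * psi1 r) *
  (Pr xi k m * Pr xi m l) + (phi1 r * psi2 r - phi2 r * psi2 r) * ((l == m)%:R * Pr xi k m) +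
  (phi2 r * psi1 r - phi2 r * psi2 r) * ((k == m)%:R * Pr xi m l) +
  phi2 r * psi2 r * ((k == m)%:R * (m == l)%:R))); last first.
  by move=> m _; rewrite /mult -/r [l == m]eq_sym; ring.
rewrite !big_split /= -!mulr_sumr Pr_idem !sum_delta /mult -/r; ring.
Qed.

Lemma MA_comp phi1 phi2 psi1 psi2 h k xi :
  MA phi1 phi2 (MA psi1 psi2 h) k xi =
  MA (fun r => phi1 r * psi1 r) (fun r => phi2 r * psi2 r) h k xi.
Proof.
rewrite /MA; under eq_bigr do rewrite mulr_sumr.
rewrite exchange_big /=; apply: eq_bigr => l _.
by rewrite -mult_comp mulr_suml; apply: eq_bigr => m _; rewrite mulrA.
Qed.

Lemma MA_adj phi1 phi2 h g xi :
  \sum_k g k xi * MA phi1 phi2 h k xi = \sum_k MA phi1 phi2 g k xi * h k xi.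
Proof.
rewrite /MA; under eq_bigr do rewrite mulr_sumr.
rewrite exchange_big /=; apply: eq_bigr => l _; rewrite mulr_suml.
apply: eq_bigr => k _; rewrite /mult Pr_sym [k == l]eq_sym; ring.
Qed.

Lemma MA_1 h k xi : MA (fun=> 1) (fun=> 1) h k xi = h k xi.
Proof.
rewrite /MA -[RHS](sum_delta k (fun l => h l xi)); apply: eq_bigr => l _.
by rewrite /mult !mul1r addrC subrK.
Qed.

Lemma MA_0 h k xi : MA (fun=> 0) (fun=> 0) h k xi = 0.
Proof. by rewrite /MA big1// => l _; rewrite /mult !mul0r addr0 mul0r. Qed.

(** Common bound for time increments of the multipliers: the cap 2 keeps it bounded on L^2, and it
    tends to 0 pointwise with [d], so that dominated convergence applies. *)
Definition md (d : R) xi : R := Num.min 2 (d * enorm xi).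

Lemma md_ge0 d xi : 0 <= d -> 0 <= md d xi.
Proof. by move=> d0; rewrite le_min ler0n mulr_ge0// enorm_ge0. Qed.

Lemma measurable_md d : measurable_fun setT (md d).
Proof.
apply: measurable_minr => //.
by apply: measurable_funM; [exact: measurable_cst|exact: measurable_enorm].
Qed.

Lemma L2_md d (h : E -> R) : 0 <= d -> L2 h -> L2 (fun xi => md d xi * h xi).
Proof.
move=> d0 Lh; apply: L2_le (L2Z 2 Lh).
  by apply: measurable_funM; [exact: measurable_md|exact: Lh.1].
move=> xi; rewrite !normrM ler_wpM2r// ger0_norm ?md_ge0// ger0_norm//.
by rewrite ge_min lexx.
Qed.

Lemma nm_md_mono d d' (h : E -> R) : 0 <= d -> d <= d' -> L2 h ->
  nm (fun xi => md d xi * h xi) <= nm (fun xi => md d' xi * h xi).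
Proof.
move=> d0 dd Lh; have d0' := le_trans d0 dd.
apply: nm_le; [exact: L2_md|exact: L2_md|move=> xi].
rewrite !normrM ler_wpM2r// !ger0_norm ?md_ge0//.
by rewrite le_min ge_min lexx /= ge_min ler_wpM2r ?orbT// enorm_ge0.
Qed.

Lemma nm_md_small (h : E -> R) : L2 h -> forall e : R, 0 < e -> exists2 d, 0 < d &
  nm (fun xi => md d xi * h xi) <= e.
Proof.
move=> Lh e e0.
have [||||_ c] := @L2_dct _ _ _ leb (fun m xi => md m.+1%:R^-1 xi * h xi) (fun=> 0) (fun xi => 2 * `|h xi|).
- by move=> m; apply: measurable_funM; [exact: measurable_md|exact: Lh.1].
- move=> m xi; rewrite normrM ler_wpM2r// ger0_norm ?md_ge0 ?invr_ge0//.
  by rewrite ge_min lexx.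
- by apply: L2Z; exact: L2_abs.
- move=> xi; have := @cvg_harmonic R; apply: (squeeze0 (K := enorm xi * `|h xi|)) => m.
  rewrite subr0 normrM mulrAC ler_wpM2r// ger0_norm ?md_ge0 ?invr_ge0//.
  rewrite ger0_norm ?invr_ge0//.
  by rewrite /md ge_min [enorm xi * _]mulrC lexx orbT.
move/seqP: c => /(_ _ e0)[N /(_ N (leqnn N))].
rewrite subr0 ger0_norm ?nm_ge0// => c; exists N.+1%:R^-1; first by rewrite invr_gt0.
apply: le_trans c; rewrite le_eqVlt; apply/orP; left; apply/eqP.
by apply: nm_ext => xi; rewrite subr0.
Qed.

Section omega.
Variables (h0 h1 : 'I_n -> E -> R).
Hypotheses (L0 : forall l, L2 (h0 l)) (L1 : forall l, L2 (h1 l))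
  (Lr : forall l, L2 (fun xi => enorm xi * h0 l xi)).

(* A modulus of continuity: [omega (C * `|s|)] dominates the norms of all the
   increments of the solution and of its derivatives over a time step [s]. *)
Definition omega (d : R) : R := \sum_l (nm (fun xi => md d xi * h0 l xi) +
  nm (fun xi => md d xi * (enorm xi * h0 l xi)) +
  nm (fun xi => md d xi * h1 l xi) + d * nm (h1 l)).

Lemma omega_small (e : R) : 0 < e -> exists2 d, 0 < d & forall d', 0 <= d' <= d -> omega d' <= e.
Proof.
suff H : forall s : seq 'I_n, forall e : R, 0 < e -> exists2 d, 0 < d &
    forall d', 0 <= d' <= d -> \sum_(l <- s) (nm (fun xi => md d' xi * h0 l xi) +
  nm (fun xi => md d' xi * (enorm xi * h0 l xi)) +
  nm (fun xi => md d' xi * h1 l xi) + d' * nm (h1 l)) <= e.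
  exact: H.
elim=> [|l s IH] {}e e0.
  by exists 1 => // d' _; rewrite big_nil ltW.
have e5 : 0 < e / 5 by rewrite divr_gt0.
have [d1 p1 H1] := nm_md_small (L0 l) e5.
have [d2 p2 H2] := nm_md_small (Lr l) e5.
have [d3 p3 H3] := nm_md_small (L1 l) e5.
have [d4 p4 H4] := IH _ e5.
have q : 0 < nm (h1 l) + 1 by rewrite ltr_wpDl ?nm_ge0.
pose d5 := e / 5 / (nm (h1 l) + 1); have p5 : 0 < d5 by exact: divr_gt0.
exists (Num.min (Num.min d1 d2) (Num.min (Num.min d3 d4) d5)).
  by rewrite !lt_min p1 p2 p3 p4 p5.
move=> d' /andP[d0]; rewrite !le_min => /andP[/andP[i1 i2] /andP[/andP[i3 i4] i5]].
rewrite big_cons.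
have b1 := le_trans (nm_md_mono d0 i1 (L0 l)) H1.
have b2 := le_trans (nm_md_mono d0 i2 (Lr l)) H2.
have b3 := le_trans (nm_md_mono d0 i3 (L1 l)) H3.
have b4 : d' * nm (h1 l) <= e / 5.
  move: i5; rewrite /d5 ler_pdivlMr// => i5; apply: le_trans i5.
  by rewrite ler_wpM2l// lerDl.
have b5 := H4 d'; rewrite d0 i4 in b5; have {}b5 := b5 isT.
apply: le_trans (lerD (lerD (lerD (lerD b1 b2) b3) b4) b5) _.
by rewrite le_eqVlt; apply/orP; left; apply/eqP; field.
Qed.

End omega.

End matrix_multipliers.

(** * Time increments of the solution and of its derivatives, in frequency *)

Section evolution.
Context (R : realType) (n : nat) (a1 a2 : R).
Hypotheses (a10 : 0 < a1) (a20 : 0 < a2).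
Local Notation E := (Rn R n).
Local Notation leb := (lebesgue_Rn R n).
Local Notation L2 := (L2 leb).
Local Notation nm := (nm leb).
Implicit Types (xi : E) (k l : 'I_n) (t s : R).
Variables (h0 h1 : 'I_n -> E -> R).
Hypotheses (L0 : forall l, L2 (h0 l)) (L1 : forall l, L2 (h1 l))
  (Lr : forall l, L2 (fun xi => enorm xi * h0 l xi)).

(** [HU] for general speeds and general frequency data; [WV] is its derivative in time. *)
Definition WU t k xi : R := MA (cosr a1 t) (cosr a2 t) h0 k xi + MA (sinr a1 t) (sinr a2 t) h1 k xi.
Definition WV t k xi : R := MA (dcosr a1 t) (dcosr a2 t) h0 k xi + MA (dsinr a1 t) (dsinr a2 t) h1 k xi.

Local Notation A := (a1 + a2).
Let A0 : 0 < A. Proof. exact: addr_gt0. Qed.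
Let le1 : a1 <= A. Proof. by rewrite lerDl ltW. Qed.
Let le2 : a2 <= A. Proof. by rewrite lerDr ltW. Qed.
Local Notation A' := (a1^-1 + a2^-1).
Let A'0 : 0 < A'. Proof. by rewrite addr_gt0// invr_gt0. Qed.
Let le1' : a1^-1 <= A'. Proof. by rewrite lerDl invr_ge0 ltW. Qed.
Let le2' : a2^-1 <= A'. Proof. by rewrite lerDr invr_ge0 ltW. Qed.

Let m0 l := (L0 l).1.
Let m1 l := (L1 l).1.
Let mt j : measurable_fun setT (fun xi : E => tnth xi j : R) := measurable_tnthR j.

Let mq j (h : 'I_n -> E -> R) : (forall l, measurable_fun setT (h l)) ->
  forall l, measurable_fun setT (fun xi => tnth xi j * h l xi).
Proof. by move=> mh l; apply: measurable_funM => //; exact: mt. Qed.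

Let pm (c w y : R) : `|c| <= `|w| -> `|c * y| <= `|w * y|.
Proof. by move=> cw; rewrite !normrM ler_wpM2r. Qed.

Let coord_r xi j (y : R) : `|tnth xi j * y| <= `|enorm xi * y|.
Proof. by rewrite !normrM ler_wpM2r// (ger0_norm (enorm_ge0 xi)) coord_enorm. Qed.

Let coord_sinr a xi j t y (K : R) : 0 < a -> a^-1 <= K ->
  `|sinr a t (enorm xi) * (tnth xi j * y)| <= `|K * y|.
Proof.
move=> a0 aK; rewrite mulrCA; apply: le_trans (coord_r _ _ _) _.
rewrite mulrA !normrM ler_wpM2r// (ger0_norm (enorm_ge0 xi)).
rewrite -normrM -/(sinr a t _); apply: le_trans (sinr_le_r a0 t (enorm_ge0 xi)) _; exact: le_trans aK (ler_norm _).
Qed.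

Lemma WU_L2 t k : L2 (WU t k).
Proof.
apply: L2D.
  apply: (@MA_est _ _ _ _ h0 h0 k _ _ m0 _ _ _).1 => //; try exact: measurable_cosr.
  - by move=> l xi; rewrite normrM ler_piMl// cosr_le.
  - by move=> l xi; rewrite normrM ler_piMl// cosr_le.
apply: (@MA_est _ _ _ _ h1 (fun l xi => t * h1 l xi) k _ _ m1 _ _ _).1; try exact: measurable_sinr.
- by move=> l xi; apply: pm; exact: sinr_le a10 _ _ (enorm_ge0 xi).
- by move=> l xi; apply: pm; exact: sinr_le a20 _ _ (enorm_ge0 xi).
- by move=> l; exact: L2Z.
Qed.

Lemma WU_H1 t k j : L2 (fun xi => tnth xi j * WU t k xi).
Proof.
rewrite (_ : (fun xi => _) = fun xi =>
   MA (cosr a1 t) (cosr a2 t) (fun l xi => tnth xi j * h0 l xi) k xi +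
   MA (sinr a1 t) (sinr a2 t) (fun l xi => tnth xi j * h1 l xi) k xi); last first.
  by apply/funext => xi; rewrite /WU mulrDr !(MA_scale (fun xi => tnth xi j)).
apply: L2D.
  apply: (@MA_est _ _ _ _ _ (fun l xi => enorm xi * h0 l xi) k _ _ _ _ _ _).1 => //; try exact: measurable_cosr.
  - by apply: mq.
  - by move=> l xi; rewrite normrM; apply: le_trans (ler_piMl _ (cosr_le _ _ _)) (coord_r _ _ _).
  - by move=> l xi; rewrite normrM; apply: le_trans (ler_piMl _ (cosr_le _ _ _)) (coord_r _ _ _).
apply: (@MA_est _ _ _ _ _ (fun l xi => A' * h1 l xi) k _ _ _ _ _ _).1; try exact: measurable_sinr.
- by apply: mq.
- by move=> l xi; exact: coord_sinr.
- by move=> l xi; exact: coord_sinr.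
- by move=> l; exact: L2Z.
Qed.

Lemma WV_L2 t k : L2 (WV t k).
Proof.
apply: L2D.
  apply: (@MA_est _ _ _ _ h0 (fun l xi => A * (enorm xi * h0 l xi)) k _ _ m0 _ _ _).1; try exact: measurable_dcosr.
  - move=> l xi; rewrite mulrA; apply: pm.
    exact: le_trans (dcosr_le a10 le1 t (enorm_ge0 xi)) (ler_norm _).
  - move=> l xi; rewrite mulrA; apply: pm.
    exact: le_trans (dcosr_le a20 le2 t (enorm_ge0 xi)) (ler_norm _).
  - by move=> l; exact: L2Z.
apply: (@MA_est _ _ _ _ h1 h1 k _ _ m1 _ _ _).1 => //; try exact: measurable_dsinr.
- by move=> l xi; rewrite normrM ler_piMl// dsinr_le.
- by move=> l xi; rewrite normrM ler_piMl// dsinr_le.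
Qed.

Let om s := omega h0 h1 (A * `|s|).
Let As s : 0 <= A * `|s|. Proof. by rewrite mulr_ge0// ltW. Qed.

Let MAB phi1 phi2 psi1 psi2 h k xi : MA phi1 phi2 h k xi - MA psi1 psi2 h k xi =
  MA (fun r => phi1 r - psi1 r) (fun r => phi2 r - psi2 r) h k xi.
Proof.
have := MA_lin 1 (-1) phi1 phi2 psi1 psi2 h k xi; rewrite mul1r mulN1r => ->.
by apply: MA_ext => //; rewrite mul1r mulN1r.
Qed.

(** Common frame of the four estimates that follow: a multiplier acting on [h0] plus one acting on
    [h1], both bounded in terms of the same constant. *)
Lemma two_terms phi1 phi2 psi1 psi2 (H0 H1 g0 g1 : 'I_n -> E -> R) k (F : E -> R) (K : R) :
  0 <= K ->
  (forall xi, F xi = MA phi1 phi2 H0 k xi + MA psi1 psi2 H1 k xi) ->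
  [/\ measurable_fun setT phi1, measurable_fun setT phi2,
      measurable_fun setT psi1 & measurable_fun setT psi2] ->
  (forall l, measurable_fun setT (H0 l)) -> (forall l, measurable_fun setT (H1 l)) ->
  (forall l xi, `|phi1 (enorm xi) * H0 l xi| <= `|K * g0 l xi|) ->
  (forall l xi, `|phi2 (enorm xi) * H0 l xi| <= `|K * g0 l xi|) ->
  (forall l xi, `|psi1 (enorm xi) * H1 l xi| <= `|K * g1 l xi|) ->
  (forall l xi, `|psi2 (enorm xi) * H1 l xi| <= `|K * g1 l xi|) ->
  (forall l, L2 (g0 l)) -> (forall l, L2 (g1 l)) ->
  L2 F /\ nm F <= 3 * K * \sum_l (nm (g0 l) + nm (g1 l)).
Proof.
move=> K0 /funext -> [mp1 mp2 mp3 mp4] mH0 mH1 b1 b2 b3 b4 Lg0 Lg1.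
have [|LA nA] := @MA_est _ _ phi1 phi2 H0 (fun l xi => K * g0 l xi) k mp1 mp2 mH0 b1 b2.
  by move=> l; exact: L2Z.
have [|LB nB] := @MA_est _ _ psi1 psi2 H1 (fun l xi => K * g1 l xi) k mp3 mp4 mH1 b3 b4.
  by move=> l; exact: L2Z.
split; first exact: L2D.
apply: le_trans (nmD LA LB) _; apply: le_trans (lerD nA nB) _.
rewrite -mulrDr -big_split /= -mulrA ler_wpM2l// mulr_sumr; apply: ler_sum => l _.
by rewrite !nmZ// (ger0_norm K0) mulrDr.
Qed.

(** One constant for all the estimates: 1 and [A] for multipliers without and with a factor a r,
    [A'] for the 1/a left by [sinr], and [A^-1] to express |s| through A |s|. *)
Local Notation K := (A + A' + A^-1 + 1).
Let K1 : 1 <= K. Proof. by rewrite lerDr !addr_ge0 ?invr_ge0// ltW. Qed.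
Let KA : A <= K. Proof. have := A'0; have : 0 < A^-1 by rewrite invr_gt0. lra. Qed.
Let KA' : A' <= K.
Proof. have := A0; have : 0 < A^-1 by rewrite invr_gt0. lra. Qed.
Let KVA : A^-1 <= K.
Proof. have := A'0; have := A0; lra. Qed.
Let K0 : 0 <= K. Proof. exact: le_trans K1. Qed.

Let mB (f g : R -> R) : measurable_fun setT f -> measurable_fun setT g ->
  measurable_fun setT (fun r => f r - g r).
Proof. exact: measurable_funB. Qed.

Let bd (c d y : R) (w z : R) : `|c| <= d * `|w| -> 0 <= d -> d <= K -> z = w * y ->
  `|c * y| <= `|K * z|.
Proof.
move=> cd d0 dK ->; rewrite mulrA !normrM (ger0_norm K0) ler_wpM2r//.
by apply: le_trans cd _; rewrite ler_wpM2r.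
Qed.

Lemma WU_diff t s k : L2 (fun xi => WU (t + s) k xi - WU t k xi) /\
  nm (fun xi => WU (t + s) k xi - WU t k xi) <= 3 * K * om s.
Proof.
have mds xi : `|md (A * `|s|) xi| = md (A * `|s|) xi by rewrite ger0_norm// md_ge0.
have [] := @two_terms (fun r => cosr a1 (t + s) r - cosr a1 t r)
  (fun r => cosr a2 (t + s) r - cosr a2 t r)
  (fun r => sinr a1 (t + s) r - sinr a1 t r) (fun r => sinr a2 (t + s) r - sinr a2 t r)
  h0 h1 (fun l xi => md (A * `|s|) xi * h0 l xi) (fun l xi => A * `|s| * h1 l xi) k
  (fun xi => WU (t + s) k xi - WU t k xi) _ K0.
- by move=> xi; rewrite /WU opprD addrACA !MAB.
- by split; apply: mB; (exact: measurable_cosr || exact: measurable_sinr).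
- exact: m0.
- exact: m1.
- move=> l xi; apply: (@bd _ 1 _ (md (A * `|s|) xi)) => //.
  by rewrite mul1r mds; exact: cosr_diff a10 le1 _ _ _ (enorm_ge0 xi).
- move=> l xi; apply: (@bd _ 1 _ (md (A * `|s|) xi)) => //.
  by rewrite mul1r mds; exact: cosr_diff a20 le2 _ _ _ (enorm_ge0 xi).
- move=> l xi; apply: (@bd _ A^-1 _ (A * `|s|)) => //; last by rewrite invr_ge0 ltW.
  rewrite (ger0_norm (As s)) mulKf ?gt_eqF//; exact: sinr_diff a10 _ _ _ (enorm_ge0 xi).
- move=> l xi; apply: (@bd _ A^-1 _ (A * `|s|)) => //; last by rewrite invr_ge0 ltW.
  rewrite (ger0_norm (As s)) mulKf ?gt_eqF//; exact: sinr_diff a20 _ _ _ (enorm_ge0 xi).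
- by move=> l; exact: L2_md.
- by move=> l; exact: L2Z.
move=> LF nF; split=> //; apply: le_trans nF _; rewrite ler_wpM2l ?mulr_ge0//.
apply: ler_sum => l _; rewrite nmZ// (ger0_norm (As s)).
by rewrite lerD2r -!addrA lerDl !addr_ge0 ?nm_ge0.
Qed.

Let om_r s : \sum_l (nm (fun xi => md (A * `|s|) xi * (enorm xi * h0 l xi)) +
  nm (fun xi => md (A * `|s|) xi * h1 l xi)) <= om s.
Proof.
apply: ler_sum => l _; have dd : 0 <= A * `|s| * nm (h1 l) by rewrite mulr_ge0 ?nm_ge0.
by have := nm_ge0 leb (fun xi => md (A * `|s|) xi * h0 l xi); lra.
Qed.


Lemma WU_diff_H1 t s k j : L2 (fun xi => tnth xi j * (WU (t + s) k xi - WU t k xi)) /\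
  nm (fun xi => tnth xi j * (WU (t + s) k xi - WU t k xi)) <= 3 * K * om s.
Proof.
have mds xi : `|md (A * `|s|) xi| = md (A * `|s|) xi by rewrite ger0_norm// md_ge0.
have [] := @two_terms (fun r => cosr a1 (t + s) r - cosr a1 t r)
  (fun r => cosr a2 (t + s) r - cosr a2 t r)
  (fun r => sinr a1 (t + s) r - sinr a1 t r) (fun r => sinr a2 (t + s) r - sinr a2 t r)
  (fun l xi => tnth xi j * h0 l xi) (fun l xi => tnth xi j * h1 l xi)
  (fun l xi => md (A * `|s|) xi * (enorm xi * h0 l xi)) (fun l xi => md (A * `|s|) xi * h1 l xi) k
  (fun xi => tnth xi j * (WU (t + s) k xi - WU t k xi)) _ K0.
- by move=> xi; rewrite /WU opprD addrACA !MAB mulrDr !(MA_scale (fun xi => tnth xi j)).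
- by split; apply: mB; (exact: measurable_cosr || exact: measurable_sinr).
- exact: mq.
- exact: mq.
- move=> l xi; rewrite mulrCA; apply: le_trans (coord_r _ _ _) _; rewrite mulrCA.
  apply: (@bd _ 1 _ (md (A * `|s|) xi)) => //.
  by rewrite mul1r mds; exact: cosr_diff a10 le1 _ _ _ (enorm_ge0 xi).
- move=> l xi; rewrite mulrCA; apply: le_trans (coord_r _ _ _) _; rewrite mulrCA.
  apply: (@bd _ 1 _ (md (A * `|s|) xi)) => //.
  by rewrite mul1r mds; exact: cosr_diff a20 le2 _ _ _ (enorm_ge0 xi).
- move=> l xi; rewrite mulrCA; apply: le_trans (coord_r _ _ _) _; rewrite [X in `|X| <= _]mulrA.
  apply: (@bd _ a1^-1 _ (md (A * `|s|) xi)) => //; last 2 first.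
  + by rewrite invr_ge0 ltW.
  + exact: le_trans le1' KA'.
  rewrite normrM (ger0_norm (enorm_ge0 xi)) mds; exact: sinr_diff_r a10 le1 _ _ _ (enorm_ge0 xi).
- move=> l xi; rewrite mulrCA; apply: le_trans (coord_r _ _ _) _; rewrite [X in `|X| <= _]mulrA.
  apply: (@bd _ a2^-1 _ (md (A * `|s|) xi)) => //; last 2 first.
  + by rewrite invr_ge0 ltW.
  + exact: le_trans le2' KA'.
  rewrite normrM (ger0_norm (enorm_ge0 xi)) mds; exact: sinr_diff_r a20 le2 _ _ _ (enorm_ge0 xi).
- by move=> l; exact: L2_md.
- by move=> l; exact: L2_md.
move=> LF nF; split=> //; apply: le_trans nF _; rewrite ler_wpM2l ?mulr_ge0//.
Qed.

Lemma WV_diff t s k : L2 (fun xi => WV (t + s) k xi - WV t k xi) /\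
  nm (fun xi => WV (t + s) k xi - WV t k xi) <= 3 * K * om s.
Proof.
have mds xi : `|md (A * `|s|) xi| = md (A * `|s|) xi by rewrite ger0_norm// md_ge0.
have [] := @two_terms (fun r => dcosr a1 (t + s) r - dcosr a1 t r)
  (fun r => dcosr a2 (t + s) r - dcosr a2 t r)
  (fun r => dsinr a1 (t + s) r - dsinr a1 t r) (fun r => dsinr a2 (t + s) r - dsinr a2 t r)
  h0 h1 (fun l xi => md (A * `|s|) xi * (enorm xi * h0 l xi)) (fun l xi => md (A * `|s|) xi * h1 l xi) k
  (fun xi => WV (t + s) k xi - WV t k xi) _ K0.
- by move=> xi; rewrite /WV opprD addrACA !MAB.
- by split; apply: mB; (exact: measurable_dcosr || exact: measurable_dsinr).
- exact: m0.
- exact: m1.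
- move=> l xi; apply: (@bd _ A _ (enorm xi * md (A * `|s|) xi)) => //; last 2 first.
  + exact: ltW.
  + by ring.
  rewrite normrM (ger0_norm (enorm_ge0 xi)) mds mulrA; exact: dcosr_diff a10 le1 _ _ _ (enorm_ge0 xi).
- move=> l xi; apply: (@bd _ A _ (enorm xi * md (A * `|s|) xi)) => //; last 2 first.
  + exact: ltW.
  + by ring.
  rewrite normrM (ger0_norm (enorm_ge0 xi)) mds mulrA; exact: dcosr_diff a20 le2 _ _ _ (enorm_ge0 xi).
- move=> l xi; apply: (@bd _ 1 _ (md (A * `|s|) xi)) => //.
  by rewrite mul1r mds; exact: dsinr_diff a10 le1 _ _ _ (enorm_ge0 xi).
- move=> l xi; apply: (@bd _ 1 _ (md (A * `|s|) xi)) => //.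
  by rewrite mul1r mds; exact: dsinr_diff a20 le2 _ _ _ (enorm_ge0 xi).
- by move=> l; exact: L2_md.
- by move=> l; exact: L2_md.
move=> LF nF; split=> //; apply: le_trans nF _; rewrite ler_wpM2l ?mulr_ge0//.
Qed.

Lemma WU_quot t s k : s != 0 ->
  nm (fun xi => s^-1 * (WU (t + s) k xi - WU t k xi) - WV t k xi) <= 3 * K * om s.
Proof.
move=> s0.
have mds xi : `|md (A * `|s|) xi| = md (A * `|s|) xi by rewrite ger0_norm// md_ge0.
have [] := @two_terms (fun r => s^-1 * (cosr a1 (t + s) r - cosr a1 t r) - dcosr a1 t r)
  (fun r => s^-1 * (cosr a2 (t + s) r - cosr a2 t r) - dcosr a2 t r)
  (fun r => s^-1 * (sinr a1 (t + s) r - sinr a1 t r) - dsinr a1 t r)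
  (fun r => s^-1 * (sinr a2 (t + s) r - sinr a2 t r) - dsinr a2 t r)
  h0 h1 (fun l xi => md (A * `|s|) xi * (enorm xi * h0 l xi)) (fun l xi => md (A * `|s|) xi * h1 l xi) k
  (fun xi => s^-1 * (WU (t + s) k xi - WU t k xi) - WV t k xi) _ K0.
- move=> xi.
  have Z phi psi (h : 'I_n -> E -> R) : s^-1 * MA phi psi h k xi =
      MA (fun r => s^-1 * phi r) (fun r => s^-1 * psi r) h k xi.
    have := MA_lin s^-1 0 phi psi phi psi h k xi; rewrite mul0r addr0 => ->.
    by apply: MA_ext => //; rewrite mul0r addr0.
  have ar (a b a' b' v w : R) : s^-1 * (a + b - (a' + b')) - (v + w) =
      s^-1 * (a - a') - v + (s^-1 * (b - b') - w) by ring.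
  by rewrite /WU /WV ar !MAB !Z !MAB.
- split; apply: mB; do ?[exact: measurable_dcosr|exact: measurable_dsinr];
  apply: measurable_funM => //; apply: mB; (exact: measurable_cosr || exact: measurable_sinr).
- exact: m0.
- exact: m1.
- move=> l xi; apply: (@bd _ A _ (enorm xi * md (A * `|s|) xi)) => //; last 2 first.
  + exact: ltW.
  + by ring.
  rewrite normrM (ger0_norm (enorm_ge0 xi)) mds mulrA; exact: cosr_quot a10 le1 _ _ _ s0 (enorm_ge0 xi).
- move=> l xi; apply: (@bd _ A _ (enorm xi * md (A * `|s|) xi)) => //; last 2 first.
  + exact: ltW.
  + by ring.
  rewrite normrM (ger0_norm (enorm_ge0 xi)) mds mulrA; exact: cosr_quot a20 le2 _ _ _ s0 (enorm_ge0 xi).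
- move=> l xi; apply: (@bd _ 1 _ (md (A * `|s|) xi)) => //.
  by rewrite mul1r mds; exact: sinr_quot a10 le1 _ _ _ s0 (enorm_ge0 xi).
- move=> l xi; apply: (@bd _ 1 _ (md (A * `|s|) xi)) => //.
  by rewrite mul1r mds; exact: sinr_quot a20 le2 _ _ _ s0 (enorm_ge0 xi).
- by move=> l; exact: L2_md.
- by move=> l; exact: L2_md.
move=> LF nF; apply: le_trans nF _; rewrite ler_wpM2l ?mulr_ge0//.
Qed.

Lemma om_small (e : R) : 0 < e -> exists2 d, 0 < d & forall s, `|s| <= d -> 3 * K * om s <= e.
Proof.
move=> e0; have K3 : 0 < 3 * K by rewrite mulr_gt0// (lt_le_trans ltr01).
have [d d0 H] := omega_small L0 L1 Lr (divr_gt0 e0 K3).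
exists (d / A); first exact: divr_gt0.
move=> s; rewrite ler_pdivlMr// mulrC => sd.
have := H (A * `|s|); rewrite As sd => /(_ isT).
by rewrite ler_pdivlMr// mulrC.
Qed.

End evolution.

Lemma ecvg0 (R : realType) (T : Type) (F : set_system T) (FF : Filter F) (N : T -> \bar R) :
  (forall e : R, 0 < e -> F [set t | exists2 r : R, N t = r%:E & 0 <= r <= e]) ->
  N @ F --> 0%E.
Proof.
move=> H; apply/fine_cvgP; split.
  by apply: filterS (H 1 ltr01) => t [r -> _].
apply/cvgrPdist_le => e e0; apply: filterS (H e e0) => t [r E /andP[r0 re]] /=.
by rewrite E /= sub0r normrN ger0_norm.
Qed.

(** * Existence, regularity and the equation *)

Section solution.
Context (R : realType) (n : nat) (lam mu : R).
Hypotheses (hlam : 0 < lam + 2 * mu) (hmu : 0 < mu).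
Local Notation E := (Rn R n).
Local Notation leb := (lebesgue_Rn R n).
Local Notation L2 := (L2 leb).
Local Notation nm := (nm leb).
Local Notation ip := (ip leb).
Local Notation itg := (itg leb).
Local Notation int := (int leb).
Local Notation cP := (@cP R n).
Local Notation a1 := (Num.sqrt (lam + 2 * mu)).
Local Notation a2 := (Num.sqrt mu).
Implicit Types (xi : E) (j k l : 'I_n) (t s : R).
Variables (f0 f1 : 'I_n -> E -> R).
Hypotheses (H0 : forall k, L12 (f0 k)) (H1 : forall k, L12 (f1 k))
  (Hd : forall k j, L2 (fun xi => tnth xi j * hart (f0 k) xi)).

Let h0 k := hart (f0 k).
Let h1 k := hart (f1 k).
Let L0 l : L2 (h0 l). Proof. exact: (hart_isometry (H0 l)).1. Qed.
Let L1 l : L2 (h1 l). Proof. exact: (hart_isometry (H1 l)).1. Qed.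
Let a10 : 0 < a1. Proof. by rewrite sqrtr_gt0. Qed.
Let a20 : 0 < a2. Proof. by rewrite sqrtr_gt0. Qed.

Let Lr l : L2 (fun xi => enorm xi * h0 l xi).
Proof.
split; first by apply: measurable_funM; [exact: measurable_enorm|exact: (L0 l).1].
apply: itg_ext (itg_sum (index_enum 'I_n) (fun j => (Hd l j).2)) => xi /=.
by rewrite exprMn enorm_sq mulr_suml; apply: eq_bigr => j _; rewrite exprMn.
Qed.

Local Notation WU_of := WU.
Local Notation WU := (WU a1 a2 h0 h1).
Local Notation WV_of := WV.
Local Notation WV := (WV a1 a2 h0 h1).

Lemma hartL2_nm_inv (f g : E -> R) : hartL2 f g -> nm f = (Num.sqrt cP)^-1 * nm g.
Proof. by move=> h; rewrite (hartL2_nm h) mulKf// gt_eqF// sqrtr_gt0 cP_gt0. Qed.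

Let cPV0 : 0 < (Num.sqrt cP)^-1. Proof. by rewrite invr_gt0 sqrtr_gt0 cP_gt0. Qed.

Lemma solution_exists : exists u v : R -> 'I_n -> E -> R,
  forall t k, hartL2 (u t k) (WU t k) /\ hartL2 (v t k) (WV t k).
Proof.
have /choice[u Hu] : forall tk : R * 'I_n, exists f, hartL2 f (WU tk.1 tk.2).
  by move=> tk; apply: hartL2_surj; exact: WU_L2.
have /choice[v Hv] : forall tk : R * 'I_n, exists f, hartL2 f (WV tk.1 tk.2).
  by move=> tk; apply: hartL2_surj; exact: WV_L2.
by exists (fun t k => u (t, k)), (fun t k => v (t, k)) => t k; split; [exact: (Hu (t, k))|exact: (Hv (t, k))].
Qed.

Variables (u v : R -> 'I_n -> E -> R).
Hypotheses (Hu : forall t, 0 <= t -> forall k, hartL2 (u t k) (WU t k))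
  (Hv : forall t k, hartL2 (v t k) (WV t k)).

Let om_le (e K : R) : 0 < e -> 0 < K -> exists2 d, 0 < d & forall s, `|s| <= d ->
  K * (3 * (a1 + a2 + (a1^-1 + a2^-1) + (a1 + a2)^-1 + 1) * omega h0 h1 ((a1 + a2) * `|s|)) <= e.
Proof.
move=> e0 K0; have [d d0 H] := om_small a10 a20 L0 L1 Lr (divr_gt0 e0 K0).
by exists d => // s /H; rewrite ler_pdivlMr// mulrC.
Qed.

Let near_within (P : R -> Prop) t0 d : 0 < d ->
  (forall t, 0 <= t -> `|t - t0| <= d -> P t) -> within [set t | 0 <= t] (nbhs t0) P.
Proof.
move=> d0 H; apply/nbhs_ballP; exists d => //= t; rewrite /ball /= distrC => /ltW td t0'.
exact: H.
Qed.

Lemma solution_C_H1 : in_C_H1 u.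
Proof.
split.
  by move=> t t0 k; apply: (H1_hart (Hu t0 k) (fun j => _)).1 => j; exact: WU_H1.
move=> t0 t00 k; apply: ecvg0 => e e0.
(* The function itself and its n derivatives. *)
have K0 : 0 < (Num.sqrt cP)^-1 * n.+1%:R by rewrite mulr_gt0.
have [d d0 H] := om_le e0 K0.
apply: (near_within d0) => t t1 td.
have hB := hartL2B (Hu t1 k) (Hu t00 k).
have tE : t0 + (t - t0) = t by rewrite addrC subrK.
have D j := WU_diff_H1 a10 a20 L0 L1 Lr t0 (t - t0) k j.
have D0 := WU_diff a10 a20 L0 L1 t0 (t - t0) k.
rewrite tE in D D0.
have [_ [r [E r0 rle]]] := H1_hart hB (fun j => (D j).1).
exists r => //; rewrite r0 /=; apply: le_trans rle _; apply: le_trans (H _ td).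
rewrite -[leRHS]mulrA ler_wpM2l ?(ltW cPV0)//.
set X := 3 * _ * _ in D D0 *; rewrite -(natr1 n) [leRHS]mulrDl [1 * X]mul1r [leRHS]addrC.
apply: lerD; first exact: D0.2.
apply: le_trans (ler_sum _ (fun j _ => (D j).2)) _.
by rewrite sumr_const card_ord mulr_natl.
Qed.

Let L2_cont (w : R -> 'I_n -> E -> R) (W : R -> 'I_n -> E -> R) :
  (forall t, 0 <= t -> forall k, hartL2 (w t k) (W t k)) ->
  (forall t s k, nm (fun xi => W (t + s) k xi - W t k xi) <=
    3 * (a1 + a2 + (a1^-1 + a2^-1) + (a1 + a2)^-1 + 1) * omega h0 h1 ((a1 + a2) * `|s|)) ->
  in_C_L2 w.
Proof.
move=> Hw HW; split.
  by move=> t t0 k; apply/in_L2P; have [] := Hw t t0 k.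
move=> t0 t00 k; apply: ecvg0 => e e0.
have [d d0 H] := om_le e0 cPV0.
apply: (near_within d0) => t t1 td.
have hB := hartL2B (Hw t t1 k) (Hw t0 t00 k); have [LB _ _] := hB.
exists (nm (fun x => w t k x - w t0 k x)); first exact: L2norm_nm.
rewrite nm_ge0 /= (hartL2_nm_inv hB); apply: le_trans (H _ td).
rewrite ler_wpM2l ?(ltW cPV0)//.
by have := HW t0 (t - t0) k; rewrite [t0 + _]addrC subrK.
Qed.

Lemma solution_C1_L2 : in_C1_L2 u v.
Proof.
split.
- apply: L2_cont Hu _ => t s k; exact: (WU_diff a10 a20 L0 L1 t s k).2.
- by apply: L2_cont (fun t _ => Hv t) _ => t s k; exact: (WV_diff a10 a20 L0 L1 Lr t s k).2.
- move=> t0 t00 k; apply: ecvg0 => e e0.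
  have [d d0 H] := om_le e0 cPV0.
  apply/nbhs_ballP; exists d => //= s; rewrite /ball /= sub0r normrN => /ltW sd s0 ts0.
  have hB := hartL2B (hartL2Z s^-1 (hartL2B (Hu ts0 k) (Hu t00 k))) (Hv t0 k).
  have [LB _ _] := hB.
  exists (nm (fun x => s^-1 * (u (t0 + s) k x - u t0 k x) - v t0 k x)); first exact: L2norm_nm.
  rewrite nm_ge0 /= (hartL2_nm_inv hB); apply: le_trans (H _ sd).
  by rewrite ler_wpM2l ?(ltW cPV0)//; apply: WU_quot.
Qed.

Let ae_of_nm (f g : E -> R) : L2 f -> L2 g -> nm (fun x => f x - g x) = 0 ->
  {ae leb, forall x, f x = g x}.
Proof.
move=> Lf Lg /(nm_ae0 (L2B Lf Lg)); apply: filterS => x /eqP.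
by rewrite subr_eq0 => /eqP.
Qed.

Lemma solution_u0 k : {ae leb, forall x, u 0 k x = f0 k x}.
Proof.
have hu := Hu (lexx 0) k; have [Lu _ _] := hu.
apply: ae_of_nm => //; first exact: (H0 k).2.
apply: hartL2_inj (hartL2_L12 (H0 k)); apply: hartL2_ext hu => // xi.
rewrite /WU_of (_ : MA _ _ h0 k xi = h0 k xi); last first.
  by rewrite -[RHS]MA_1; apply: MA_ext => //; rewrite /cosr !mul0r cos0.
rewrite (_ : MA _ _ h1 k xi = 0) ?addr0//.
by rewrite -[RHS](MA_0 h1 k xi); apply: MA_ext => //; rewrite /sinr !mul0r sin0 mul0r.
Qed.

(** Needed for the initial velocity, as [dsinr] at time 0 equals 1 only off the origin. *)
Lemma null_origin : (0 < n)%N -> {ae leb, forall xi : E, enorm xi != 0}.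
Proof.
move=> n0; exists [set x : E | forall i, [set (0 : R)] (tnth x i)]; split.
- rewrite (_ : [set _ | _] = \bigcap_(i in setT) ((fun x : E => tnth x i) @^-1` [set (0 : R)])).
    apply: fin_bigcap_measurable => [|i _]; first exact: finite_finset.
    by rewrite -[X in measurable X]setTI; exact: measurable_tnth.
  by apply/seteqP; split => x /= H i; [move=> _|]; exact: H.
- rewrite (lebesgue_Rn_box (A := fun=> [set (0 : R)]))//.
  by rewrite (bigD1 (Ordinal n0))//= lebesgue_measure_set1 mul0e.
- move=> xi /= /negP; rewrite negbK => /eqP r0 i.
  by apply/eqP; rewrite -normr_le0 -r0 coord_enorm.
Qed.

Lemma solution_v0 k : {ae leb, forall x, v 0 k x = f1 k x}.
Proof.
have hv := Hv 0 k; have [Lv LV _] := hv.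
apply: ae_of_nm => //; first exact: (H1 k).2.
apply: hartL2_inj (hartL2_L12 (H1 k)); apply: hartL2_congr hv (L1 k) _.
have n0 : (0 < n)%N := leq_ltn_trans (leq0n k) (ltn_ord k).
have m0 : measurable_fun setT (fun xi => WV 0 k xi - hart (f1 k) xi).
  by apply: measurable_funB; [exact: LV.1|exact: (L1 k).1].
have [] := @L2_ae _ _ _ leb (fun=> 0) (fun xi => WV 0 k xi - hart (f1 k) xi) _ m0 (@L2_0 _ _ _ _).
  apply: filterS (null_origin n0) => xi r0.
  rewrite /WV_of (_ : MA _ _ h0 k xi = 0); last first.
    rewrite -[RHS](MA_0 h0 k xi); apply: MA_ext => //; by rewrite /dcosr !mul0r sin0 mulr0.
  rewrite add0r (_ : MA _ _ h1 k xi = h1 k xi) ?subrr//.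
  by rewrite -[RHS]MA_1; apply: MA_ext => //; rewrite /dsinr !mul0r cos0 mul1r mulfV// mulf_neq0// gt_eqF.
by move=> _ <-; rewrite nm0.
Qed.

Local Opaque hart.

Section equation.
Variable phi : 'I_n -> 'rV[R]_n -> R.
Hypothesis tphi : forall k, test_function (phi k).

Lemma test_sum (I : Type) (s : seq I) (psi : I -> 'rV[R]_n -> R) :
  (forall i, test_function (psi i)) -> test_function (fun x => \sum_(i <- s) psi i x).
Proof.
move=> tp; elim: s => [|i s IH].
  rewrite (_ : (fun x => _) = fun=> 0); last by apply/funext => x; rewrite big_nil.
  apply/test_functionP; split; first by move=> k; exact: smooth_cst.
  by exists 0%N => x; rewrite eqxx.
rewrite (_ : (fun x => _) = fun x => psi i x + \sum_(j <- s) psi j x).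
  exact: testD.
by apply/funext => x; rewrite big_cons.
Qed.

Lemma hart_sum (I : Type) (s : seq I) (F : I -> E -> R) xi : (forall i, itg (F i)) ->
  hart (fun x => \sum_(i <- s) F i x) xi = \sum_(i <- s) hart (F i) xi.
Proof.
move=> IF; elim: s => [|i s IH].
  rewrite big_nil -[RHS](@hart0 R n xi); apply: hart_ext => x; by rewrite big_nil.
rewrite big_cons -IH -hartD//; last exact: itg_sum.
by apply: hart_ext => x; rewrite big_cons.
Qed.

Let Hp k := hart (fun x : E => phi k (vec x)).
Let Lp k : L2 (Hp k). Proof. exact: (hart_isometry (test_L12 (tphi k))).1. Qed.

Lemma hart_partial2 i j k xi :
  hart (fun x : E => partial i (partial j (phi k)) (vec x)) xi = - (tnth xi i * tnth xi j * Hp k xi).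
Proof.
rewrite hart_partial; last exact: test_partial.
rewrite hart_partial// tnth_negx negxK; rewrite /Hp; ring.
Qed.

Lemma L2_r2 k : L2 (fun xi => enorm xi ^+ 2 * Hp k xi).
Proof.
have T j : L12 (fun x : E => partial j (partial j (phi k)) (vec x)).
  by apply: test_L12; apply: test_partial; exact: test_partial.
have Lj j : L2 (hart (fun x : E => partial j (partial j (phi k)) (vec x))).
  exact: (hart_isometry (T j)).1.
apply: L2_ext (L2N (L2_sum (index_enum 'I_n) Lj)) => xi /=.
rewrite -sumrN enorm_sq mulr_suml; apply: eq_bigr => j _.
by rewrite hart_partial2 opprK expr2.
Qed.

Lemma enorm_Pr xi k l : enorm xi ^+ 2 * Pr xi k l = tnth xi k * tnth xi l.
Proof.
rewrite /Pr; have [r0|r0] := eqVneq (enorm xi) 0; last by field.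
have z i : tnth xi i = 0 by apply/eqP; rewrite -normr_le0 -r0 coord_enorm.
by rewrite !z !mul0r mulr0.
Qed.

Lemma navier_L12 k : L12 (fun x : E => navier_op lam mu phi k (vec x)).
Proof.
apply: L12D; apply: L12Z.
  by apply: (test_L12 (test_sum _ (fun j => test_partial j (test_partial j (tphi k))))).
apply: (test_L12 (test_partial k (test_sum (index_enum 'I_n) (fun j => test_partial j (tphi j))))).
Qed.

(** Two derivatives undo the reflection of [hart_partial], and [enorm_Pr] identifies the products
    xi_k xi_l with r^2 P; the coefficients match since a1^2 - a2^2 = lam + mu. *)
Lemma hart_navier k xi : hart (fun x : E => navier_op lam mu phi k (vec x)) xi =
  MA (fun r => - (a1 ^+ 2 * r ^+ 2)) (fun r => - (a2 ^+ 2 * r ^+ 2)) Hp k xi.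
Proof.
have t2 j : test_function (partial j (partial j (phi k))).
  by apply: test_partial; exact: test_partial.
have tS : test_function (fun y => \sum_j partial j (phi j) y).
  by apply: test_sum => j; exact: test_partial.
have I1 := (test_L12 (test_sum (index_enum 'I_n) t2)).1.
have I2 := (test_L12 (test_partial k tS)).1.
rewrite /navier_op hartD; [|exact: itgZ|exact: itgZ].
rewrite !hartZ// hart_partial// !hart_sum; first last.
- by move=> j; exact: (test_L12 (t2 j)).1.
- by move=> j; exact: (test_L12 (test_partial j (tphi j))).1.
have S1 : \sum_j hart (fun x : E => partial j (partial j (phi k)) (vec x)) xi =
    \sum_j - (Hp k xi * tnth xi j ^+ 2).
  apply: eq_bigr => j _; apply: eq_trans (hart_partial2 j j k xi) _.
  by rewrite expr2 mulrC.
rewrite [X in _ * X + _ = _]S1.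
have -> : \sum_j hart (fun x : E => partial j (phi j) (vec x)) (negx xi) =
    \sum_j tnth xi j * Hp j xi.
  by apply: eq_bigr => j _; rewrite hart_partial// tnth_negx negxK opprK.
rewrite /MA; under [RHS]eq_bigr => l _.
  have -> : mult (fun r => - (a1 ^+ 2 * r ^+ 2)) (fun r => - (a2 ^+ 2 * r ^+ 2)) xi k l * Hp l xi =
     - (a1 ^+ 2 - a2 ^+ 2) * tnth xi k * (tnth xi l * Hp l xi) +
     - a2 ^+ 2 * enorm xi ^+ 2 * ((k == l)%:R * Hp l xi).
    have -> : mult (fun r => - (a1 ^+ 2 * r ^+ 2)) (fun r => - (a2 ^+ 2 * r ^+ 2)) xi k l =
      - (a1 ^+ 2 - a2 ^+ 2) * (enorm xi ^+ 2 * Pr xi k l) - a2 ^+ 2 * enorm xi ^+ 2 * (k == l)%:R.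
      by rewrite /mult; ring.
    by rewrite enorm_Pr; ring.
  over.
rewrite big_split /= -!mulr_sumr sum_delta.
rewrite sumrN -mulr_sumr -enorm_sq (sqr_sqrtr (ltW hmu)) (sqr_sqrtr (ltW hlam)).
by rewrite /Hp; ring.
Qed.

Let pairing (w W s : 'I_n -> E -> R) : (forall k, hartL2 (w k) (W k)) -> (forall k, L12 (s k)) ->
  \sum_k int (fun x => w k x * s k x) = cP^-1 * int (fun xi => \sum_k W k xi * hart (s k) xi).
Proof.
move=> Hw Ls.
have L k : itg (fun xi => W k xi * hart (s k) xi).
  by apply: L2_mul; [have [] := Hw k|exact: (hart_isometry (Ls k)).1].
rewrite int_sum// mulr_sumr; apply: eq_bigr => k _.
rewrite -[int (fun xi => W k xi * _)]/(ip (W k) (hart (s k))).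
by rewrite (hartL2_ip (Hw k) (hartL2_L12 (Ls k))) mulKf// gt_eqF// cP_gt0.
Qed.

Local Notation A := (a1 + a2).

(** Parseval's identity takes both pairings to frequency space, where the symmetric multiplier of
    the operator moves from the test function onto [WU]. The second-order time expansions of the
    multipliers have the integrable majorant [G], and [der_quad] applies. *)
Lemma solution_equation t : 0 < t ->
  is_derive t (1 : R) (fun s => \sum_k \int[leb]_x (v s k x * phi k (vec x)))
    (\sum_k \int[leb]_x (u t k x * navier_op lam mu phi k (vec x))).
Proof.
move=> t0.
pose psi a r : R := - (a ^+ 2 * r ^+ 2).
pose J s xi := \sum_k WV s k xi * Hp k xi.
pose D xi := \sum_k WU t k xi * hart (fun x : E => navier_op lam mu phi k (vec x)) xi.
have E1 s : \sum_k \int[leb]_x (v s k x * phi k (vec x)) = cP^-1 * int (J s).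
  exact: (pairing (Hv s) (fun k => test_L12 (tphi k))).
have E2 : \sum_k \int[leb]_x (u t k x * navier_op lam mu phi k (vec x)) = cP^-1 * int D.
  exact: (pairing (Hu (ltW t0)) navier_L12).
rewrite E2 (funext E1).
have IJ s : itg (J s).
  apply: itg_sum => k; apply: L2_mul => //; exact: WV_L2.
have ID : itg D.
  apply: itg_sum => k; apply: L2_mul; [exact: WU_L2|exact: (hart_isometry (navier_L12 k)).1].
pose G xi := \sum_k \sum_l (3 * (A ^+ 3 * `|enorm xi * h0 l xi| * `|enorm xi ^+ 2 * Hp k xi|) +
   3 * (A ^+ 2 * `|h1 l xi| * `|enorm xi ^+ 2 * Hp k xi|)).
have IG : itg G.
  apply: itg_sum => k; apply: itg_sum => l; have L3 := L2_abs (L2_r2 k).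
  by apply: itgD; apply: itgZ; apply: L2_mul => //; apply: L2Z; exact: L2_abs.
have le1 : a1 <= A by rewrite lerDl ltW.
have le2 : a2 <= A by rewrite lerDr ltW.
apply: (@der_quad _ _ _ _ (cP^-1 * int G)) => s _.
have ar (c x y z : R) : c * x - c * y - s * (c * z) = c * (x - y - s * z) by ring.
rewrite ar.
rewrite -intB// -(intZ s ID) -intB; [|exact: itgB|exact: itgZ].
rewrite normrM ger0_norm ?invr_ge0 ?(ltW (cP_gt0 _ _))// -mulrA.
rewrite ler_wpM2l ?invr_ge0 ?(ltW (cP_gt0 _ _))// mulrC -(intZ _ IG).
have IX : itg (fun xi => J (t + s) xi - J t xi - s * D xi).
  by apply: itgB; [exact: itgB|exact: itgZ].
apply: le_trans (int_abs IX) _; apply: int_le; [exact: itg_abs|exact: itgZ|move=> xi /=].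
have r0 := enorm_ge0 xi.
pose eta a r : R := dcosr a (t + s) r - dcosr a t r + s * (a ^+ 2 * r ^+ 2) * cosr a t r.
pose zeta a r : R := dsinr a (t + s) r - dsinr a t r + s * (a ^+ 2 * r ^+ 2) * sinr a t r.
have -> : J (t + s) xi - J t xi - s * D xi =
   \sum_k (MA (eta a1) (eta a2) h0 k xi + MA (zeta a1) (zeta a2) h1 k xi) * Hp k xi.
  rewrite /D; under [\sum_k WU t k xi * _]eq_bigr do rewrite hart_navier.
  rewrite MA_adj /J mulr_sumr -!sumrB; apply: eq_bigr => k _.
  have -> : MA (psi a1) (psi a2) (WU t) k xi =
     MA (fun r => psi a1 r * cosr a1 t r) (fun r => psi a2 r * cosr a2 t r) h0 k xi +
     MA (fun r => psi a1 r * sinr a1 t r) (fun r => psi a2 r * sinr a2 t r) h1 k xi.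
    rewrite -!MA_comp /MA -big_split; apply: eq_bigr => l _ /=.
    by rewrite /WU_of mulrDr.
  rewrite mulrA -!mulrBl; congr (_ * _).
  rewrite /WV_of /MA mulrDr !mulr_sumr opprD.
  rewrite -!big_split /= -!sumrN -!big_split /=; apply: eq_bigr => l _.
  by rewrite /mult /eta /zeta /psi; ring.
rewrite /G mulr_sumr; apply: le_trans (ler_norm_sum _ _ _) _; apply: ler_sum => k _.
rewrite normrM; apply: le_trans (ler_wpM2r (normr_ge0 _) (ler_normD _ _)) _.
rewrite mulrDl mulr_sumr.
have M (f1' f2' : R -> R) (h : 'I_n -> E -> R) (b : 'I_n -> R) :
   (forall l, `|f1' (enorm xi) * h l xi| <= b l) -> (forall l, `|f2' (enorm xi) * h l xi| <= b l) ->
   `|MA f1' f2' h k xi| <= \sum_l 3 * b l.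
  move=> b1 b2; apply: le_trans (ler_norm_sum _ _ _) _; apply: ler_sum => l _.
  exact: mult_le.
apply: le_trans (lerD (ler_wpM2r (normr_ge0 _) (M _ _ _ (fun l => A ^+ 3 * enorm xi ^+ 3 * s ^+ 2 * `|h0 l xi|) _ _))
    (ler_wpM2r (normr_ge0 _) (M _ _ _ (fun l => A ^+ 2 * enorm xi ^+ 2 * s ^+ 2 * `|h1 l xi|) _ _))) _.
- by move=> l; rewrite normrM ler_wpM2r//; exact: dcosr_quad.
- by move=> l; rewrite normrM ler_wpM2r//; exact: dcosr_quad.
- by move=> l; rewrite normrM ler_wpM2r//; exact: dsinr_quad.
- by move=> l; rewrite normrM ler_wpM2r//; exact: dsinr_quad.
rewrite !mulr_suml -big_split /=; apply: ler_sum => l _.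
rewrite !normrM ?normrX !(ger0_norm r0).
by rewrite le_eqVlt; apply/orP; left; apply/eqP; ring.
Qed.

End equation.

Local Transparent hart.

Lemma solution_solves : solves_cauchy lam mu f0 f1 u v.
Proof.
split; [exact: solution_u0|exact: solution_v0|].
by move=> phi tphi t t0; exact: solution_equation.
Qed.

End solution.

(** * Upper bound *)

Section dyadic.
Context (R : realType) (n : nat).
Local Notation E := (Rn R n).
Local Notation leb := (lebesgue_Rn R n).
Local Notation L2 := (L2 leb).
Local Notation nm := (nm leb).
Local Notation itg := (itg leb).
Local Notation int := (int leb).
Implicit Types (xi : E) (k K : nat) (t a : R).

Definition dyad k : set E := box (fun=> - (2^-1) ^+ k) (fun=> (2^-1) ^+ k).

Lemma int_dyad k : int \1_(dyad k) = (2 * 2^-1 ^+ k) ^+ n.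
Proof.
have p : 0 <= 2^-1 ^+ k :> R by rewrite exprn_ge0// invr_ge0.
rewrite int_indic; last exact: measurable_box.
rewrite leb_box => [|i]; last by rewrite (le_trans _ p)// oppr_le0.
by rewrite /= prodr_const card_ord opprK mulrDl mul1r.
Qed.

Lemma dyad_out k xi : ~ dyad k xi -> 2^-1 ^+ k <= enorm xi.
Proof.
move=> /existsNP[i /negP]; rewrite negb_and -leNgt -ltNge => h.
apply: le_trans (coord_enorm xi i).
by case/orP: h => h; rewrite ler_normr; apply/orP; [right; rewrite lerNr|left; exact: ltW].
Qed.

Lemma dyad_shell K xi : dyad 0 xi -> dyad K xi \/ exists2 k, (k < K)%N & dyad k xi /\ ~ dyad k.+1 xi.
Proof.
move=> x0; elim: K => [|K [IH|[k kK H]]]; first by left.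
  have [h|h] := pselect (dyad K.+1 xi); first by left.
  by right; exists K.
by right; exists k => //; exact: ltnW.
Qed.

(** The number of shells: large enough for the innermost cube, of half side 2^-K, to be smaller than
    the scale 1/t, and at most a multiple of ln (t + 2). *)
Lemma log2_scale t : 0 <= t -> exists K, t + 2 <= 2 ^+ K /\ K%:R * ln 2 <= 2 * ln (t + 2).
Proof.
move=> t0.
have ex : exists K, t + 2 < 2 ^+ K.
  exists (Num.truncn (t + 2)).+1; apply: lt_le_trans (truncnS_gt _) _.
  by rewrite -natrX ler_nat ltnW// ltn_expl.
case: (ex_minnP ex) => K hK min; exists K; split; first exact: ltW.
have t2 : 0 < t + 2 by rewrite ltr_wpDl.
have l2 : ln 2 <= ln (t + 2) by rewrite ler_ln ?posrE// lerDr.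
case: K hK min => [|K] _ min; first by rewrite mul0r mulr_ge0// (le_trans _ l2)// ln_ge0// ler1n.
have h2 : 2 ^+ K <= t + 2 by rewrite leNgt; apply/negP => /min; rewrite ltnn.
have : ln (2 ^+ K) <= ln (t + 2) by rewrite ler_ln ?posrE ?exprn_gt0.
rewrite lnXn// -[_ *+ K]mulr_natl => h.
rewrite -(natr1 K) mulrDl mul1r; apply: le_trans (lerD h l2) _.
by rewrite le_eqVlt; apply/orP; left; apply/eqP; ring.
Qed.

Definition log_factor t : R := if n == 2 then Num.sqrt (ln (t + 2)) else 1.

(** Low-frequency part of [sinr]. Outside the cube [dyad 0] one has r >= 1, and [sinr] is at most
    1/a. *)
Definition sigma a t xi : R := sinr a t (enorm xi) * \1_(dyad 0) xi.

Lemma measurable_sigma a t : measurable_fun setT (sigma a t).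
Proof.
apply: measurable_funM; last exact: measurable_indicR (measurable_box _ _).
exact: (measurableT_comp (measurable_sinr a t) (@measurable_enorm R n)).
Qed.

Lemma indic_ge0 (A : set E) xi : 0 <= \1_A xi :> R.
Proof. by rewrite indicE. Qed.

(** Majorant of [sigma] squared: between [dyad k] and [dyad k.+1], r is at least 2^-(k+1), hence
    a^-2 4^(k+1); in the innermost cube [sinr] is at most t. Shells are enlarged to full cubes,
    whose volumes are explicit. *)
Definition sigma_major a t K xi : R :=
  \sum_(k < K) (a^-1) ^+ 2 * 4 ^+ k.+1 * \1_(dyad k) xi + t ^+ 2 * \1_(dyad K) xi.

Lemma itg_dyad k : itg (\1_(dyad k) : E -> R).
Proof. exact: (L12_box _ _).1. Qed.

Lemma sigma_le a t K xi : 0 < a -> sigma a t xi ^+ 2 <= sigma_major a t K xi.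
Proof.
move=> a0; rewrite /sigma /sigma_major.
have s0 : 0 <= \sum_(k < K) (a^-1) ^+ 2 * 4 ^+ k.+1 * \1_(dyad k) xi.
  apply: sumr_ge0 => k _; apply: mulr_ge0; last exact: indic_ge0.
  by rewrite mulr_ge0 ?sqr_ge0 ?exprn_ge0.
have [x0|x0] := pselect (dyad 0 xi); last first.
  by rewrite [X in (_ * X) ^+ 2]indicE memNset// mulr0 expr0n addr_ge0// mulr_ge0 ?sqr_ge0 ?indic_ge0.
rewrite [X in (_ * X) ^+ 2]indicE mem_set// mulr1 -real_normK ?num_real//.
have r0 := enorm_ge0 xi.
have [xK|[k kK [xk xk1]]] := dyad_shell K x0.
  apply: (@le_trans _ _ (t ^+ 2 * \1_(dyad K) xi)); last by rewrite lerDr.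
  rewrite indicE mem_set// mulr1 -(real_normK (num_real t)).
  by rewrite lerXn2r// ?nnegrE//; exact: sinr_le.
apply: (@le_trans _ _ ((a^-1) ^+ 2 * 4 ^+ k.+1)); last first.
  rewrite (bigD1 (Ordinal kK))//= [X in _ * X + _]indicE mem_set// mulr1 -addrA lerDl addr_ge0//.
    apply: sumr_ge0 => l _; apply: mulr_ge0; last exact: indic_ge0.
    by rewrite mulr_ge0 ?sqr_ge0 ?exprn_ge0.
  by rewrite mulr_ge0 ?sqr_ge0 ?indic_ge0.
have -> : (a^-1) ^+ 2 * 4 ^+ k.+1 = (a^-1 * 2 ^+ k.+1) ^+ 2 :> R.
  have pow4 m : 4 ^+ m = (2 ^+ m) ^+ 2 :> R by rewrite -exprM mulnC exprM; congr (_ ^+ _); rewrite -natrX.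
  by rewrite [RHS]exprMn pow4.
rewrite lerXn2r ?nnegrE// ?mulr_ge0 ?invr_ge0 ?(ltW a0) ?exprn_ge0//.
have h := dyad_out xk1; have rp : 0 < enorm xi by apply: lt_le_trans h; rewrite exprn_gt0// invr_gt0.
have := sinr_le_r a0 t r0; rewrite -ler_pdivlMl// => h2; apply: le_trans h2 _.
rewrite mulrC ler_wpM2l ?invr_ge0 ?(ltW a0)//.
by rewrite -[leRHS]invrK lef_pV2// ?posrE ?invr_gt0 ?exprn_gt0// -exprVn.
Qed.

Lemma itg_major a t K : itg (sigma_major a t K).
Proof.
apply: itgD; last by apply: itgZ; exact: itg_dyad.
by apply: itg_sum => k; apply: itgZ; exact: itg_dyad.
Qed.

Lemma int_major a t K : int (sigma_major a t K) =
  \sum_(k < K) (a^-1) ^+ 2 * 4 ^+ k.+1 * (2 * 2^-1 ^+ k) ^+ n + t ^+ 2 * (2 * 2^-1 ^+ K) ^+ n.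
Proof.
have Ik k : itg (fun xi : E => (a^-1) ^+ 2 * 4 ^+ k.+1 * \1_(dyad k) xi).
  by apply: itgZ; exact: itg_dyad.
rewrite intD; [|by apply: itg_sum => k; exact: Ik|by apply: itgZ; exact: itg_dyad].
rewrite int_sum => [|k]; last exact: Ik.
rewrite intZ; last exact: itg_dyad.
rewrite int_dyad; congr (_ + _); apply: eq_bigr => k _.
by rewrite intZ ?int_dyad//; exact: itg_dyad.
Qed.

Lemma sigma_bound a : (2 <= n)%N -> 0 < a -> exists2 c, 0 < c & forall t, 0 <= t ->
  L2 (sigma a t) /\ nm (sigma a t) <= c * log_factor t.
Proof.
move=> n2 a0; have ai : 0 <= (a^-1) ^+ 2 :> R by exact: sqr_ge0.
have l2 : 0 < ln 2 :> R by rewrite ln_gt0// ltr1n.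
(* For n = 2: 32 is 16 per shell times the 2 of [log2_scale], and 4 bounds the innermost cube. For n
   >= 3: 8 * 2^n is 4 * 2^n times the sum 2 of the geometric series, and the last term bounds the
   innermost cube. *)
pose c2 := ((a^-1) ^+ 2 * 32 + 4) / ln 2 + 8 * 2 ^+ n * (a^-1) ^+ 2 + 2 ^+ n.
have c20 : 0 < c2.
  have p1 : 0 <= (a^-1) ^+ 2 * 32 + 4 by rewrite addr_ge0// mulr_ge0.
  have p2 : 0 <= 8 * 2 ^+ n * (a^-1) ^+ 2 by apply: mulr_ge0 => //; apply: mulr_ge0 => //; exact: exprn_ge0.
  by rewrite ltr_wpDl ?exprn_gt0// addr_ge0// divr_ge0// ltW.
exists (Num.sqrt c2); first by rewrite sqrtr_gt0.
move=> t t0; have [K [hK1 hK2]] := log2_scale t0.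
have LS : L2 (sigma a t).
  split; first exact: measurable_sigma.
  apply: (itg_le _ _ (itg_major a t K)).
    by apply: measurable_funX; exact: measurable_sigma.
  by move=> xi; rewrite ger0_norm ?sqr_ge0// sigma_le.
split=> //.
have nS : nm (sigma a t) ^+ 2 <= int (sigma_major a t K).
  rewrite nm_sqE; apply: int_le; [exact: L2_itg|exact: itg_major|move=> xi; exact: sigma_le].
rewrite int_major in nS.
have p2 : 0 < 2 ^+ K :> R by rewrite exprn_gt0.
have tK : t * 2^-1 ^+ K <= 1.
  by rewrite exprVn ler_pdivrMr// mul1r; apply: le_trans hK1; rewrite lerDl.
have h01 k : 0 <= (2^-1 : R) ^+ k <= 1.
  by rewrite exprn_ge0 ?invr_ge0//= exprn_ile1 ?invr_ge0// invf_le1// ler1n.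
have tail : t ^+ 2 * (2 * 2^-1 ^+ K) ^+ n <= 2 ^+ n.
  rewrite exprMn mulrCA ler_piMr ?exprn_ge0//.
  have /andP[q0 q1] := h01 K.
  apply: (@le_trans _ _ (t ^+ 2 * (2^-1 ^+ K) ^+ 2)).
    by rewrite ler_wpM2l ?sqr_ge0// ler_wiXn2l.
  by rewrite -exprMn exprn_ile1 ?mulr_ge0.
have ge0 : 0 <= Num.sqrt c2 * log_factor t.
  by rewrite mulr_ge0 ?sqrtr_ge0// /log_factor; case: ifP => // _; exact: sqrtr_ge0.
rewrite -(@ler_pXn2r _ 2)// ?nnegrE ?nm_ge0// exprMn (sqr_sqrtr (ltW c20)).
apply: le_trans nS _.
rewrite /log_factor; case: ifP => [/eqP nE|/negbT nE].
- have lt2 : ln 2 <= ln (t + 2) :> R by rewrite ler_ln ?posrE ?ltr_wpDl// lerDr.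
  rewrite sqr_sqrtr ?(le_trans (ltW l2))//.
  have -> : \sum_(k < K) (a^-1) ^+ 2 * 4 ^+ k.+1 * (2 * 2^-1 ^+ k) ^+ n = K%:R * ((a^-1) ^+ 2 * 16) :> R.
    rewrite (eq_bigr (fun=> (a^-1) ^+ 2 * 16)) ?sumr_const ?card_ord ?mulr_natl// => k _.
    rewrite nE -mulrA; congr (_ * _); rewrite exprMn exprS -mulrA [4 ^+ k * _]mulrCA -exprM mulnC exprM -exprMn.
    by rewrite expr2 -natrM (_ : 4 * 2^-1 ^+ 2 = 1 :> R) ?expr1n; [rewrite mulr1 -natrM|field].
  have tl : t ^+ 2 * (2 * 2^-1 ^+ K) ^+ n <= 4 by rewrite (le_trans tail)// nE expr2 -natrM.
  have q : 0 < (ln 2)^-1 :> R by rewrite invr_gt0.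
  have e1 : K%:R <= 2 * ln (t + 2) / ln 2 by rewrite ler_pdivlMr.
  have e2 : 1 <= ln (t + 2) / ln 2 by rewrite ler_pdivlMr// mul1r.
  have b1 : K%:R * ((a^-1) ^+ 2 * 16) <= 2 * ln (t + 2) / ln 2 * ((a^-1) ^+ 2 * 16).
    by rewrite ler_wpM2r// mulr_ge0.
  apply: le_trans (lerD b1 tl) _.
  apply: (@le_trans _ _ (((a^-1) ^+ 2 * 32 + 4) / ln 2 * ln (t + 2))).
    have -> : ((a^-1) ^+ 2 * 32 + 4) / ln 2 * ln (t + 2) =
      2 * ln (t + 2) / ln 2 * ((a^-1) ^+ 2 * 16) + 4 * (ln (t + 2) / ln 2) by ring.
    by rewrite lerD2l ler_peMr.
  rewrite ler_wpM2r ?(le_trans (ltW l2))// /c2 -addrA lerDl addr_ge0 ?exprn_ge0//.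
  by apply: mulr_ge0 => //; apply: mulr_ge0 => //; exact: exprn_ge0.
- have n3 : (3 <= n)%N by rewrite ltn_neqAle eq_sym nE.
  rewrite expr1n mulr1.
  have S2 : forall m : nat, \sum_(k < m) 2^-1 ^+ k <= 2 :> R.
    move=> m; suff -> : \sum_(k < m) 2^-1 ^+ k = 2 - 2 * 2^-1 ^+ m :> R.
      by rewrite gerBl mulr_ge0//; have /andP[] := h01 m.
    elim: m => [|m IH]; first by rewrite big_ord0 expr0 mulr1 subrr.
    by rewrite big_ord_recr /= IH exprS; field.
  have main : \sum_(k < K) (a^-1) ^+ 2 * 4 ^+ k.+1 * (2 * 2^-1 ^+ k) ^+ n <=
      8 * 2 ^+ n * (a^-1) ^+ 2.
    apply: (@le_trans _ _ (\sum_(k < K) (4 * 2 ^+ n * (a^-1) ^+ 2) * 2^-1 ^+ k)).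
      apply: ler_sum => k _; have /andP[q0 q1] := h01 k.
      have hn : (2^-1 ^+ k) ^+ n <= (2^-1 ^+ k) ^+ 3 :> R by rewrite ler_wiXn2l.
      have e4 : 4 ^+ k * (2^-1 ^+ k) ^+ 3 = 2^-1 ^+ k :> R.
        rewrite -exprM mulnC exprM -exprMn; congr (_ ^+ _); by field.
      rewrite exprMn.
      have -> : (a^-1) ^+ 2 * 4 ^+ k.+1 * (2 ^+ n * (2^-1 ^+ k) ^+ n) =
        4 * 2 ^+ n * (a^-1) ^+ 2 * (4 ^+ k * (2^-1 ^+ k) ^+ n).
        rewrite (exprS 4 k); move: (2 ^+ n) (4 ^+ k) ((2^-1 ^+ k) ^+ n) => x y z; ring.
      have q2 : 0 <= 4 * 2 ^+ n * (a^-1) ^+ 2 by apply: mulr_ge0 => //; apply: mulr_ge0 => //; exact: exprn_ge0.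
      rewrite ler_wpM2l//.
      by rewrite -[leRHS]e4 ler_wpM2l// exprn_ge0.
    rewrite -mulr_sumr; apply: le_trans (ler_wpM2l _ (S2 K)) _.
      by apply: mulr_ge0 => //; apply: mulr_ge0 => //; exact: exprn_ge0.
    by rewrite le_eqVlt; apply/orP; left; apply/eqP; ring.
  apply: le_trans (lerD main tail) _.
  by rewrite /c2 lerD2r lerDr divr_ge0 ?(ltW l2)// addr_ge0// mulr_ge0.
Qed.

End dyadic.

(** * Upper bound for the transformed solution *)

Section upper_bound.
Context (R : realType) (n : nat).
Hypothesis n2 : (2 <= n)%N.
Variables (lam mu : R).
Hypotheses (hlam : 0 < lam + 2 * mu) (hmu : 0 < mu).
Local Notation E := (Rn R n).
Local Notation leb := (lebesgue_Rn R n).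
Local Notation L2 := (L2 leb).
Local Notation nm := (nm leb).
Local Notation int := (int leb).
Local Notation cP := (@cP R n).
Local Notation a1 := (Num.sqrt (lam + 2 * mu)).
Local Notation a2 := (Num.sqrt mu).
Local Notation lf := (log_factor n).

(** On the cube [dyad 0] the transform of f1 is at most twice its L^1 norm and multiplies [sigma];
    outside, the multiplier is bounded and the L^2 norm serves. The majorant [g] adds both bounds
    and both speeds, so that a single use of [MA_est] suffices. *)
Lemma nm_HU_le : exists2 C : R, 0 < C & forall f0 f1 : 'I_n -> E -> R,
  (forall k, L12 (f0 k)) -> (forall k, L12 (f1 k)) -> forall t, 0 <= t -> forall k,
  nm (HU lam mu f0 f1 t k) <= C * (\sum_l nm (f0 l) +
    (\sum_l int (fun x => `|f1 l x|)) * lf t + \sum_l nm (f1 l)).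
Proof.
have a10 : 0 < a1 by rewrite sqrtr_gt0.
have a20 : 0 < a2 by rewrite sqrtr_gt0.
have [c1 c10 Hc1] := sigma_bound n2 a10.
have [c2 c20 Hc2] := sigma_bound n2 a20.
pose A' := a1^-1 + a2^-1; have A'0 : 0 < A' by rewrite addr_gt0// invr_gt0.
have s0 : 0 < Num.sqrt cP by rewrite sqrtr_gt0 cP_gt0.
exists (3 * Num.sqrt cP + 6 * (c1 + c2) + 3 * A' * Num.sqrt cP).
  by rewrite !addr_gt0// !mulr_gt0// addr_gt0.
move=> f0 f1 H0 H1 t t0 k.
have L0 l := (hart_isometry (H0 l)).1; have L1 l := (hart_isometry (H1 l)).1.
have N0 l := (hart_isometry (H0 l)).2; have N1 l := (hart_isometry (H1 l)).2.
have [LS1 nS1] := Hc1 t t0; have [LS2 nS2] := Hc2 t t0.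
have [|||LA nA] := @MA_est R n (cosr a1 t) (cosr a2 t) (fun l => hart (f0 l)) (fun l => hart (f0 l)) k
  (measurable_cosr _ _) (measurable_cosr _ _) (fun l => (L0 l).1).
- by move=> l xi; rewrite normrM ler_piMl// cosr_le.
- by move=> l xi; rewrite normrM ler_piMl// cosr_le.
- exact: L0.
pose b l := int (fun x => `|f1 l x|).
have b0 l : 0 <= b l by apply: int_ge0.
pose g l xi := A' * `|hart (f1 l) xi| + 2 * b l * (`|sigma a1 t xi| + `|sigma a2 t xi|).
have g_le a l xi : 0 < a -> a^-1 <= A' -> `|sigma a t xi| <= `|sigma a1 t xi| + `|sigma a2 t xi| ->
    `|sinr a t (enorm xi) * hart (f1 l) xi| <= `|g l xi|.
  move=> a0 aA sa; have gg : 0 <= g l xi by rewrite addr_ge0 ?mulr_ge0 ?addr_ge0// ltW.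
  rewrite (ger0_norm gg) normrM /g.
  have [x0|x0] := pselect (dyad 0 xi).
    apply: (@le_trans _ _ (2 * b l * (`|sigma a1 t xi| + `|sigma a2 t xi|))).
      rewrite mulrC; apply: ler_pM => //; first exact: hart_bound (H1 l).1.
      by move: sa; rewrite {1}/sigma indicE mem_set// mulr1.
    by rewrite lerDr mulr_ge0// ltW.
  apply: (@le_trans _ _ (A' * `|hart (f1 l) xi|)).
    rewrite ler_wpM2r//; apply: le_trans aA; apply: le_trans (sinr_le_r a0 t (enorm_ge0 xi)).
    by rewrite ler_peMl//; have := dyad_out x0; rewrite expr0.
  by rewrite lerDl mulr_ge0 ?addr_ge0// mulr_ge0.
have Lg1 l : L2 (fun xi => A' * `|hart (f1 l) xi|) by apply: L2Z; exact: L2_abs.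
have Lss : L2 (fun xi => `|sigma a1 t xi| + `|sigma a2 t xi|).
  by apply: L2D; exact: L2_abs.
have Lg2 l : L2 (fun xi => 2 * b l * (`|sigma a1 t xi| + `|sigma a2 t xi|)) by exact: L2Z.
have [|||LB nB] := @MA_est R n (sinr a1 t) (sinr a2 t) (fun l => hart (f1 l)) g k
  (measurable_sinr _ _) (measurable_sinr _ _) (fun l => (L1 l).1).
- by move=> l xi; apply: g_le => //; [rewrite lerDl invr_ge0 ltW|rewrite lerDl].
- by move=> l xi; apply: g_le => //; [rewrite lerDr invr_ge0 ltW|rewrite lerDr].
- by move=> l; exact: L2D.
have nabs (f : E -> R) : L2 f -> nm (fun x => `|f x|) = nm f.
  move=> Lf; apply/eqP; rewrite eq_le; apply/andP; split; apply: nm_le => //; try exact: L2_abs.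
  - by move=> x; rewrite normr_id.
  - by move=> x; rewrite normr_id.
have ng l : nm (g l) <= A' * Num.sqrt cP * nm (f1 l) + 2 * (c1 + c2) * lf t * b l.
  apply: le_trans (nmD (Lg1 l) (Lg2 l)) _; apply: lerD.
    rewrite nmZ; last exact: L2_abs.
    by rewrite nabs// (ger0_norm (ltW A'0)) N1 mulrA.
  rewrite nmZ// ger0_norm ?mulr_ge0//.
  have : nm (fun xi => `|sigma a1 t xi| + `|sigma a2 t xi|) <= (c1 + c2) * lf t.
    apply: le_trans (nmD (L2_abs LS1) (L2_abs LS2)) _.
    by rewrite !nabs// [leRHS]mulrDl lerD.
  move=> h; apply: le_trans (ler_wpM2l _ h) _; first by rewrite mulr_ge0.
  by rewrite le_eqVlt; apply/orP; left; apply/eqP; ring.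
have lf0 : 0 <= lf t by rewrite /log_factor; case: ifP => // _; exact: sqrtr_ge0.
have F0 : 0 <= \sum_l nm (f0 l) by apply: sumr_ge0 => l _; exact: nm_ge0.
have F1 : 0 <= \sum_l nm (f1 l) by apply: sumr_ge0 => l _; exact: nm_ge0.
have B0 : 0 <= \sum_l b l by apply: sumr_ge0.
apply: le_trans (nmD LA LB) _; apply: le_trans (lerD nA nB) _.
have E0 : \sum_l nm (hart (f0 l)) = Num.sqrt cP * \sum_l nm (f0 l).
  by rewrite mulr_sumr; apply: eq_bigr.
have E1 : \sum_l nm (g l) <= A' * Num.sqrt cP * (\sum_l nm (f1 l)) + 2 * (c1 + c2) * lf t * \sum_l b l.
  by rewrite !mulr_sumr -big_split; apply: ler_sum.
rewrite E0; apply: le_trans (lerD (lexx _) (ler_wpM2l _ E1)) _ => //.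
rewrite -/b; set x := \sum_l nm (f0 l) in F0 *; set y := \sum_l b l in B0 *; set z := \sum_l nm (f1 l) in F1 *.
set w := Num.sqrt cP in s0 *; set L := lf t in lf0 *.
have yL : 0 <= y * L by exact: mulr_ge0.
have c12 : 0 < c1 + c2 by exact: addr_gt0.
have Aw : 0 < A' * w by exact: mulr_gt0.
have -> : (3 * w + 6 * (c1 + c2) + 3 * A' * w) * (x + y * L + z) =
  3 * (w * x) + 3 * (A' * w * z + 2 * (c1 + c2) * L * y) +
  (3 * w * (y * L + z) + 6 * (c1 + c2) * (x + z) + 3 * (A' * w) * (x + y * L)) by ring.
by rewrite lerDl !addr_ge0// mulr_ge0// ?addr_ge0// ?mulr_ge0// ltW.
Qed.

End upper_bound.

(** * Lower bound *)

Section oscillation.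
Context (R : realType) (n : nat).
Local Notation lam := (@lebesgue_measure R).
Local Notation E := (Rn R n.+2).
Local Notation leb := (lebesgue_Rn R n.+2).
Local Notation leb' := (lebesgue_Rn R n.+1).
Local Notation itg_of := itg.
Local Notation itg := (itg leb).
Local Notation int_of := int.
Local Notation int := (int leb).
Implicit Types (xi : E) (p q : 'I_n.+2 -> R).

(* The derivative of [enorm] in the direction of the first coordinate. *)
Definition wt xi : R := tnth xi ord0 / enorm xi.

Lemma wt_le1 xi : `|wt xi| <= 1.
Proof.
rewrite /wt; have [->|r0] := eqVneq (enorm xi) 0; first by rewrite invr0 mulr0 normr0.
rewrite normrM normfV (ger0_norm (enorm_ge0 xi)) ler_pdivrMr ?mul1r ?coord_enorm//.
by rewrite lt_def r0 enorm_ge0.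
Qed.

Lemma measurable_wt : measurable_fun setT wt.
Proof.
apply: measurable_funM; first exact: measurable_tnthR.
by apply: (measurableT_comp (@measurable_invR R)); exact: measurable_enorm.
Qed.

Lemma der_norm_line (s x : R) : 0 < s ->
  der (fun y => Num.sqrt (y ^+ 2 + s)) x (x / Num.sqrt (x ^+ 2 + s)).
Proof.
move=> s0; have p : 0 < x ^+ 2 + s by rewrite ltr_wpDl ?sqr_ge0.
have d1 : der (fun y => y ^+ 2 + s) x (2 * x).
  apply: der_eq; first by (under eq_fun do rewrite expr2); derive.
  by rewrite /=; ring.
have d2 : der (@Num.sqrt R) (x ^+ 2 + s) (2 * Num.sqrt (x ^+ 2 + s))^-1.
  exact: is_derive1_sqrt.
apply: der_eq; first exact: (der_comp (f := fun y => y ^+ 2 + s) d2 d1).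
by field; rewrite gt_eqF// sqrtr_gt0.
Qed.

Variables (g G : R -> R).
Hypotheses (cg : continuous g) (dG : forall x, der G x (g x))
  (g1 : forall x, `|g x| <= 1) (G1 : forall x, `|G x| <= 1).

(** In the first coordinate the integrand is the derivative of tau^-1 G(tau |xi|), so each line
    contributes two boundary values only. The other coordinates are positive on the box, which keeps
    |xi| differentiable along the whole line. *)
Lemma osc_box p q (tau : R) : (forall i, 0 < p i) -> (forall i, p i <= q i) -> tau != 0 ->
  `|int (fun xi => \1_(box p q) xi * (wt xi * g (tau * enorm xi)))| <=
  2 / `|tau| * int_of leb' \1_(box (fun i => p (lift ord0 i)) (fun i => q (lift ord0 i))).
Proof.
move=> p0 pq tau0; set Q' := box (fun i => p (lift ord0 i)) _.
pose b xi := wt xi * g (tau * enorm xi).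
have mb : measurable_fun setT b.
  apply: measurable_funM; first exact: measurable_wt.
  apply: (measurableT_comp (continuous_measurable_fun cg)).
  by apply: measurable_funM; [exact: measurable_cst|exact: measurable_enorm].
have b1 xi : `|b xi| <= 1 by rewrite normrM mulr_ile1 ?wt_le1.
have IQ : itg (fun xi => \1_(box p q) xi * b xi) by exact: itg_bounded_box mb b1.
rewrite (int_consRn (itg_meas IQ)).
have := (itg_consRn (itg_meas IQ)).1 IQ; set k := (_ \o _) => Ik.
have kE x y : k (x, y) = \1_(`]p ord0, q ord0]%classic) x * (\1_Q' y * b (consRn (x, y))).
  by rewrite /k /= box_cons mulrA.
have mbc : measurable_fun setT (fun z => b (@consRn R n.+1 z)).
  exact: measurableT_comp mb (@measurable_consRn R n.+1).
have Ix x : itg_of leb' (fun y => k (x, y)).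
  rewrite (_ : (fun y => _) = fun y => \1_Q' y * (\1_(`]p ord0, q ord0]%classic) x * b (consRn (x, y)))); last first.
    by apply/funext => y; rewrite kE mulrCA.
  apply: (@itg_bounded_box _ _ _ _ _ 1).
    apply: measurable_funM; first exact: measurable_cst.
    exact: (measurable_section1 x mbc).
  move=> y; rewrite normrM mulr_ile1 ?b1// indicE; case: (_ \in _); rewrite ?normr1 ?normr0//.
have Iy y : itg_of lam (fun x => k (x, y)).
  rewrite (_ : (fun x => _) = fun x => \1_(`]p ord0, q ord0]%classic) x * (\1_Q' y * b (consRn (x, y)))); last first.
    by apply/funext => x; rewrite kE.
  apply: itg_lam_itv.
    apply: measurable_funM; first exact: measurable_cst.
    exact: (measurable_section2 y mbc).
  move=> x; rewrite normrM mulr_ile1 ?b1// indicE; case: (_ \in _); rewrite ?normr1 ?normr0//.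
rewrite (int_prod Ik Ix).2 (int_prod_swap Ik Ix Iy).
have I1 : itg_of leb' (fun y => \1_Q' y) by exact: (L12_box _ _).1.
have in_le y : `|int_of lam (fun x => k (x, y))| <= 2 / `|tau| * \1_Q' y.
  have [yQ|yQ] := pselect (Q' y); last first.
    rewrite (_ : (fun x => _) = fun=> 0) ?int0 ?normr0 ?mulr_ge0// ?indicE// ?divr_ge0//.
    apply/funext => x; rewrite kE (_ : \1_Q' y = 0) ?mul0r ?mulr0//.
    by rewrite indicE memNset.
  pose s := dot y y.
  have s0 : 0 < s.
    rewrite /s /dot big_ord_recl ltr_pwDl ?sumr_ge0// => [|i _]; last by rewrite -expr2 sqr_ge0.
    have /andP[h _] := yQ ord0; have h' : 0 < tnth y ord0 by exact: lt_trans (p0 _) h.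
    by rewrite mulr_gt0.
  have rE x : enorm (consRn (x, y)) = Num.sqrt (x ^+ 2 + s).
    by rewrite /enorm dot_cons expr2.
  pose h x := x / Num.sqrt (x ^+ 2 + s) * g (tau * Num.sqrt (x ^+ 2 + s)).
  have sq0 x : Num.sqrt (x ^+ 2 + s) != 0.
    by rewrite gt_eqF// sqrtr_gt0 ltr_wpDl ?sqr_ge0.
  have dH x : der (fun x => tau^-1 * G (tau * Num.sqrt (x ^+ 2 + s))) x (h x).
    apply: der_eq.
      apply: derM; first exact: der_cst.
      by apply: der_comp (dG _) _; apply: derM (der_cst _ _) (der_norm_line _ s0).
    by rewrite /h /=; field; rewrite sq0 tau0.
  have csq : continuous (fun x : R => Num.sqrt (x ^+ 2 + s)).
    by move=> x; exact: der_continuous (der_norm_line x s0).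
  have ch : continuous h.
    move=> x; apply: cvgM.
      by apply: cvgM; [exact: cvg_id|apply: cvgV => //; exact: csq].
    apply: continuous_comp; last exact: cg.
    by apply: cvgM; [exact: cvg_cst|exact: csq].
  rewrite (_ : (fun x => _) = fun x => \1_(`]p ord0, q ord0]%classic) x * h x); last first.
    apply/funext => x; rewrite kE (_ : \1_Q' y = 1) ?mul1r; last by rewrite indicE mem_set.
    congr (_ * _).
    by rewrite /b /wt rE /consRn tnth0.
  rewrite (int_itv_ftc (pq ord0) ch dH) -mulrBr normrM normfV mulrC indicE mem_set// mulr1.
  rewrite ler_wpM2r ?invr_ge0//; apply: le_trans (ler_normB _ _) _.
  by rewrite (_ : 2 = 1 + 1)// lerD.
have Iint : itg_of leb' (fun y => int_of lam (fun x => k (x, y))).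
  apply: (itg_le _ _ (itgZ (2 / `|tau|) I1)) => //.
  exact: (@measurable_int2 _ _ (measurableTypeR R) (Rn R n.+1) R lam k (itg_meas Ik)).
apply: le_trans (int_abs Iint) _; rewrite -intZ//.
by apply: int_le; [exact: itg_abs|exact: itgZ|exact: in_le].
Qed.

End oscillation.

(** * Quadratic lower bound for two-speed oscillations on a box *)

Section core.
Context (R : realType) (n : nat).
Local Notation E := (Rn R n.+2).
Local Notation leb := (lebesgue_Rn R n.+2).
Local Notation leb' := (lebesgue_Rn R n.+1).
Local Notation itg := (itg leb).
Local Notation int_of := int.
Local Notation int := (int leb).
Implicit Types (xi : E) (p q : 'I_n.+2 -> R).

Definition trig (b : bool) (x : R) : R := if b then sin x else cos x.

(** Isolates the mean value of the square from eight oscillating terms, with frequencies 2x, 2y, x +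
    y and x - y. *)
Lemma trig_square (a b c d x y : R) :
  (a * cos x + b * sin x + c * cos y + d * sin y) ^+ 2 =
  (a ^+ 2 + b ^+ 2 + c ^+ 2 + d ^+ 2) / 2 +
  ((a ^+ 2 - b ^+ 2) / 2 * cos (x + x) + a * b * sin (x + x) +
   (c ^+ 2 - d ^+ 2) / 2 * cos (y + y) + c * d * sin (y + y) +
   (a * c + b * d) * cos (x - y) + (a * c - b * d) * cos (x + y) +
   (a * d + b * c) * sin (x + y) + (b * c - a * d) * sin (x - y)).
Proof.
rewrite !cosD !sinD cosN sinN.
have hx := cos2Dsin2 x; have hy := cos2Dsin2 y.
have -> : (a ^+ 2 + b ^+ 2 + c ^+ 2 + d ^+ 2) / 2 =
  (a ^+ 2 + b ^+ 2) / 2 * (cos x ^+ 2 + sin x ^+ 2) +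
  (c ^+ 2 + d ^+ 2) / 2 * (cos y ^+ 2 + sin y ^+ 2) by rewrite hx hy; field.
by field.
Qed.

Lemma osc_trig p q (tau : R) b : (forall i, 0 < p i) -> (forall i, p i <= q i) -> tau != 0 ->
  `|int (fun xi => \1_(box p q) xi * (wt xi * trig b (tau * enorm xi)))| <=
  2 / `|tau| * int_of leb' \1_(box (fun i => p (lift ord0 i)) (fun i => q (lift ord0 i))).
Proof.
case: b => p0 pq tau0.
  apply: (@osc_box R n sin (fun x => - cos x)) => //.
  - exact: continuous_sin.
  - move=> x; apply: der_eq; first by apply: derN; exact: is_derive_cos.
    by rewrite opprK.
  - by move=> x; exact: sin_max.
  - by move=> x; rewrite normrN; exact: cos_max.
apply: (@osc_box R n cos sin) => //.
- exact: continuous_cos.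
- by move=> x; exact: is_derive_sin.
- by move=> x; exact: cos_max.
- by move=> x; exact: sin_max.
Qed.

Lemma measurable_trig b : measurable_fun setT (trig b).
Proof. by case: b; [exact: measurable_sinR|exact: measurable_cosR]. Qed.

Lemma itg_osc p q b (tau : R) :
  itg (fun xi => \1_(box p q) xi * (wt xi * trig b (tau * enorm xi))).
Proof.
apply: (@itg_bounded_box _ _ _ _ _ 1).
  apply: measurable_funM; first exact: measurable_wt.
  apply: (measurableT_comp (measurable_trig b)).
  by apply: measurable_funM; [exact: measurable_cst|exact: measurable_enorm].
by move=> xi; rewrite normrM mulr_ile1 ?wt_le1//; case: b; [exact: sin_max|exact: cos_max].
Qed.

Lemma osc_sum p q (s : seq (R * R * bool)) (T K : R) :
  (forall i, 0 < p i) -> (forall i, p i <= q i) -> 0 < T -> 0 <= K ->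
  all (fun z => (T <= `|z.1.2|) && (`|z.1.1| <= K)) s ->
  itg (fun xi => \1_(box p q) xi * (wt xi * \sum_(z <- s) z.1.1 * trig z.2 (z.1.2 * enorm xi))) /\
  `|int (fun xi => \1_(box p q) xi * (wt xi * \sum_(z <- s) z.1.1 * trig z.2 (z.1.2 * enorm xi)))| <=
  (size s)%:R * K * (2 / T * int_of leb' \1_(box (fun i => p (lift ord0 i)) (fun i => q (lift ord0 i)))).
Proof.
move=> p0 pq T0 K0; set V' := int_of leb' _.
have V0 : 0 <= V' by apply: int_ge0 => y; rewrite indicE.
elim: s => [_|[[c tau] b] s IH].
  rewrite (_ : (fun xi => _) = fun=> 0); last by apply/funext => xi; rewrite big_nil !mulr0.
  by rewrite int0 normr0 !mul0r; split => //; exact: itg0.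
rewrite [all _ _]/= => /andP[/andP[hT hK] /IH{IH}[I1 h1]].
have t0 : tau != 0 by rewrite -normr_gt0; exact: lt_le_trans hT.
have I0 := itgZ c (itg_osc p q b tau).
rewrite (_ : (fun xi => _) = fun xi => c * (\1_(box p q) xi * (wt xi * trig b (tau * enorm xi))) +
   \1_(box p q) xi * (wt xi * \sum_(z <- s) z.1.1 * trig z.2 (z.1.2 * enorm xi))); last first.
  by apply/funext => xi; rewrite big_cons /=; ring.
split; first exact: itgD.
rewrite intD// intZ; last exact: itg_osc.
rewrite [size _]/= -natr1 -mulrA mulrDl mul1r addrC mulrA.
apply: le_trans (ler_normD _ _) _; apply: lerD; first exact: h1.
rewrite normrM; apply: ler_pM => //; apply: le_trans (osc_trig b p0 pq t0) _.
by rewrite ler_wpM2r// ler_wpM2l// lef_pV2// posrE// normr_gt0.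
Qed.

Lemma coef_bounds (a b c d S : R) : S = a ^+ 2 + b ^+ 2 + c ^+ 2 + d ^+ 2 ->
  [&& `|(a ^+ 2 - b ^+ 2) / 2| <= S, `|a * b| <= S, `|(c ^+ 2 - d ^+ 2) / 2| <= S, `|c * d| <= S,
   `|a * c + b * d| <= S, `|a * c - b * d| <= S, `|a * d + b * c| <= S & `|b * c - a * d| <= S].
Proof.
move=> ->.
have am (x y : R) : `|x * y| <= (x ^+ 2 + y ^+ 2) / 2.
  have h1 := sqr_ge0 (x - y); have h2 := sqr_ge0 (x + y).
  rewrite sqrrB -mulr_natr in h1; rewrite sqrrD -mulr_natr in h2.
  by rewrite ler_norml; apply/andP; split; lra.
have ab := am a b; have cd := am c d; have ac := am a c; have bd := am b d.
have ad := am a d; have bc := am b c.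
have qa := sqr_ge0 a; have qb := sqr_ge0 b; have qc := sqr_ge0 c; have qd := sqr_ge0 d.
have dif (x y : R) : 0 <= x -> 0 <= y -> `|(x - y) / 2| <= (x + y) / 2.
  by move=> x0 y0; rewrite ler_norml; apply/andP; split; lra.
have d1 := dif _ _ qa qb; have d2 := dif _ _ qc qd.
have s1 := ler_normD (a * c) (b * d); have s2 := ler_normB (a * c) (b * d).
have s3 := ler_normD (a * d) (b * c); have s4 := ler_normB (b * c) (a * d).
move: (a ^+ 2) (b ^+ 2) (c ^+ 2) (d ^+ 2) ab cd ac bd ad bc qa qb qc qd d1 d2 s1 s2 s3 s4.
move: (`|a * b|) (`|c * d|) (`|a * c|) (`|b * d|) (`|a * d|) (`|b * c|).
move: (`|a * c + b * d|) (`|a * c - b * d|) (`|a * d + b * c|) (`|b * c - a * d|).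
move=> *; repeat (apply/andP; split); lra.
Qed.

Lemma square_split (x y e : R) : (x - y) ^+ 2 <= e -> y ^+ 2 <= 2 * x ^+ 2 + 2 * e.
Proof. by move=> h; have := sqr_ge0 (2 * x - y); move: h; rewrite !expr2 => *; nra. Qed.

Lemma core_arith (S I x y z e X : R) : - X <= z -> x <= S * I -> e <= y ->
  x / 4 - y - z / 2 <= 2^-1 * (S / 2 * I + X) - e.
Proof. by move=> *; lra. Qed.

(* [wt], being the derivative of [enorm], is what makes each oscillating
   integral computable in the first coordinate, as in [osc_box]. *)
Lemma core_lower p q (H : E -> R) (a b c d t al1 al2 gam eta w0 : R) :
  (forall i, 0 < p i) -> (forall i, p i <= q i) -> L2 leb H ->
  0 < t -> 0 < gam -> gam <= al1 -> gam <= al2 -> gam <= `|al1 - al2| -> 0 < w0 ->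
  (forall xi, box p q xi -> w0 <= wt xi) ->
  (forall xi, box p q xi -> `|H xi - (a * cos (t * al1 * enorm xi) + b * sin (t * al1 * enorm xi) +
     c * cos (t * al2 * enorm xi) + d * sin (t * al2 * enorm xi))| <= eta) ->
  let S := a ^+ 2 + b ^+ 2 + c ^+ 2 + d ^+ 2 in eta ^+ 2 <= S * w0 / 8 ->
  S * (w0 / 8 * int \1_(box p q) - 8 / (gam * t) *
    int_of leb' \1_(box (fun i => p (lift ord0 i)) (fun i => q (lift ord0 i)))) <=
  int (fun xi => \1_(box p q) xi * H xi ^+ 2).
Proof.
move=> p0 pq LH t0 gam0 g1 g2 g12 w00 hw hH S hS.
have S0 : 0 <= S by rewrite !addr_ge0 ?sqr_ge0.
have gt0 : 0 < gam * t by exact: mulr_gt0.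
set V := int \1_(box p q); set V' := int_of leb' _.
have IV : itg \1_(box p q) by exact: (L12_box _ _).1.
pose F xi := a * cos (t * al1 * enorm xi) + b * sin (t * al1 * enorm xi) +
     c * cos (t * al2 * enorm xi) + d * sin (t * al2 * enorm xi).
(* The terms of [trig_square] as amplitude, frequency and kind. Every frequency is at least gam t in
   modulus, as gam is below both speeds and their gap. *)
pose s := [:: ((a ^+ 2 - b ^+ 2) / 2, t * (al1 + al1), false); (a * b, t * (al1 + al1), true);
  ((c ^+ 2 - d ^+ 2) / 2, t * (al2 + al2), false); (c * d, t * (al2 + al2), true);
  (a * c + b * d, t * (al1 - al2), false); (a * c - b * d, t * (al1 + al2), false);
  (a * d + b * c, t * (al1 + al2), true); (b * c - a * d, t * (al1 - al2), true)].
have FE xi : F xi ^+ 2 = S / 2 + \sum_(z <- s) z.1.1 * trig z.2 (z.1.2 * enorm xi).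
  rewrite /F trig_square; congr (_ + _); rewrite /s !big_cons big_nil /trig /=.
  by rewrite !mulrDr !mulrN !mulrDl !mulNr; ring.
have al10 : 0 < al1 by exact: lt_le_trans g1.
have al20 : 0 < al2 by exact: lt_le_trans g2.
have A2 : all (fun z => (gam * t <= `|z.1.2|) && (`|z.1.1| <= S)) s.
  have fr x : gam <= `|x| -> gam * t <= `|t * x|.
    by move=> h; rewrite normrM (gtr0_norm t0) mulrC ler_wpM2l// ltW.
  have fs (x y : R) : 0 < x -> 0 < y -> gam <= x -> gam <= `|x + y|.
    move=> x0 y0 gx; have xy : 0 <= x + y by rewrite addr_ge0// ltW.
    by rewrite (ger0_norm xy); apply: le_trans gx _; rewrite lerDl ltW.
  have f1 := fs _ _ al10 al10 g1; have f2 := fs _ _ al20 al20 g2; have f3 := fs _ _ al10 al20 g1.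
  rewrite /s /= !fr// !andTb andbT; exact: coef_bounds.
have [Is hs] := osc_sum p0 pq gt0 S0 A2.
rewrite -/V' [size s]/= in hs.
set X := int _ in hs.
have IQw : itg (fun xi => \1_(box p q) xi * wt xi).
  by apply: (itg_bounded_box _ _ (@measurable_wt R n)) => xi; exact: wt_le1.
have IH2 : itg (fun xi => \1_(box p q) xi * H xi ^+ 2).
  apply: (itg_le _ _ (L2_itg LH)).
    by apply: measurable_funM; [exact: itg_meas IV|apply: measurable_funX; exact: LH.1].
  move=> xi; rewrite normrM [X in _ * X]ger0_norm ?sqr_ge0// ler_piMl ?sqr_ge0//.
  exact: indic_norm.
have Vw : w0 * V <= int (fun xi => \1_(box p q) xi * wt xi).
  rewrite -intZ//; apply: int_le => //; first exact: itgZ.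
  move=> xi; rewrite mulrC indicE; have [xQ|xQ] := pselect (box p q xi).
    by rewrite mem_set// !mul1r hw.
  by rewrite memNset// !mul0r.
have eta0 : 0 <= eta ^+ 2 by exact: sqr_ge0.
(* The weight can be inserted because it lies between 0 and 1 on the box; replacing [H] by its model
   [F] costs a factor 1/2 and the term in eta, by [square_split]. *)
have low : 2^-1 * (S / 2 * int (fun xi => \1_(box p q) xi * wt xi) + X) - eta ^+ 2 * V <=
    int (fun xi => \1_(box p q) xi * H xi ^+ 2).
  rewrite -(intZ (S / 2) IQw) -intD//; last exact: itgZ.
  rewrite -(intZ 2^-1); last by apply: itgD => //; exact: itgZ.
  rewrite -(intZ (eta ^+ 2) IV) -intB; last exact: itgZ; last first.
    by apply: itgZ; apply: itgD => //; exact: itgZ.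
  apply: int_le => //; first by apply: itgB; [apply: itgZ; apply: itgD => //; exact: itgZ|exact: itgZ].
  move=> xi; rewrite !indicE; have [xQ|xQ] := pselect (box p q xi); last first.
    by rewrite memNset// !mul0r !mulr0 !addr0 !mulr0 subrr.
  rewrite mem_set// !mul1r mulr1.
  have h := hH _ xQ; rewrite -/(F xi) in h.
  have w1 : wt xi <= 1 by apply: le_trans (wt_le1 xi); exact: ler_norm.
  have w2 : 0 <= wt xi by apply: le_trans (hw _ xQ); exact: ltW.
  have FH : F xi ^+ 2 <= 2 * H xi ^+ 2 + 2 * eta ^+ 2.
    have h2 : (H xi - F xi) ^+ 2 <= eta ^+ 2.
      by rewrite -real_normK ?num_real// lerXn2r// nnegrE (le_trans _ h).
    exact: square_split.
  have -> : 2^-1 * (S / 2 * wt xi + wt xi * \sum_(z <- s) z.1.1 * trig z.2 (z.1.2 * enorm xi)) =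
     2^-1 * (wt xi * F xi ^+ 2) by rewrite FE; ring.
  have : wt xi * F xi ^+ 2 <= F xi ^+ 2 by rewrite ler_piMl ?sqr_ge0.
  move: FH; move: (wt xi * F xi ^+ 2) (F xi ^+ 2) (H xi ^+ 2) (eta ^+ 2); clear; move=> *; lra.
apply: le_trans low.
have V0 : 0 <= V by apply: int_ge0 => y; rewrite indicE.
have h1 : - X <= 8 * S * (2 / (gam * t) * V') by apply: le_trans hs; rewrite -normrN ler_norm.
have h2 : S * (w0 * V) <= S * int (fun xi => \1_(box p q) xi * wt xi) by rewrite ler_wpM2l.
have h3 : eta ^+ 2 * V <= S * w0 / 8 * V by rewrite ler_wpM2r.
(* Eight terms, each at most S * 2 / (gam t) * V', enter with a factor 1/2, whence 8 / (gam t). The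
   main term w0 / 4 loses w0 / 8 to the error eta. *)
have -> : S * (w0 / 8 * V - 8 / (gam * t) * V') =
   S * (w0 * V) / 4 - S * w0 / 8 * V - (8 * S * (2 / (gam * t) * V')) / 2.
  by field; rewrite gt_eqF// gt_eqF.
exact: core_arith.
Qed.

End core.

(** * Continuity of transforms and the choice of a direction *)

Section neighborhoods.
Context (R : realType) (n : nat).
Local Notation E := (Rn R n).
Local Notation leb := (lebesgue_Rn R n).
Local Notation itg := (itg leb).
Local Notation int := (int leb).
Implicit Types (x xi : E) (k l : 'I_n).

(* The neighborhood filter of a point: tuples carry no topology. *)
Definition nb x0 : set_system E :=
  [set A | exists2 d : R, 0 < d & forall x, (forall i, `|tnth x i - tnth x0 i| <= d) -> A x].

Global Instance nb_filter x0 : ProperFilter (nb x0).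
Proof.
split; first by move=> [d d0 /(_ x0)]; apply => i; rewrite subrr normr0 ltW.
split.
- by exists 1.
- move=> P Q [d d0 HP] [e e0 HQ]; exists (Num.min d e); first by rewrite lt_min d0.
  move=> x hx; split; [apply: HP|apply: HQ] => i; apply: le_trans (hx i) _;
    by rewrite ge_min lexx ?orbT.
- by move=> P Q PQ [d d0 HP]; exists d => // x hx; apply: PQ; exact: HP.
Qed.

Lemma cvg_tnth x0 i : (tnth x i : R) @[x --> nb x0] --> (tnth x0 i : R).
Proof.
by apply/cvgrPdist_le => e e0; exists e => // x /(_ i); rewrite distrC.
Qed.

Lemma cas_lip (a b : R) : `|cas a - cas b| <= 2 * `|a - b|.
Proof.
rewrite /cas opprD addrACA mulr_natl mulr2n.
by apply: le_trans (ler_normD _ _) _; apply: lerD; [exact: cos_lip|exact: sin_lip].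
Qed.

(** The kernels at two frequencies differ by at most 4, and by at most twice the difference of the
    phases. The minimum of the two bounds, for the radii 1/(m+1), gives a modulus of continuity that
    dominated convergence sends to 0. *)
Lemma hart_cvg f x0 : itg f -> hart f xi @[xi --> nb x0] --> hart f x0.
Proof.
move=> If; apply/cvgrPdist_le => e e0.
pose s (x : E) : R := \sum_i `|tnth x i|.
have ms : measurable_fun setT s.
  by apply: measurable_sum => i; apply: measurableT_comp => //; exact: measurable_tnthR.
pose d (m : nat) (x : E) : R := Num.min 4 (2 * (m.+1%:R^-1 * s x)) * `|f x|.
have s0 x : 0 <= s x by apply: sumr_ge0.
have mf := itg_meas (itg_abs If).
have md m : measurable_fun setT (d m).
  apply: measurable_funM => //; apply: measurable_minr => //.
  by apply: measurable_funM; [exact: measurable_cst|apply: measurable_funM => //; exact: measurable_cst].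
have min0 m x : 0 <= Num.min 4 (2 * (m.+1%:R^-1 * s x)).
  by rewrite le_min ler0n !mulr_ge0.
have d4 m x : `|d m x| <= 4 * `|f x|.
  by rewrite /d normrM normr_id ger0_norm// ler_wpM2r// ge_min lexx.
have dc x : d m x @[m --> \oo] --> (0 : R).
  have := @cvg_harmonic R; apply: (squeeze0 (K := 2 * s x * `|f x|)) => m.
  have i0 : 0 <= m.+1%:R^-1 :> R by rewrite invr_ge0.
  rewrite subr0 normrM normr_id (ger0_norm (min0 m x)) (ger0_norm i0).
  rewrite mulrAC ler_wpM2r// ge_min; apply/orP; right.
  by rewrite -mulrA ler_wpM2l// mulrC.
have [_ + _] := int_dct md d4 (itgZ 4 (itg_abs If)) dc.
rewrite int0 => /seqP/(_ e e0)[N /(_ N (leqnn N))]; rewrite subr0 => hN.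
exists N.+1%:R^-1; first by rewrite invr_gt0.
move=> xi hxi; rewrite /hart -intB; [|exact: itg_cas|exact: itg_cas].
apply: le_trans (le_trans (ler_norm _) hN).
apply: le_trans (int_abs (itgB (itg_cas x0 If) (itg_cas xi If))) _.
apply: int_le; first by apply: itg_abs; apply: itgB; exact: itg_cas.
  by apply: (itg_le _ (d4 N)) => //; apply: itgZ; exact: itg_abs.
move=> x; rewrite -mulrBl normrM ler_wpM2r// le_min; apply/andP; split.
  apply: le_trans (ler_normB _ _) _; rewrite (_ : 4 = 2 + 2); last by ring.
  by rewrite lerD ?cas_max.
apply: le_trans (cas_lip _ _) _; rewrite ler_wpM2l//.
rewrite /dot -sumrB mulr_sumr; apply: le_trans (ler_norm_sum _ _ _) _.
apply: ler_sum => i _; rewrite -mulrBr normrM mulrC ler_wpM2r// distrC; exact: hxi.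
Qed.

Lemma cvg_sumf (T : Type) (F : set_system T) (FF : Filter F) (I : Type) (s : seq I)
    (f : I -> T -> R) (a : I -> R) : (forall i, f i t @[t --> F] --> a i) ->
  \sum_(i <- s) f i t @[t --> F] --> \sum_(i <- s) a i.
Proof.
move=> H; elim: s => [|i s IH].
  rewrite (_ : (fun t => _) = fun=> 0); first by rewrite big_nil; exact: cvg_cst.
  by apply/funext => t; rewrite big_nil.
rewrite (_ : (fun t => _) = fun t => f i t + \sum_(j <- s) f j t).
  by rewrite big_cons; exact: cvgD.
by apply/funext => t; rewrite big_cons.
Qed.

Lemma cvg_enorm x0 : enorm x @[x --> nb x0] --> enorm x0.
Proof.
have cd : dot x x @[x --> nb x0] --> dot x0 x0.
  by apply: cvg_sumf => i; apply: cvgM; exact: cvg_tnth.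
exact: cvg_comp cd (@sqrt_continuous R _).
Qed.

Lemma cvg_Pr x0 k l : enorm x0 != 0 -> Pr x k l @[x --> nb x0] --> Pr x0 k l.
Proof.
move=> r0; have ci : (enorm x)^-1 @[x --> nb x0] --> (enorm x0)^-1.
  by apply: cvgV => //; exact: cvg_enorm.
by apply: cvgM; apply: cvgM => //; exact: cvg_tnth.
Qed.

Definition proj (h : 'I_n -> E -> R) k xi : R := \sum_l Pr xi k l * h l xi.

Lemma MA_split phi psi (h : 'I_n -> E -> R) k xi :
  MA phi psi h k xi = phi (enorm xi) * proj h k xi + psi (enorm xi) * (h k xi - proj h k xi).
Proof.
rewrite /MA /proj -[X in _ * (X - _)](sum_delta k (fun l => h l xi)) -sumrB !mulr_sumr -big_split /=.
by apply: eq_bigr => l _; rewrite /mult; ring.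
Qed.

(** Component k of P h is xi_k (xi.h) / |xi|^2. *)
Lemma proj_neq0 (h : 'I_n -> E -> R) k xi : tnth xi k != 0 ->
  \sum_l tnth xi l * h l xi != 0 -> proj h k xi != 0.
Proof.
move=> xk hs; have r0 : enorm xi != 0.
  by apply: contraNneq xk => r0; rewrite -normr_le0 -r0 coord_enorm.
rewrite /proj (eq_bigr (fun l => tnth xi k / enorm xi ^+ 2 * (tnth xi l * h l xi))); last first.
  by move=> l _; rewrite /Pr; field.
by rewrite -mulr_sumr mulf_neq0// mulf_neq0// invr_eq0 expf_neq0.
Qed.

Lemma hart_0 f (z : E) : (forall i, tnth z i = 0) -> hart f z = moment f.
Proof.
move=> z0; apply: int_ext => x; rewrite /dot big1 => [|i _]; last by rewrite z0 mulr0.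
by rewrite /cas cos0 sin0 addr0 mul1r.
Qed.

(** The diagonal is taken unless it is orthogonal to M; then adding a basis vector e_l with M l
    nonzero repairs it. Coordinates between 1 and 2 keep the direction off the coordinate
    hyperplanes. *)
Lemma good_direction (M : 'I_n -> R) : \sum_k `|M k| != 0 ->
  exists om : E, (forall i, 1 <= tnth om i <= 2) /\ \sum_l tnth om l * M l != 0.
Proof.
move=> M0.
have [s0|s0] := eqVneq (\sum_l M l) 0; last first.
  exists [tuple 1 | i < n]; split; first by move=> i; rewrite tnth_mktuple lexx ler1n.
  by under eq_bigr do rewrite tnth_mktuple mul1r.
have [l Ml] : exists l, M l != 0.
  apply/existsP; apply: contraNT M0 => /existsPn H.
  by rewrite big1// => l _; move: (H l); rewrite negbK => /eqP ->; rewrite normr0.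
exists [tuple 1 + (i == l)%:R | i < n]; split.
  by move=> i; rewrite tnth_mktuple; case: eqP => _ /=; rewrite ?(mulr1n, mulr0n); apply/andP; split; lra.
under eq_bigr do rewrite tnth_mktuple mulrDl mul1r eq_sym.
by rewrite big_split /= s0 add0r sum_delta.
Qed.

End neighborhoods.

(** * Lower bound by a constant for large times *)

Section lower_bound.
Context (R : realType) (n : nat) (lam mu : R).
Hypotheses (hlam : 0 < lam + 2 * mu) (hmu : 0 < mu) (hne : lam + mu != 0).
Local Notation E := (Rn R n.+2).
Local Notation leb := (lebesgue_Rn R n.+2).
Local Notation L2 := (L2 leb).
Local Notation nm := (nm leb).
Local Notation itg := (itg leb).
Local Notation int_of := int.
Local Notation int := (int leb).
Local Notation a1 := (Num.sqrt (lam + 2 * mu)).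
Local Notation a2 := (Num.sqrt mu).
Implicit Types (xi : E).
Variables (f0 f1 : 'I_n.+2 -> E -> R).
Hypotheses (H0 : forall k, L12 (f0 k)) (H1 : forall k, L12 (f1 k)).
Variable N : 'I_n.+2.

Let a10 : 0 < a1. Proof. by rewrite sqrtr_gt0. Qed.
Let a20 : 0 < a2. Proof. by rewrite sqrtr_gt0. Qed.

(** Times t, it bounds from below the frequencies 2 a1, 2 a2, a1 + a2 and |a1 - a2| left after
    squaring. *)
Definition gam : R := Num.min (Num.min a1 a2) `|a1 - a2|.

Lemma gam_gt0 : 0 < gam.
Proof.
rewrite !lt_min a10 a20 normr_gt0 subr_eq0 /=; apply: contraNneq hne => e.
have := congr1 (fun z => z ^+ 2) e; rewrite !sqr_sqrtr ?(ltW hlam) ?(ltW hmu)// => h.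
by apply/eqP; lra.
Qed.

Lemma gam1 : gam <= a1. Proof. by rewrite !ge_min lexx. Qed.
Lemma gam2 : gam <= a2. Proof. by rewrite !ge_min lexx orbT. Qed.
Lemma gam12 : gam <= `|a1 - a2|. Proof. by rewrite ge_min lexx orbT. Qed.

Let h0 k := hart (f0 k).
Let h1 k := hart (f1 k).

Lemma HU_amp t xi : HU lam mu f0 f1 t N xi =
  proj h0 N xi * cos (t * a1 * enorm xi) + proj h1 N xi / (a1 * enorm xi) * sin (t * a1 * enorm xi) +
  (h0 N xi - proj h0 N xi) * cos (t * a2 * enorm xi) +
  (h1 N xi - proj h1 N xi) / (a2 * enorm xi) * sin (t * a2 * enorm xi).
Proof. by rewrite /HU (MA_split _ _ h0) (MA_split _ _ h1) /cosr /sinr; ring. Qed.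

Lemma HU_L2 t : L2 (HU lam mu f0 f1 t N).
Proof.
have L0 l : L2 (h0 l) by exact: (hart_isometry (H0 l)).1.
have L1 l : L2 (h1 l) by exact: (hart_isometry (H1 l)).1.
exact: (WU_L2 a10 a20 L0 L1 t N).
Qed.

Lemma amp_error (a b c d a' b' c' d' x y e : R) : `|a - a'| <= e -> `|b - b'| <= e ->
  `|c - c'| <= e -> `|d - d'| <= e ->
  `|(a * cos x + b * sin x + c * cos y + d * sin y) -
    (a' * cos x + b' * sin x + c' * cos y + d' * sin y)| <= 4 * e.
Proof.
move=> ea eb ec ed.
have -> : (a * cos x + b * sin x + c * cos y + d * sin y) -
    (a' * cos x + b' * sin x + c' * cos y + d' * sin y) =
    (a - a') * cos x + (b - b') * sin x + (c - c') * cos y + (d - d') * sin y by ring.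
have B (u v : R) : `|u| <= e -> `|v| <= 1 -> `|u * v| <= e.
  by move=> ue v1; rewrite normrM; apply: le_trans ue; rewrite ler_piMr.
have -> : 4 * e = e + e + e + e by ring.
apply: le_trans (ler_normD _ _) _; apply: lerD; last by apply: B => //; exact: sin_max.
apply: le_trans (ler_normD _ _) _; apply: lerD; last by apply: B => //; exact: cos_max.
by apply: le_trans (ler_normD _ _) _; apply: lerD; apply: B => //; [exact: cos_max|exact: sin_max].
Qed.

(** 128 = 8 * 16: beyond this time the oscillating part of [core_lower] takes at most half of the
    main term. *)
Lemma tail_arith (g t w D : R) : 128 <= t * (g * w * D) -> 8 <= w / 16 * D * (g * t).
Proof. by move=> h; lra. Qed.

Lemma int_box m (p q : 'I_m -> R) (D : R) : (forall i, q i - p i = D) -> 0 <= D ->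
  int_of (lebesgue_Rn R m) \1_(box p q) = D ^+ m.
Proof.
move=> pq D0; rewrite int_indic; last exact: measurable_box.
rewrite leb_box => [|i]; last by rewrite -subr_ge0 pq.
by rewrite /= (eq_bigr (fun=> D)) ?prodr_const ?card_ord.
Qed.

Lemma int_box_le (Q : set E) (H : E -> R) : measurable Q -> L2 H ->
  int (fun xi => \1_Q xi * H xi ^+ 2) <= nm H ^+ 2.
Proof.
move=> mQ LH; rewrite nm_sqE; apply: int_le; last first.
- by move=> xi; rewrite ler_piMl ?sqr_ge0//; apply: le_trans (indic_norm Q xi); exact: ler_norm.
- exact: L2_itg.
apply: (itg_le _ _ (L2_itg LH)).
  by apply: measurable_funM; [exact: measurable_indicR|apply: measurable_funX; exact: LH.1].
move=> xi; rewrite normrM [X in _ * X]ger0_norm ?sqr_ge0// ler_piMl ?sqr_ge0//.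
exact: indic_norm.
Qed.

Lemma cvg_wt (x0 : E) : enorm x0 != 0 -> wt x @[x --> nb x0] --> wt x0.
Proof. by move=> r0; apply: cvgM; [exact: cvg_tnth|apply: cvgV => //; exact: cvg_enorm]. Qed.

Lemma cvg_proj (f : 'I_n.+2 -> E -> R) (x0 : E) : (forall k, itg (f k)) -> enorm x0 != 0 ->
  proj (fun k => hart (f k)) N x @[x --> nb x0] --> proj (fun k => hart (f k)) N x0.
Proof.
by move=> If r0; apply: cvg_sumf => l; apply: cvgM; [exact: cvg_Pr|exact: hart_cvg].
Qed.

Lemma near_eq_le (T : Type) (F : set_system T) (FF : Filter F) (f : T -> R) (a e : R) :
  f @ F --> a -> 0 < e -> F [set t | `|f t - a| <= e].
Proof.
by move=> /cvgrPdist_le H e0; apply: filterS (H e e0) => t /=; rewrite distrC.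
Qed.

(** By continuity the four amplitudes of [HU_amp] can be frozen at [x0] on a small box; they do not
    all vanish, since the longitudinal part of one datum does not. *)
Lemma lower_point (x0 : E) (m : R) : 0 < m -> (forall i, m <= tnth x0 i) ->
  proj h0 N x0 != 0 \/ proj h1 N x0 != 0 ->
  exists2 c : R, 0 < c & exists T : R, forall t, T <= t -> c <= nm (HU lam mu f0 f1 t N).
Proof.
move=> m0 hm hA.
have r0 : 0 < enorm x0.
  apply: lt_le_trans (coord_enorm x0 ord0); rewrite normr_gt0 gt_eqF//.
  exact: lt_le_trans (hm _).
have rn : enorm x0 != 0 by rewrite gt_eqF.
have I0 k : itg (f0 k) := (H0 k).1. have I1 k : itg (f1 k) := (H1 k).1.
have cp0 := cvg_proj I0 rn; have cp1 := cvg_proj I1 rn.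
have cr := @cvg_enorm R _ x0.
have inv (a : R) : 0 < a -> (a * enorm x)^-1 @[x --> nb x0] --> (a * enorm x0)^-1.
  by move=> a0; apply: cvgV; [rewrite mulf_neq0// gt_eqF|apply: cvgM => //; exact: cvg_cst].
pose am1 := proj h0 N; pose am2 xi := proj h1 N xi / (a1 * enorm xi).
pose am3 xi := h0 N xi - proj h0 N xi; pose am4 xi := (h1 N xi - proj h1 N xi) / (a2 * enorm xi).
have c1 : am1 x @[x --> nb x0] --> am1 x0 by exact: cp0.
have c2 : am2 x @[x --> nb x0] --> am2 x0 by apply: cvgM => //; exact: inv.
have c3 : am3 x @[x --> nb x0] --> am3 x0 by apply: cvgB => //; exact: hart_cvg.
have c4 : am4 x @[x --> nb x0] --> am4 x0.
  by apply: cvgM; [apply: cvgB => //; exact: hart_cvg|exact: inv].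
pose S := am1 x0 ^+ 2 + am2 x0 ^+ 2 + am3 x0 ^+ 2 + am4 x0 ^+ 2.
have S0 : 0 < S.
  have q (u : R) : u != 0 -> 0 < u ^+ 2 by move=> u0; rewrite lt_def sqr_ge0 sqrf_eq0 u0.
  have p1 := sqr_ge0 (am1 x0); have p2 := sqr_ge0 (am2 x0).
  have p34 : 0 <= am3 x0 ^+ 2 + am4 x0 ^+ 2 by rewrite addr_ge0 ?sqr_ge0.
  rewrite /S -addrA ltr_wpDr//; case: hA => h.
    by rewrite ltr_pwDl// q.
  by rewrite ltr_wpDl// q// /am2 mulf_neq0// invr_eq0 mulf_neq0// gt_eqF.
have wp : 0 < wt x0 by rewrite divr_gt0// (lt_le_trans m0).
pose w0 := wt x0 / 2; have w00 : 0 < w0 by rewrite divr_gt0.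
(* The four amplitude errors add up to 4 e, whose square is exactly the tolerance S w0 / 8 of
   [core_lower]. *)
pose e := Num.sqrt (S * w0 / 8) / 4.
have Sw : 0 < S * w0 / 8 by rewrite divr_gt0// mulr_gt0.
have e0 : 0 < e by rewrite divr_gt0// sqrtr_gt0.
have [d d0 Hd] : nb x0 [set x | [/\ `|am1 x - am1 x0| <= e, `|am2 x - am2 x0| <= e,
    `|am3 x - am3 x0| <= e, `|am4 x - am4 x0| <= e & w0 <= wt x]].
  have FF : Filter (nb x0) by exact: nb_filter.
  have n1 := near_eq_le FF c1 e0; have n2 := near_eq_le FF c2 e0.
  have n3 := near_eq_le FF c3 e0; have n4 := near_eq_le FF c4 e0.
  have n5 := near_eq_le FF (cvg_wt rn) w00.
  apply: filterS (filterI n1 (filterI n2 (filterI n3 (filterI n4 n5)))) => x /= [? [? [? [? h]]]].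
  split => //; move: h; rewrite ler_norml /w0 => /andP[h _]; lra.
(* The bound m / 2 keeps the box in the open positive orthant. *)
pose d' := Num.min d (m / 2).
have d'0 : 0 < d' by rewrite lt_min d0 divr_gt0.
have d'd : d' <= d by rewrite ge_min lexx.
have d'm : d' <= m / 2 by rewrite ge_min lexx orbT.
pose p i := tnth x0 i - d'; pose q i := tnth x0 i + d'.
have p0 i : 0 < p i by rewrite subr_gt0; apply: le_lt_trans d'm _; apply: lt_le_trans (hm i); lra.
have qp i : q i - p i = 2 * d' by rewrite /q /p; ring.
have pq i : p i <= q i by rewrite -subr_ge0 qp mulr_ge0// ltW.
have inQ x : box p q x -> forall i, `|tnth x i - tnth x0 i| <= d.
  move=> hx i; have /andP[/ltW b1 b2] := hx i.
  by apply: le_trans d'd; rewrite ler_distl b1 b2.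
pose D := 2 * d'; have D0 : 0 < D by rewrite mulr_gt0.
have V : int \1_(box p q : set E) = D ^+ n.+2 by apply: int_box => //; exact: ltW.
have V' : int_of (lebesgue_Rn R n.+1) \1_(box (fun i => p (lift ord0 i)) (fun i => q (lift ord0 i))) = D ^+ n.+1.
  by apply: int_box; [move=> i; exact: qp|exact: ltW].
have g0 := gam_gt0.
pose c2' := S * (w0 / 16 * D ^+ n.+2).
have c0 : 0 < c2'.
  by apply: mulr_gt0 => //; apply: mulr_gt0; [exact: divr_gt0|exact: exprn_gt0].
exists (Num.sqrt c2'); first by rewrite sqrtr_gt0.
exists (128 / (gam * w0 * D)) => t Tt.
have gw : 0 < gam * w0 * D by apply: mulr_gt0 => //; exact: mulr_gt0.
have T0 : 0 < 128 / (gam * w0 * D) by exact: divr_gt0.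
have t0 : 0 < t by exact: lt_le_trans Tt.
have := @core_lower R n p q (HU lam mu f0 f1 t N) (am1 x0) (am2 x0) (am3 x0) (am4 x0)
  t a1 a2 gam (4 * e) w0 p0 pq (HU_L2 t) t0 g0 gam1 gam2 gam12 w00.
move=> /(_ _ _ _); rewrite V V' -/S.
have hw x : box p q x -> w0 <= wt x by move=> /inQ/Hd[].
have hH x : box p q x -> `|HU lam mu f0 f1 t N x - (am1 x0 * cos (t * a1 * enorm x) +
   am2 x0 * sin (t * a1 * enorm x) + am3 x0 * cos (t * a2 * enorm x) + am4 x0 * sin (t * a2 * enorm x))| <= 4 * e.
  by move=> /inQ/Hd[*]; rewrite HU_amp; exact: amp_error.
move=> /(_ hw hH); have -> : (4 * e) ^+ 2 = S * w0 / 8.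
  rewrite /e mulrC divfK ?sqr_sqrtr ?ltW//.
move=> /(_ (lexx _)) core.
have := le_trans core (int_box_le (measurable_box p q) (HU_L2 t)) => {}core.
rewrite -(@ler_pXn2r _ 2)// ?nnegrE ?sqrtr_ge0 ?nm_ge0// (sqr_sqrtr (ltW c0)).
apply: le_trans core; rewrite /c2' ler_wpM2l ?(ltW S0)//.
move: Tt; rewrite (ler_pdivrMr _ _ gw) => Tt.
have gtp : 0 < gam * t by exact: mulr_gt0.
have h8 : 8 / (gam * t) * D ^+ n.+1 <= w0 / 16 * D ^+ n.+2.
  rewrite [D ^+ n.+2]exprS mulrA ler_wpM2r ?exprn_ge0 ?(ltW D0)//.
  rewrite (ler_pdivrMr _ _ gtp); exact: tail_arith.
have -> : w0 / 8 * D ^+ n.+2 = w0 / 16 * D ^+ n.+2 + w0 / 16 * D ^+ n.+2 by field.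
by rewrite -addrA lerDl subr_ge0.
Qed.

(** Near the origin the transforms are close to the moments, so at a small multiple of a good
    direction xi.hart f is nonzero, and with it the longitudinal projection. *)
Lemma lower_const : vmoment f0 != 0 \/ vmoment f1 != 0 ->
  exists2 c : R, 0 < c & exists T : R, forall t, T <= t -> c <= nm (HU lam mu f0 f1 t N).
Proof.
have key (f : 'I_n.+2 -> E -> R) : (forall k, L12 (f k)) -> vmoment f != 0 ->
    exists2 m : R, 0 < m & exists x0 : E, (forall i, m <= tnth x0 i) /\ proj (fun k => hart (f k)) N x0 != 0.
  move=> Hf /good_direction[om [om12 hs]].
  pose z : E := [tuple 0 | i < n.+2].
  have z0 i : tnth z i = 0 by rewrite tnth_mktuple.
  have c : (\sum_l tnth om l * hart (f l) x) @[x --> nb z] --> \sum_l tnth om l * moment (f l).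
    apply: cvg_sumf => l; apply: cvgM; first exact: cvg_cst.
    by rewrite -(hart_0 _ z0); apply: hart_cvg; exact: (Hf l).1.
  have s0 : 0 < `|\sum_l tnth om l * moment (f l)| / 2 by rewrite divr_gt0// normr_gt0.
  have [d d0 Hd] := near_eq_le (nb_filter z) c s0.
  (* Halved because the coordinates of the direction go up to 2. *)
  exists (d / 2); first by rewrite divr_gt0.
  pose x0 : E := [tuple (d / 2) * tnth om i | i < n.+2].
  have xE i : tnth x0 i = d / 2 * tnth om i by rewrite tnth_mktuple.
  have d2 : 0 < d / 2 by rewrite divr_gt0.
  exists x0; split.
    by move=> i; rewrite xE ler_peMr ?(ltW d2)//; have /andP[] := om12 i.
  have hx : \sum_l tnth om l * hart (f l) x0 != 0.
    have hx i : `|tnth x0 i - tnth z i| <= d.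
      rewrite xE z0 subr0 normrM (gtr0_norm d2).
      have /andP[b1 b2] := om12 i.
      rewrite ger0_norm ?(le_trans _ b1)//; nra.
    have /= := Hd x0 hx; apply: contraTneq => ->.
    rewrite sub0r normrN -ltNge; move: s0; lra.
  apply: proj_neq0.
    have /andP[b1 _] := om12 N.
    by rewrite xE mulf_neq0 ?gt_eqF//; exact: lt_le_trans b1.
  rewrite (eq_bigr (fun l => d / 2 * (tnth om l * hart (f l) x0))); last first.
    by move=> l _; rewrite xE mulrA.
  by rewrite -mulr_sumr mulf_neq0// gt_eqF.
case=> [/(key _ H0)|/(key _ H1)] [m m0 [x0 [hx hp]]].
  exact: (lower_point m0 hx (or_introl hp)).
exact: (lower_point m0 hx (or_intror hp)).
Qed.

End lower_bound.

Section scaling.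
Context (R : realType) (n : nat).
Local Notation E := (Rn R n).
Implicit Types (x : E) (c : R).

Definition scale c x : E := coordmap (fun _ y => c * y) x.

Lemma tnth_scale c x i : tnth (scale c x) i = c * tnth x i.
Proof. by rewrite tnth_mktuple. Qed.

Lemma enorm_scale c x : 0 <= c -> enorm (scale c x) = c * enorm x.
Proof.
move=> c0; rewrite /enorm (_ : dot _ _ = c ^+ 2 * dot x x).
  by rewrite sqrtrM ?sqr_ge0// sqrtr_sqr ger0_norm.
by rewrite /dot mulr_sumr; apply: eq_bigr => i _; rewrite tnth_scale; ring.
Qed.

Lemma Pr_scale c x k l : 0 < c -> Pr (scale c x) k l = Pr x k l.
Proof.
move=> c0; rewrite /Pr enorm_scale ?ltW// !tnth_scale.
have [->|r0] := eqVneq (enorm x) 0; first by rewrite mulr0 invr0 !mulr0.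
by field; rewrite r0 gt_eqF.
Qed.

End scaling.

Lemma log2_floor (R : realType) (t : R) : 0 <= t ->
  exists K : nat, ln (t + 2) <= K%:R * ln 2 /\ 2 ^+ K <= 2 * (t + 2).
Proof.
move=> t0; have t2 : 0 < t + 2 by rewrite ltr_wpDl.
have ex : exists K, t + 2 < 2 ^+ K.
  exists (Num.truncn (t + 2)).+1; apply: lt_le_trans (truncnS_gt _) _.
  by rewrite -natrX ler_nat ltnW// ltn_expl.
case: (ex_minnP ex) => K hK min; exists K; split.
  have : ln (t + 2) <= ln (2 ^+ K) by rewrite ler_ln ?posrE ?exprn_gt0// ltW.
  by rewrite lnXn// -[_ *+ K]mulr_natl.
case: K hK min => [|K] _ min; first by rewrite expr0; lra.
rewrite exprS ler_wpM2l// leNgt; apply/negP => /min; by rewrite ltnn.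
Qed.

Lemma sum_tail_ge (R : realType) (a : nat -> R) (c : R) (k0 L : nat) :
  (forall k, 0 <= a k) -> (forall k, (k0 <= k < L)%N -> c <= a k) ->
  (L - k0)%:R * c <= \sum_(k < L) a k.
Proof.
move=> a0; elim: L => [|L IH] ha; first by rewrite big_ord0 sub0n mul0r.
rewrite big_ord_recr /=; have [kL|kL] := leqP k0 L.
  rewrite subSn// -natr1 mulrDl mul1r lerD//; last by apply: ha; rewrite kL ltnSn.
  by apply: IH => k /andP[k1 k2]; apply: ha; rewrite k1 ltnW.
by rewrite (eqP (_ : L.+1 - k0 == 0)%N) ?mul0r ?addr_ge0 ?sumr_ge0// subn_eq0.
Qed.

Lemma radial_cancel (R : realType) (r b1 b2 p0 p1 q0 q1 c1 s1 c2 s2 : R) :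
  r != 0 -> b1 != 0 -> b2 != 0 ->
  r * (p0 * c1 + p1 / (b1 * r) * s1 + q0 * c2 + q1 / (b2 * r) * s2) =
  r * p0 * c1 + p1 / b1 * s1 + r * q0 * c2 + q1 / b2 * s2.
Proof. by move=> r0 b10 b20; field; rewrite r0 b10 b20. Qed.

Lemma count_arith (R : realType) (c l lt K k m : R) : 0 < c -> 0 < l ->
  lt <= K * l -> 2 * k * l <= lt -> K - k <= m -> c / (2 * l) * lt <= m * c.
Proof.
move=> c0 l0 h1 h2 h3; rewrite mulrAC ler_pdivrMr ?mulr_gt0// [m * c]mulrC -mulrA ler_wpM2l ?(ltW c0)//.
have := ler_wpM2r (ltW l0) h3; nra.
Qed.

(** * Logarithmic growth in dimension 2 *)

Section log_growth.
Context (R : realType) (lam mu : R).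
Hypotheses (hlam : 0 < lam + 2 * mu) (hmu : 0 < mu) (hne : lam + mu != 0).
Local Notation E := (Rn R 2).
Local Notation leb := (lebesgue_Rn R 2).
Local Notation L2 := (L2 leb).
Local Notation nm := (nm leb).
Local Notation itg := (itg leb).
Local Notation int_of := int.
Local Notation int := (int leb).
Local Notation a1 := (Num.sqrt (lam + 2 * mu)).
Local Notation a2 := (Num.sqrt mu).
Local Notation gam := (gam lam mu).
Variables (f0 f1 : 'I_2 -> E -> R).
Hypotheses (H0 : forall k, L12 (f0 k)) (H1 : forall k, L12 (f1 k))
  (M1 : vmoment f1 != 0).
Variable N : 'I_2.

Let a10 : 0 < a1. Proof. by rewrite sqrtr_gt0. Qed.
Let a20 : 0 < a2. Proof. by rewrite sqrtr_gt0. Qed.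

Let h0 k := hart (f0 k).
Let h1 k := hart (f1 k).

Local Notation half := (2^-1 : R).

Let half_gt0 k : 0 < half ^+ k. Proof. by rewrite exprn_gt0// invr_gt0. Qed.

(* Points near [om] scaled by arbitrarily small powers of [1/2]. *)
Let F om : set_system (E * nat) := filter_prod (nb om) \oo.

Lemma cvg_scale_hart f om : itg f ->
  hart f (scale (half ^+ z.2) z.1) @[z --> F om] --> moment f.
Proof.
move=> If; pose z0 : E := [tuple 0 | i < 2].
have z00 i : tnth z0 i = 0 by rewrite tnth_mktuple.
rewrite -(hart_0 f z00).
apply: (cvg_comp (fun z : E * nat => scale (half ^+ z.2) z.1) (hart f)); last exact: hart_cvg If.
move=> A [d d0 HA].
have c : half ^+ k @[k --> \oo] --> (0 : R).
  by apply: cvg_expr; rewrite ger0_norm ?invr_ge0// invf_lt1// ltr1n.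
pose B := \sum_i `|tnth om i| + 1.
have B0 : 0 < B by rewrite ltr_wpDl// sumr_ge0.
have e0 : 0 < d / B by exact: divr_gt0.
exists ([set x | forall i, `|tnth x i - tnth om i| <= 1], [set k | half ^+ k <= d / B]).
  split=> /=; first by exists 1.
  by apply: filterS (near_eq_le _ c e0) => k /=; rewrite subr0 ger0_norm// ltW.
move=> [x k] [/= hx hk]; apply: HA => i.
rewrite z00 subr0 tnth_scale normrM (gtr0_norm (half_gt0 k)).
apply: (@le_trans _ _ (d / B * B)); last by rewrite divfK// gt_eqF.
apply: ler_pM; [exact: ltW|exact: normr_ge0|exact: hk|].
have := ler_normD (tnth x i - tnth om i) (tnth om i); rewrite subrK => h.
apply: le_trans h _; rewrite addrC; apply: lerD => //.
by rewrite (bigD1 i)//= lerDl sumr_ge0.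
Qed.

Let FF om : Filter (F om). Proof. exact: filter_prod_filter. Qed.

(** After multiplication by r, the amplitudes coming from f0 tend to 0 along the scaled boxes while
    those from f1 tend to constants, with [A2] nonzero. One lower bound thus holds on every box 2^-k
    Q with t 2^-k large, and these disjoint boxes number a multiple of ln (t + 2). *)
Lemma lower_log : exists2 c : R, 0 < c & exists T : R, forall t, T <= t ->
  c * Num.sqrt (ln (t + 2)) <= nm (HU lam mu f0 f1 t N).
Proof.
have [om [om12 hs]] := good_direction M1.
have om0 i : 0 < tnth om i by have /andP[b1 _] := om12 i; exact: lt_le_trans b1.
have r0 : 0 < enorm om.
  by apply: lt_le_trans (coord_enorm om ord0); rewrite normr_gt0 gt_eqF.
have rn : enorm om != 0 by rewrite gt_eqF.
pose pM (f : 'I_2 -> E -> R) := \sum_l Pr om N l * moment (f l).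
have c1st (f : E -> R) (a : R) : f x @[x --> nb om] --> a -> f z.1 @[z --> F om] --> a.
  by move=> h; apply: (cvg_comp (@fst E nat) f); [exact: cvg_fst|exact: h].
have cproj f : (forall k, itg (f k)) ->
    proj (fun k => hart (f k)) N (scale (half ^+ z.2) z.1) @[z --> F om] --> pM f.
  move=> If; rewrite (_ : (fun z => _) = fun z : E * nat => \sum_l Pr z.1 N l *
      hart (f l) (scale (half ^+ z.2) z.1)); last first.
    by apply/funext => z; apply: eq_bigr => l _; rewrite Pr_scale.
  apply: cvg_sumf => l; apply: cvgM; last exact: cvg_scale_hart.
  by apply: (c1st (fun x => Pr x N l)); exact: cvg_Pr.
have I0 k : itg (f0 k) := (H0 k).1. have I1 k : itg (f1 k) := (H1 k).1.
have chalf : half ^+ z.2 @[z --> F om] --> (0 : R).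
  apply: (cvg_comp (@snd E nat) (fun k => half ^+ k)); first exact: cvg_snd.
  by apply: cvg_expr; rewrite ger0_norm ?invr_ge0// invf_lt1// ltr1n.
have cr : enorm (scale (half ^+ z.2) z.1) @[z --> F om] --> (0 : R).
  rewrite (_ : (fun z => _) = fun z : E * nat => half ^+ z.2 * enorm z.1); last first.
    by apply/funext => z; rewrite enorm_scale// ltW.
  rewrite -[X in _ --> X](mul0r (enorm om)); apply: cvgM => //.
  by apply: (c1st (@enorm R 2)); exact: cvg_enorm.
pose sc (z : E * nat) : E := scale (half ^+ z.2) z.1.
pose am1 xi := enorm xi * proj h0 N xi; pose am2 xi := proj h1 N xi / a1.
pose am3 xi := enorm xi * (h0 N xi - proj h0 N xi); pose am4 xi := (h1 N xi - proj h1 N xi) / a2.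
pose A2 := pM f1 / a1; pose A4 := (moment (f1 N) - pM f1) / a2.
have c1 : am1 (sc z) @[z --> F om] --> (0 : R).
  by rewrite -[X in _ --> X](mul0r (pM f0)); apply: cvgM => //; exact: cproj.
have c2 : am2 (sc z) @[z --> F om] --> A2.
  by apply: cvgM; [exact: cproj|exact: cvg_cst].
have c3 : am3 (sc z) @[z --> F om] --> (0 : R).
  rewrite -[X in _ --> X](mul0r (moment (f0 N) - pM f0)); apply: cvgM => //.
  by apply: cvgB; [exact: cvg_scale_hart|exact: cproj].
have c4 : am4 (sc z) @[z --> F om] --> A4.
  by apply: cvgM; [apply: cvgB; [exact: cvg_scale_hart|exact: cproj]|exact: cvg_cst].
have A20 : A2 != 0.
  rewrite mulf_neq0 ?invr_eq0 ?(gt_eqF a10)//.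
  rewrite /pM (eq_bigr (fun l => tnth om N / enorm om ^+ 2 * (tnth om l * moment (f1 l)))).
    by rewrite -mulr_sumr !mulf_neq0 ?invr_eq0 ?expf_neq0// gt_eqF.
  by move=> l _; rewrite /Pr; field.
pose S := 0 ^+ 2 + A2 ^+ 2 + 0 ^+ 2 + A4 ^+ 2.
have S0 : 0 < S.
  rewrite /S expr0n /= add0r addr0 ltr_pwDl ?sqr_ge0//.
  by rewrite lt_def sqr_ge0 sqrf_eq0 A20.
have wp : 0 < wt om by exact: divr_gt0.
pose w0 := wt om / 2; have w00 : 0 < w0 by exact: divr_gt0.
pose e := Num.sqrt (S * w0 / 8) / 4.
have Sw : 0 < S * w0 / 8 by apply: divr_gt0 => //; exact: mulr_gt0.
have e0 : 0 < e by apply: divr_gt0 => //; rewrite sqrtr_gt0.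
pose rho := enorm om + 1; have rho0 : 0 < rho by exact: addr_gt0.
have [[U W] /= [[d d0 Hd] [k0 _ Hk0]] HUW] : F om [set z | [/\ `|am1 (sc z) - 0| <= e,
    `|am2 (sc z) - A2| <= e, `|am3 (sc z) - 0| <= e, `|am4 (sc z) - A4| <= e &
    w0 <= wt z.1 /\ enorm z.1 <= rho]].
  have n1 := near_eq_le (FF om) c1 e0; have n2 := near_eq_le (FF om) c2 e0.
  have n3 := near_eq_le (FF om) c3 e0; have n4 := near_eq_le (FF om) c4 e0.
  have n5 := near_eq_le (FF om) (c1st _ _ (cvg_wt rn)) w00.
  have n6 := near_eq_le (FF om) (c1st _ _ (@cvg_enorm R _ om)) ltr01.
  apply: filterS (filterI n1 (filterI n2 (filterI n3 (filterI n4 (filterI n5 n6))))) => z /=.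
  move=> [? [? [? [? [h h']]]]]; split => //; split.
    by move: h; rewrite ler_norml /w0 => /andP[h _]; lra.
  by move: h'; rewrite ler_norml /rho => /andP[_ h']; lra.
(* With 3 d' < 1 <= om_i, one gets 2^-(k+1) (om_i + d') <= 2^-k (om_i - d'): consecutive boxes are
   disjoint. *)
pose d' := Num.min d (4^-1).
have d'0 : 0 < d' by rewrite lt_min; apply/andP; split=> //; rewrite invr_gt0 ltr0n.
have d'd : d' <= d by rewrite ge_min lexx.
have d'm : d' <= 4^-1 by rewrite ge_min lexx orbT.
pose p k (i : 'I_2) := half ^+ k * (tnth om i - d').
pose q k (i : 'I_2) := half ^+ k * (tnth om i + d').
have omd i : 0 < tnth om i - d' by have /andP[b1 _] := om12 i; lra.
have p0 k i : 0 < p k i by exact: mulr_gt0.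
pose D := 2 * d'; have D0 : 0 < D by exact: mulr_gt0.
have qp k i : q k i - p k i = half ^+ k * D by rewrite /q /p /D; ring.
have hD k : 0 <= half ^+ k * D by apply: mulr_ge0; exact: ltW.
have pq k i : p k i <= q k i by rewrite -subr_ge0 qp.
have V k : int \1_(box (p k) (q k) : set E) = (half ^+ k * D) ^+ 2.
  by apply: int_box; [exact: qp|exact: hD].
have V' k : int_of (lebesgue_Rn R 1) \1_(box (fun i => p k (lift ord0 i)) (fun i => q k (lift ord0 i))) =
    half ^+ k * D.
  by rewrite -[RHS]expr1; apply: int_box; [move=> i; exact: qp|exact: hD].
have inQ k x : box (p k) (q k) x -> (k0 <= k)%N -> exists z : E, [/\ x = sc (z, k), U z & W k].
  move=> hx kk; exists (scale (2 ^+ k) x); split.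
  - apply: eq_from_tnth => i; rewrite !tnth_scale mulrA -exprMn mulVf ?expr1n ?mul1r//.
  - apply: Hd => i; rewrite tnth_scale; apply: le_trans d'd.
    have /andP[/ltW b1 b2] := hx i.
    have e2 : 2 ^+ k * half ^+ k = 1 by rewrite -exprMn mulfV ?expr1n.
    have t2 : 0 <= 2 ^+ k :> R by rewrite exprn_ge0.
    have := ler_wpM2l t2 b1; have := ler_wpM2l t2 b2.
    rewrite /p /q !mulrA e2 !mul1r ler_distl => -> ->; exact: erefl.
  - exact: Hk0.
have g0 := gam_gt0 hlam hmu hne.
(* Free of k: in dimension 2 the area of the box and the bound on r^2 both scale like 4^-k. *)
pose cc := S * w0 * D ^+ 2 / (16 * rho ^+ 2).
have cc0 : 0 < cc.
  apply: divr_gt0; last by apply: mulr_gt0 => //; exact: exprn_gt0.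
  by apply: mulr_gt0; [exact: mulr_gt0|exact: exprn_gt0].
have LH t := HU_L2 hlam hmu H0 H1 N t.
pose u t := HU lam mu f0 f1 t N.
have shell t k : 0 < t -> (k0 <= k)%N -> 128 <= t * (gam * w0 * (half ^+ k * D)) ->
    cc <= int (fun xi => \1_(box (p k) (q k)) xi * u t xi ^+ 2).
  move=> t0 kk ht; set Q := box (p k) (q k).
  have mQ : measurable Q by exact: measurable_box.
  have hw x : Q x -> w0 <= wt x.
    move=> /inQ/(_ kk)[z [-> Uz Wk]]; have [_ _ _ _ [h _]] := HUW (z, k) (conj Uz Wk).
    rewrite /wt tnth_scale enorm_scale ?(ltW (half_gt0 _))//=.
    by rewrite -mulf_div divff ?mul1r// gt_eqF.
  have hr x : Q x -> enorm x <= half ^+ k * rho.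
    move=> /inQ/(_ kk)[z [-> Uz Wk]]; have [_ _ _ _ [_ h]] := HUW (z, k) (conj Uz Wk).
    by rewrite enorm_scale ?(ltW (half_gt0 _))//= ler_wpM2l// ltW.
  pose G xi := \1_Q xi * (enorm xi * u t xi).
  have LG : L2 G.
    apply: L2_le (L2Z (half ^+ k * rho) (LH t)).
      apply: measurable_funM; first exact: measurable_indicR.
      by apply: measurable_funM; [exact: measurable_enorm|exact: (LH t).1].
    move=> xi; have [xQ|xQ] := pselect (Q xi); last by rewrite /G indicE memNset// mul0r normr0.
    rewrite /G indicE mem_set// mul1r !normrM ler_wpM2r// (ger0_norm (enorm_ge0 _)).
    by apply: le_trans (hr _ xQ) _; rewrite -normrM ler_norm.
  have hH x : Q x -> `|G x - (0 * cos (t * a1 * enorm x) + A2 * sin (t * a1 * enorm x) +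
      0 * cos (t * a2 * enorm x) + A4 * sin (t * a2 * enorm x))| <= 4 * e.
    move=> xQ; have [z [xz Uz Wk]] := inQ k x xQ kk.
    have [e1 e2 e3 e4 _] := HUW (z, k) (conj Uz Wk); rewrite -xz in e1 e2 e3 e4.
    have rx : enorm x != 0.
      rewrite gt_eqF//; apply: lt_le_trans (coord_enorm x ord0); rewrite normr_gt0 gt_eqF//.
      by have /andP[b1 _] := xQ ord0; exact: lt_trans (p0 k ord0) b1.
    rewrite /G indicE mem_set// mul1r /u HU_amp.
    rewrite (_ : enorm x * _ = am1 x * cos (t * a1 * enorm x) + am2 x * sin (t * a1 * enorm x) +
      am3 x * cos (t * a2 * enorm x) + am4 x * sin (t * a2 * enorm x)); first exact: amp_error.
    exact: (radial_cancel _ _ _ _ _ _ _ _ rx (lt0r_neq0 a10) (lt0r_neq0 a20)).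
  have := core_lower (p0 k) (pq k) LG t0 g0 (gam1 _ _) (gam2 _ _) (gam12 _ _) w00 hw hH.
  rewrite V V' -/S; have -> : (4 * e) ^+ 2 = S * w0 / 8.
    rewrite /e mulrC divfK ?sqr_sqrtr ?ltW//.
  move=> /(_ (lexx _)) core.
  have up : int (fun xi => \1_Q xi * G xi ^+ 2) <=
      (half ^+ k * rho) ^+ 2 * int (fun xi => \1_Q xi * u t xi ^+ 2).
    have IQ (f : E -> R) : L2 f -> itg (fun xi => \1_Q xi * f xi ^+ 2).
      move=> Lf; apply: (itg_le _ _ (L2_itg Lf)).
        by apply: measurable_funM; [exact: measurable_indicR|apply: measurable_funX; exact: Lf.1].
      move=> xi; rewrite normrM [X in _ * X]ger0_norm ?sqr_ge0// ler_piMl ?sqr_ge0//.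
      exact: indic_norm.
    have IH' := IQ _ (LH t).
    rewrite -(intZ _ IH').    apply: int_le; [exact: IQ|apply: itgZ; exact: IQ|move=> xi].
    have [xQ|xQ] := pselect (Q xi); last by rewrite indicE memNset// !mul0r mulr0.
    rewrite /G indicE mem_set// !mul1r exprMn ler_wpM2r ?sqr_ge0//.
    by rewrite lerXn2r ?nnegrE ?enorm_ge0 ?hr//; apply: le_trans (hr _ xQ); exact: enorm_ge0.
  have low : S * w0 / 16 * (half ^+ k * D) ^+ 2 <= int (fun xi => \1_Q xi * G xi ^+ 2).
    apply: le_trans core.
    have gtp : 0 < gam * t by exact: mulr_gt0.
    have h8 : 8 / (gam * t) * (half ^+ k * D) <= w0 / 16 * (half ^+ k * D) ^+ 2.
      rewrite expr2 mulrA ler_wpM2r//; rewrite (ler_pdivrMr _ _ gtp); exact: tail_arith.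
    have -> : S * w0 / 16 * (half ^+ k * D) ^+ 2 = S * (w0 / 16 * (half ^+ k * D) ^+ 2) by ring.
    rewrite ler_wpM2l ?(ltW S0)//.
    have -> : w0 / 8 * (half ^+ k * D) ^+ 2 = w0 / 16 * (half ^+ k * D) ^+ 2 + w0 / 16 * (half ^+ k * D) ^+ 2 by field.
    by rewrite -addrA lerDl subr_ge0.
  have := le_trans low up; have hk2 : 0 < (half ^+ k * rho) ^+ 2 by apply: exprn_gt0; exact: mulr_gt0.
  rewrite -ler_pdivrMl// => h; apply: le_trans h.
  rewrite le_eqVlt; apply/orP; left; apply/eqP; rewrite /cc.
  by field; rewrite (gt_eqF rho0) gt_eqF.
(* The right-hand side records that the first K boxes lie beyond [q K] in the first coordinate,
   which is what separates them from the next one in the induction. *)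
have disj x (K : nat) : \sum_(k < K) (\1_(box (p k) (q k)) x : R) <= ((q K ord0 < tnth x ord0)%R)%:R.
  elim: K => [|K IH]; first by rewrite big_ord0 ler0n.
  rewrite big_ord_recr /=.
  have qpK : q K.+1 ord0 <= p K ord0.
    rewrite /q /p exprS [half * _]mulrC -mulrA ler_wpM2l ?(ltW (half_gt0 K))//.
    have /andP[b1 _] := om12 ord0; lra.
  have [xQ|xQ] := pselect (box (p K) (q K) x).
    have /andP[b1 b2] := xQ ord0.
    have z : \sum_(k < K) (\1_(box (p k) (q k)) x : R) <= 0.
      by apply: le_trans IH _; rewrite ltNge b2.
    rewrite (le_lt_trans qpK b1) [X in _ + X]indicE mem_set//=.
    by rewrite -[leRHS]add0r lerD2r.
  rewrite [X in _ + X]indicE memNset// addr0; apply: le_trans IH _.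
  rewrite ler_nat; case: ltP => // h; rewrite (le_lt_trans _ h)//.
  by apply: le_trans qpK (pq K ord0).
have sumle t (K : nat) : \sum_(k < K) int (fun xi => \1_(box (p k) (q k)) xi * u t xi ^+ 2) <= nm (u t) ^+ 2.
  have IQ k : itg (fun xi => \1_(box (p k) (q k)) xi * u t xi ^+ 2).
    apply: (itg_le _ _ (L2_itg (LH t))).
      apply: measurable_funM; last by apply: measurable_funX; exact: (LH t).1.
      by apply: measurable_indicR; exact: measurable_box.
    move=> xi; rewrite normrM [X in _ * X]ger0_norm ?sqr_ge0// ler_piMl ?sqr_ge0//.
    exact: indic_norm.
  rewrite -int_sum => [|k]; last exact: IQ.
  rewrite nm_sqE; apply: int_le; [by apply: itg_sum => k; exact: IQ|exact: L2_itg (LH t)|move=> xi].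
  rewrite -mulr_suml ler_piMl ?sqr_ge0//; apply: le_trans (disj xi K) _.
  by case: (_ < _).
(* The largeness condition of [shell] reads 2^k <= kap t. *)
pose kap := gam * w0 * D / 128.
have kap0 : 0 < kap by apply: divr_gt0 => //; apply: mulr_gt0 => //; exact: mulr_gt0.
(* Discarding the last k1 boxes turns 2^K <= 4 t into 2^k <= kap t. *)
have [k1 hk1] : exists k1 : nat, 4 / kap <= 2 ^+ k1.
  exists (Num.truncn (4 / kap)).+1; apply: le_trans (ltW (truncnS_gt _)) _.
  by rewrite -natrX ler_nat ltnW// ltn_expl.
have l2 : 0 < ln 2 :> R by rewrite ln_gt0// ltr1n.
pose k2 := (k0 + k1)%N.
pose c := Num.sqrt (cc / (2 * ln 2)).
have c0 : 0 < cc / (2 * ln 2) by apply: divr_gt0 => //; exact: mulr_gt0.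
exists c; first by rewrite sqrtr_gt0.
(* From here on the k2 discarded boxes are at most half of log2 (t + 2), which accounts for the 2 in
   the constant. *)
exists (4 ^+ k2 + 2) => t Tt.
have p4 : 0 <= 4 ^+ k2 :> R by exact: exprn_ge0.
have t2 : 2 <= t by lra.
have t0 : 0 < t by lra.
have [K [hK1 hK2]] := log2_floor (ltW t0).
have lt0 : 0 <= ln (t + 2) by apply: ln_ge0; lra.
rewrite -(@ler_pXn2r _ 2)// ?nnegrE ?mulr_ge0 ?sqrtr_ge0 ?nm_ge0//.
rewrite exprMn (sqr_sqrtr lt0) (sqr_sqrtr (ltW c0)).
have cnt : (K - k2)%:R * cc <= nm (u t) ^+ 2.
  apply: le_trans (sumle t (K - k1)%N).
  have sub : (K - k2 = K - k1 - k0)%N by rewrite /k2 addnC subnDA.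
  rewrite sub; set L := (K - k1)%N.
  apply: (sum_tail_ge (a := fun k => int (fun xi => \1_(box (p k) (q k)) xi * u t xi ^+ 2))) => [k|k /andP[kk kL]].
    by apply: int_ge0 => xi; rewrite mulr_ge0 ?sqr_ge0// indicE.
  apply: shell => //.
  have kK : (k + k1 <= K)%N by move: kL; rewrite /L ltn_subRL addnC => /ltnW.
  have b1 : 2 ^+ (k + k1) <= 4 * t.
    apply: (@le_trans _ _ (2 ^+ K)); first by rewrite ler_eXn2l// ltr1n.
    by apply: le_trans hK2 _; lra.
  have b2 : 4 * 2 ^+ k <= 4 * (t * kap).
    move: hk1; rewrite ler_pdivrMr// => hk1.
    have := ler_wpM2l (exprn_ge0 k (ler0n R 2)) hk1.
    rewrite [X in _ <= X -> _]mulrA -exprD => h; rewrite mulrC; apply: le_trans h _.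
    by rewrite [leRHS]mulrA ler_wpM2r// ltW.
  have b3 : 2 ^+ k <= t * kap by move: b2; rewrite ler_pM2l.
  have -> : t * (gam * w0 * (half ^+ k * D)) = 128 * (t * kap) * half ^+ k by rewrite /kap; field.
  rewrite -[leLHS]mulr1 -mulrA ler_wpM2l//.
  have e1k : 2 ^+ k * half ^+ k = 1 by rewrite -exprMn mulfV ?expr1n.
  by have := ler_wpM2r (ltW (half_gt0 k)) b3; rewrite e1k.
apply: le_trans cnt.
have hlt : 2 * k2%:R * ln 2 <= ln (t + 2).
  have : ln (4 ^+ k2) <= ln (t + 2) by rewrite ler_ln ?posrE ?exprn_gt0//; lra.
  rewrite (_ : 4 = 2 ^+ 2); last by rewrite -natrX.
  by rewrite -exprM lnXn// -[_ *+ _]mulr_natl natrM.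
have hKk : K%:R - k2%:R <= (K - k2)%:R :> R.
  have [kK|kK] := leqP k2 K; first by rewrite natrB.
  by apply: le_trans (ler0n _ _); rewrite subr_le0 ler_nat ltnW.
exact: count_arith hK1 hlt hKk.
Qed.

End log_growth.

(** * Assembly of the bounds *)

Lemma vmoment_ge0 (R : realType) n (f : 'I_n -> Rn R n -> R) : 0 <= vmoment f.
Proof. by apply: sumr_ge0. Qed.

Lemma vL2norm_nm (R : realType) n (f : 'I_n -> Rn R n -> R) : (forall k, L12 (f k)) ->
  vL2norm f = \sum_k nm (lebesgue_Rn R n) (f k).
Proof. by move=> H; apply: eq_bigr => k _; rewrite L2norm_nm//; exact: (H k).2. Qed.

Lemma vL1norm_int (R : realType) n (f : 'I_n -> Rn R n -> R) : (forall k, L12 (f k)) ->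
  vL1norm f = \sum_k int (lebesgue_Rn R n) (fun x => `|f k x|).
Proof. by move=> H; apply: eq_bigr => k _; rewrite L1norm_int//; exact: (H k).1. Qed.

(** Turns a positive constant into a multiple of the moments, the factor being allowed to depend on
    the data; the 1 covers vanishing moments. *)
Lemma lower_scale (R : realType) (c0 a : R) : 0 < c0 -> 0 <= a -> c0 / (a + 1) * a <= c0.
Proof. by move=> c0_gt0 a0; rewrite mulrAC ler_pdivrMr ?ltr_wpDl//; nra. Qed.

Lemma lower_bound_HU (R : realType) (n : nat) (n2 : (2 <= n)%N) (lam mu : R)
    (hlam : 0 < lam + 2 * mu) (hmu : 0 < mu) (hne : lam + mu != 0)
    (f0 f1 : 'I_n -> Rn R n -> R) (N : 'I_n) :
  (forall k, L12 (f0 k)) -> (forall k, L12 (f1 k)) -> vmoment f0 != 0 \/ vmoment f1 != 0 ->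
  exists2 c : R, 0 < c & exists T : R, forall t : R, T <= t ->
    (if n == 2%N then c * vmoment f0 + c * vmoment f1 * Num.sqrt (ln (t + 2))
     else c * (vmoment f0 + vmoment f1)) <= nm (lebesgue_Rn R n) (HU lam mu f0 f1 t N).
Proof.
case: n n2 f0 f1 N => [//|[//|n]] n2 f0 f1 N H0 H1 hM.
have [c0 c00 [T0 HT0]] := lower_const hlam hmu hne H0 H1 N hM.
have v0 := vmoment_ge0 f0; have v1 := vmoment_ge0 f1.
case: n n2 f0 f1 N H0 H1 hM HT0 v0 v1 => [|n] n2 f0 f1 N H0 H1 hM HT0 v0 v1 /=; last first.
  exists (c0 / (vmoment f0 + vmoment f1 + 1)).
    by apply: divr_gt0 => //; rewrite ltr_wpDl// addr_ge0.
  by exists T0 => t /HT0; apply: le_trans; apply: lower_scale => //; rewrite addr_ge0.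
have [M1|M1] := eqVneq (vmoment f1) 0.
  exists (c0 / (vmoment f0 + 1)); first by apply: divr_gt0 => //; rewrite ltr_wpDl.
  exists T0 => t /HT0; apply: le_trans; rewrite M1 mulr0 mul0r addr0.
  exact: lower_scale.
have [c1 c10 [T1 HT1]] := lower_log hlam hmu hne H0 H1 M1 N.
have p0 : 0 < c0 / (vmoment f0 + 1) by apply: divr_gt0 => //; rewrite ltr_wpDl.
have p1 : 0 < c1 / (vmoment f1 + 1) by apply: divr_gt0 => //; rewrite ltr_wpDl.
pose c := Num.min (c0 / (vmoment f0 + 1)) (c1 / (vmoment f1 + 1)).
have cc0 : c <= c0 / (vmoment f0 + 1) by rewrite ge_min lexx.
have cc1 : c <= c1 / (vmoment f1 + 1) by rewrite ge_min lexx orbT.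
(* The two lower bounds are averaged. *)
exists (c / 2); first by apply: divr_gt0 => //; rewrite lt_min p0.
exists (Num.max T0 T1) => t; rewrite ge_max => /andP[/HT0 h0 /HT1 h1].
have s0 : 0 <= Num.sqrt (ln (t + 2)) by exact: sqrtr_ge0.
have b0 : c * vmoment f0 <= c0.
  by apply: le_trans (ler_wpM2r v0 cc0) _; exact: lower_scale.
have b1 : c * vmoment f1 * Num.sqrt (ln (t + 2)) <= c1 * Num.sqrt (ln (t + 2)).
  apply: ler_wpM2r => //; apply: le_trans (ler_wpM2r v1 cc1) _; exact: lower_scale.
have := le_trans b0 h0; have := le_trans b1 h1; clear.
move: (nm _ _) (vmoment f0) (vmoment f1) (Num.sqrt _) => x a b s; lra.
Qed.

Theorem theorem1p1 (R : realType) (n : nat) (n2 : (2 <= n)%N) (lam mu : R)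
    (hlam : 0 < lam + 2 * mu) (hmu : 0 < mu) (N : 'I_n) :
  exists C : R, 0 < C /\
  forall f0 f1 : 'I_n -> Rn R n -> R,
    (forall k, in_H1 (f0 k) /\ in_L1 (f0 k)) ->
    (forall k, in_L2 (f1 k) /\ in_L1 (f1 k)) ->
    (exists u, fourier_solution lam mu f0 f1 u) /\
    forall u, fourier_solution lam mu f0 f1 u ->
      [/\ in_C_H1 u,
          exists v, in_C1_L2 u v /\ solves_cauchy lam mu f0 f1 u v,
          forall t : R, 0 <= t ->
            (L2norm (u t N) <=
             (C * (if n == 2%N then
                     vL2norm f0 + vL1norm f1 * Num.sqrt (ln (t + 2)) + vL2norm f1
                   else vL2norm f0 + vL1norm f1 + vL2norm f1))%:E)%E &
          lam + mu != 0 -> vmoment f0 != 0 \/ vmoment f1 != 0 ->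
            exists c : R, 0 < c /\ exists T : R, forall t : R, T <= t ->
              ((if n == 2%N then
                  c * vmoment f0 + c * vmoment f1 * Num.sqrt (ln (t + 2))
                else c * (vmoment f0 + vmoment f1))%:E <= L2norm (u t N))%E].
Proof.
have [C C0 HC] := nm_HU_le n2 hlam hmu.
have s0 : 0 < (Num.sqrt (cP R n))^-1 by rewrite invr_gt0 sqrtr_gt0 cP_gt0.
exists ((Num.sqrt (cP R n))^-1 * C); split; first exact: mulr_gt0.
move=> f0 f1 hf0 hf1.
have H0 k : L12 (f0 k) by have [[h _] h'] := hf0 k; apply/in_L12P.
have H1 k : L12 (f1 k) by have [h h'] := hf1 k; apply/in_L12P.
have Hd k j : L2 (lebesgue_Rn R n) (fun xi : Rn R n => tnth xi j * hart (f0 k) xi).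
  have [[_ /(_ j)[g /in_L2P Lg wg]] _] := hf0 k; exact: weak_freq (H0 k) Lg wg.
have I0 k := (H0 k).1; have I1 k := (H1 k).1.
have [u' [v Huv]] := solution_exists hlam hmu H0 H1 Hd.
have Hv t k := (Huv t k).2.
split.
  by exists u'; apply/(fourier_solution_hart lam mu u' I0 I1) => t _ k; exact: (Huv t k).1.
move=> u /(fourier_solution_hart lam mu u I0 I1) Hu.
have Lu t : 0 <= t -> L2norm (u t N) =
    ((Num.sqrt (cP R n))^-1 * nm (lebesgue_Rn R n) (HU lam mu f0 f1 t N))%:E.
  by move=> t0; rewrite -(hartL2_nm_inv (Hu t t0 N)) L2norm_nm//; have [] := Hu t t0 N.
split.
- exact: (solution_C_H1 hlam hmu H0 H1 Hd Hu).
(* Only the transform of [v] enters, so the [v] built together with [u'] serves every solution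
   [u]. *)
- exists v; split; first exact: (solution_C1_L2 hlam hmu H0 H1 Hd Hu Hv).
  exact: (solution_solves hlam hmu H0 H1 Hd Hu Hv).
- move=> t t0; rewrite Lu// lee_fin -mulrA (ler_pM2l s0).
  have := HC f0 f1 H0 H1 t t0 N; rewrite -!vL2norm_nm// -vL1norm_int//.
  by rewrite /log_factor; case: (n == 2%N); rewrite ?mulr1.
- move=> hne hM; have [c c0 [T HT]] := lower_bound_HU n2 hlam hmu hne N H0 H1 hM.
  exists ((Num.sqrt (cP R n))^-1 * c); split; first exact: mulr_gt0.
  exists (Num.max T 0) => t; rewrite ge_max => /andP[/HT h t0].
  rewrite Lu// lee_fin; have := h; rewrite -(ler_pM2l s0); apply: le_trans.
  by case: (n == 2%N); rewrite ?mulrDr !mulrA.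
Qed.
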